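(* Let $T>0$, $d\ge 3$ and $p,q,s,\tilde s\in[1,\infty)$, let $p',s'$ be the Hölder conjugate exponents of $p,s$ respectively, and assume $p>1$ and $$\frac1p+\frac1q>1-\frac{p-1}{4(p+1)p},\qquad \tilde s\le \frac{s}{\,s/s'+(1+2\beta)/(1+4\beta)\,},\qquad\text{where }\beta=\frac{(p-1)(d-1)}{4p(p+1)}.$$ For any $\epsilon>0$ and any time-periodic $\tilde\rho\in C^\infty([0,T]\times\mathbb T^d)$ with constant mean, i.e. $$\int_{\mathbb T^d}\tilde\rho(t,x)\,dx=\int_{\mathbb T^d}\tilde\rho(0,x)\,dx\quad\text{for all }t\in[0,T],$$ there exist a divergence-free vector field $\boldsymbol u$ and a density $\rho$ such that the following hold. (i) $\boldsymbol u\in L^{\tilde s}(0,T;W^{1,q}(\mathbb T^d))\cap L^{s'}(0,T;L^{p'}(\mathbb T^d))$ and $\rho\in L^s(0,T;L^p(\mathbb T^d))$. (ii) $\rho(t)$ is continuous in time in the distributional sense, and $\rho(t)=\tilde\rho(t)$ for $t=0$ and $t=T$. (iii) $(\rho,\boldsymbol u)$ is a weak solution to the transport equation $\partial_t\rho+\boldsymbol u\cdot\nabla\rho=0$ on $[0,T]\times\mathbb T^d$ with initial datum $\tilde\rho(0)$. (iv) $\|\rho-\tilde\rho\|_{L^s(0,T;L^p(\mathbb T^d))}\le\epsilon$.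
   Context: $\mathbb T^d=\mathbb R^d/\mathbb Z^d$. Divergence-free means $\operatorname{div}\boldsymbol u=0$ in the sense of distributions (in $x$). If $s=1$ then $s'=\infty$ and $s/s'=0$. The interval $[0,T]$ is identified with a one-dimensional torus; a time-periodic $f$ on $[0,T]$ means $f(t+nT)=f(t)$ for all $n\in\mathbb Z$ (so a smooth time-periodic function extends to a smooth $T$-periodic function of $t\in\mathbb R$). ''$\rho(t)$ is continuous in time in the distributional sense'' means that (for a suitable representative) $t\mapsto\int_{\mathbb T^d}\rho(t,x)\phi(x)\,dx$ is continuous on $[0,T]$ for every $\phi\in C^\infty(\mathbb T^d)$; the values $\rho(0),\rho(T)$ are understood in this sense. Weak solution with initial datum $\rho_0$ (for divergence-free $\boldsymbol u$): $$\int_0^T\!\!\int_{\mathbb T^d}\rho(\partial_t\phi+\boldsymbol u\cdot\nabla\phi)\,dx\,dt=-\int_{\mathbb T^d}\rho_0\,\phi(0,x)\,dx\quad\text{for all }\phi\in C_c^\infty([0,T)\times\mathbb T^d).$$ Equivalently, the left-hand side vanishes for all $\phi\in C_c^\infty((0,T)\times\mathbb T^d)$, and $\rho$ is continuous in time in the distributional sense with $\lim_{t\to0^+}\rho(t)=\rho_0$ in the distributional sense. *)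

(* Defs.v *)
From HB Require Import structures.
From mathcomp Require Import all_boot all_order all_algebra.
From mathcomp Require Import all_classical all_reals all_analysis.
Set Implicit Arguments.
Unset Strict Implicit.
Unset Printing Implicit Defensive.
Import Order.TTheory GRing.Theory Num.Theory.
Import numFieldNormedType.Exports.
Local Open Scope classical_set_scope.
Local Open Scope ring_scope.

(* The torus R^d / Z^d is represented by the Z^d-periodic functions on
   'rV[R]_d, integrated over the unit cube. *)

(* Borel sigma-algebra of R^n, generated by the coordinates. *)
Section rV_measurable.
Variables (R : realType) (n : nat).

Let coord (i : 'I_n) (x : 'rV[R]_n) : R := x ord0 i.

Let rV_set0 : g_sigma_preimage coord set0.
Proof. exact: sigma_algebra0. Qed.

Let rV_setC A : g_sigma_preimage coord A -> g_sigma_preimage coord (~` A).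
Proof. exact: sigma_algebraC. Qed.

Let rV_bigcup (F : (set 'rV[R]_n)^nat) :
  (forall i, g_sigma_preimage coord (F i)) ->
  g_sigma_preimage coord (\bigcup_i (F i)).
Proof. exact: sigma_algebra_bigcup. Qed.

HB.instance Definition _ := @isMeasurable.Build
  (measure_tuple_display default_measure_display)
  'rV[R]_n (g_sigma_preimage coord) rV_set0 rV_setC rV_bigcup.

End rV_measurable.

Lemma measurable_coord_rV (R : realType) n (i : 'I_n) :
  measurable_fun [set: 'rV[R]_n] (fun x : 'rV[R]_n => x ord0 i).
Proof.
move=> _ Y mY; rewrite setTI; apply: sub_sigma_algebra => /=.
rewrite -bigcup_seq/=; exists i => /=; first by rewrite mem_index_enum.
by exists Y => //; rewrite setTI.
Qed.

Lemma measurable_fun_rV d (T : measurableType d) (R : realType) n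
    (f : T -> 'rV[R]_n) :
  (forall i, measurable_fun [set: T] (fun x => f x ord0 i)) ->
  measurable_fun [set: T] f.
Proof.
move=> mf; pose c (i : 'I_n) (x : 'rV[R]_n) : R := x ord0 i.
suff prefS : g_sigma_preimage (fun i => c i \o f) `<=` measurable.
  move=> _ A mA; rewrite setTI; apply: prefS.
  by rewrite g_sigma_preimage_comp; exists A => //; rewrite setTI.
case: n => [|n] in f mf c *.
  by apply: smallest_sub; [exact: sigma_algebra_measurable|rewrite big_ord0].
apply: smallest_sub; first exact: sigma_algebra_measurable.
rewrite -bigcup_mkord_ord; apply: bigcup_sub => i Ii.
by move=> A [B mB <-]; exact: mf.
Qed.

Section torus_measure.
Variable R : realType.

Definition rV_cons n (p : measurableTypeR R * 'rV[R]_n) : 'rV[R]_n.+1 :=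
  row_mx (const_mx p.1 : 'rV[R]_1) p.2.

Lemma measurable_rV_cons n : measurable_fun setT (@rV_cons n).
Proof.
apply: measurable_fun_rV => i.
have [j|j] := splitP (i : 'I_(1 + n)) => ij.
- have -> : i = lshift n j by exact/val_inj.
  rewrite [X in measurable_fun _ X](_ : _ = fst); first exact: measurable_fst.
  by apply/funext => p; apply: etrans (row_mxEl _ _ _ _) _; rewrite mxE.
- have -> : i = rshift 1 j by exact/val_inj.
  rewrite [X in measurable_fun _ X](_ :
    _ = (fun x : 'rV[R]_n => x ord0 j) \o snd).
    by apply: measurableT_comp => //; exact: measurable_coord_rV.
  by apply/funext => p; exact: row_mxEr.
Qed.

HB.instance Definition _ n := isMeasurableFun.Build _ _ _ _
  (@rV_cons n) (@measurable_rV_cons n).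

(* Lebesgue measure on the unit cube, i.e. the Haar probability measure of the
   torus, as an n-fold product of Lebesgue measure on [0,1]. *)
Fixpoint torus_measure (n : nat) : probability 'rV[R]_n R :=
  match n with
  | 0 => dirac (0 : 'rV[R]_0)
  | m.+1 => distribution
      (uniform_prob (@ltr01 R) \x torus_measure m)%E (@rV_cons m)
  end.

End torus_measure.

Section smooth_functions.
Variables (R : realType) (d : nat).

Fixpoint iter_derive (V : normedModType R) (f : V -> R) (vs : seq V) : V -> R :=
  if vs is v :: vs' then 'D_v (iter_derive f vs') else f.

(* This is C^oo for V finite-dimensional; vs ranges over all directions, not
   only basis vectors. *)
Definition smooth (V : normedModType R) (f : V -> R) : Prop :=
  forall vs : seq V, continuous (iter_derive f vs) /\
    forall x v, derivable (iter_derive f vs) x v.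

Definition Zperiodic (T : Type) (f : 'rV[R]_d -> T) : Prop :=
  forall (x : 'rV[R]_d) (k : 'rV[int]_d), f (x + map_mx intr k) = f x.

Definition basis_vec (i : 'I_d) : 'rV[R]_d := delta_mx 0 i.

Definition smooth_torus (phi : 'rV[R]_d -> R) : Prop :=
  smooth phi /\ Zperiodic phi.

(* Time-periodic elements of C^oo([0,T] x T^d), as smooth functions on
   R x R^d which are T-periodic in t and Z^d-periodic in x. *)
Definition smooth_time_periodic (T : R) (f : R * 'rV[R]_d -> R) : Prop :=
  [/\ smooth f, forall t x, f (t + T, x) = f (t, x) &
      forall t, Zperiodic (fun x => f (t, x))].

(* C_c^oo([0,T) x T^d): only the values for t in [0,T) matter, and smoothness
   up to t = 0 is expressed by a smooth extension to negative times. *)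
Definition test_function (T : R) (phi : R * 'rV[R]_d -> R) : Prop :=
  [/\ smooth phi, forall t, Zperiodic (fun x => phi (t, x)) &
      exists2 T0, T0 < T & forall t x, T0 <= t -> phi (t, x) = 0].

(* Distributions on T^d, as linear functionals on C^oo(T^d) of finite order. *)
Definition distribution_torus (S : ('rV[R]_d -> R) -> R) : Prop :=
  (forall (a : R) phi psi, smooth_torus phi -> smooth_torus psi ->
     S (fun x => a * phi x + psi x) = a * S phi + S psi) /\
  exists (N : nat) (C : R), forall phi (M : R), smooth_torus phi ->
    (forall (s : seq 'I_d) x, (size s <= N)%N ->
       `|iter_derive phi [seq basis_vec i | i <- s] x| <= M) ->
    `|S phi| <= C * M.

End smooth_functions.

Section spaces.
Variables (R : realType) (d : nat).
Local Notation E := 'rV[R]_d.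
Local Notation mu := (torus_measure R d).

Definition time_measure (T : R) : {measure set (measurableTypeR R) -> \bar R} :=
  mrestr lebesgue_measure (measurable_itv `[0, T]).

Definition spacetime_measure (T : R) :
    {measure set (measurableTypeR R * E) -> \bar R} :=
  (time_measure T \x mu)%E.

(* Norm of the Bochner space L^s(0,T; L^p(T^d)), for jointly measurable f *)
Definition LL_norm (T : R) (s p : \bar R) (f : R * E -> R) : \bar R :=
  Lnorm (time_measure T) s (fun t => Lnorm mu p (fun x => (f (t, x))%:E)).

Definition in_LL (T : R) (s p : \bar R) (f : R * E -> R) : Prop :=
  measurable_fun [set: measurableTypeR R * E] f /\ (LL_norm T s p f < +oo)%E.

Definition weak_partial (i : 'I_d) (f g : E -> R) : Prop :=
  [/\ mu.-integrable setT (EFin \o f), mu.-integrable setT (EFin \o g) &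
    forall phi, smooth_torus phi ->
      \int[mu]_x (f x * 'D_(basis_vec R i) phi x) = - \int[mu]_x (g x * phi x)].

(* Norm of W^{1,q}(T^d) when g i is the i-th weak partial derivative of f *)
Definition W1_norm (q : \bar R) (f : E -> R) (g : 'I_d -> E -> R) : \bar R :=
  (Lnorm mu q (EFin \o f) + \sum_(i < d) Lnorm mu q (EFin \o g i))%E.

(* Membership in L^s(0,T; W^{1,q}(T^d)); g is the weak spatial gradient of f,
   jointly measurable. *)
Definition in_LW (T : R) (s q : \bar R) (f : R * E -> R) : Prop :=
  measurable_fun [set: measurableTypeR R * E] f /\
  exists g : 'I_d -> R * E -> R,
  [/\ forall i, measurable_fun [set: measurableTypeR R * E] (g i),
      {ae time_measure T, forall t, forall i,
        weak_partial i (fun x => f (t, x)) (fun x => g i (t, x))} &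
      (Lnorm (time_measure T) s
        (fun t => W1_norm q (fun x => f (t, x)) (fun i x => g i (t, x))) < +oo)%E].

Definition div_free (v : E -> E) : Prop :=
  (forall i, mu.-integrable setT (fun x => (v x 0 i)%:E)) /\
  forall phi, smooth_torus phi ->
    \int[mu]_x (\sum_(i < d) v x 0 i * 'D_(basis_vec R i) phi x) = 0.

(* S is a representative of rho in C([0,T]; D'(T^d)): the values at
   exceptional times are distributions, not necessarily functions. *)
Definition distributional_representative (T : R) (rho : R * E -> R)
    (S : R -> (E -> R) -> R) : Prop :=
  [/\ forall t, t \in `[0, T] -> distribution_torus (S t),
      forall phi, smooth_torus phi -> {within `[0, T], continuous (S ^~ phi)} &
      {ae time_measure T, forall t,
        mu.-integrable setT (fun x => (rho (t, x))%:E) /\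
        forall phi, smooth_torus phi ->
          S t phi = \int[mu]_x (rho (t, x) * phi x)}].

(* For divergence-free u. Rintegral is total, so the integrability of the
   integrand is required explicitly. *)
Definition weak_solution (T : R) (rho : R * E -> R) (u : R * E -> E)
    (rho0 : E -> R) : Prop :=
  forall phi, test_function T phi ->
  let F z := rho z * ('D_(1, 0) phi z +
                      \sum_(i < d) u z 0 i * 'D_(0, basis_vec R i) phi z) in
  (spacetime_measure T).-integrable setT (EFin \o F) /\
  \int[spacetime_measure T]_z F z = - \int[mu]_x (rho0 x * phi (0, x)).

End spaces.

(* Main.v *)
(* Convex integration with building blocks concentrated in space and in time. A
   triple (rho, u, R) of finite sums of tensors alpha(t) f(x) with
   d_t rho + div (rho u) = div R is improved by removing one term
   beta(t) F(x) e_i of R at a time. To rho one adds gam(t) d_j0 Z(x), to u the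
   divergence-free field chi(t) (w_1 e_i + w_2 e_j0), where Z and the stream
   function of w are an amplitude times a fast oscillating profile Phi (n x)
   concentrated along the lines parallel to e_i, so that d_j0 Z * w_1 averages
   to F, while gam and chi are combs of nu bumps of relative width 1 / kap such
   that gam chi averages to - beta. The oscillating remainder
   beta + gam chi = B' is removed by adding - B d_i F to rho. Linking the two
   concentrations by kap^(1/s) = m^g, with g from concentration_exponent, the
   density increment costs a prescribed a, the velocity increment costs
   O(size / a) in L^s' L^p', where size is that of the removed term, and as
   little as desired in L^st W^(1,q). The new error terms are as small as
   desired and their number is known in advance, so R, processed as a queue,
   tends to 0. The supports of gam and chi are summable in measure: by
   Borel-Cantelli, at almost every time the velocity is a finite smooth sum. *)

(* Two requirements compete for the parameter m. With D = d - 1 and 1/p + 1/r = 1, the velocity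
   increment has W^(1,q) norm of order m^(1 + D/r - D/q) in space, which need not be small;
   concentration in time multiplies it by kap^(1 - 1/s - 1/st), a negative power. But the time
   derivative of the density increment is the divergence of gam' Z e_j0, of size kap^(1/s) m^(-1 -
   D/r), so kap^(1/s) must stay below m^(1 + D/r). The hypotheses on the exponents guarantee that
   both demands on g can be met. Removing one tensor at a time replaces disjointness of supports:
   the new theta = d_j0 Z and w are small in L^1, hence so are their products with the finitely many
   smooth older terms, and only the product of the new pair survives. That pair must average to a
   signed F, while its L^p and L^r norms should see only the L^1 norm of F; so F is split into
   amplitudes built on a smooth substitute for |F|. The profiles gam and B vanish at 0 and at T, so
   the end values are exact from the start and never corrected. *)
Require Import Defs.
From HB Require Import structures.
From mathcomp Require Import all_boot all_order all_algebra.
From mathcomp Require Import all_classical all_reals all_analysis.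
From mathcomp Require Import measurable_realfun ess_sup_inf.
From mathcomp Require Import ring lra zify.
Set Implicit Arguments.
Unset Strict Implicit.
Unset Printing Implicit Defensive.
Import Order.TTheory GRing.Theory Num.Theory.
Import numFieldNormedType.Exports.
Local Open Scope classical_set_scope.
Local Open Scope ring_scope.


(** * Integration in time and on the torus *)

Section cont_measurable.
Variables (R : realType) (d : nat).
Local Notation E := 'rV[R]_d.

(** Boxes with rational centre and radius 1/(n+1): a countable base of the topology, each measurable
    coordinate by coordinate. *)
Let box (k : rat * 'rV[rat]_d * nat) : set (measurableTypeR R * E) :=
  [set z : measurableTypeR R * E | `|ratr k.1.1 - (z.1 : R)| < k.2.+1%:R^-1 /\
     forall i, `|ratr (k.1.2 0 i) - z.2 0 i| < k.2.+1%:R^-1].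

Let measurable_box k : measurable (box k).
Proof.
have mb (q e : R) : measurable [set y : measurableTypeR R | `|q - (y : R)| < e].
  by apply: open_measurable; exact: (ball_open q).
have -> : box k = (fst @^-1` [set y : measurableTypeR R | `|ratr k.1.1 - (y : R)| < k.2.+1%:R^-1]) `&`
   \bigcap_(i in [set: 'I_d]) ((fun z : measurableTypeR R * E => (z.2 0 i : measurableTypeR R)) @^-1` [set y : measurableTypeR R | `|ratr (k.1.2 0 i) - (y : R)| < k.2.+1%:R^-1]).
  apply/seteqP; split => [z [h1 h2]|z [h1 h2]]; split => //=.
    by move=> i _; exact: h2 i.
  by move=> i; exact: h2 i I.
apply: measurableI.
  by rewrite -[X in measurable X]setTI; apply: measurable_fst.
apply: fin_bigcap_measurable; first exact: finite_finset.
move=> i _.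
rewrite -[X in measurable X]setTI.
apply: (measurableT_comp (f := fun x : E => (x 0 i : measurableTypeR R)) (g := snd)) => //.
exact: measurable_coord_rV.
Qed.

(** The sigma-algebra on the product is generated by the coordinates, while continuity refers to the
    norm. They meet because the preimage of an open interval is the union of the countably many
    rational boxes that it contains. *)
Lemma measurable_continuous_pair (f : R * E -> R) : continuous f ->
  measurable_fun [set: measurableTypeR R * E] f.
Proof.
move=> cf; apply: (measurability _ (RGenOpens.measurableE R)).
move=> _ [_ [a [b ->]] <-]; rewrite setTI.
set A : set R := `]a, b[%classic.
have oA : open A by exact: interval_open.
have oU : open (f @^-1` A) by apply: open_comp => // x _; exact: cf.
set U := f @^-1` A.
have -> : U = \bigcup_(k in [set k | box k `<=` U]) box k.
  apply/seteqP; split; last by move=> z [k kU] /kU.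
  move=> z Uz.
  have [e0 e00 eU0] : exists2 e : R, 0 < e & ball z e `<=` U.
    by have /nbhs_ballP[e /= e0 eU] : nbhs z U; [exact: open_nbhs_nbhs | exists e].
  pose e := 2 * e0; have e0' : e0 = e / 2 by rewrite /e; field.
  have e_0 : 0 < e by rewrite /e mulr_gt0.
  have {}eU : ball z (e / 2) `<=` U by rewrite -e0'.
  have e20 : 0 < e / 2 by rewrite divr_gt0.
  (* The radius 1/(n+1) is at most e/4, so a box of that radius that contains z lies within e/2 of
     z. *)
  pose n := Num.truncn (4 / e).
  have ne : (n.+1%:R : R)^-1 * 2 <= e / 2.
    have : 4 / e < n.+1%:R by exact: truncnS_gt.
    move=> h; rewrite mulrC ler_pdivrMr//; move: h; rewrite ltr_pdivrMr// => h.
    by rewrite mulrAC ler_pdivlMr// mulrC; nra.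
  have n0 : 0 < (n.+1%:R : R)^-1 by rewrite invr_gt0.
  have rapp (y : R) : {q : rat | `|ratr q - y| < n.+1%:R^-1}.
    apply: cid; have /rat_in_itvoo[q] : y - n.+1%:R^-1 < y + n.+1%:R^-1.
      by rewrite ltrBlDr -addrA ltrDl addr_gt0.
    by rewrite in_itv/= => h; exists q; rewrite ltr_distl.
  exists (sval (rapp z.1), \row_i sval (rapp (z.2 0 i)), n); last first.
    split => /=; first exact: (svalP (rapp z.1)).
    by move=> i; rewrite mxE; exact: (svalP (rapp (z.2 0 i))).
  move=> y [/= h1 h2]; apply: eU; split => /=.
    suff : `|(z.1 : R) - (y.1 : R)| < e / 2 by [].
    have := svalP (rapp z.1) => /= h.
    rewrite (le_lt_trans (ler_distD (ratr (sval (rapp z.1))) _ _))//.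
    rewrite (lt_le_trans _ ne)// mulrDr mulr1 ltrD//; first by rewrite distrC.
  split=> // i j; rewrite (ord1 i) {i}.
  suff : `|z.2 0 j - y.2 0 j| < e / 2 by [].
  have := svalP (rapp (z.2 0 j)) => /= h.
  rewrite (le_lt_trans (ler_distD (ratr (sval (rapp (z.2 0 j)))) _ _))//.
  rewrite (lt_le_trans _ ne)// mulrDr mulr1 ltrD//; first by rewrite distrC.
  by have := h2 j; rewrite mxE.
rewrite bigcup_mkcond; apply: countable_bigcupT_measurable; first exact: countableP.
by move=> k; case: ifPn.
Qed.

End cont_measurable.


Section time_integral.
Variables (R : realType) (T : R).

(* time_measure again, so that its finiteness can be registered. *)
Definition tmf : set (measurableTypeR R) -> \bar R :=
  mrestr lebesgue_measure (measurable_itv `[0, T]).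
HB.instance Definition _ :=
  Measure.copy tmf (mrestr lebesgue_measure (measurable_itv `[0, T])).

Let tmf_fin : fin_num_fun tmf.
Proof.
apply: lty_fin_num_fun.
rewrite [X in (X < _)%E](_ : _ = lebesgue_measure (`[0, T] : set R)).
  by rewrite lebesgue_measure_itv /=; case: ifP => // _; rewrite EFinN ltry.
by rewrite /= /tmf /= /mrestr setTI.
Qed.
HB.instance Definition _ := @Measure_isFinite.Build _ _ _ tmf tmf_fin.

Lemma integral_tmf (f : R -> \bar R) : measurable_fun [set: measurableTypeR R] f ->
  (forall x, 0 <= f x)%E ->
  (\int[tmf]_t f t = \int[lebesgue_measure]_(t in `[0%R, T]) f t)%E.
Proof.
move=> mf f0.
have -> : (\int[lebesgue_measure]_(t in `[0%R, T]) f t = \int[tmf]_(t in `[0%R, T]) f t)%E.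
  apply/esym; apply: eq_measure_integral => A mA /setIidl AT.
  by rewrite /= /tmf /mrestr; congr (_ _).
have -> : [set: measurableTypeR R] = `[0, T] `|` ~` `[0, T] by rewrite setUv.
rewrite ge0_integral_setU//=; last 3 first.
- exact: measurableC.
- by rewrite setUv.
- by rewrite /disj_set setICr.
rewrite [X in (_ + X)%E]null_set_integral ?adde0//.
- exact: measurableC.
- exact: measurable_funTS.
- by rewrite /= /tmf /mrestr setICl measure0.
Qed.

End time_integral.

Section time_integral_theory.
Variables (R : realType) (T : R).
Hypothesis T0 : 0 < T.

Lemma integrable_tmf (f : R -> R) : {within `[0, T], continuous f} ->
  measurable_fun [set: measurableTypeR R] f -> (tmf T).-integrable setT (EFin \o f).
Proof.
move=> cf mf; have /continuous_compact_integrable := @segment_compact R 0 T => /(_ f cf) /integrableP [_ h].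
apply/integrableP; split; first exact/measurable_EFinP.
rewrite integral_tmf//.
by apply/measurableT_comp => //; exact/measurable_EFinP.
Qed.

Lemma Rintegral_tmf (f : R -> R) : {within `[0, T], continuous f} ->
  measurable_fun [set: measurableTypeR R] f ->
  \int[tmf T]_t f t = \int[lebesgue_measure]_(t in `[0, T]) f t.
Proof.
move=> cf mf; rewrite /Rintegral integralE [in RHS]integralE; congr (fine (_ - _)%E).
  rewrite integral_tmf//; exact/measurable_funepos/measurable_EFinP.
rewrite integral_tmf//; exact/measurable_funeneg/measurable_EFinP.
Qed.

Lemma FTC_tmf (f F : R -> R) : continuous f ->
  (forall x : R, is_derive x (1 : R) F (f x)) -> \int[tmf T]_t f t = F T - F 0.
Proof.
move=> cf dF.
have cF : continuous F by move=> x; apply/differentiable_continuous/derivable1_diffP; exact: ex_derive.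
rewrite Rintegral_tmf; last first.
- exact: continuous_measurable_fun.
- exact: continuous_subspaceT.
rewrite /Rintegral (continuous_FTC2 (F := F))//.
- exact: continuous_subspaceT.
- split.
  + by move=> x _; exact: ex_derive.
  + exact/cvg_at_right_filter/cF.
  + exact/cvg_at_left_filter/cF.
- by move=> x _; rewrite derive1E derive_val.
Qed.

End time_integral_theory.

Lemma primitive (R : realType) (f : R -> R) : continuous f ->
  exists F : R -> R, forall x : R, is_derive x (1 : R) F (f x).
Proof.
move=> cf.
have intf (a b : R) : lebesgue_measure.-integrable `[a, b] (EFin \o f).
  by apply: continuous_compact_integrable; [exact: segment_compact|exact: continuous_subspaceT].
pose G (a x : R) := \int[lebesgue_measure]_(t in `[a, x]) f t.
have GG (a b x : R) : a <= b -> b <= x -> G a x = G a b + G b x.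
  move=> ab bx; rewrite /G.
  have := @Rintegral_itvB R f (BLeft a) (BRight x) b (intf a x).
  rewrite !bnd_simp => /(_ ab bx) h.
  have -> : \int[lebesgue_measure]_(t in `[b, x]) f t = \int[lebesgue_measure]_(t in `]b, x]) f t.
    rewrite Rintegral_itv_obnd_cbnd//; apply: integrableS (intf b x) => //.
    by apply: subset_itvr; rewrite bnd_simp.
  by rewrite -h addrC subrK.
(* The fundamental theorem differentiates an integral only to the right of its base point, so the
   base point moves with x and stays left of both x and 0; [FE] shows that the value does not depend
   on it. *)
pose F x := G (- `|x| - 1) x - G (- `|x| - 1) 0.
have FE (a x : R) : a < x -> a < 0 -> F x = G a x - G a 0.
  move=> ax a0; rewrite /F; set c := - `|x| - 1.
  have cx : c < x by rewrite /c; have := ler_norm (- x); rewrite normrN; lra.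
  have c0 : c < 0 by rewrite /c; have := normr_ge0 x; lra.
  have [ac|/ltW ca] := leP a c.
    by rewrite (GG a c x ac (ltW cx)) (GG a c 0 ac (ltW c0)); ring.
  by rewrite (GG c a x ca (ltW ax)) (GG c a 0 ca (ltW a0)); ring.
exists F => x.
pose a := - `|x| - 1.
have ax : a < x by rewrite /a; have := ler_norm (- x); rewrite normrN; lra.
have a0 : a < 0 by rewrite /a; have := normr_ge0 x; lra.
have [dG GE] : derivable (G a) x 1 /\ (G a)^`()%classic x = f x.
  by apply: (@continuous_FTC1_closed _ f a x (x + 1)) => //; [lra|exact: cf].
have dG' : is_derive x (1 : R) (fun y => G a y - G a 0) (f x).
  have : is_derive x (1 : R) (G a) (f x) by rewrite -GE derive1E; exact: derivableP.
  move=> h; have := is_deriveB h (is_derive_cst (G a 0) x (1 : R)).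
  by rewrite subr0.
have nF : \forall y \near x, (fun y => G a y - G a 0) y = F y.
  have : \forall y \near x, a < y by exact: lt_nbhsr.
  by apply: filterS => y ay; rewrite (FE a).
exact: (near_eq_is_derive nF dG').
Qed.


(** * Boundedness and integrability of continuous periodic functions *)

Section periodic_functions.
Variables (R : realType).

Lemma floor_shift d (x : 'rV[R]_d) : exists k : 'rV[int]_d,
  forall i, 0 <= (x + map_mx intr k) 0 i <= 1.
Proof.
exists (\row_i - Num.floor (x 0 i)) => i; rewrite !mxE mulrNz.
by rewrite subr_ge0 floor_le_tmp/= lerBlDr addrC -intrD1 ltW// floorD1_gt.
Qed.

Lemma continuous_coord d (i : 'I_d) : continuous (fun x : 'rV[R]_d => x 0 i).
Proof. by move=> x; exact: coord_continuous. Qed.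

Lemma continuous_pairl d (f : R * 'rV[R]_d -> R) (t : R) : continuous f ->
  continuous (fun x => f (t, x)).
Proof.
move=> cf x; apply: (@continuous_comp _ _ _ (fun x => (t, x)) f); last exact: cf.
by apply: (@cvg_pair _ _ _ (nbhs x) (nbhs t) (nbhs x)); [exact: cvg_cst|exact: cvg_id].
Qed.

Lemma continuous_pairr d (f : R * 'rV[R]_d -> R) (x : 'rV[R]_d) : continuous f ->
  continuous (fun t => f (t, x)).
Proof.
move=> cf t; apply: (@continuous_comp _ _ _ (fun t => (t, x)) f); last exact: cf.
by apply: (@cvg_pair _ _ _ (nbhs t) (nbhs t) (nbhs x)); [exact: cvg_id|exact: cvg_cst].
Qed.

(** An integer translation brings x into the unit cube, and [0, T] times the cube is compact. The
    bound is for times in [0, T] only, since f need not be periodic in time. *)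
Lemma periodic_bounded_pair d (T : R) (f : R * 'rV[R]_d -> R) : continuous f ->
  (forall t, Zperiodic (fun x => f (t, x))) ->
  exists2 M : R, 0 < M & forall t x, 0 <= t <= T -> `|f (t, x)| <= M.
Proof.
move=> cf pf; have [T0|T0] := ltP T 0.
  by exists 1 => // t x /andP[t0 /(le_trans t0)]; rewrite leNgt T0.
pose K := `[0, T]%classic `*` [set v : 'rV[R]_d | forall i, `[0%R, 1%R]%classic (v ord0 i)].
have cK : compact K.
  by apply: compact_setX; [exact: segment_compact|exact: (rV_compact (fun i => @segment_compact R 0 1))].
have K0 : K !=set0.
  by exists (0, 0); split => [|i] /=; rewrite in_itv/= ?lexx ?T0// mxE lexx ler01.
have cf' : continuous (fun z => `|f z|) by move=> z; apply: continuous_comp; [exact: cf|exact: norm_continuous].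
have [c cK' cM] := compact_EVT_max K0 cK (continuous_subspaceT cf').
exists (`|f c| + 1); first by rewrite ltr_wpDl.
move=> t x t0T; have [k kx] := floor_shift x.
rewrite -(pf t x k) (le_trans (cM (t, x + map_mx intr k) _)) ?lerDl//.
rewrite inE; split => /=; first by rewrite in_itv.
by move=> i; rewrite in_itv/= kx.
Qed.

Lemma periodic_bounded d (f : 'rV[R]_d -> R) : continuous f -> Zperiodic f ->
  exists2 M : R, 0 < M & forall x, `|f x| <= M.
Proof.
move=> cf pf.
have [||M M0 h] := @periodic_bounded_pair d 0 (f \o snd).
- by move=> z; apply: continuous_comp; [exact: cvg_snd|exact: cf].
- by move=> t x k; exact: pf.
- by exists M => // x; apply: (h 0 x); rewrite lexx.
Qed.

Lemma measurable_periodic d (f : 'rV[R]_d -> R) : continuous f ->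
  measurable_fun setT f.
Proof.
move=> cf; have cf' : continuous (f \o snd : R * 'rV[R]_d -> R).
  by move=> z; apply: continuous_comp; [exact: cvg_snd|exact: cf].
exact: (measurableT_comp (measurable_continuous_pair cf') (measurable_pair1 (0 : measurableTypeR R))).
Qed.

Lemma bounded_integrable d (X : measurableType d) (m : {measure set X -> \bar R})
    (f : X -> R) (M : R) : (m setT < +oo)%E -> measurable_fun setT f ->
  (forall x, `|f x| <= M) -> m.-integrable setT (EFin \o f).
Proof.
move=> moo mf fM; apply: measurable_bounded_integrable => //.
exists M; split; first exact: num_real.
by move=> N MN x _ /=; rewrite (le_trans (fM x))// ltW.
Qed.

Lemma integrable_torus d (f : 'rV[R]_d -> R) : continuous f -> Zperiodic f ->
  (torus_measure R d).-integrable setT (EFin \o f).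
Proof.
move=> cf pf; have [M _ fM] := periodic_bounded cf pf.
apply: bounded_integrable fM; last exact: measurable_periodic.
by rewrite ltey_eq fin_num_measure.
Qed.

Lemma torus_cst d (c : R) : \int[torus_measure R d]_x c = c.
Proof. by rewrite Rintegral_cst// [X in fine X](_ : _ = 1%E) ?mulr1//; exact: probability_setT. Qed.

Lemma rV_cons0 d (z : R * 'rV[R]_d) : rV_cons z 0 ord0 = z.1.
Proof.
have -> : ord0 = lshift d (ord0 : 'I_1) by exact/val_inj.
by apply: etrans (row_mxEl _ _ _ _) _; rewrite mxE.
Qed.

Lemma rV_consS d (z : R * 'rV[R]_d) k : rV_cons z 0 (lift ord0 k) = z.2 0 k.
Proof.
have -> : lift ord0 k = rshift 1 k by exact/val_inj.
exact: row_mxEr.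
Qed.

Lemma rV_ext T d (u v : 'rV[T]_d.+1) : u 0 ord0 = v 0 ord0 ->
  (forall k, u 0 (lift ord0 k) = v 0 (lift ord0 k)) -> u = v.
Proof.
move=> h0 hS; apply/rowP => j; have [k ->|->] := unliftP ord0 j; [exact: hS|exact: h0].
Qed.

Lemma continuous_rV_cons d : continuous (@rV_cons R d : R * 'rV[R]_d -> 'rV[R]_d.+1).
Proof.
move=> z; apply/cvg_ballP => e e0; apply: filterS (nbhsx_ballx z e e0) => y.
move=> [/= h1 [_ h2]]; split => // i j; rewrite (ord1 i).
have [k ->|->] := unliftP ord0 j; first by rewrite !rV_consS; exact: h2.
by rewrite !rV_cons0.
Qed.

Lemma rV_consD d (s t : R) (x y : 'rV[R]_d) :
  rV_cons (s, x) + rV_cons (t, y) = rV_cons (s + t, x + y).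
Proof. by apply: rV_ext => [|k]; rewrite mxE ?rV_cons0// !rV_consS/= mxE. Qed.

Lemma rV_consZ d (s t : R) (x : 'rV[R]_d) :
  s *: rV_cons (t, x) = rV_cons (s * t, s *: x).
Proof. by apply: rV_ext => [|k]; rewrite mxE ?rV_cons0// !rV_consS/= mxE. Qed.

Lemma Zperiodic_cons d (f : 'rV[R]_d.+1 -> R) (s : R) : Zperiodic f ->
  Zperiodic (fun x => f (rV_cons (s, x))).
Proof.
move=> pf x k.
rewrite -(pf (rV_cons (s, x)) (\row_j (if unlift ord0 j is Some i then k 0 i else 0))); congr f.
apply: rV_ext => [|i]; rewrite [RHS]mxE !(rV_cons0, rV_consS) !mxE.
  by rewrite unlift_none addr0.
by rewrite liftK.
Qed.

Lemma Zperiodic_cons1 d (f : 'rV[R]_d.+1 -> R) (x : 'rV[R]_d) : Zperiodic f ->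
  forall s, f (rV_cons (s + 1, x)) = f (rV_cons (s, x)).
Proof.
move=> pf s; rewrite -(pf (rV_cons (s, x)) (delta_mx 0 ord0)); congr f.
apply: rV_ext => [|i]; rewrite [RHS]mxE !(rV_cons0, rV_consS) !mxE.
  by rewrite eqxx.
by rewrite /= addr0.
Qed.

End periodic_functions.

Section torus_integral.
Variables (R : realType).

Lemma integral_uniform01 (f : R -> \bar R) :
  (\int[uniform_prob (@ltr01 R)]_t f t = \int[tmf 1]_t f t)%E.
Proof.
apply: eq_measure_integral => A mA _ /=.
rewrite /uniform_prob integral_uniform_pdf.
under eq_integral => x.
  rewrite inE => -[_ /=]; rewrite in_itv/= => /andP[x0 x1].
  rewrite /uniform_pdf x0 x1/= subr0 invr1.
  over.
rewrite integral_cst ?mul1e//; exact: measurableI.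
Qed.

Lemma Rintegral_uniform01 (f : R -> R) :
  \int[uniform_prob (@ltr01 R)]_t f t = \int[tmf 1]_t f t.
Proof. by rewrite /Rintegral integral_uniform01. Qed.

Section fubini.
Variables (d1 d2 : measure_display) (X : measurableType d1) (Y : measurableType d2).
Variables (m1 : {finite_measure set X -> \bar R}) (m2 : {finite_measure set Y -> \bar R}).
Variable f : X * Y -> R.
Hypothesis intf : (m1 \x m2)%E.-integrable setT (EFin \o f).
Hypothesis int2 : forall x, m2.-integrable setT (EFin \o (fun y => f (x, y))).
Hypothesis int1 : forall y, m1.-integrable setT (EFin \o (fun x => f (x, y))).

(** Every slice is assumed integrable, not just almost every one, so that [fine] commutes with the
    inner integral at each point. *)
Lemma Rfubini12 : \int[(m1 \x m2)%E]_z f z = \int[m1]_x \int[m2]_y f (x, y).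
Proof.
rewrite /Rintegral -integral12_prod_meas1//; congr fine; apply: eq_integral => x _.
by rewrite fineK//; apply: integrable_fin_num (int2 x).
Qed.

Lemma Rfubini21 : \int[(m1 \x m2)%E]_z f z = \int[m2]_y \int[m1]_x f (x, y).
Proof.
rewrite /Rintegral -integral21_prod_meas1//; congr fine; apply: eq_integral => x _.
by rewrite fineK//; apply: integrable_fin_num (int1 x).
Qed.

End fubini.

Section torus_succ.
Variables (d : nat) (f : 'rV[R]_d.+1 -> R).
Hypotheses (cf : continuous f) (pf : Zperiodic f).

Let g (z : R * 'rV[R]_d) := f (rV_cons z).
Let cg : continuous g.
Proof. by move=> z; apply: continuous_comp; [exact: continuous_rV_cons|exact: cf]. Qed.

Let intg : (uniform_prob (@ltr01 R) \x torus_measure R d)%E.-integrable setT (EFin \o g).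
Proof.
have [M _ fM] := periodic_bounded cf pf.
apply: (@bounded_integrable R _ _ _ _ M); [|exact: measurable_continuous_pair|by move=> z; exact: fM].
rewrite [X in (X < _)%E](_ : _ = 1%E) ?ltry//; exact: probability_setT.
Qed.

Let int1 (y : 'rV[R]_d) : (uniform_prob (@ltr01 R)).-integrable setT (EFin \o (fun x => g (x, y))).
Proof.
have [M _ fM] := periodic_bounded cf pf.
apply: (@bounded_integrable R _ _ _ _ M); [rewrite [X in (X < _)%E](_ : _ = 1%E) ?ltry//; exact: probability_setT|apply: continuous_measurable_fun; exact: continuous_pairr|move=> z; exact: fM].
Qed.

Let int2 (x : R) : (torus_measure R d).-integrable setT (EFin \o (fun y => g (x, y))).
Proof.
apply: integrable_torus; first exact/continuous_pairl/cg.
exact: Zperiodic_cons.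
Qed.

Let torus_consE : \int[torus_measure R d.+1]_x f x =
  \int[(uniform_prob (@ltr01 R) \x torus_measure R d)%E]_z g z.
Proof.
have mf : measurable_fun setT (EFin \o f).
  by apply/measurable_EFinP; exact: measurable_periodic.
rewrite /Rintegral (@integral_distribution _ _ _ _ _ _ _ (EFin \o f))//; exact: intg.
Qed.

Lemma torus_cons12 : \int[torus_measure R d.+1]_x f x =
  \int[tmf 1]_s \int[torus_measure R d]_y f (rV_cons (s, y)).
Proof. by rewrite torus_consE (Rfubini12 intg int2) Rintegral_uniform01. Qed.

Lemma torus_cons21 : \int[torus_measure R d.+1]_x f x =
  \int[torus_measure R d]_y \int[tmf 1]_s f (rV_cons (s, y)).
Proof.
rewrite torus_consE (Rfubini21 intg int1); apply: eq_Rintegral => y _.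
by rewrite Rintegral_uniform01.
Qed.

End torus_succ.

Lemma tmf_out (T : R) : tmf T (~` `[0, T]) = 0%E.
Proof. by rewrite /tmf /mrestr setICl measure0. Qed.

Lemma integrable_tmf_cont (T : R) (g : R -> R) : continuous g -> (tmf T).-integrable setT (EFin \o g).
Proof.
move=> cg; have [T0|T0] := ltP 0 T.
  by apply: integrable_tmf => //; [exact: continuous_subspaceT|exact: continuous_measurable_fun].
(* For T <= 0 the measure vanishes. *)
have mg : measurable_fun setT (EFin \o g).
  by apply/measurable_EFinP; apply: continuous_measurable_fun.
apply/integrableP; split => //.
rewrite integral_tmf//; last exact: measurableT_comp.
rewrite null_set_integral//; first by apply/measurable_funTS; apply: measurableT_comp.
have : lebesgue_measure (`[0, T] : set R) = 0%E.
  by rewrite lebesgue_measure_itv/= lte_fin ltNge T0.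
by [].
Qed.

Section spacetime.
Variables (d : nat) (T : R) (f : R * 'rV[R]_d -> R).
Hypotheses (cf : continuous f) (pf : forall t, Zperiodic (fun x => f (t, x))).

(** A bound on f is available on [0, T] only, hence the splitting into the slab and its complement,
    which is a null set. *)
Lemma integrable_spacetime : (tmf T \x torus_measure R d)%E.-integrable setT (EFin \o f).
Proof.
have [M M0 fM] := periodic_bounded_pair T cf pf.
pose D := [set z : measurableTypeR R * 'rV[R]_d | `[0, T]%classic (z.1 : R)].
have mD : measurable D.
  by rewrite -[D]setTI; exact: (measurable_fst measurableT _ (measurable_itv `[0, T])).
have mf := measurable_continuous_pair cf.
have DC : ((tmf T \x torus_measure R d) (~` D) = 0)%E.
  have -> : ~` D = (~` `[0, T]%classic) `*` setT by apply/seteqP; split => z //= [].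
  rewrite product_measure1E//; last by apply: measurableC; exact: measurable_itv.
  by rewrite [X in (X * _)%E](_ : _ = 0%E) ?mul0e//; exact: tmf_out.
apply/integrableP; split; first exact/measurable_EFinP.
have -> : [set: measurableTypeR R * 'rV[R]_d] = D `|` ~` D by rewrite setUv.
rewrite ge0_integral_setU//=; last 3 first.
- exact: measurableC.
- by rewrite setUv; apply/measurable_EFinP; exact: measurableT_comp.
- by rewrite /disj_set setICr.
rewrite [X in (_ + X)%E]null_set_integral ?adde0//; last 2 first.
- exact: measurableC.
- by apply/measurable_funTS; apply/measurable_EFinP; exact: measurableT_comp.
apply: (@le_lt_trans _ _ (\int[(tmf T \x torus_measure R d)%E]_(z in D) cst M%:E z)%E).
  apply: ge0_le_integral => //.
  - by apply/measurable_funTS; apply/measurable_EFinP; exact: measurableT_comp.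
  - by move=> [t x]; rewrite /D/= in_itv/= lee_fin => /fM.
rewrite integral_cst//.
have -> : D = `[0, T]%classic `*` setT by apply/seteqP; split => z //= [].
have -> : (M%:E * (tmf T \x torus_measure R d) (`[0%R, T]%classic `*` setT) = M%:E * (tmf T `[0%R, T]%classic * torus_measure R d setT))%E.
  by rewrite -product_measure1E//; exact: measurable_itv.
rewrite lte_mul_pinfty//; first by rewrite lee_fin ltW.
by rewrite ltey_eq fin_numM// fin_num_measure.
Qed.

Let int1 y : (tmf T).-integrable setT (EFin \o (fun x => f (x, y))).
Proof. by apply: integrable_tmf_cont; exact: continuous_pairr. Qed.

Let int2 (x : R) : (torus_measure R d).-integrable setT (EFin \o (fun y => f (x, y))).
Proof. by apply: integrable_torus; [exact: continuous_pairl|exact: pf]. Qed.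

Lemma spacetime12 : \int[spacetime_measure d T]_z f z =
  \int[tmf T]_t \int[torus_measure R d]_x f (t, x).
Proof. exact: (Rfubini12 integrable_spacetime int2). Qed.

Lemma spacetime21 : \int[spacetime_measure d T]_z f z =
  \int[torus_measure R d]_x \int[tmf T]_t f (t, x).
Proof. exact: (Rfubini21 integrable_spacetime int1). Qed.

End spacetime.

End torus_integral.

(** * Translations and dilations of the torus *)

Section torus_invariance.
Variables (R : realType).

Lemma cont_comp (X Y Z : topologicalType) (f : X -> Y) (g : Y -> Z) :
  continuous f -> continuous g -> continuous (fun x => g (f x)).
Proof. by move=> cf cg x; apply: continuous_comp; [exact: cf|exact: cg]. Qed.

Lemma cont_rV (X : topologicalType) n (f : X -> 'rV[R]_n) :
  (forall i, continuous (fun x => f x 0 i)) -> continuous f.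
Proof.
move=> cf x; apply/cvg_ballP => e e0.
have : \forall y \near x, forall i, ball (f x 0 i) e (f y 0 i).
  by apply: filter_forall => i; apply: (cf i x); exact: nbhsx_ballx.
by apply: filterS => y xy; split => // i j; rewrite (ord1 i).
Qed.

Lemma cont_addr (V : normedModType R) (a : V) : continuous ((fun x => x + a) : V -> V).
Proof. by move=> x; apply: cvgD; [exact: cvg_id|exact: cvg_cst]. Qed.

Lemma cont_addrR (a : R) : continuous ((fun x => x + a) : R -> R).
Proof. by move=> x; apply: cvgD; [exact: cvg_id|exact: cvg_cst]. Qed.

Lemma cont_scale (V : normedModType R) (c : R) : continuous ((fun x => c *: x) : V -> V).
Proof. exact: scaler_continuous. Qed.

Lemma cont_mull (c : R) : continuous ((fun x => c * x) : R -> R).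
Proof. exact: mulrl_continuous. Qed.

Lemma cont_bigprod (X : topologicalType) I (r : seq I) (f : I -> X -> R) :
  (forall i, continuous (f i)) -> continuous (fun x => \prod_(i <- r) f i x).
Proof.
move=> cf; elim: r => [|i r IH].
  by under eq_fun do rewrite big_nil; move=> x; exact: cvg_cst.
by under eq_fun do rewrite big_cons; move=> x; apply: cvgM; [exact: cf|exact: IH].
Qed.

Lemma cont_bigsum (X : topologicalType) I (r : seq I) (f : I -> X -> R) :
  (forall i, continuous (f i)) -> continuous (fun x => \sum_(i <- r) f i x).
Proof.
move=> cf; elim: r => [|i r IH].
  by under eq_fun do rewrite big_nil; move=> x; exact: cvg_cst.
by under eq_fun do rewrite big_cons; move=> x; apply: cvgD; [exact: cf|exact: IH].
Qed.

(** For a primitive F of f the difference F (t + 1) - F t is constant, its derivative being f (t +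
    1) - f t = 0. The two integrals are its values at a and at 0. *)
Lemma translation_tmf (f : R -> R) (a : R) : continuous f ->
  (forall x, f (x + 1) = f x) -> \int[tmf 1]_t f (t + a) = \int[tmf 1]_t f t.
Proof.
move=> cf pf; have [F dF] := primitive cf.
have ca : continuous (fun t : R => f (t + a)).
  move=> t; apply: (@continuous_comp R R R (fun t : R => t + a) f); last exact: cf.
  by apply: (@cvgD R R); [exact: cvg_id|exact: cvg_cst].
have dFa b (x : R) : is_derive x (1 : R) (fun t : R => F (t + b)) (f (x + b)).
  have h1 : is_derive x (1 : R) (fun t : R => t + b) 1.
    by have := is_deriveD (is_derive_id x (1 : R)) (is_derive_cst b x (1 : R)); rewrite addr0.
  have := @is_derive1_comp _ F (fun t : R => t + b) x _ _ (dF (x + b)) h1.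
  by rewrite mulr1.
rewrite (FTC_tmf ltr01 ca (dFa a)) (FTC_tmf ltr01 cf dF) add0r.
pose G (t : R) := F (t + 1) - F t.
have dG (x : R) : is_derive x (1 : R) G 0.
  by have := is_deriveB (dFa 1 x) (dF x); rewrite pf subrr.
have := is_derive_0_is_cst a 0 dG.
by rewrite /G add0r (addrC a).
Qed.

(** The integral is (F (n+1) - F 0) / (n+1) for a primitive F of f, and the increments of F over
    unit intervals are all equal by periodicity. *)
Lemma dilation_tmf (f : R -> R) (n : nat) : continuous f ->
  (forall x, f (x + 1) = f x) -> \int[tmf 1]_t f (n.+1%:R * t) = \int[tmf 1]_t f t.
Proof.
move=> cf pf; have [F dF] := primitive cf.
have n0 : n.+1%:R != 0 :> R by rewrite pnatr_eq0.
have ca : continuous (fun t : R => f (n.+1%:R * t)).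
  exact: (cont_comp (@cont_mull _) cf).
have dFa (x : R) : is_derive x (1 : R) (fun t : R => n.+1%:R^-1 * F (n.+1%:R * t)) (f (n.+1%:R * x)).
  have h1 : is_derive x (1 : R) (fun t : R => n.+1%:R * t) n.+1%:R.
    by have := is_deriveZ n.+1%:R (is_derive_id x (1 : R)); rewrite /GRing.scale/= mulr1.
  have := is_deriveZ n.+1%:R^-1 (@is_derive1_comp _ F (fun t : R => n.+1%:R * t) x _ _ (dF _) h1).
  by rewrite /GRing.scale/= mulrC -mulrA mulfV// mulr1.
rewrite (FTC_tmf ltr01 ca dFa) (FTC_tmf ltr01 cf dF) mulr1 mulr0 -mulrBr.
have dFb (x : R) : is_derive x (1 : R) (fun t : R => F (t + 1)) (f (x + 1)).
  have h1 : is_derive x (1 : R) (fun t : R => t + 1) 1.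
    by have := is_deriveD (is_derive_id x (1 : R)) (is_derive_cst (1 : R) x (1 : R)); rewrite addr0.
  have := @is_derive1_comp _ F (fun t : R => t + 1) x _ _ (dF (x + 1)) h1.
  by rewrite mulr1.
pose G (t : R) := F (t + 1) - F t.
have dG (x : R) : is_derive x (1 : R) G 0.
  by have := is_deriveB (dFb x) (dF x); rewrite pf subrr.
have GE (k : nat) : F k.+1%:R - F k%:R = F 1 - F 0.
  by have := is_derive_0_is_cst k%:R 0 dG; rewrite /G add0r natr1.
have -> : F n.+1%:R - F 0 = n.+1%:R * (F 1 - F 0).
  elim: (n.+1) => [|k IH]; first by rewrite subrr mul0r.
  by rewrite -(subrK (F k%:R) (F k.+1%:R)) -addrA IH GE -natr1 mulrDl mul1r addrC.
by rewrite mulrA mulVf// mul1r.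
Qed.

Lemma continuous_shift d (f : 'rV[R]_d -> R) (a : 'rV[R]_d) : continuous f ->
  continuous (fun x : 'rV[R]_d => f (x + a)).
Proof.
move=> cf; exact: (cont_comp (@cont_addr 'rV[R]_d a) cf).
Qed.

Lemma Zperiodic_shift d (f : 'rV[R]_d -> R) (a : 'rV[R]_d) : Zperiodic f ->
  Zperiodic (fun x : 'rV[R]_d => f (x + a)).
Proof. by move=> pf x k; rewrite addrAC pf. Qed.

Lemma continuous_dilate d (f : 'rV[R]_d -> R) (n : nat) : continuous f ->
  continuous (fun x : 'rV[R]_d => f (n%:R *: x)).
Proof.
move=> cf; exact: (cont_comp (@cont_scale 'rV[R]_d _) cf).
Qed.

Lemma Zperiodic_dilate d (f : 'rV[R]_d -> R) (n : nat) : Zperiodic f ->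
  Zperiodic (fun x : 'rV[R]_d => f (n%:R *: x)).
Proof.
move=> pf x k; rewrite -(pf (n%:R *: x) (k *+ n)) scalerDr; congr (f (_ + _)).
by apply/rowP => i; rewrite !mxE mulr_natl mulmxnE rmorphMn.
Qed.

(** Induction on the dimension: the first coordinate is treated by the one-dimensional lemmas, the
    others by the induction hypothesis, with Fubini in between. *)
Lemma torus_invariance d (f : 'rV[R]_d -> R) (n : nat) (a : 'rV[R]_d) :
  continuous f -> Zperiodic f ->
  \int[torus_measure R d]_x f (n.+1%:R *: x + a) = \int[torus_measure R d]_x f x.
Proof.
elim: d f a => [|d IH] f a cf pf.
  by apply: eq_Rintegral => x _; congr f; apply/rowP => -[].
pose g (x : 'rV[R]_d.+1) := f (n.+1%:R *: x + a).
have cg : continuous g by apply: (@continuous_dilate _ (fun x : 'rV[R]_d.+1 => f (x + a))); exact: continuous_shift.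
have pg : Zperiodic g by apply: (@Zperiodic_dilate _ (fun x : 'rV[R]_d.+1 => f (x + a))); exact: Zperiodic_shift.
pose a' : 'rV[R]_d := \row_i a 0 (lift ord0 i).
have aE : a = rV_cons (a 0 ord0, a').
  by apply: rV_ext => [|k]; rewrite ?rV_cons0// rV_consS mxE.
rewrite (torus_cons21 cg pg).
have gE s y : g (rV_cons (s, y)) = f (rV_cons (n.+1%:R * s + a 0 ord0, n.+1%:R *: y + a')).
  by rewrite /g rV_consZ [in LHS]aE rV_consD.
have cfr y : continuous (fun s : R => f (rV_cons (s, y))).
  by apply: (@continuous_pairr _ _ (fun z => f (rV_cons z))) => z; apply: continuous_comp; [exact: continuous_rV_cons|exact: cf].
have cfl s : continuous (fun y : 'rV[R]_d => f (rV_cons (s, y))).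
  by apply: (@continuous_pairl _ _ (fun z => f (rV_cons z))) => z; apply: continuous_comp; [exact: continuous_rV_cons|exact: cf].
transitivity (\int[torus_measure R d]_y \int[tmf 1]_s f (rV_cons (s, n.+1%:R *: y + a'))).
  apply: eq_Rintegral => y _; under eq_Rintegral do rewrite gE.
  rewrite (@dilation_tmf (fun s : R => f (rV_cons (s + a 0 ord0, n.+1%:R *: y + a')))).
  - by rewrite (@translation_tmf (fun s : R => f (rV_cons (s, n.+1%:R *: y + a'))))// => s; exact: Zperiodic_cons1.
  - move=> t; apply: (@continuous_comp R R R (fun t : R => t + a 0 ord0) (fun s : R => f (rV_cons (s, n.+1%:R *: y + a')))); last exact: cfr.
    by apply: cvgD; [exact: cvg_id|exact: cvg_cst].
  - by move=> s; rewrite addrAC; exact: Zperiodic_cons1.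
(* [h] transforms the last d coordinates only. It is itself continuous and periodic, so Fubini can
   swap the two integrals before the induction hypothesis is applied slice by slice. *)
pose h (x : 'rV[R]_d.+1) := f (rV_cons (x 0 ord0, n.+1%:R *: (\row_i x 0 (lift ord0 i)) + a')).
have hE s y : h (rV_cons (s, y)) = f (rV_cons (s, n.+1%:R *: y + a')).
  rewrite /h rV_cons0; congr (f (rV_cons (_, _ *: _ + _))).
  by apply/rowP => i; rewrite mxE rV_consS.
pose D : 'rV[R]_d.+1 := rV_cons (0, a').
pose S (x : 'rV[R]_d.+1) : 'rV[R]_d.+1 := \row_i (if i == ord0 then x 0 i else n.+1%:R * x 0 i).
have hS x : h x = f (S x + D).
  rewrite /h; congr f; apply: rV_ext => [|k]; rewrite [RHS]mxE !(rV_cons0, rV_consS) !mxE ?addr0//.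
have ch : continuous h.
  rewrite (_ : h = fun x : 'rV[R]_d.+1 => f (S x + D)); last exact/funext.
  move=> x; apply: (@continuous_comp _ _ _ S (fun x : 'rV[R]_d.+1 => f (x + D))); last exact: continuous_shift.
  move: x; apply: cont_rV => i.
  rewrite (_ : (fun x => S x 0 i) = (fun x => (if i == ord0 then 1 else n.+1%:R) * x 0 i)); last first.
    by apply/funext => x; rewrite mxE; case: ifP; rewrite ?mul1r.
  exact: (@cont_comp _ _ _ (fun x : 'rV[R]_d.+1 => x 0 i) _ (@continuous_coord _ _ i) (@cont_mull _)).
have ph : Zperiodic h.
  move=> x k; rewrite !hS.
  rewrite -(pf (S x + D) (\row_i (if i == ord0 then k 0 i else k 0 i *+ n.+1))); congr f.
  apply/rowP => i; rewrite !mxE addrAC; congr (_ + _).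
  by case: ifP => // _; rewrite mulrDr rmorphMn/= -(mulr_natl (k 0 i)%:~R).
have -> : \int[torus_measure R d]_y \int[tmf 1]_s f (rV_cons (s, n.+1%:R *: y + a')) = \int[torus_measure R d.+1]_x h x.
  by rewrite (torus_cons21 ch ph); apply: eq_Rintegral => y _; apply: eq_Rintegral => s _; rewrite hE.
rewrite (torus_cons12 ch ph) (torus_cons12 cf pf); apply: eq_Rintegral => s _.
under eq_Rintegral do rewrite hE.
by rewrite (IH (fun y : 'rV[R]_d => f (rV_cons (s, y))))//; exact: Zperiodic_cons.
Qed.

Lemma torus_translation d (f : 'rV[R]_d -> R) (a : 'rV[R]_d) :
  continuous f -> Zperiodic f ->
  \int[torus_measure R d]_x f (x + a) = \int[torus_measure R d]_x f x.
Proof.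
by move=> cf pf; rewrite -(@torus_invariance _ f 0 a)//; apply: eq_Rintegral => x _; rewrite scale1r.
Qed.

Lemma torus_dilation d (f : 'rV[R]_d -> R) (n : nat) : (0 < n)%N ->
  continuous f -> Zperiodic f ->
  \int[torus_measure R d]_x f (n%:R *: x) = \int[torus_measure R d]_x f x.
Proof.
by case: n => // n _ cf pf; rewrite -(@torus_invariance _ f n 0)//; apply: eq_Rintegral => x _; rewrite addr0.
Qed.

Lemma torus_prod d (f : 'I_d -> R -> R) : (forall i, continuous (f i)) ->
  (forall i x, f i (x + 1) = f i x) ->
  \int[torus_measure R d]_x \prod_i f i (x 0 i) = \prod_i \int[tmf 1]_t f i t.
Proof.
elim: d f => [|d IH] f cf pf.
  by under eq_Rintegral do rewrite big_ord0; rewrite torus_cst big_ord0.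
have cp : continuous (fun x : 'rV[R]_d.+1 => \prod_i f i (x 0 i)).
  by apply: cont_bigprod => i; exact: (cont_comp (@continuous_coord _ _ i) (cf i)).
have fz i (y : R) (k : int) : f i (y + k%:~R) = f i y.
  case: k => k.
    by elim: k y => [|k IHk] y; rewrite ?addr0// -addn1 PoszD intrD addrA pf IHk.
  rewrite NegzE; elim: k y => [|k IHk] y; first by rewrite -[in RHS](subrK 1 y) pf.
  have -> : y + (- (k.+2)%:Z)%:~R = (y - 1) + (- (k.+1)%:Z)%:~R.
    by rewrite !mulrNz -!pmulrn -[k.+2%:R]natr1; ring.
  by rewrite IHk -[in RHS](subrK 1 y) pf.
have pp : Zperiodic (fun x : 'rV[R]_d.+1 => \prod_i f i (x 0 i)).
  by move=> x k; apply: eq_bigr => i _; rewrite !mxE fz.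
rewrite (torus_cons12 cp pp) big_ord_recl.
transitivity (\int[tmf 1]_s (f ord0 s * \prod_(i < d) \int[tmf 1]_t f (lift ord0 i) t)).
  apply: eq_Rintegral => s _.
  rewrite -IH//.
  have cq : continuous (fun x : 'rV[R]_d => \prod_i f (lift ord0 i) (x 0 i)).
    by apply: cont_bigprod => i; exact: (cont_comp (@continuous_coord _ _ i) (cf _)).
  rewrite -RintegralZl//.
    apply: eq_Rintegral => y _; rewrite big_ord_recl rV_cons0; congr (_ * _).
    by apply: eq_bigr => i _; rewrite rV_consS.
  by apply: integrable_torus => // x k; apply: eq_bigr => i _; rewrite !mxE fz.
by rewrite RintegralZr//; apply: integrable_tmf_cont; exact: cf.
Qed.

End torus_invariance.



(** * Smooth periodic functions *)

Section lines.
Variables (R : realType) (V : normedModType R).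
Implicit Types (f : V -> R) (x v : V).

(** Directional derivatives are reduced to derivatives on the real line, where the mean value
    theorem and the chain rule are available. *)
Lemma is_derive_line f x v (s l : R) : is_derive (x + s *: v) v f l ->
  is_derive s (1 : R) (fun h : R => f (x + h *: v)) l.
Proof.
move=> [df dv].
have E : (fun h : R => h^-1 *: (((fun h : R => f (x + h *: v)) \o shift s) (h *: (1 : R)) - f (x + s *: v))) =
         (fun h : R => h^-1 *: ((f \o shift (x + s *: v)) (h *: v) - f (x + s *: v))).
  apply/funext => h /=; congr (_ *: (f _ - _)).
  have -> : h *: (1 : R) = h by rewrite -[RHS]mulr1.
  by rewrite scalerDl addrCA.
by split; rewrite /derivable /derive E.
Qed.

Lemma line_is_derive f x v (l : R) :
  is_derive (0 : R) (1 : R) (fun h : R => f (x + h *: v)) l -> is_derive x v f l.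
Proof.
move=> [df dv].
have E : (fun h : R => h^-1 *: (((fun h : R => f (x + h *: v)) \o shift (0 : R)) (h *: (1 : R)) - f (x + (0 : R) *: v))) =
         (fun h : R => h^-1 *: ((f \o shift x) (h *: v) - f x)).
  apply/funext => h /=; rewrite scale0r !addr0; congr (_ *: (f _ - _)).
  have -> : h *: (1 : R) = h by rewrite -[RHS]mulr1.
  by rewrite addrC.
by split; [move: df|move: dv]; rewrite /derivable /derive E.
Qed.

Lemma continuous_line x v : continuous ((fun h : R => x + h *: v) : R -> V).
Proof. by move=> h; apply: cvgD; [exact: cvg_cst|apply: cvgZr_tmp; exact: cvg_id]. Qed.

Lemma MVT_line f x v (h : R) : (forall y, derivable f y v) -> 0 < h ->
  exists2 s : R, 0 < s < h & f (x + h *: v) - f x = 'D_v f (x + s *: v) * h.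
Proof.
move=> df h0.
have dl (s : R) : is_derive s (1 : R) (fun h : R => f (x + h *: v)) ('D_v f (x + s *: v)).
  by apply: is_derive_line; exact: derivableP.
have cl : {within `[0, h], continuous (fun h : R => f (x + h *: v))}.
  apply: continuous_subspaceT => s; apply/differentiable_continuous/derivable1_diffP.
  exact: ex_derive.
have [s + E] := MVT h0 (fun s _ => dl s) cl.
by rewrite in_itv/= => s0h; exists s => //; rewrite -[RHS]/(_ * h) -[in RHS](subr0 h) -E scale0r addr0.
Qed.

(** The mean value theorem is used twice: along u for y -> f (y + h w) - f y, then along w for the
    derivative of f along u. *)
Lemma second_difference f (u w x : V) (h : R) : (forall y, derivable f y u) ->
  (forall y, derivable ('D_u f) y w) -> 0 < h ->
  exists s t : R, [/\ 0 < s < h, 0 < t < h &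
    f (x + h *: u + h *: w) - f (x + h *: u) - f (x + h *: w) + f x =
    'D_w ('D_u f) (x + s *: u + t *: w) * h * h].
Proof.
move=> fu fuw h0.
pose g y := f (y + h *: w) - f y.
have dg y : is_derive y u g ('D_u f (y + h *: w) - 'D_u f y).
  apply: is_deriveB; last exact: derivableP.
  apply: line_is_derive.
  have -> : (fun k : R => f (y + k *: u + h *: w)) = (fun k : R => f ((y + h *: w) + k *: u)).
    by apply/funext => k; rewrite addrAC.
  by apply: is_derive_line; rewrite scale0r addr0; exact: derivableP.
have [s s0h Es] := MVT_line x (fun y => @ex_derive _ _ _ _ _ _ _ (dg y)) h0.
have [t t0h Et] := MVT_line (x + s *: u) (fuw) h0.
exists s, t; split => //.
have Dg : 'D_u g (x + s *: u) = 'D_u f (x + s *: u + h *: w) - 'D_u f (x + s *: u) by have [_] := dg (x + s *: u).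
by rewrite -Et -Dg -Es /g; ring.
Qed.

Lemma continuous_eq_near (F G : V -> R) x : {for x, continuous F} -> {for x, continuous G} ->
  (forall r : R, 0 < r -> exists y z, [/\ `|x - y| < r, `|x - z| < r & F y = G z]) ->
  F x = G x.
Proof.
move=> cF cG H; apply/eqP; rewrite -subr_eq0 -normr_le0; apply/ler_addgt0Pr => e e0; rewrite add0r.
have e20 : 0 < e / 2 by rewrite divr_gt0.
have /cvgrPdist_le/(_ _ e20) /nbhs_ballP[r1 /= r10 B1] := cF.
have /cvgrPdist_le/(_ _ e20) /nbhs_ballP[r2 /= r20 B2] := cG.
have [|y [z [xy xz yz]]] := H (Num.min r1 r2); first by rewrite lt_min r10.
rewrite (splitr e) (le_trans (ler_distD (F y) _ _))// lerD//.
  by apply: B1; rewrite -ball_normE/= (lt_le_trans xy)// ge_min lexx.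
by rewrite yz distrC; apply: B2; rewrite -ball_normE/= (lt_le_trans xz)// ge_min lexx orbT.
Qed.

(** The second difference is symmetric in a and b. It forces F and G to take a common value at
    points arbitrarily close to x, and continuity concludes. *)
Lemma eq_of_second_differences f (a b x : V) (F G : V -> R) :
  {for x, continuous F} -> {for x, continuous G} ->
  (forall h : R, 0 < h -> exists s t : R, [/\ 0 < s < h, 0 < t < h &
    f (x + h *: a + h *: b) - f (x + h *: a) - f (x + h *: b) + f x = F (x + s *: a + t *: b) * h * h]) ->
  (forall h : R, 0 < h -> exists s t : R, [/\ 0 < s < h, 0 < t < h &
    f (x + h *: b + h *: a) - f (x + h *: b) - f (x + h *: a) + f x = G (x + s *: b + t *: a) * h * h]) ->
  F x = G x.
Proof.
move=> cF cG inF inG.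
apply: continuous_eq_near => // r r0.
(* With h = r / N, a displacement by less than h along both a and b is shorter than r. *)
pose N := `|a| + `|b| + 1; have N0 : 0 < N by rewrite ltr_wpDl ?addr_ge0.
pose h := r / N; have h0 : 0 < h by rewrite divr_gt0.
have inr (u w : V) (s t : R) : `|u| + `|w| < N -> 0 < s < h -> 0 < t < h -> `|x - (x + s *: u + t *: w)| < r.
  move=> uw /andP[s0 sh] /andP[t0 th].
  rewrite -addrA opprD addrA subrr add0r normrN (le_lt_trans (ler_normD _ _))// !normrZ !gtr0_norm//.
  apply: (@le_lt_trans _ _ (h * (`|u| + `|w|))).
    by rewrite mulrDr lerD// ler_wpM2r// ltW.
  by rewrite /h mulrAC ltr_pdivrMr// ltr_pM2l.
have abN : `|a| + `|b| < N by rewrite /N ltrDl.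
have baN : `|b| + `|a| < N by rewrite addrC.
have [s [t [s0 t0 E1]]] := inF h h0.
have [s' [t' [s0' t0' E2]]] := inG h h0.
exists (x + s *: a + t *: b), (x + s' *: b + t' *: a); split; [exact: inr|exact: inr|].
apply: (mulIf (lt0r_neq0 h0)); apply: (mulIf (lt0r_neq0 h0)); rewrite -E1 -E2.
by rewrite (addrAC x (h *: b)); ring.
Qed.

Lemma schwarz f (a b : V) :
  (forall x, derivable f x a) -> (forall x, derivable f x b) ->
  (forall x, derivable ('D_a f) x b) -> (forall x, derivable ('D_b f) x a) ->
  continuous ('D_b ('D_a f)) -> continuous ('D_a ('D_b f)) ->
  'D_b ('D_a f) = 'D_a ('D_b f).
Proof.
move=> fa fb fab fba cab cba; apply/funext => x.
exact: (@eq_of_second_differences f a b x ('D_b ('D_a f)) ('D_a ('D_b f)) (cab x) (cba x)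
  (fun h => @second_difference f a b x h fa fab) (fun h => @second_difference f b a x h fb fba)).
Qed.

End lines.

Lemma contD (R : realType) (X : topologicalType) (f g : X -> R) :
  continuous f -> continuous g -> continuous ((fun x => f x + g x) : X -> R).
Proof. by move=> cf cg x; apply: cvgD; [exact: cf|exact: cg]. Qed.

Lemma contM (R : realType) (X : topologicalType) (f g : X -> R) :
  continuous f -> continuous g -> continuous ((fun x => f x * g x) : X -> R).
Proof. by move=> cf cg x; apply: cvgM; [exact: cf|exact: cg]. Qed.

Section smooth_calculus.
Variables (R : realType) (d : nat).
Local Notation E := 'rV[R]_d.
Local Notation e := (@basis_vec R d).
Implicit Types (f g : E -> R).

Definition pd (j : 'I_d) f : E -> R := 'D_(e j) f.

(** Only coordinate directions occur, unlike in [smooth]: closure under products, compositions and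
    dilations is then an induction on n. *)
Fixpoint Cn (n : nat) f : Prop :=
  continuous f /\
  if n is m.+1 then (forall j x, derivable f x (e j)) /\ forall j, Cn m (pd j f)
  else True.

Definition sm f := Zperiodic f /\ forall n, Cn n f.

Lemma Cn_cont n f : Cn n f -> continuous f.
Proof. by case: n => [|n] []. Qed.

Lemma CnW n f : Cn n.+1 f -> Cn n f.
Proof.
elim: n f => [|n IH] f [cf]; first by [].
by move=> [df dn]; split => //; split => // j; apply: IH.
Qed.

Lemma pdP n f j x : Cn n.+1 f -> is_derive x (e j) f (pd j f x).
Proof. by move=> [_ [df _]]; exact: derivableP. Qed.

Lemma pd_val f j (x : E) l : is_derive x (e j) f l -> pd j f x = l.
Proof. by move=> h; rewrite /pd derive_val. Qed.

Lemma Cn_build n f (g : 'I_d -> E -> R) : continuous f ->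
  (forall j x, is_derive x (e j) f (g j x)) -> (forall j, Cn n (g j)) -> Cn n.+1 f.
Proof.
move=> cf df dg; split => //; split => [j x|j]; first exact: ex_derive.
by rewrite (_ : pd j f = g j)//; apply/funext => x; exact: pd_val.
Qed.

Lemma is_derive_cst' (c : R) (x v : E) : is_derive x v (fun=> c) 0.
Proof. exact: is_derive_cst. Qed.

Lemma Cn_cst n (c : R) : Cn n (fun=> c).
Proof.
have cc (c' : R) : continuous ((fun=> c') : E -> R) by exact: cst_continuous.
elim: n c => [|n IH] c; first by split.
apply: (@Cn_build _ _ (fun _ _ => 0)).
- exact: cc.
- by move=> j; exact: (IH 0).
Qed.

Lemma Cn_pd n f j : Cn n.+1 f -> Cn n (pd j f).
Proof. by move=> [_ [_ h]]; exact: h. Qed.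

Lemma CnD n f g : Cn n f -> Cn n g -> Cn n (fun x => f x + g x).
Proof.
elim: n f g => [|n IH] f g Cf Cg.
  by split => //; apply: contD; [exact: (Cn_cont Cf)|exact: (Cn_cont Cg)].
apply: (@Cn_build _ _ (fun j x => pd j f x + pd j g x)).
- by apply: contD; [exact: (Cn_cont Cf)|exact: (Cn_cont Cg)].
- by move=> j x; exact: (is_deriveD (pdP j x Cf) (pdP j x Cg)).
- by move=> j; apply: IH; [case: Cf => _ [_]; exact|case: Cg => _ [_]; exact].
Qed.

Lemma CnM n f g : Cn n f -> Cn n g -> Cn n (fun x => f x * g x).
Proof.
elim: n f g => [|n IH] f g Cf Cg.
  by split => //; apply: contM; [exact: (Cn_cont Cf)|exact: (Cn_cont Cg)].
apply: (@Cn_build _ _ (fun j x => f x * pd j g x + g x * pd j f x)).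
- by apply: contM; [exact: (Cn_cont Cf)|exact: (Cn_cont Cg)].
- by move=> j x; exact: (is_deriveM (pdP j x Cf) (pdP j x Cg)).
- move=> j; apply: CnD; apply: IH; [exact: CnW| |exact: CnW|].
    exact: Cn_pd.
  exact: Cn_pd.
Qed.

(* Faa di Bruno is avoided by carrying all the derivatives F k of F 0. *)
Lemma Cn_comp n (F : nat -> R -> R) f :
  (forall k x, is_derive (f x) (1 : R) (F k) (F k.+1 (f x))) ->
  Cn n f -> forall k, Cn n (fun x => F k (f x)).
Proof.
move=> dF; elim: n => [|n IH] Cf k.
  have cf := Cn_cont Cf; split => //; move=> x; apply: continuous_comp; first exact: cf.
  by apply/differentiable_continuous/derivable1_diffP; have [] := dF k x.
apply: (@Cn_build _ _ (fun j x => F k.+1 (f x) * pd j f x)).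
- have cf := Cn_cont Cf; move=> x; apply: continuous_comp; first exact: cf.
  by apply/differentiable_continuous/derivable1_diffP; have [] := dF k x.
- move=> j x; apply: line_is_derive.
  have h1 : is_derive (0 : R) (1 : R) (fun h : R => f (x + h *: e j)) (pd j f x).
    by apply: is_derive_line; rewrite scale0r addr0; exact: pdP Cf.
  have h2 : is_derive (f (x + (0 : R) *: e j)) (1 : R) (F k) (F k.+1 (f x)).
    by rewrite scale0r addr0.
  exact: (@is_derive1_comp _ (F k) (fun h : R => f (x + h *: e j)) 0 _ _ h2 h1).
- by move=> j; apply: CnM; [apply: IH; exact: CnW|exact: Cn_pd].
Qed.

Lemma pd_comp (F : R -> R) f j x l : derivable f x (e j) ->
  is_derive (f x) (1 : R) F l -> pd j (fun x => F (f x)) x = l * pd j f x.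
Proof.
move=> df dF; apply: pd_val; apply: line_is_derive.
have h1 : is_derive (0 : R) (1 : R) (fun h : R => f (x + h *: e j)) (pd j f x).
  by apply: is_derive_line; rewrite scale0r addr0; exact: derivableP.
have h2 : is_derive (f (x + (0 : R) *: e j)) (1 : R) F l by rewrite scale0r addr0.
exact: (@is_derive1_comp _ F (fun h : R => f (x + h *: e j)) 0 _ _ h2 h1).
Qed.

Lemma sm_cont f : sm f -> continuous f.
Proof. by move=> [_ /(_ 0%N) []]. Qed.
Lemma sm_der f : sm f -> forall j x, derivable f x (e j).
Proof. by move=> [_ /(_ 1%N) [_ []]]. Qed.
Lemma sm_is f : sm f -> forall j x, is_derive x (e j) f (pd j f x).
Proof. by move=> sf j x; apply: derivableP; exact: sm_der. Qed.

Lemma Zperiodic_pd f j : Zperiodic f -> Zperiodic (pd j f).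
Proof.
move=> pf x k.
have E : (fun h : R => h^-1 *: ((f \o shift (x + map_mx intr k)) (h *: e j) - f (x + map_mx intr k))) =
         (fun h : R => h^-1 *: ((f \o shift x) (h *: e j) - f x)).
  by apply/funext => h /=; rewrite addrA !pf.
by rewrite /pd /derive E.
Qed.

Lemma sm_pd f j : sm f -> sm (pd j f).
Proof. by move=> [pf Cf]; split; [exact: Zperiodic_pd|move=> n; exact/Cn_pd/Cf]. Qed.
Lemma sm_cst (c : R) : sm (fun=> c).
Proof. by split => // n; exact: Cn_cst. Qed.
Lemma smD f g : sm f -> sm g -> sm (fun x => f x + g x).
Proof. by move=> [pf Cf] [pg Cg]; split => [x k|n]; [rewrite pf pg|exact: CnD]. Qed.
Lemma smM f g : sm f -> sm g -> sm (fun x => f x * g x).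
Proof. by move=> [pf Cf] [pg Cg]; split => [x k|n]; [rewrite pf pg|exact: CnM]. Qed.
Lemma smZ (c : R) f : sm f -> sm (fun x => c * f x).
Proof. by move=> sf; apply: smM => //; exact: sm_cst. Qed.
Lemma smN f : sm f -> sm (fun x => - f x).
Proof. by move=> /(smZ (-1)); congr sm; apply/funext => x; rewrite mulN1r. Qed.
Lemma smB f g : sm f -> sm g -> sm (fun x => f x - g x).
Proof. by move=> sf sg; apply: smD => //; exact: smN. Qed.
Lemma sm_sum I (r : seq I) (f : I -> E -> R) : (forall i, sm (f i)) ->
  sm (fun x => \sum_(i <- r) f i x).
Proof.
move=> sf; elim: r => [|i r IH].
  by under eq_fun do rewrite big_nil; exact: sm_cst.
by under eq_fun do rewrite big_cons; exact: smD.
Qed.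
Lemma sm_prod I (r : seq I) (P : pred I) (f : I -> E -> R) : (forall i, P i -> sm (f i)) ->
  sm (fun x => \prod_(i <- r | P i) f i x).
Proof.
move=> sf; elim: r => [|i r IH].
  by under eq_fun do rewrite big_nil; exact: sm_cst.
have [Pi|/negbTE Pi] := boolP (P i).
  by under eq_fun do rewrite big_cons Pi; apply: smM => //; exact: sf.
by under eq_fun do rewrite big_cons Pi.
Qed.

Lemma pdD f g j x : sm f -> sm g -> pd j (fun x => f x + g x) x = pd j f x + pd j g x.
Proof. by move=> sf sg; apply: pd_val; exact: (is_deriveD (sm_is sf j x) (sm_is sg j x)). Qed.
Lemma pdM f g j x : sm f -> sm g ->
  pd j (fun x => f x * g x) x = f x * pd j g x + g x * pd j f x.
Proof. by move=> sf sg; apply: pd_val; exact: (is_deriveM (sm_is sf j x) (sm_is sg j x)). Qed.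
Lemma pd_cst (c : R) j x : pd j (fun=> c) x = 0.
Proof. by apply: pd_val; exact: is_derive_cst'. Qed.
Lemma pdZ (c : R) f j x : sm f -> pd j (fun x => c * f x) x = c * pd j f x.
Proof. by move=> sf; rewrite pdM ?pd_cst ?mulr0 ?addr0//; exact: sm_cst. Qed.
Lemma pdN f j x : sm f -> pd j (fun x => - f x) x = - pd j f x.
Proof. by move=> sf; under eq_fun do rewrite -mulN1r; rewrite pdZ// mulN1r. Qed.
Lemma sm_schwarz f i j : sm f -> pd i (pd j f) = pd j (pd i f).
Proof.
move=> sf; apply: schwarz; do ?[exact: sm_der | exact/sm_cont/sm_pd/sm_pd].
- by move=> x; apply: sm_der; exact: sm_pd.
- by move=> x; apply: sm_der; exact: sm_pd.
Qed.

Lemma smooth_torus_sm (phi : E -> R) : smooth_torus phi -> sm phi.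
Proof.
move=> [sphi pphi]; split => // n.
suff : forall vs, Cn n (iter_derive phi vs) by move/(_ [::]).
elim: n => [|n IH] vs; first by split => //; have [] := sphi vs.
split; first by have [] := sphi vs.
split => [j x|j]; first by have [_] := sphi vs; exact.
exact: (IH (e j :: vs)).
Qed.

Lemma sm_dilate f (n : nat) : sm f -> sm (fun x => f (n%:R *: x)).
Proof.
move=> [pf Cf]; split; first exact: Zperiodic_dilate.
suff H m g : Cn m g -> Cn m (fun x => g (n%:R *: x)) by move=> m; exact: H.
elim: m g => [|m IH] g Cg; first by split => //; apply: continuous_dilate; exact: (Cn_cont Cg).
apply: (@Cn_build _ _ (fun j x => n%:R * pd j g (n%:R *: x))).
- by apply: continuous_dilate; exact: (Cn_cont Cg).
- move=> j x; apply: line_is_derive.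
  have h1 : is_derive (n%:R * 0 : R) (1 : R) (fun h : R => g (n%:R *: x + h *: e j)) (pd j g (n%:R *: x)).
    by apply: is_derive_line; rewrite mulr0 scale0r addr0; exact: pdP Cg.
  have h2 : is_derive (0 : R) (1 : R) (fun h : R => n%:R * h) n%:R.
    by have := is_deriveZ (n%:R : R) (is_derive_id (0 : R) (1 : R)); rewrite /GRing.scale/= mulr1.
  have := @is_derive1_comp _ (fun h : R => g (n%:R *: x + h *: e j)) (fun h : R => n%:R * h) 0 _ _ h1 h2.
  rewrite mulrC; congr is_derive; apply/funext => h /=.
  by rewrite scalerDr scalerA.
- by move=> j; apply: CnM; [exact: Cn_cst|apply: IH; exact: Cn_pd].
Qed.

Lemma pd_dilate f (n : nat) j x : sm f ->
  pd j (fun x => f (n%:R *: x)) x = n%:R * pd j f (n%:R *: x).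
Proof.
move=> sf; apply: pd_val; apply: line_is_derive.
have h1 : is_derive (n%:R * 0 : R) (1 : R) (fun h : R => f (n%:R *: x + h *: e j)) (pd j f (n%:R *: x)).
  by apply: is_derive_line; rewrite mulr0 scale0r addr0; exact: sm_is.
have h2 : is_derive (0 : R) (1 : R) (fun h : R => n%:R * h) n%:R.
  by have := is_deriveZ (n%:R : R) (is_derive_id (0 : R) (1 : R)); rewrite /GRing.scale/= mulr1.
have := @is_derive1_comp _ (fun h : R => f (n%:R *: x + h *: e j)) (fun h : R => n%:R * h) 0 _ _ h1 h2.
rewrite mulrC; congr is_derive; apply/funext => h /=.
by rewrite scalerDr scalerA.
Qed.

(** The point moves along one coordinate axis at a time, with the mean value theorem on each
    segment. *)
Lemma lipschitz_pd f (M : R) (x v : E) : (forall j x, derivable f x (e j)) ->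
  0 <= M -> (forall j x, `|pd j f x| <= M) ->
  `|f (x + v) - f x| <= M * \sum_j `|v 0 j|.
Proof.
move=> df M0 fM.
have H1 (y : E) j (h : R) : 0 <= h -> `|f (y + h *: e j) - f y| <= M * h.
  rewrite le_eqVlt => /predU1P[<-|h0]; first by rewrite scale0r addr0 subrr normr0 mulr0.
  have [s _ ->] := MVT_line y (df j) h0.
  by rewrite normrM (gtr0_norm h0) ler_pM2r//; exact: fM.
have H2 (y : E) j (h : R) : `|f (y + h *: e j) - f y| <= M * `|h|.
  have [h0|/ltW h0] := leP 0 h; first by rewrite (ger0_norm h0); exact: H1.
  rewrite (ler0_norm h0).
  have := H1 (y + h *: e j) j (- h); rewrite oppr_ge0 => /(_ h0).
  by rewrite scaleNr addrK distrC.
have -> : x + v = x + \sum_j v 0 j *: e j by rewrite [in LHS](row_sum_delta v).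
elim: (index_enum _) => [|j r IH]; first by rewrite !big_nil addr0 subrr normr0 mulr0.
rewrite !big_cons mulrDr addrCA addrC.
rewrite (le_trans (ler_distD (f (x + \sum_(j <- r) v 0 j *: e j)) _ _))// lerD//.
Qed.

Lemma sm_bounded f : sm f -> exists2 M : R, 0 < M & forall x, `|f x| <= M.
Proof. by move=> sf; apply: periodic_bounded; [exact: sm_cont|case: sf]. Qed.

Lemma sm_pd_bounded f : sm f -> exists2 M : R, 0 < M & forall j x, `|pd j f x| <= M.
Proof.
move=> sf.
have /choice[M hM] : forall j, exists M : R, 0 < M /\ forall x, `|pd j f x| <= M.
  by move=> j; have [M M0 h] := sm_bounded (sm_pd j sf); exists M.
exists (1 + \sum_j M j).
  by rewrite ltr_pwDl// sumr_ge0// => j _; exact/ltW/(hM j).1.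
move=> j x; rewrite (le_trans ((hM j).2 x))// (bigD1 j)//= addrCA lerDl addr_ge0// sumr_ge0// => k _.
exact/ltW/(hM k).1.
Qed.

Lemma pd0_cst f : sm f -> (forall j x, pd j f x = 0) -> forall x, f x = f 0.
Proof.
move=> sf f0 x; apply/eqP; rewrite -subr_eq0 -normr_le0.
have := @lipschitz_pd f 0 0 x (sm_der sf) (lexx 0).
by rewrite add0r mul0r; apply => j y; rewrite f0 normr0.
Qed.

Lemma sm_integrable f : sm f -> (torus_measure R d).-integrable setT (EFin \o f).
Proof. by move=> sf; apply: integrable_torus; [exact: sm_cont|case: sf]. Qed.

End smooth_calculus.



Lemma cont_of_dist (R : realType) (X : topologicalType) (f : X -> R) :
  (forall x r, 0 < r -> \forall y \near x, `|f x - f y| <= r) -> continuous f.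
Proof. by move=> H x; apply/cvgrPdist_le => r r0; exact: H. Qed.

Section tmf_continuous.
Variables (R : realType) (T : R).
Hypothesis T0 : 0 < T.
Implicit Types f g : R -> R.

Lemma cont_norm (X : topologicalType) (f : X -> R) : continuous f ->
  continuous (fun x => `|f x|).
Proof. by move=> cf x; apply: continuous_comp; [exact: cf|exact: norm_continuous]. Qed.

Lemma tmf_cst (c : R) : \int[tmf T]_t c = c * T.
Proof.
have cc : continuous ((fun=> c) : R -> R) by exact: cst_continuous.
have dc (t : R) : is_derive t (1 : R) (fun t : R => c * t) c.
  by have := is_deriveZ c (is_derive_id t (1 : R)); rewrite /GRing.scale/= mulr1.
by rewrite (FTC_tmf T0 cc dc) mulr0 subr0.
Qed.

Lemma tmf_le f g : continuous f -> continuous g ->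
  (forall t, 0 <= t <= T -> f t <= g t) -> \int[tmf T]_t f t <= \int[tmf T]_t g t.
Proof.
move=> cf cg fg; rewrite !Rintegral_tmf.
- apply: le_Rintegral; [exact: measurable_itv| | |].
  + by apply: continuous_compact_integrable; [exact: segment_compact|exact: continuous_subspaceT].
  + by apply: continuous_compact_integrable; [exact: segment_compact|exact: continuous_subspaceT].
  + by move=> t /=; rewrite in_itv/=; exact: fg.
- exact: continuous_subspaceT.
- exact: continuous_measurable_fun.
- exact: continuous_subspaceT.
- exact: continuous_measurable_fun.
Qed.

Lemma tmf_eq f g : continuous f -> continuous g ->
  (forall t, 0 <= t <= T -> f t = g t) -> \int[tmf T]_t f t = \int[tmf T]_t g t.
Proof.
by move=> cf cg fg; apply/eqP; rewrite eq_le !tmf_le// => t /fg ->.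
Qed.

Lemma tmf_norm f : continuous f -> `|\int[tmf T]_t f t| <= \int[tmf T]_t `|f t|.
Proof. by move=> cf; apply: le_normr_Rintegral => //; exact: integrable_tmf_cont. Qed.

Lemma tmf_le_norm f (M : R) : continuous f ->
  (forall t, 0 <= t <= T -> `|f t| <= M) -> `|\int[tmf T]_t f t| <= M * T.
Proof.
move=> cf fM; rewrite (le_trans (tmf_norm cf))// -tmf_cst tmf_le//.
- exact: cont_norm.
- exact: cst_continuous.
Qed.

Lemma tmfD f g : continuous f -> continuous g ->
  \int[tmf T]_t (f t + g t) = \int[tmf T]_t f t + \int[tmf T]_t g t.
Proof. by move=> cf cg; rewrite RintegralD//; exact: integrable_tmf_cont. Qed.

Lemma tmfB f g : continuous f -> continuous g ->
  \int[tmf T]_t (f t - g t) = \int[tmf T]_t f t - \int[tmf T]_t g t.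
Proof. by move=> cf cg; rewrite RintegralB//; exact: integrable_tmf_cont. Qed.

Lemma tmfZ (c : R) f : continuous f ->
  \int[tmf T]_t (c * f t) = c * \int[tmf T]_t f t.
Proof. by move=> cf; rewrite RintegralZl//; exact: integrable_tmf_cont. Qed.

End tmf_continuous.

(** * Integration by parts and antidivergence on the torus *)

Section torus_calculus.
Variables (R : realType) (d : nat).
Local Notation E := 'rV[R]_d.
Local Notation e := (@basis_vec R d).
Local Notation mu := (torus_measure R d).
Implicit Types (f g : E -> R).

Local Notation I f := (\int[mu]_x f x).

Lemma torusD f g : sm f -> sm g -> I (fun x => f x + g x) = I f + I g.
Proof. by move=> sf sg; rewrite RintegralD//; exact: sm_integrable. Qed.

Lemma torusB f g : sm f -> sm g -> I (fun x => f x - g x) = I f - I g.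
Proof. by move=> sf sg; rewrite RintegralB//; exact: sm_integrable. Qed.

Lemma Zperiodic_e f j : Zperiodic f -> forall x, f (x + e j) = f x.
Proof.
move=> pf x; rewrite -(pf x (delta_mx 0 j)); congr (f (_ + _)).
by apply/rowP => i; rewrite !mxE; case: (_ && _).
Qed.

Lemma cont_shift_line f j : continuous f -> continuous (fun z : R * E => f (z.2 + z.1 *: e j)).
Proof.
move=> cf; apply: (@cont_comp _ _ _ (fun z : R * E => z.2 + z.1 *: e j) f) => // z.
apply: cvgD; first exact: cvg_snd.
by apply: cvgZr_tmp; exact: cvg_fst.
Qed.

Lemma Zperiodic_shift_line f j : Zperiodic f ->
  forall s, Zperiodic (fun x : E => f (x + s *: e j)).
Proof. by move=> pf s x k; rewrite addrAC pf. Qed.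

(** By translation invariance the integral equals its mean over the translations by s e_j with s in
    [0, 1]. After Fubini the inner integral is f (x + e_j) - f x = 0. *)
Lemma torus_pd f j : sm f -> I (pd j f) = 0.
Proof.
move=> sf; have [pf _] := sf.
have cg := cont_shift_line (j := j) (sm_cont (sm_pd j sf)).
have pg := Zperiodic_shift_line j (Zperiodic_pd j pf).
have H := spacetime12 1 cg pg; rewrite (spacetime21 1 cg pg) in H.
transitivity (\int[tmf 1]_s \int[mu]_x pd j f (x + s *: e j)).
  transitivity (\int[tmf 1]_s I (pd j f)).
    by rewrite (tmf_cst ltr01) mulr1.
  apply: eq_Rintegral => s _; rewrite torus_translation//; last exact: Zperiodic_pd.
  exact/sm_cont/sm_pd.
rewrite -H -[RHS](torus_cst d 0); apply: eq_Rintegral => x _.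
have cl := cont_comp (@continuous_line _ _ x (e j)) (sm_cont (sm_pd j sf)).
by rewrite (FTC_tmf ltr01 cl (fun s => is_derive_line (sm_is sf j _))) scale1r scale0r addr0 Zperiodic_e// subrr.
Qed.

Lemma torus_ibp f g j : sm f -> sm g ->
  I (fun x => f x * pd j g x) = - I (fun x => pd j f x * g x).
Proof.
move=> sf sg; apply/eqP; rewrite -subr_eq0 opprK; apply/eqP.
rewrite -torusD; [|by apply: smM => //; exact: sm_pd..].
rewrite -[RHS](torus_pd j (smM sf sg)); apply: eq_Rintegral => x _.
by rewrite pdM// [X in _ + X]mulrC.
Qed.

(** Two integrations by parts and the symmetry of second derivatives. This makes rotated gradients
    weakly divergence-free, and it later exchanges derivatives between an error field and the test
    function. *)
Lemma torus_skew f g i j : sm f -> sm g ->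
  I (fun x => pd j f x * pd i g x) = I (fun x => pd i f x * pd j g x).
Proof.
move=> sf sg.
have H i' j' : I (fun x => pd j' f x * pd i' g x) = - I (fun x => f x * pd j' (pd i' g) x).
  by rewrite (torus_ibp j' sf (sm_pd i' sg)) opprK.
by rewrite !H (sm_schwarz i j sg).
Qed.

Section average.
Variable k : R -> R.
Hypothesis ck : continuous k.

Let kb : exists2 M, 0 < M & forall s, 0 <= s <= 1 -> `|k s| <= M.
Proof.
have c' : continuous (fun s => `|k s|) by move=> s; apply: continuous_comp; [exact: ck|exact: norm_continuous].
have [c _ cM] := @EVT_max _ (fun s => `|k s|) 0 1 ler01 (continuous_subspaceT c').
exists (`|k c| + 1); first by rewrite ltr_wpDl.
by move=> s s01; rewrite (le_trans (cM s _)) ?in_itv// lerDl.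
Qed.

(* The kernel is cut off outside [0, 1], where tmf 1 vanishes. *)
(* k = 1 gives the mean of f in direction j, and k = id a primitive of f minus that mean. *)
Definition avg (j : 'I_d) f (x : E) : R := \int[tmf 1]_s (k s * f (x + s *: e j)).

Lemma avg_cont_integrand f j x : continuous f -> continuous (fun s : R => k s * f (x + s *: e j)).
Proof.
move=> cf; apply: contM => //.
exact: (cont_comp (@continuous_line _ _ x (e j)) cf).
Qed.

Let bint f j x : continuous f -> (tmf 1).-integrable setT (EFin \o (fun s : R => k s * f (x + s *: e j))).
Proof. by move=> cf; apply: integrable_tmf_cont; exact: avg_cont_integrand. Qed.

Lemma avg_cont f j : sm f -> continuous (avg j f).
Proof.
move=> sf; have [M M0 kM] := kb; have [L L0 fL] := sm_pd_bounded sf.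
have cf := sm_cont sf.
apply: cont_of_dist => x r r0.
pose C := M * (L * d%:R); have C0 : 0 <= C by rewrite !mulr_ge0// ltW.
have C1 : 0 < C + 1 by rewrite ltr_wpDl.
have rC : 0 < r / (C + 1) by rewrite divr_gt0.
apply: filterS (nbhsx_ballx x _ rC) => y; rewrite -ball_normE/= ltr_pdivlMr// => xy1.
have -> : avg j f x - avg j f y = \int[tmf 1]_s (k s * (f (x + s *: e j) - f (y + s *: e j))).
  rewrite /avg -RintegralB//; [|exact: bint..].
  by apply: eq_Rintegral => s _; rewrite mulrBr.
have xy : `|x - y| * C <= r.
  by rewrite (le_trans _ (ltW xy1))// ler_wpM2l// lerDl.
rewrite (le_trans _ xy)// -[X in _ <= X]mulr1; apply: tmf_le_norm => //.
  apply: contM => //; apply: contD.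
    exact: (cont_comp (@continuous_line _ _ x (e j)) cf).
  move=> s; apply: cvgN; exact: (cont_comp (@continuous_line _ _ y (e j)) cf).
move=> s s01; rewrite normrM /C [X in _ <= X]mulrCA ler_pM//; first exact: kM.
have := @lipschitz_pd _ _ f L (y + s *: e j) (x - y) (sm_der sf) (ltW L0) fL.
rewrite [y + _ + _]addrAC (addrC y) subrK => /le_trans; apply.
rewrite mulrCA ler_pM2l//.
apply: (@le_trans _ _ (\sum_(i < d) `|x - y|)); last by rewrite sumr_const card_ord mulr_natr.
apply: ler_sum => i _; rewrite /Num.norm/= mx_normrE.
exact: (le_bigmax _ (fun ij : 'I_1 * 'I_d => `|(x - y) ij.1 ij.2|) (0, i)).
Qed.

Lemma avg_is_derive f j i x : sm f -> is_derive x (e i) (avg j f) (avg j (pd i f) x).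
Proof.
move=> sf; have cf := sm_cont sf; have cpf := sm_cont (sm_pd i sf).
have [M M0 kM] := kb; have [L L0 fL] := sm_bounded (sm_pd i sf).
apply: line_is_derive.
(* Differentiation under the integral asks for a dominating bound at every s, so k is replaced by a
   continuous function that equals it on [0, 1] and stays bounded outside. *)
pose k' (s : R) := k (Num.max 0 (Num.min s 1)).
have k'E (s : R) : 0 <= s <= 1 -> k' s = k s.
  by move=> /andP[s0 s1]; rewrite /k' (min_idPl s1) (max_idPr s0).
have k'M s : `|k' s| <= M.
  by apply: kM; rewrite le_max lexx/= ge_max ler01 ge_min lexx orbT.
have ck' : continuous k'.
  apply: (@cont_comp R R R (fun s : R => Num.max 0 (Num.min s 1)) k) => // s.
  have c1 : continuous (fun s : R => Num.min s 1).
    by move=> t; apply: continuous_min; [exact: cvg_id|exact: cvg_cst].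
  by apply: (@continuous_max R R (fun=> 0) (fun s : R => Num.min s 1) s); [exact: cvg_cst|exact: c1].
have swap g y : continuous g -> avg j g y = \int[tmf 1]_s (k' s * g (y + s *: e j)).
  move=> cg; apply: tmf_eq => //; last by move=> s /k'E ->.
    exact: avg_cont_integrand.
  by apply: contM => //; exact: (cont_comp (@continuous_line _ _ y (e j)) cg).
pose F (h s : R) := k' s * f (x + h *: e i + s *: e j).
have dF (h s : R) : is_derive h (1 : R) (F ^~ s) (k' s * pd i f (x + h *: e i + s *: e j)).
  have h1 : is_derive h (1 : R) (fun h : R => f ((x + s *: e j) + h *: e i)) (pd i f (x + h *: e i + s *: e j)).
    by apply: is_derive_line; rewrite addrAC; exact: sm_is.
  have := is_deriveZ (k' s) h1.
  by congr is_derive; apply/funext => u; rewrite /F /GRing.scale/= addrAC.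
have E1 : (fun h : R => avg j f (x + h *: e i)) = (fun h : R => \int[tmf 1]_(s in setT) F h s).
  by apply/funext => h; rewrite swap.
have cF h : continuous (F h).
  by apply: contM => //; exact: (cont_comp (@continuous_line _ _ (x + h *: e i) (e j)) cf).
have Hint h : `](-1 : R), 1[%classic h -> (tmf 1).-integrable setT (EFin \o F h).
  by move=> _; exact: integrable_tmf_cont.
have I0 : (`](-1 : R), 1[%classic : set R) 0 by rewrite /= in_itv/= ltr01 ltrN10.
have Hder h s : `](-1 : R), 1[%classic h -> setT s -> derivable (F ^~ s) h 1.
  by move=> _ _; exact: ex_derive.
have iG : (tmf 1).-integrable setT (EFin \o (fun _ : R => M * L)).
  by apply: integrable_tmf_cont => s; exact: cvg_cst.
have Hub (h s : R) : `](-1 : R), 1[%classic h -> setT s -> `|partial1of2 F h s| <= M * L.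
  move=> _ _; rewrite partial1of2E derive_val normrM ler_pM//; exact: fL.
have ML0 (s : R) : 0 <= M * L by rewrite mulr_ge0 ?ltW.
have D0 := @derivable_under_integral _ _ _ (tmf 1) F setT measurableT 0 (-1) 1 I0 Hint Hder _ ML0 iG Hub.
have D1 := @differentiation_under_integral _ _ _ (tmf 1) F setT measurableT 0 (-1) 1 I0 Hint Hder _ ML0 iG Hub.
rewrite E1; split; first exact: D0.
rewrite -derive1E D1 swap//; apply: eq_Rintegral => s _.
by rewrite partial1of2E derive_val scale0r addr0.
Qed.

Lemma pd_avg f j i : sm f -> pd i (avg j f) = avg j (pd i f).
Proof. by move=> sf; apply/funext => x; apply: pd_val; exact: avg_is_derive. Qed.

Lemma sm_avg f j : sm f -> sm (avg j f).
Proof.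
move=> sf; split.
  by move=> x m; apply: eq_Rintegral => s _; rewrite addrAC; have [-> _] := sf.
move=> n; elim: n f sf => [|n IH] f sf; first by split => //; exact: avg_cont.
apply: (@Cn_build _ _ _ _ (fun i => avg j (pd i f))).
- exact: avg_cont.
- by move=> i x; exact: avg_is_derive.
- by move=> i; apply: IH; exact: sm_pd.
Qed.

(** Pointwise, |avg| is at most the mean of |f| over the segment from x to x + e_j, and that mean
    has the same integral as |f| by Fubini and translation invariance. *)
Lemma avg_L1 f j : (forall s, 0 <= s <= 1 -> `|k s| <= 1) -> sm f ->
  I (fun x => `|avg j f x|) <= I (fun x => `|f x|).
Proof.
move=> k1 sf; have cf := sm_cont sf; have [pf _] := sf.
have can : continuous (fun x : E => `|f x|) by move=> x; apply: continuous_comp; [exact: cf|exact: norm_continuous].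
have pan : Zperiodic (fun x : E => `|f x|) by move=> x m; rewrite pf.
have cg := cont_shift_line (j := j) can.
have pg := Zperiodic_shift_line j pan.
have H := spacetime12 1 cg pg; rewrite (spacetime21 1 cg pg) in H.
have HI : \int[tmf 1]_s \int[mu]_x `|f (x + s *: e j)| = I (fun x => `|f x|).
  transitivity (\int[tmf 1]_s I (fun x => `|f x|)).
    by apply: eq_Rintegral => s _; rewrite (torus_translation _ can pan).
  by rewrite (tmf_cst ltr01) mulr1.
rewrite -HI -H.
have sA := sm_avg j sf.
have [L L0 fL] := sm_bounded sf.
pose A (x : E) := \int[tmf 1]_s `|f (x + s *: e j)|.
have cAi x : continuous (fun s : R => `|f (x + s *: e j)|).
  exact: (cont_comp (@continuous_line _ _ x (e j)) can).
have iA : mu.-integrable setT (EFin \o A).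
  apply: (@bounded_integrable R _ _ _ _ (L * 1)).
  - by rewrite ltey_eq fin_num_measure.
  - apply/measurable_EFinP; have := measurable_fubini_G (integrable_spacetime 1 cg pg).
    congr (measurable_fun _ _); apply/funext => x.
    rewrite /fubini_G/= /A /Rintegral fineK//; apply: integrable_fin_num => //.
    exact: integrable_tmf_cont.
  - by move=> x; apply: tmf_le_norm => // s _; rewrite normr_id.
apply: le_Rintegral => //.
  by apply: integrable_norm; exact: sm_integrable.
move=> x _; rewrite /avg /A.
rewrite (le_trans (tmf_norm 1 _))//; first exact: avg_cont_integrand.
apply: tmf_le => //.
- exact/cont_norm/avg_cont_integrand.
- exact: cAi.
- by move=> s s01; rewrite normrM ler_piMl// k1.
Qed.

End average.

(** Integration by parts in s: s f (x + s e_j) has derivative s d_j f + f, and its increment over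
    [0, 1] is f (x + e_j) = f x. *)
Lemma pd_avg_id f j x : sm f ->
  pd j (avg id j f) x = f x - avg (fun=> 1) j f x.
Proof.
move=> sf; have cid : continuous (id : R -> R) by move=> s; exact: cvg_id.
have c1 : continuous ((fun=> 1) : R -> R) by exact: cst_continuous.
have cf := sm_cont sf.
rewrite pd_avg// /avg.
have ca := avg_cont_integrand cid (j := j) (x := x) (sm_cont (sm_pd j sf)).
have cb := avg_cont_integrand c1 (j := j) (x := x) cf.
have dG (s : R) : is_derive s (1 : R) (fun s => s * f (x + s *: e j)) (s * pd j f (x + s *: e j) + 1 * f (x + s *: e j)).
  have h1 : is_derive s (1 : R) (fun h : R => f (x + h *: e j)) (pd j f (x + s *: e j)).
    by apply: is_derive_line; exact: sm_is.
  by have := is_deriveM (is_derive_id s (1 : R)) h1; rewrite /GRing.scale/= mulr1 mul1r.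
have := FTC_tmf ltr01 (contD ca cb) dG.
rewrite !mul1r mul0r subr0 scale1r Zperiodic_e; last by case: sf.
by move=> <-; rewrite RintegralD ?addrK//; exact: integrable_tmf_cont.
Qed.

Definition indep (i : 'I_d) f := forall x (s : R), f (x + s *: e i) = f x.

Lemma pd_indep i f x : indep i f -> pd i f x = 0.
Proof.
move=> h; apply: pd_val; apply: line_is_derive.
under eq_fun do rewrite h; exact: is_derive_cst.
Qed.

Lemma avg_indep k i j f : indep i f -> indep i (avg k j f).
Proof. by move=> h x s; apply: eq_Rintegral => t _; rewrite addrAC h. Qed.

(** The coordinates are averaged out one at a time. Removing from f all but its mean in direction j
    leaves the derivative d_j of [avg id j f]; once all directions are averaged a constant remains,
    which vanishes since f has mean 0. Both averages contract L^1 and preserve independence of a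
    coordinate, so the bounds survive the recursion. *)
Lemma antidivergence f : sm f -> I f = 0 ->
  exists J : 'I_d -> E -> R, [/\ forall j, sm (J j),
    forall x, f x = \sum_j pd j (J j) x,
    forall j, I (fun x => `|J j x|) <= I (fun x => `|f x|) &
    forall i, indep i f -> forall j, indep i (J j)].
Proof.
move=> sf f0.
have cid : continuous (id : R -> R) by move=> s; exact: cvg_id.
have c1 : continuous ((fun=> 1) : R -> R) by exact: cst_continuous.
have kid (s : R) : 0 <= s <= 1 -> `|id s| <= 1 by move=> /andP[s0 s1]; rewrite ger0_norm.
have kone (s : R) : 0 <= s <= 1 -> `|(fun=> 1 : R) s| <= 1 by rewrite normr1.
(* For a list r of directions a remainder g is kept, constant in the directions of r. *)
suff H (r : seq 'I_d) : uniq r -> forall f, sm f ->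
  exists (J : 'I_d -> E -> R) (g : E -> R), [/\ sm g, forall j, sm (J j),
    forall x, f x = g x + \sum_(j <- r) pd j (J j) x,
    (forall j, I (fun x => `|J j x|) <= I (fun x => `|f x|)) &
    [/\ forall i, indep i f -> (forall j, indep i (J j)) /\ indep i g,
        forall i x, (forall x, pd i f x = 0) -> pd i g x = 0 &
        forall i x, i \in r -> pd i g x = 0]].
  have [J [g [sg sJ fE JL [Ji _ g0]]]] := H (index_enum _) (index_enum_uniq _) f sf.
  have gc := pd0_cst sg (fun j x => g0 j x (mem_index_enum j)).
  have g00 : g 0 = 0.
    have S0 (s : seq 'I_d) : I (fun x => \sum_(j <- s) pd j (J j) x) = 0.
      elim: s => [|j s IH].
        by under eq_Rintegral do rewrite big_nil; rewrite torus_cst.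
      under eq_Rintegral do rewrite big_cons.
      rewrite torusD; [|exact/sm_pd|by apply: sm_sum => i; exact: sm_pd].
      by rewrite torus_pd// add0r IH.
    rewrite -f0 -[LHS](torus_cst d) -[LHS]addr0 -(S0 (index_enum _)).
    rewrite -torusD; [|exact: sm_cst|by apply: sm_sum => i; exact: sm_pd].
    by apply: eq_Rintegral => x _; rewrite fE (gc x).
  exists J; split => // [x|i fi j]; first by rewrite fE (gc x) g00 add0r.
  by have [h _] := Ji i fi; exact: h.
elim: r => [_ {f f0 sf} f sf|j r IH /= /andP[jr ur] {f f0 sf} f sf].
  exists (fun _ _ => 0), f; split; [exact: sf|by move=> j; exact: sm_cst|by move=> x; rewrite big_nil addr0| |by split].
  by move=> j; under eq_Rintegral do rewrite normr0; rewrite torus_cst; apply: Rintegral_ge0.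
have sP := sm_avg c1 j sf.
have [J [g [sg sJ fE JL [Ji g0 g0r]]]] := IH ur _ sP.
exists (fun i => if i == j then avg id j f else J i), g; split => //.
- by move=> i; case: ifP => _ //; exact: sm_avg.
- move=> x; rewrite big_cons eqxx pd_avg_id// big_seq.
  rewrite (eq_bigr (fun i => pd i (J i) x)); last first.
    by move=> i ir; case: ifP => // /eqP ij; move: jr; rewrite -ij ir.
  by rewrite -big_seq addrCA -fE subrK.
- move=> i; case: ifP => _; first exact: (avg_L1 cid).
  by rewrite (le_trans (JL i))//; exact: (avg_L1 c1).
- split.
  + move=> i fi; have [h1 h2] := Ji i (@avg_indep (fun=> 1) i j f fi).
    by split => // l; case: ifP => // _; exact: avg_indep.
  + move=> i x fi; apply: g0 => y; rewrite pd_avg// /avg.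
    under eq_Rintegral do rewrite fi mulr0.
    by rewrite Rintegral_cst// mul0r.
  + move=> i x; rewrite inE => /predU1P[->|ir]; last exact: g0r.
    apply: g0 => y; rewrite pd_avg// /avg.
    have cl := cont_comp (@continuous_line _ _ y (e j)) (sm_cont (sm_pd j sf)).
    under eq_Rintegral do rewrite mul1r.
    rewrite (FTC_tmf ltr01 cl (fun s => is_derive_line (sm_is sf j _))) scale1r scale0r addr0.
    by rewrite Zperiodic_e ?subrr//; case: sf.
Qed.

End torus_calculus.



(** * Building blocks in space *)

Section profile.
Variables (R : realType) (m : R).
Hypothesis m1 : 1 <= m.
Local Notation u := (fun y : R => m * cos (pi * y)).
Local Notation s := (fun y : R => sin (pi * y)).

(* This profile is concentrated at scale 1 / m, and its derivatives are bounded by powers of m times itself. *)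
Definition prof (y : R) : R := (1 + (m * cos (pi * y)) ^+ 2)^-1.
(** The logarithmic derivative of [prof]; it is O(m), which is how derivatives of [prof] get bounded
    by multiples of [prof] itself. *)
Definition rat_prof (y : R) : R := 2 * pi * m * (m * cos (pi * y)) * sin (pi * y) * prof y.
Definition drat_prof (y : R) : R :=
  2 * pi ^+ 2 * ((m * cos (pi * y)) ^+ 2 - m ^+ 2 * sin (pi * y) ^+ 2) * prof y +
  rat_prof y ^+ 2.

Let m0 : 0 < m. Proof. exact: lt_le_trans m1. Qed.

Lemma prof_den_gt0 (v : R) : 0 < 1 + v ^+ 2.
Proof. by rewrite ltr_pwDl// sqr_ge0. Qed.

Lemma prof_gt0 y : 0 < prof y.
Proof. by rewrite invr_gt0 prof_den_gt0. Qed.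

Lemma prof_le1 y : prof y <= 1.
Proof. by rewrite invf_le1 ?prof_den_gt0// lerDl sqr_ge0. Qed.

Lemma is_derive_pi (f : R -> R) (y l : R) : is_derive (pi * y) (1 : R) f l ->
  is_derive y (1 : R) (fun y : R => f (pi * y)) (l * pi).
Proof.
move=> df; apply: (@is_derive1_comp _ f (fun y : R => pi * y)).
by have := is_deriveZ (pi : R) (is_derive_id y (1 : R)); rewrite /GRing.scale/= mulr1.
Qed.

Lemma is_derive_u y : is_derive y (1 : R) u (- pi * m * s y).
Proof.
have := is_deriveZ m (is_derive_pi (is_derive_cos (pi * y))).
by rewrite /GRing.scale/=; congr is_derive; ring.
Qed.

Lemma is_derive_s y : is_derive y (1 : R) s (pi * cos (pi * y)).
Proof. by have := is_derive_pi (is_derive_sin (pi * y)); rewrite mulrC. Qed.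

(** Together with [atan] these functions span the primitives of the powers of 1 / (1 + v ^ 2) that
    occur below. *)
Lemma is_derive_rat (k : nat) (v : R) :
  is_derive v (1 : R) (fun v : R => v / (1 + v ^+ 2) ^+ k.+1)
   ((1 + v ^+ 2) ^- k.+1 - 2 * k.+1%:R * v ^+ 2 / (1 + v ^+ 2) ^+ k.+2).
Proof.
have n0 : 1 + v ^+ 2 != 0 by rewrite gt_eqF// prof_den_gt0.
have h1 : is_derive v (1 : R) (fun v : R => 1 + v ^+ 2) (2 * v).
  have := is_deriveD (is_derive_cst (1 : R) v (1 : R)) (is_deriveX 2 (is_derive_id v (1 : R))).
  by rewrite /GRing.scale/= add0r expr1 mulr1; congr is_derive; apply/funext.
have h2 := is_deriveX k.+1 h1; rewrite exprfctE in h2.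
have n1 : (1 + v ^+ 2) ^+ k.+1 != 0 by rewrite expf_neq0.
have h3 := @is_deriveV _ (fun v : R => (1 + v ^+ 2) ^+ k.+1) v _ (1 : R) n1 h2.
have h4 := is_deriveM (is_derive_id v (1 : R)) h3.
have -> : (1 + v ^+ 2) ^- k.+1 - 2 * k.+1%:R * v ^+ 2 / (1 + v ^+ 2) ^+ k.+2 =
  id v *: (- ((1 + v ^+ 2) ^+ k.+1) ^- 2 *: ((k.+1%:R * (1 + v ^+ 2) ^+ k) *: (2 * v))) + ((1 + v ^+ 2) ^+ k.+1)^-1 *: (1 : R).
  rewrite /GRing.scale/=; move: (1 + v ^+ 2) n0 {n1 h1 h2 h3 h4} => D D0.
  by rewrite !exprS; field; rewrite ?D0 ?expf_neq0.
exact: h4.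
Qed.

Lemma is_derive_prof y : is_derive y (1 : R) prof (rat_prof y * prof y).
Proof.
have n0 : 1 + (u y) ^+ 2 != 0 by rewrite gt_eqF// prof_den_gt0.
have h1 := is_deriveD (is_derive_cst (1 : R) y (1 : R)) (is_deriveX 2 (is_derive_u y)).
have h2 := @is_deriveV _ (fun y : R => 1 + (u y) ^+ 2) y _ (1 : R) n0 h1.
have -> : rat_prof y * prof y = - (1 + (u y) ^+ 2) ^- 2 *: (0 + (2%:R * u y ^+ 1) *: (- pi * m * s y)).
  by rewrite /rat_prof /prof /GRing.scale/=; field.
exact: h2.
Qed.

Lemma is_derive_rat_prof y : is_derive y (1 : R) rat_prof (drat_prof y).
Proof.
have h1 := is_deriveM (is_deriveM (is_derive_u y) (is_derive_s y)) (is_derive_prof y).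
have h2 := is_deriveZ (2 * pi * m) h1.
have E : rat_prof = (fun y : R => (2 * pi * m) * (u y * s y * prof y)).
  by apply/funext => z; rewrite /rat_prof; ring.
rewrite E.
suff -> : drat_prof y = (2 * pi * m) *: ((u y * s y) *: (rat_prof y * prof y) + prof y *: (u y *: (pi * cos (pi * y)) + s y *: (- pi * m * s y))).
  exact: h2.
by rewrite /drat_prof /rat_prof /GRing.scale/=; ring.
Qed.

Lemma rat_prof_le y : `|rat_prof y| <= pi * m.
Proof.
have p0 : 0 < pi :> R by exact: pi_gt0.
have su : `|m * cos (pi * y) * prof y| * 2 <= 1.
  rewrite /prof normrM normfV (gtr0_norm (prof_den_gt0 _)) mulrAC ler_pdivrMr ?prof_den_gt0// mul1r.
  rewrite -[X in _ <= 1 + X]real_normK ?num_real//.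
  by have := sqr_ge0 (`|m * cos (pi * y)| - 1); nra.
have s1 : `|sin (pi * y)| <= 1.
  by rewrite ler_norml sin_geN1 sin_le1.
have -> : rat_prof y = (pi * m) * ((m * cos (pi * y) * prof y) * 2 * sin (pi * y)).
  by rewrite /rat_prof; ring.
rewrite normrM (gtr0_norm (mulr_gt0 p0 m0)) ler_piMr//; first exact: ltW (mulr_gt0 p0 m0).
rewrite normrM normrM (ger0_norm (ler0n _ 2)) (le_trans _ su)// ler_piMr// mulr_ge0.
Qed.

Lemma drat_prof_le y : `|drat_prof y| <= 3 * pi ^+ 2 * m ^+ 2.
Proof.
have p0 : 0 < pi :> R by exact: pi_gt0.
have h1 := rat_prof_le y.
have h2 : `|rat_prof y ^+ 2| <= pi ^+ 2 * m ^+ 2.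
  by rewrite normrX -exprMn lerXn2r ?nnegrE// mulr_ge0// ltW.
rewrite /drat_prof (le_trans (ler_normD _ _))//.
have h3 : `|(m * cos (pi * y)) ^+ 2 - m ^+ 2 * sin (pi * y) ^+ 2| <= m ^+ 2.
  have E := sin2cos2 (pi * y).
  have -> : (m * cos (pi * y)) ^+ 2 - m ^+ 2 * sin (pi * y) ^+ 2 = m ^+ 2 * (1 - 2 * sin (pi * y) ^+ 2).
    by rewrite exprMn; have -> : cos (pi * y) ^+ 2 = 1 - sin (pi * y) ^+ 2; [move: E; lra|ring].
  rewrite normrM (ger0_norm (sqr_ge0 m)) ler_piMr ?sqr_ge0// ler_norml.
  have := sqr_ge0 (sin (pi * y)); have := sqr_ge0 (cos (pi * y)); move: E; lra.
set Z := `|rat_prof y ^+ 2| in h2 *.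
rewrite !(normrM, normrX) (gtr0_norm (prof_gt0 y)) (ger0_norm (ler0n _ 2)) (gtr0_norm p0).
have h4 : 2 * pi ^+ 2 * `|(m * cos (pi * y)) ^+ 2 - m ^+ 2 * sin (pi * y) ^+ 2| * prof y <= 2 * pi ^+ 2 * m ^+ 2.
  rewrite (@le_trans _ _ (2 * pi ^+ 2 * `|(m * cos (pi * y)) ^+ 2 - m ^+ 2 * sin (pi * y) ^+ 2|))//.
    by apply: ler_piMr; [rewrite mulr_ge0// mulr_ge0// sqr_ge0|exact: prof_le1].
  by rewrite ler_pM2l// mulr_gt0// exprn_gt0.
by move: h2 h4; lra.
Qed.

Lemma cont_u : continuous (u : R -> R).
Proof.
move=> y; apply: continuous_comp; last exact: cont_mull.
apply: continuous_comp; [exact: cont_mull|exact: continuous_cos].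
Qed.

Lemma cont_s : continuous (s : R -> R).
Proof. by move=> y; apply: continuous_comp; [exact: cont_mull|exact: continuous_sin]. Qed.

Lemma cont_of_derive (f g : R -> R) : (forall y : R, is_derive y (1 : R) f (g y)) -> continuous f.
Proof.
move=> df y; apply/differentiable_continuous/derivable1_diffP; exact: ex_derive.
Qed.

Lemma cont_prof : continuous prof.
Proof. exact: cont_of_derive is_derive_prof. Qed.

Lemma cont_rat_prof : continuous rat_prof.
Proof. exact: cont_of_derive is_derive_rat_prof. Qed.

Lemma u_0 : u 0 = m. Proof. by rewrite /= mulr0 cos0 mulr1. Qed.
Lemma u_1 : u 1 = - m. Proof. by rewrite /= mulr1 cospi mulrN1. Qed.

Lemma s_itv y : 0 <= y <= 1 -> 0 <= s y <= 1.
Proof.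
move=> /andP[y0 y1]; rewrite sin_le1 andbT sin_ge0_pi// mulr_ge0 ?pi_ge0//=.
by rewrite ler_piMr ?pi_ge0.
Qed.

(* Substitution v = u y for the integrals weighted by s. *)
Lemma int_s (f F : R -> R) : continuous f -> (forall v : R, is_derive v (1 : R) F (f v)) ->
  \int[tmf 1]_y (s y * f (u y)) = (F m - F (- m)) / (pi * m).
Proof.
move=> cf dF.
have pn : pi != 0 :> R by rewrite gt_eqF ?pi_gt0.
have mn : m != 0 by rewrite gt_eqF.
have dG (y : R) : is_derive y (1 : R) (fun y => - (pi * m)^-1 * F (u y)) (s y * f (u y)).
  have h := is_deriveZ (- (pi * m)^-1) (@is_derive1_comp _ F u y _ _ (dF (u y)) (is_derive_u y)).
  have -> : s y * f (u y) = - (pi * m)^-1 *: (f (u y) * (- pi * m * s y)) :> R.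
    rewrite /GRing.scale/=; move: (pi : R) pn {h} => q qn; field.
    by rewrite ?qn ?mn.
  exact: h.
have cg : continuous (fun y : R => s y * f (u y)).
  apply: contM; first exact: cont_s.
  exact: (cont_comp cont_u cf).
rewrite (FTC_tmf ltr01 cg dG) u_0 u_1; move: (pi : R) pn => q qn; field.
by rewrite ?qn ?mn.
Qed.

Lemma cont_den (k : nat) : continuous (fun v : R => (1 + v ^+ 2) ^- k : R).
Proof.
move=> v; apply: cvgV; first by rewrite expf_neq0// gt_eqF// prof_den_gt0.
apply: (@continuous_comp _ _ _ (fun v : R => 1 + v ^+ 2) (fun w : R => w ^+ k)); last exact: exprn_continuous.
by apply: cvgD; [exact: cvg_cst|exact: exprn_continuous].
Qed.

(** Split 1 = cos^2 + sin^2. The first part is at most 1 / m^2 pointwise; in the second sin^2 <= sin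
    on the interval, and the substitution gives (atan m - atan (- m)) / (pi m) <= 1 / m. *)
Lemma int_prof_le : \int[tmf 1]_y prof y <= 2 / m.
Proof.
have p0 : 0 < pi :> R by exact: pi_gt0.
have H := @int_s (fun v => (1 + v ^+ 2)^-1) atan _ (@is_derive1_atan R).
have {}H : \int[tmf 1]_y (s y * prof y) = (atan m - atan (- m)) / (pi * m).
  by apply: H => v; have := @cont_den 1 v; under eq_fun do rewrite expr1.
have Hle : \int[tmf 1]_y (s y * prof y) <= m^-1.
  rewrite H atanN opprK ler_pdivrMr ?mulr_gt0// mulrCA mulVf ?mulr1 ?gt_eqF//.
  by have := atan_ltpi2 m; lra.
apply: (@le_trans _ _ (\int[tmf 1]_y (s y * prof y + (m ^+ 2)^-1))).
  apply: tmf_le => //; first exact: cont_prof.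
  - by apply: contD; [apply: contM; [exact: cont_s|exact: cont_prof]|exact: cst_continuous].
  - move=> y /s_itv/andP[s0 s1].
    have E := sin2cos2 (pi * y).
    have : prof y * (cos (pi * y)) ^+ 2 <= (m ^+ 2)^-1.
      rewrite -[X in _ <= X]mul1r ler_pdivlMr ?exprn_gt0// -mulrA -exprMn mulrC (mulrC (cos _)) /prof.
      by rewrite ler_pdivrMr ?prof_den_gt0// mul1r lerDr.
    have : prof y * (sin (pi * y)) ^+ 2 <= s y * prof y.
      by rewrite mulrC ler_wpM2r ?(ltW (prof_gt0 y))// expr2 ler_piMl.
    have : prof y = prof y * (cos (pi * y)) ^+ 2 + prof y * (sin (pi * y)) ^+ 2.
      by rewrite -mulrDr sin2cos2 addrC subrK mulr1.
    by lra.
rewrite tmfD; last 2 first.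
- by apply: contM; [exact: cont_s|exact: cont_prof].
- exact: cst_continuous.
rewrite (tmf_cst ltr01) mulr1 mulr_natl mulr2n lerD// lef_pV2 ?posrE ?exprn_gt0//.
by rewrite expr2 ler_peMr// ltW.
Qed.

(** Inserting the weight sin (pi y) <= 1 makes the integral explicit; the increment of [F] is at
    least atan m >= pi / 4. *)
Lemma int_prof2_ge : (4 * m)^-1 <= \int[tmf 1]_y (prof y ^+ 2).
Proof.
have p0 : 0 < pi :> R by exact: pi_gt0.
pose F (v : R) := 2^-1 * (atan v + v / (1 + v ^+ 2) ^+ 1).
have dF (v : R) : is_derive v (1 : R) F ((1 + v ^+ 2) ^- 2).
  have n0 : 1 + v ^+ 2 != 0 by rewrite gt_eqF// prof_den_gt0.
  have h := is_deriveZ (2^-1 : R) (is_deriveD (is_derive1_atan v) (is_derive_rat 0 v)).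
  have -> : (1 + v ^+ 2) ^- 2 = 2^-1 *: ((1 + v ^+ 2)^-1 + ((1 + v ^+ 2) ^- 1 - 2 * 1 * v ^+ 2 / (1 + v ^+ 2) ^+ 2)).
    by rewrite /GRing.scale/=; field.
  exact: h.
have H := int_s (@cont_den 2) dF.
apply: (@le_trans _ _ (\int[tmf 1]_y (s y * (1 + u y ^+ 2) ^- 2))).
  rewrite H /F atanN -[leLHS]mul1r ler_pdivlMr ?mulr_gt0// invfM sqrrN.
  have at1 : pi / 4 <= atan m by rewrite -atan1; exact: le_atan.
  have : 0 <= m / (1 + m ^+ 2) ^+ 1 by rewrite divr_ge0 ?(ltW m0)// exprn_ge0// ltW// prof_den_gt0.
  rewrite mulNr; set z := m / _ => z0.
  have -> : 1 * (4^-1 / m) * (pi * m) = pi / 4.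
    by move: (pi : R) => q; field; rewrite gt_eqF.
  lra.
apply: tmf_le => //.
- by apply: contM; [exact: cont_s|exact: (cont_comp cont_u (@cont_den 2))].
- apply: (@cont_comp R R R prof (fun w : R => w ^+ 2)); [exact: cont_prof|exact: exprn_continuous].
- move=> y /s_itv/andP[s0 s1]; rewrite /prof exprVn ler_piMl// invr_ge0 exprn_ge0//.
  exact/ltW/prof_den_gt0.
Qed.

(** One factor sin (pi y) of the square is kept as the weight of the substitution; the other is
    bounded below, at the price of the negative term of [f], which m >= 8 makes harmless. *)
Lemma int_dprof2_ge : 8 <= m -> m / 4 <= \int[tmf 1]_y ((rat_prof y * prof y) ^+ 2).
Proof.
move=> m8; have p0 : 0 < pi :> R by exact: pi_gt0.
have p2 : 2 <= pi :> R by exact: pi_ge2.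
(* From sin >= sin^2 = 1 - u^2 / m^2 and u^4 (1 + u^2)^-4 <= (1 + u^2)^-1. The coefficients of [F]
   come from the reduction formula for the powers of 1 / (1 + v^2). *)
pose f (v : R) := 4 * (v ^+ 2 * (1 + v ^+ 2) ^- 4) - 4 / m ^+ 2 * (1 + v ^+ 2)^-1.
pose F (v : R) := 4 / 6 * (3 / 8 * atan v + 3 / 8 * (v / (1 + v ^+ 2) ^+ 1) + 1 / 4 * (v / (1 + v ^+ 2) ^+ 2) - v / (1 + v ^+ 2) ^+ 3) - 4 / m ^+ 2 * atan v.
have dF (v : R) : is_derive v (1 : R) F (f v).
  have n0 : 1 + v ^+ 2 != 0 by rewrite gt_eqF// prof_den_gt0.
  have a1 := is_deriveZ (3 / 8 : R) (is_derive1_atan v).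
  have a2 := is_deriveZ (3 / 8 : R) (is_derive_rat 0 v).
  have a3 := is_deriveZ (1 / 4 : R) (is_derive_rat 1 v).
  have a4 := is_derive_rat 2 v.
  have a5 := is_deriveZ (4 / m ^+ 2 : R) (is_derive1_atan v).
  have h := is_deriveB (is_deriveZ (4 / 6 : R) (is_deriveB (is_deriveD (is_deriveD a1 a2) a3) a4)) a5.
  set l := (X in is_derive _ _ _ X) in h.
  have -> : f v = l; last exact: h.
  rewrite /l /f /GRing.scale/=; field.
  by rewrite n0 gt_eqF.
have cf : continuous f.
  have c4 := @cont_den 4; have c1 : continuous (fun v : R => (1 + v ^+ 2)^-1 : R).
    by move=> v; have := @cont_den 1 v; under eq_fun do rewrite expr1.
  move=> v; apply: cvgB.
    apply: cvgM; first exact: cvg_cst.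
    by apply: cvgM; [exact: exprn_continuous|exact: c4].
  by apply: cvgM; [exact: cvg_cst|exact: c1].
have H := int_s cf dF.
apply: (@le_trans _ _ (\int[tmf 1]_y (pi ^+ 2 * m ^+ 2 * (s y * f (u y))))).
  rewrite tmfZ; last by apply: contM; [exact: cont_s|exact: (cont_comp cont_u cf)].
  rewrite H /F atanN sqrrN !mulNr.
  have at1 : pi / 4 <= atan m by rewrite -atan1; exact: le_atan.
  have at2 : atan m <= pi / 2 by apply: ltW; exact: atan_ltpi2.
  set d0 := 1 + m ^+ 2.
  have d00 : 2 <= d0 by rewrite /d0; nra.
  have d0p : 0 < d0 by rewrite (lt_le_trans _ d00).
  have x0 : 0 <= m / d0 ^+ 1 by rewrite divr_ge0// ?ltW// exprn_gt0.
  have x1 : 0 <= m / d0 ^+ 2 by rewrite divr_ge0// ?ltW// exprn_gt0.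
  have x2 : m / d0 ^+ 3 <= 1 / 4 * (m / d0 ^+ 1).
    rewrite mulrCA ler_pM2l// mul1r -invfM lef_pV2 ?posrE ?mulr_gt0 ?exprn_gt0// expr1 !exprS expr0 mulr1.
    by nra.
  have x3 : 4 / m ^+ 2 <= 1 / 16.
    rewrite ler_pdivrMr ?exprn_gt0//; nra.
  have x4 : 0 <= 4 / m ^+ 2 by rewrite divr_ge0// sqr_ge0.
  set e0 := m / d0 ^+ 1 in x0 x2 *; set e1 := m / d0 ^+ 2 in x1 *; set e2 := m / d0 ^+ 3 in x2 *; set e3 := 4 / m ^+ 2 in x3 x4 *.
  set Q := (X in pi ^+ 2 * m ^+ 2 * (X / _)).
  have Qge : pi / 16 <= Q.
    rewrite /Q.
    have : e3 * atan m <= 1 / 16 * atan m by rewrite ler_wpM2r// (le_trans _ at1)// divr_ge0// ltW.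
    by lra.
  have -> : pi ^+ 2 * m ^+ 2 * (Q / (pi * m)) = pi * Q * m by move: (pi : R) p0 Q {Qge} => q q0 Q; field; rewrite !gt_eqF.
  have h1 : pi * (pi / 16) <= pi * Q by rewrite ler_pM2l.
  have h2 : 1 / 4 <= pi * (pi / 16) :> R by move: p2; set q := (pi : R) => q2; nra.
  have : 1 / 4 * m <= pi * Q * m by rewrite ler_pM2r// (le_trans h2).
  lra.
apply: tmf_le => //.
- apply: contM; first exact: cst_continuous.
  by apply: contM; [exact: cont_s|exact: (cont_comp cont_u cf)].
- apply: (@cont_comp R R R (fun y : R => rat_prof y * prof y) (fun w : R => w ^+ 2)); last exact: exprn_continuous.
  by apply: contM; [exact: cont_rat_prof|exact: cont_prof].
- move=> y /s_itv/andP[s0 s1].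
  have E := sin2cos2 (pi * y).
  have -> : (rat_prof y * prof y) ^+ 2 = pi ^+ 2 * m ^+ 2 * (s y * (s y * (4 * (u y ^+ 2 * (1 + u y ^+ 2) ^- 4)))).
    have := prof_den_gt0 (u y); rewrite /rat_prof /prof /u /s /=.
    clear; move: (cos (pi * y)) (sin (pi * y)) => a b; move: (pi : R) => q h0.
    by field; rewrite gt_eqF.
  apply: ler_wpM2l; first by rewrite mulr_ge0 ?sqr_ge0.
  apply: ler_wpM2l => //; rewrite /f.
  set I4 := (1 + u y ^+ 2) ^- 4; set I1 := (1 + u y ^+ 2)^-1.
  have den := prof_den_gt0 (u y).
  have I40 : 0 <= I4 by rewrite invr_ge0 exprn_ge0// ltW.
  have sE : sin (pi * y) ^+ 2 = 1 - u y ^+ 2 / m ^+ 2.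
    by have := E; rewrite exprMn mulrAC mulfV ?expf_neq0 ?gt_eqF// mul1r; lra.
  have ss : sin (pi * y) ^+ 2 <= s y by rewrite expr2 ler_piMl.
  have k1 : (1 - u y ^+ 2 / m ^+ 2) * (4 * (u y ^+ 2 * I4)) <= s y * (4 * (u y ^+ 2 * I4)).
    rewrite -sE; apply: ler_wpM2r => //.
    by rewrite mulr_ge0// mulr_ge0// sqr_ge0.
  apply: le_trans k1.
  have k2 : u y ^+ 2 * (u y ^+ 2 * I4) <= I1.
    have := sqr_ge0 (u y); rewrite /I4 /I1 /=; move: ((m * cos (pi * y)) ^+ 2) => w w0.
    have w1 : 0 < 1 + w by lra.
    rewrite [leRHS](_ : _ = (1 + w) ^+ 3 * (1 + w) ^- 4); last by field; rewrite gt_eqF.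
    rewrite mulrA; apply: ler_wpM2r; first by rewrite invr_ge0 exprn_ge0// ltW.
    rewrite !exprS expr0 mulr1; nra.
  have m20 : 0 < 4 / m ^+ 2 by rewrite divr_gt0// exprn_gt0.
  have : 4 / m ^+ 2 * (u y ^+ 2 * (u y ^+ 2 * I4)) <= 4 / m ^+ 2 * I1 by rewrite ler_pM2l.
  clear; move: (I4 : R) (I1 : R) ((m * cos (pi * y)) ^+ 2) (m ^- 2) => a b v n h.
  rewrite [leRHS](_ : _ = 4 * (v * a) - 4 * n * (v * (v * a))); last by ring.
  by rewrite lerD2l lerN2.
Qed.

End profile.



Section coordinates.
Variables (R : realType) (d : nat).
Local Notation E := 'rV[R]_d.
Local Notation e := (@basis_vec R d).

Lemma periodic_int (g : R -> R) : (forall y, g (y + 1) = g y) ->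
  forall (k : int) y, g (y + k%:~R) = g y.
Proof.
move=> pg [] k.
  by elim: k => [|k IHk] y; rewrite ?addr0// -addn1 PoszD intrD addrA pg IHk.
rewrite NegzE; elim: k => [|k IHk] y; first by rewrite -[in RHS](subrK 1 y) pg.
have -> : y + (- (k.+2)%:Z)%:~R = (y - 1) + (- (k.+1)%:Z)%:~R.
  by rewrite !mulrNz -!pmulrn -[k.+2%:R]natr1; ring.
by rewrite IHk -[in RHS](subrK 1 y) pg.
Qed.

Lemma is_derive_coord j l (x : E) : is_derive x (e l) (fun x : E => x 0 j) (l == j)%:R.
Proof.
apply: line_is_derive.
have h := is_deriveD (is_derive_cst (x 0 j : R) (0 : R) (1 : R)) (is_deriveZ (l == j)%:R (is_derive_id (0 : R) (1 : R))).
have -> : (l == j)%:R = 0 + (l == j)%:R *: 1 :> R by rewrite add0r /GRing.scale/= mulr1.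
have -> : (fun h : R => (x + h *: e l) 0 j) = (fun h : R => x 0 j + (l == j)%:R * h).
  by apply/funext => s; rewrite !mxE eqxx/= mulrC eq_sym.
exact: h.
Qed.

Lemma Cn_coord n j : Cn n (fun x : E => x 0 j).
Proof.
elim: n => [|n IH]; first by split => //; exact: continuous_coord.
apply: (@Cn_build _ _ _ _ (fun l _ => (l == j)%:R)).
- exact: continuous_coord.
- by move=> l x; exact: is_derive_coord.
- by move=> l; exact: Cn_cst.
Qed.

Lemma Cn_trig n (c : R) j : Cn n (fun x : E => cos (c * x 0 j)) /\ Cn n (fun x : E => sin (c * x 0 j)).
Proof.
have Cc : Cn n (fun x : E => c * x 0 j) by apply: CnM; [exact: Cn_cst|exact: Cn_coord].
(* Differentiation acts on the pair (cos, sin) as a quarter turn. *)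
pose F (k : nat) (y : R) := iter k (fun ab : R * R => (- ab.2, ab.1)) (cos y, sin y).
have FE k (y : R) : is_derive y (1 : R) (fun y => (F k y).1) (- (F k y).2) /\
                    is_derive y (1 : R) (fun y => (F k y).2) ((F k y).1).
  elim: k => [|k [h1 h2]] /=; first by split; [exact: is_derive_cos|exact: is_derive_sin].
  split; last exact: h1.
  exact: is_deriveN h2.
split.
- exact: (@Cn_comp _ _ n (fun k y => (F k y).1) _ (fun k x => (FE k (c * x 0 j)).1) Cc 0%N).
- apply: (@Cn_comp _ _ n (fun k y => (iter k (fun ab : R * R => (- ab.2, ab.1)) (sin y, - cos y)).1) _ _ Cc 0%N) => k x.
  have G (y : R) : is_derive y (1 : R) (fun y => (iter k (fun ab : R * R => (- ab.2, ab.1)) (sin y, - cos y)).1) (- (iter k (fun ab : R * R => (- ab.2, ab.1)) (sin y, - cos y)).2) /\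
     is_derive y (1 : R) (fun y => (iter k (fun ab : R * R => (- ab.2, ab.1)) (sin y, - cos y)).2) ((iter k (fun ab : R * R => (- ab.2, ab.1)) (sin y, - cos y)).1).
    elim: k => [|k [h1 h2]] /=.
      rewrite opprK; split; first exact: is_derive_sin.
      by have := is_deriveN (is_derive_cos y); rewrite opprK.
    by split; [exact: is_deriveN h2|exact: h1].
  exact: (G _).1.
Qed.

Lemma Cn_powR n (f : E -> R) (r : R) : (forall x, 0 < f x) -> Cn n f ->
  Cn n (fun x => f x `^ r).
Proof.
move=> f0 Cf.
(* Falling factorial: c k y^(r - k) is the k-th derivative of y^r. *)
pose c k := \prod_(l < k) (r - l%:R).
have -> : (fun x => f x `^ r) = (fun x => c 0%N * f x `^ (r - 0%:R)).
  by apply/funext => x; rewrite /c big_ord0 mul1r subr0.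
apply: (@Cn_comp _ _ n (fun k y => c k * y `^ (r - k%:R))) => // k x.
have := is_deriveZ (c k) (is_derive1_powR (r - k%:R) (f0 x)).
have -> : c k.+1 * f x `^ (r - k.+1%:R) = c k *: ((r - k%:R) * f x `^ (r - k%:R - 1)).
  by rewrite /c big_ord_recr/= /GRing.scale/= -natr1 opprD addrA mulrA.
exact.
Qed.

Lemma sm_powR (f : E -> R) (r : R) : (forall x, 0 < f x) -> sm f -> sm (fun x => f x `^ r).
Proof. by move=> f0 [pf Cf]; split => [x k|n]; [rewrite pf|exact: Cn_powR]. Qed.

Lemma pd_coord (g : R -> R) (g' : R) j l (x : E) : is_derive (x 0 j) (1 : R) g g' ->
  pd l (fun x : E => g (x 0 j)) x = (l == j)%:R * g'.
Proof.
move=> dg; rewrite (@pd_comp _ _ g (fun x : E => x 0 j) l x g')//; last exact: (@ex_derive _ _ _ _ _ _ _ (is_derive_coord j l x)).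
by rewrite mulrC (pd_val (is_derive_coord j l x)).
Qed.

End coordinates.

Section pipe.
Variables (R : realType) (d : nat) (m : R) (i j0 : 'I_d).
Hypotheses (m8 : 8 <= m) (ij0 : j0 != i).
Local Notation E := 'rV[R]_d.
Local Notation e := (@basis_vec R d).
Local Notation mu := (torus_measure R d).
Local Notation I f := (\int[mu]_x f x).

Let m1 : 1 <= m. Proof. by rewrite (le_trans _ m8)// ler1n. Qed.
Let m0 : 0 < m. Proof. exact: lt_le_trans m1. Qed.

Lemma prof_periodic y : prof m (y + 1) = prof m y.
Proof. by rewrite /prof mulrDr mulr1 cosDpi mulrN sqrrN. Qed.
Lemma rat_prof_periodic y : rat_prof m (y + 1) = rat_prof m y.
Proof. by rewrite /rat_prof prof_periodic (mulrDr pi) mulr1 cosDpi sinDpi !mulrN !mulNr opprK. Qed.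

Lemma sm_prof j : sm (fun x : E => prof m (x 0 j)).
Proof.
split => [x k|n]; first by rewrite !mxE (periodic_int prof_periodic).
have -> : (fun x : E => prof m (x 0 j)) = (fun x : E => (1 + (m * cos (pi * x 0 j)) * (m * cos (pi * x 0 j))) `^ (-1)).
  by apply/funext => x; rewrite -expr2 powR_inv1 ?(ltW (prof_den_gt0 _)).
apply: Cn_powR => [x|]; first by rewrite -expr2 prof_den_gt0.
have Cc : Cn n (fun x : E => m * cos (pi * x 0 j)).
  by apply: CnM; [exact: Cn_cst|exact: (Cn_trig n pi j).1].
by apply: CnD; [exact: Cn_cst|exact: CnM].
Qed.

Lemma sm_rat_prof j : sm (fun x : E => rat_prof m (x 0 j)).
Proof.
split => [x k|n]; first by rewrite !mxE (periodic_int rat_prof_periodic).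
rewrite /rat_prof; apply: CnM; last by have [_] := sm_prof j.
apply: CnM; last exact: (Cn_trig n pi j).2.
by apply: CnM; [exact: Cn_cst|apply: CnM; [exact: Cn_cst|exact: (Cn_trig n pi j).1]].
Qed.

Definition Phi (x : E) : R := \prod_(j | j != i) prof m (x 0 j).
(** The logarithmic gradient of [Phi], which is constant along e_i. *)
Definition rat (l : 'I_d) : E -> R :=
  if l == i then (fun=> 0) else (fun x => rat_prof m (x 0 l)).

Lemma sm_Phi : sm Phi.
Proof. by apply: sm_prod => j _; exact: sm_prof. Qed.

Lemma sm_rat l : sm (rat l).
Proof. by rewrite /rat; case: ifP => _; [exact: sm_cst|exact: sm_rat_prof]. Qed.

Lemma Phi_gt0 x : 0 < Phi x.
Proof. by apply: prodr_gt0 => j _; exact: prof_gt0. Qed.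

Lemma Phi_le1 x : Phi x <= 1.
Proof. by apply: prodr_ile1 => j _; rewrite ltW ?prof_gt0// prof_le1. Qed.

Lemma indep_Phi_part (P : pred 'I_d) l : ~~ P l -> indep l (fun x : E => \prod_(j | P j) prof m (x 0 j)).
Proof.
move=> Pl x s; apply: eq_bigr => j Pj; rewrite !mxE eqxx/=.
have /negbTE -> : j != l by apply: contraNneq Pl => <-.
by rewrite mulr0 addr0.
Qed.

Lemma indep_Phi : indep i Phi.
Proof. by apply: indep_Phi_part; rewrite eqxx. Qed.

Lemma pd_Phi l : pd l Phi = (fun x => rat l x * Phi x).
Proof.
apply/funext => x; rewrite /rat; have [->|li] := eqVneq l i.
  by rewrite mul0r pd_indep//; exact: indep_Phi.
have PhiE : Phi = (fun x : E => prof m (x 0 l) * \prod_(j | (j != i) && (j != l)) prof m (x 0 j)).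
  by apply/funext => y; rewrite /Phi (bigD1 l).
have sp : sm (fun x : E => \prod_(j | (j != i) && (j != l)) prof m (x 0 j)).
  by apply: sm_prod => j _; exact: sm_prof.
rewrite PhiE pdM//; last exact: sm_prof.
rewrite [X in _ * X + _]pd_indep ?mulr0 ?add0r; last first.
  by apply: indep_Phi_part; rewrite eqxx andbF.
rewrite (@pd_coord _ _ (prof m) _ l l x (is_derive_prof m (x 0 l))) eqxx mul1r.
by rewrite mulrC -mulrA.
Qed.

Lemma rat_le l x : `|rat l x| <= pi * m.
Proof.
rewrite /rat; case: ifP => _; last exact: rat_prof_le.
by rewrite normr0 mulr_ge0 ?pi_ge0// ltW.
Qed.

Lemma pd_rat_le l j x : `|pd l (rat j) x| <= 3 * pi ^+ 2 * m ^+ 2.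
Proof.
have h0 : 0 <= 3 * pi ^+ 2 * m ^+ 2 by rewrite mulr_ge0 ?sqr_ge0// mulr_ge0 ?sqr_ge0.
rewrite /rat; case: ifP => _; first by rewrite pd_cst normr0.
rewrite (@pd_coord _ _ (rat_prof m) _ j l x (is_derive_rat_prof m (x 0 j))).
by case: eqP => _; rewrite ?mul0r ?normr0// mul1r drat_prof_le.
Qed.

(** pi^2 comes from a product of two logarithmic derivatives, 3 pi^2 from the derivative of one. *)
Definition pipe_cst : R := 4 * pi ^+ 2.
Lemma pipe_cst_ge1 : 1 <= pipe_cst.
Proof. by have : 2 <= pi :> R by [exact: pi_ge2]; rewrite /pipe_cst => h; nra. Qed.

Lemma pd2_Phi_le l j x : `|pd l (pd j Phi) x| <= pipe_cst * m ^+ 2 * Phi x.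
Proof.
rewrite (pd_Phi j) pdM; [|exact: sm_rat|exact: sm_Phi].
rewrite pd_Phi.
have -> : rat j x * (rat l x * Phi x) + Phi x * pd l (rat j) x = (rat j x * rat l x + pd l (rat j) x) * Phi x by ring.
rewrite normrM (gtr0_norm (Phi_gt0 x)) ler_wpM2r ?(ltW (Phi_gt0 x))//.
rewrite (le_trans (ler_normD _ _))// normrM /pipe_cst.
have h1 := pd_rat_le l j x.
have h2 : `|rat j x| * `|rat l x| <= (pi * m) * (pi * m) by rewrite ler_pM// rat_le.
have -> : 4 * pi ^+ 2 * m ^+ 2 = (pi * m) * (pi * m) + 3 * pi ^+ 2 * m ^+ 2 by ring.
exact: lerD.
Qed.

Let prodE (f : R -> R) (x : E) : \prod_(j | j != i) f (x 0 j) = \prod_j (if j != i then f else (fun=> 1)) (x 0 j).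
Proof. by rewrite big_mkcond; apply: eq_bigr => j _; case: ifP. Qed.

Lemma torus_Phi_le : I Phi <= (2 / m) ^+ d.-1.
Proof.
rewrite (_ : I Phi = \prod_j \int[tmf 1]_t (if j != i then prof m else (fun=> 1)) t); last first.
  rewrite -torus_prod; last 2 first.
  - by move=> j; case: ifP => _; [exact: cont_prof|exact: cst_continuous].
  - by move=> j y; case: ifP => _ //; exact: prof_periodic.
  by apply: eq_Rintegral => x _; rewrite /Phi prodE.
rewrite (bigD1 i)//= eqxx/= (tmf_cst ltr01) !mul1r.
have -> : (2 / m) ^+ d.-1 = \prod_(j | j != i) (2 / m) :> R.
  by rewrite prodr_const cardC1 card_ord.
apply: ler_prod => j ji; rewrite ji; apply/andP; split; last exact: int_prof_le.
by apply: Rintegral_ge0 => y _; rewrite ltW// prof_gt0.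
Qed.

(** The integral factorises: 1 in direction i, the squared derivative in direction j0, squares of
    the profile in the d - 2 others. The building block is normalised by this integral, so it must
    not be too small. *)
Lemma torus_pdPhi2_ge : m / 4 * (4 * m)^-1 ^+ d.-2 <= I (fun x => pd j0 Phi x ^+ 2).
Proof.
pose f (j : 'I_d) (y : R) : R := if j == i then 1 else if j == j0 then (rat_prof m y * prof m y) ^+ 2 else prof m y ^+ 2.
have fi y : f i y = 1 by rewrite /f eqxx.
have fj0 y : f j0 y = (rat_prof m y * prof m y) ^+ 2 by rewrite /f (negbTE ij0) eqxx.
have csq (g : R -> R) : continuous g -> continuous (fun y : R => g y ^+ 2).
  by move=> cg; apply: (@cont_comp R R R g (fun w : R => w ^+ 2)) => //; exact: exprn_continuous.
have cf j : continuous (f j).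
  rewrite /f; case: eqP => _; first exact: cst_continuous.
  case: eqP => _; last by apply: csq; exact: cont_prof.
  by apply: csq; apply: contM; [exact: cont_rat_prof|exact: cont_prof].
rewrite [leRHS](_ : _ = \prod_j \int[tmf 1]_t f j t); last first.
  rewrite -torus_prod//; last first.
    by move=> j y; rewrite /f !(prof_periodic, rat_prof_periodic).
  apply: eq_Rintegral => x _; rewrite pd_Phi /rat (negbTE ij0) exprMn /Phi.
  rewrite [RHS](bigD1 i)//= fi mul1r.
  rewrite [in LHS](bigD1 j0)//= [RHS](bigD1 j0)//= fj0.
  rewrite !exprMn mulrA; congr (_ * _).
  rewrite -prodrXl; apply: eq_bigr => j /andP[ji jj0].
  by rewrite /f (negbTE ji) (negbTE jj0).
rewrite (bigD1 i)//= {1}/f eqxx (tmf_cst ltr01) !mul1r (bigD1 j0)//=.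
apply: ler_pM.
- by rewrite divr_ge0// ltW.
- by rewrite exprn_ge0// invr_ge0 mulr_ge0// ltW.
- by rewrite /f (negbTE ij0) eqxx int_dprof2_ge.
- have -> : (4 * m)^-1 ^+ d.-2 = \prod_(j | (j != i) && (j != j0)) (4 * m)^-1 :> R.
    rewrite prodr_const; congr (_ ^+ _).
    have := cardC (pred2 i j0); rewrite card2 eq_sym ij0 card_ord.
    move=> /(congr1 (fun n => n.-2)); rewrite !addSn add0n /= => <-.
    by apply: eq_card => j; rewrite !inE negb_or.
  apply: ler_prod => j /andP[ji jj0]; apply/andP; split.
    by rewrite invr_ge0 mulr_ge0// ltW.
  by rewrite /f (negbTE ji) (negbTE jj0); exact: int_prof2_ge.
Qed.

End pipe.


Section powers.
Variable R : realType.
Implicit Types x y r : R.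

Lemma ler_powRl x y r : 0 <= r -> 0 <= x -> x <= y -> x `^ r <= y `^ r.
Proof.
by move=> r0 x0 xy; apply: ge0_ler_powR; rewrite ?nnegrE// (le_trans x0).
Qed.

Lemma powR_addr_le x y r : 0 <= x -> 0 <= y -> 0 <= r ->
  (x + y) `^ r <= 2 `^ r * (x `^ r + y `^ r).
Proof.
wlog xy : x y / x <= y => [H x0 y0 r0|x0 y0 r0].
  by case: (lerP x y) => [|/ltW] h; [|rewrite addrC [X in _ * X]addrC]; exact: H.
apply: (@le_trans _ _ ((2 * y) `^ r)); first by apply: ler_powRl => //; lra.
rewrite powRM// ler_wpM2l ?powR_ge0// lerDr powR_ge0//.
Qed.

Lemma powR_le1 x r : 0 < x <= 1 -> 1 <= r -> x `^ r <= x.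
Proof. by move=> x01 r1; exact: ge1r_powR. Qed.

Lemma cont_powR_norm (X : topologicalType) (f : X -> R) r : 0 < r ->
  continuous f -> continuous (fun z => `|f z| `^ r).
Proof.
move=> r0 cf; apply: (@cont_comp _ _ _ f (fun y : R => `|y| `^ r)) => // x.
have [->|x0] := eqVneq x 0; last first.
  have ax : 0 < `|x| by rewrite normr_gt0.
  have d := is_derive1_powR r ax.
  have c : {for `|x|, continuous (fun y : R => y `^ r)}.
    by apply: differentiable_continuous; apply/derivable1_diffP; case: d.
  by apply: (@continuous_comp _ _ _ (fun y : R => `|y|) (fun y : R => y `^ r)) => //; exact: norm_continuous.
apply/cvgrPdist_le => /= ee e0; near=> y.
rewrite normr0 powR0 ?gt_eqF// sub0r normrN ger0_norm ?powR_ge0//.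
have -> : ee = (ee `^ r^-1) `^ r by rewrite -powRrM mulVf ?gt_eqF// powRr1// ltW.
apply: ler_powRl => //; first exact: ltW.
near: y; apply: (@nbhs0_le _ R); by rewrite powR_gt0.
Unshelve. all: by end_near. Qed.

End powers.

Section continuous_periodic.
Variables (R : realType) (d : nat).
Local Notation E := 'rV[R]_d.
Local Notation mu := (torus_measure R d).
Local Notation I f := (\int[mu]_x f x).
Implicit Types f g : E -> R.

(** Weaker than [sm], so that absolute values and real powers stay inside the class. *)
Definition cp f := continuous f /\ Zperiodic f.

Lemma sm_cp f : sm f -> cp f. Proof. by move=> sf; split; [exact: sm_cont|case: sf]. Qed.

Lemma cp_integrable f : cp f -> mu.-integrable setT (EFin \o f).
Proof. by case; exact: integrable_torus. Qed.

Lemma cpM f g : cp f -> cp g -> cp (fun x => f x * g x).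
Proof. by move=> [cf pf] [cg pg]; split; [exact: contM|move=> x k; rewrite pf pg]. Qed.

Lemma cpD f g : cp f -> cp g -> cp (fun x => f x + g x).
Proof. by move=> [cf pf] [cg pg]; split; [exact: contD|move=> x k; rewrite pf pg]. Qed.

Lemma cp_cst (c : R) : cp (fun=> c).
Proof. by split => //; exact: cst_continuous. Qed.

Lemma cp_norm f : cp f -> cp (fun x => `|f x|).
Proof. by move=> [cf pf]; split => [|x k]; [exact: cont_norm|rewrite pf]. Qed.

Lemma cp_powR f (r : R) : 0 < r -> cp f -> cp (fun x => `|f x| `^ r).
Proof. by move=> r0 [cf pf]; split => [|x k]; [exact: cont_powR_norm|rewrite pf]. Qed.

Lemma cp_sum J (s : seq J) (f : J -> E -> R) : (forall j, cp (f j)) ->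
  cp (fun x => \sum_(j <- s) f j x).
Proof.
move=> cf; split; first by apply: cont_bigsum => j; case: (cf j).
by move=> x k; apply: eq_bigr => j _; case: (cf j) => _ ->.
Qed.

Lemma cp_le f g : cp f -> cp g -> (forall x, f x <= g x) -> I f <= I g.
Proof. by move=> cf cg fg; apply: le_Rintegral => //; exact: cp_integrable. Qed.

Lemma cpID f g : cp f -> cp g -> I (fun x => f x + g x) = I f + I g.
Proof. by move=> cf cg; rewrite RintegralD//; exact: cp_integrable. Qed.

Lemma cpIZ (c : R) f : cp f -> I (fun x => c * f x) = c * I f.
Proof. by move=> cf; rewrite RintegralZl//; exact: cp_integrable. Qed.

Lemma cpI_sum J (s : seq J) (f : J -> E -> R) : (forall j, cp (f j)) ->
  I (fun x => \sum_(j <- s) f j x) = \sum_(j <- s) I (f j).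
Proof.
move=> cf; elim: s => [|j s IH].
  by rewrite big_nil -[RHS](torus_cst d); apply: eq_Rintegral => x _; rewrite big_nil.
rewrite big_cons -IH -cpID//; last exact: cp_sum.
by apply: eq_Rintegral => x _; rewrite big_cons.
Qed.

Lemma cp_abs f : cp f -> `|I f| <= I (fun x => `|f x|).
Proof. by move=> cf; apply: le_normr_Rintegral => //; exact: cp_integrable. Qed.

Lemma cpI_ge0 f : (forall x, 0 <= f x) -> 0 <= I f.
Proof. by move=> f0; apply: Rintegral_ge0. Qed.

Lemma cp_le_bounded f g (M : R) : cp f -> cp g -> (forall x, `|f x| <= M) ->
  I (fun x => `|f x * g x|) <= M * I (fun x => `|g x|).
Proof.
move=> cf cg fM; rewrite -cpIZ; last exact: cp_norm.
apply: cp_le => [||x]; [exact/cp_norm/cpM|by apply: cpM; [exact: cp_cst|exact: cp_norm]|].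
by rewrite normrM ler_wpM2r.
Qed.

(** An antidivergence of f - I f, dilated by n and divided by n: dilation leaves L^1 norms
    unchanged, so a factor 1 / n is gained. The factor 2 bounds |f - I f|, and independence of a
    coordinate is inherited from [antidivergence]. *)
Lemma oscillation f (n : nat) : sm f -> (forall x, 0 <= f x) -> (0 < n)%N ->
  exists Psi : 'I_d -> E -> R, [/\ forall j, sm (Psi j),
    forall x, f (n%:R *: x) = I f + \sum_j pd j (Psi j) x,
    forall j, I (fun x => `|Psi j x|) <= 2 * I f / n%:R &
    forall i, indep i f -> forall j x, pd i (Psi j) x = 0].
Proof.
move=> sf f0 n0.
have sfc : sm (fun x => f x - I f) by apply: smB => //; exact: sm_cst.
have [|J [sJ JE J1 Ji]] := antidivergence sfc.
  by rewrite torusB//; [rewrite torus_cst subrr|exact: sm_cst].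
have nn : n%:R != 0 :> R by rewrite pnatr_eq0 -lt0n.
exists (fun j x => n%:R^-1 * J j (n%:R *: x)); split.
- by move=> j; apply: smZ; exact: sm_dilate.
- move=> x; rewrite -[LHS](subrK (I f)) addrC JE; congr (_ + _); apply: eq_bigr => j _.
  rewrite pdZ; last exact: sm_dilate.
  by rewrite pd_dilate// mulrA mulVf// mul1r.
- move=> j.
  rewrite [leLHS](_ : _ = n%:R^-1 * I (fun x => `|J j (n%:R *: x)|)); last first.
    rewrite -cpIZ; last by apply/cp_norm/sm_cp; exact: sm_dilate.
    by apply: eq_Rintegral => x _; rewrite normrM ger0_norm.
  rewrite mulrC ler_wpM2r ?invr_ge0//.
  have [cJ pJ] := cp_norm (sm_cp (sJ j)).
  rewrite (torus_dilation n0 cJ pJ) (le_trans (J1 j))//.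
  apply: (@le_trans _ _ (I (fun x => f x + I f))).
    apply: cp_le => [||x]; [exact/cp_norm/sm_cp|by apply: cpD; [exact: sm_cp|exact: cp_cst]|].
    by rewrite (le_trans (ler_normB _ _))// !ger0_norm// cpI_ge0.
  by rewrite cpID; [|exact: sm_cp|exact: cp_cst]; rewrite torus_cst mulr_natl mulr2n.
- move=> i fi j x; rewrite pdZ; last exact: sm_dilate.
  rewrite pd_dilate// pd_indep ?mulr0//.
  by apply: Ji => y s; rewrite /= fi.
Qed.

(** A slow function A and a fast one are nearly uncorrelated: the oscillating part of f is a
    divergence, and integration by parts puts the derivative on A. *)
Lemma decorrelation f A (M : R) (n : nat) : sm f -> (forall x, 0 <= f x) -> (0 < n)%N ->
  sm A -> 0 <= M -> (forall j x, `|pd j A x| <= M) ->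
  I (fun x => A x * f (n%:R *: x)) <= I f * (I A + M * (2 * d%:R / n%:R)).
Proof.
move=> sf f0 n0 sA M0 AM; have [Psi [sP PE P1 _]] := oscillation sf f0 n0.
have sAP j : sm (fun x => A x * pd j (Psi j) x) by apply: smM => //; exact: sm_pd.
rewrite [leLHS](_ : _ = I f * I A + \sum_j I (fun x => A x * pd j (Psi j) x)); last first.
  rewrite -cpIZ; last exact: sm_cp.
  rewrite -cpI_sum; last by move=> j; exact: sm_cp.
  rewrite -cpID; last 2 first.
  - by apply: cpM; [exact: cp_cst|exact: sm_cp].
  - by apply: cp_sum => j; exact: sm_cp.
  by apply: eq_Rintegral => x _; rewrite PE mulrDr mulrC mulr_sumr.
rewrite mulrDr lerD2l.
apply: (@le_trans _ _ (\sum_(j < d) M * (2 * I f / n%:R))).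
  apply: ler_sum => j _; rewrite torus_ibp//.
  rewrite (le_trans (ler_norm _))// normrN.
  have cA := sm_cp (sm_pd j sA); have cP := sm_cp (sP j).
  rewrite (le_trans (cp_abs (cpM cA cP)))// (le_trans (cp_le_bounded cA cP (AM j)))//.
  by rewrite ler_wpM2l.
rewrite sumr_const card_ord -mulr_natl le_eqVlt; apply/orP; left; apply/eqP; ring.
Qed.

End continuous_periodic.


(** * The spatial building block of a single term F e_i *)

Section building_block.
Variables (R : realType) (d : nat) (p r K0 D : R) (i j0 : 'I_d) (F : 'rV[R]_d -> R) (eta m S : R) (n : nat).
Hypotheses (K0E : K0 = pipe_cst R) (DE : D = d.-1%:R).
Hypotheses (p1 : 1 < p) (r1 : 1 < r) (pr : p^-1 + r^-1 = 1) (ij0 : j0 != i) (sF : sm F)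
  (eta0 : 0 < eta) (m8 : 8 <= m) (n0 : (0 < n)%N) (S1 : 1 <= S).
Local Notation E := 'rV[R]_d.
Local Notation mu := (torus_measure R d).
Local Notation I f := (\int[mu]_x f x).

Let m1 : 1 <= m. Proof. by rewrite (le_trans _ m8)// ler1n. Qed.
Let m0 : 0 < m. Proof. exact: lt_le_trans m1. Qed.
Let n1 : 1 <= n%:R :> R. Proof. by rewrite ler1n. Qed.
Let nn : 0 < n%:R :> R. Proof. exact: lt_le_trans n1. Qed.
Let S0 : 0 < S. Proof. exact: lt_le_trans S1. Qed.
Let K1 : 1 <= K0. Proof. by rewrite K0E; exact: pipe_cst_ge1. Qed.
Let K00 : 0 < K0. Proof. exact: lt_le_trans K1. Qed.
Let p0 : 0 < p. Proof. exact: lt_trans p1. Qed.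
Let r0 : 0 < r. Proof. exact: lt_trans r1. Qed.

(** Positive thanks to eta, so that its real powers are smooth also where F vanishes. *)
Let G (x : E) : R := F x * F x + eta * eta.
Let G0 x : 0 < G x.
Proof. by rewrite /G ltr_wpDl -?expr2 ?sqr_ge0// exprn_gt0. Qed.
Let sG : sm G.
Proof. by apply: smD; [exact: smM|exact: sm_cst]. Qed.

(* dens is a smooth substitute for |F|, and F = ampa * ampb with |ampa|^p <= dens and |ampb|^r = dens. *)
Definition dens (x : E) : R := G x `^ 2^-1.
Definition ampa : E -> R := locked (fun x => F x * G x `^ (- (2 * r)^-1)).
Definition ampb : E -> R := locked (fun x => G x `^ (2 * r)^-1).

Lemma sm_dens : sm dens. Proof. exact: sm_powR. Qed.
Lemma sm_ampa : sm ampa. Proof. by rewrite /ampa -lock; apply: smM => //; exact: sm_powR. Qed.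
Lemma sm_ampb : sm ampb. Proof. rewrite /ampb -lock; exact: sm_powR. Qed.

Lemma ampM x : ampa x * ampb x = F x.
Proof. rewrite /ampa /ampb -!lock -mulrA -powRD; last by rewrite (gt_eqF (G0 x)) implybT.
by rewrite addNr powRr0 mulr1. Qed.

Let F_le_dens x : `|F x| <= dens x.
Proof.
rewrite /dens powR12_sqrt ?(ltW (G0 x))// -(@ler_sqr R) ?nnegrE ?sqrtr_ge0//.
by rewrite sqr_sqrtr ?(ltW (G0 x))// real_normK ?num_real// expr2 lerDl mulr_ge0// ltW.
Qed.

Lemma dens_le x : dens x <= `|F x| + eta.
Proof.
rewrite /dens powR12_sqrt ?(ltW (G0 x))// -(@ler_sqr R) ?nnegrE ?sqrtr_ge0 ?addr_ge0 ?(ltW eta0)//.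
rewrite sqr_sqrtr ?(ltW (G0 x))// sqrrD real_normK ?num_real// /G -!expr2.
by rewrite lerD2r lerDl mulrn_wge0// mulr_ge0// ltW.
Qed.

Lemma ampb_powR x : `|ampb x| `^ r = dens x.
Proof.
rewrite /ampb -lock ger0_norm ?powR_ge0// -powRrM /dens; congr (_ `^ _).
by rewrite invfM -mulrA mulVf ?mulr1// gt_eqF.
Qed.

Lemma ampa_powR x : `|ampa x| `^ p <= dens x.
Proof.
have h : `|ampa x| <= G x `^ (2 * p)^-1.
  rewrite /ampa -lock normrM [X in _ * X]ger0_norm ?powR_ge0//.
  apply: (@le_trans _ _ (G x `^ 2^-1 * G x `^ (- (2 * r)^-1))).
    by rewrite ler_wpM2r ?powR_ge0//; exact: F_le_dens.
  rewrite -powRD ?(gt_eqF (G0 x)) ?implybT// !invfM.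
  suff -> : 2^-1 - 2^-1 * r^-1 = 2^-1 * p^-1 by [].
  by rewrite -{1}[2^-1]mulr1 -mulrBr -pr addrK.
apply: (le_trans (ler_powRl (ltW p0) (normr_ge0 _) h)).
by rewrite -powRrM invfM -mulrA mulVf ?mulr1// gt_eqF.
Qed.

Definition pipe (x : E) : R := Phi m i (n%:R *: x).
Let ratn l (x : E) := rat m i l (n%:R *: x).

Lemma sm_pipe : sm pipe. Proof. exact/sm_dilate/sm_Phi. Qed.
Lemma pipe_gt0 x : 0 < pipe x. Proof. exact: Phi_gt0. Qed.
Lemma pipe_le1 x : pipe x <= 1. Proof. exact: Phi_le1. Qed.
Let pipe_ge0 x : 0 <= pipe x. Proof. exact/ltW/pipe_gt0. Qed.
Let sm_ratn l : sm (ratn l). Proof. exact/sm_dilate/sm_rat. Qed.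

Let pd_pipe l x : pd l pipe x = n%:R * (ratn l x * pipe x).
Proof. by rewrite /pipe pd_dilate ?pd_Phi//; exact: sm_Phi. Qed.

Let ratn_le l x : `|ratn l x| <= K0 * m.
Proof.
rewrite (le_trans (rat_le i m8 l _))// ler_wpM2r ?ltW// K0E /pipe_cst.
by have : 2 <= pi :> R by [exact: pi_ge2]; move: (pi : R) => q q2; nra.
Qed.

Let pd_pipe_le l x : `|pd l pipe x| <= n%:R * K0 * m * pipe x.
Proof.
rewrite pd_pipe !normrM (ger0_norm (pipe_ge0 x)) ger0_norm// -!mulrA ler_wpM2l// mulrA.
by rewrite ler_wpM2r.
Qed.

Let pd2_pipe_le l j x : `|pd l (pd j pipe) x| <= n%:R ^+ 2 * K0 * m ^+ 2 * pipe x.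
Proof.
have -> : pd j pipe = (fun x => n%:R * pd j (Phi m i) (n%:R *: x)).
  by apply/funext => y; rewrite /pipe pd_dilate//; exact: sm_Phi.
rewrite pdZ; last by apply: sm_dilate; apply: sm_pd; exact: sm_Phi.
rewrite pd_dilate; last by apply: sm_pd; exact: sm_Phi.
rewrite mulrA -expr2 normrM ger0_norm ?exprn_ge0//.
rewrite [leRHS](_ : _ = n%:R ^+ 2 * (K0 * m ^+ 2 * pipe x)); last by ring.
by rewrite ler_wpM2l ?exprn_ge0// K0E; exact: pd2_Phi_le.
Qed.

Lemma torus_pipe_le : I pipe <= (2 / m) ^+ d.-1.
Proof.
have [cP pP] := sm_cp (sm_Phi m i).
by rewrite /pipe (torus_dilation n0 cP pP); exact: torus_Phi_le.
Qed.

(** As 0 < [pipe] <= 1 and q >= 1, [pipe] ^ q <= [pipe]: every L^q bound reduces to the integral of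
    [pipe]. *)
Lemma pipe_bound (W : E -> R) (k q : R) : cp W -> 0 <= k -> 1 <= q ->
  (forall x, `|W x| <= k * pipe x) ->
  I (fun x => `|W x| `^ q) <= k `^ q * (2 / m) ^+ d.-1.
Proof.
move=> cW k0 q1 Wk; have q0 : 0 < q by exact: lt_le_trans q1.
apply: (@le_trans _ _ (k `^ q * I pipe)); last by rewrite ler_wpM2l ?powR_ge0// torus_pipe_le.
rewrite -cpIZ; last exact/sm_cp/sm_pipe.
apply: cp_le => [||x]; first exact: cp_powR.
  by apply: cpM; [exact: cp_cst|exact/sm_cp/sm_pipe].
apply: (le_trans (ler_powRl (ltW q0) (normr_ge0 _) (Wk x))).
rewrite powRM// ler_wpM2l ?powR_ge0// powR_le1// pipe_gt0; exact: pipe_le1.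
Qed.

Lemma pipe_bound1 (W : E -> R) (k : R) : cp W -> 0 <= k ->
  (forall x, `|W x| <= k * pipe x) -> I (fun x => `|W x|) <= k * (2 / m) ^+ d.-1.
Proof.
move=> cW k0 Wk; have := pipe_bound cW k0 (lexx 1) Wk.
rewrite powRr1//; apply: le_trans; rewrite le_eqVlt; apply/orP; left; apply/eqP.
by apply: eq_Rintegral => x _; rewrite powRr1.
Qed.

Hypothesis SA : forall l x, `|pd l dens x| <= S.

(** At the exponents p and r the estimate must see the integral of [dens], that is the size of F,
    instead of the crude bound S. [decorrelation] separates [dens] from the fast factor [pipe], and
    S enters only divided by n. *)
Lemma pipe_bound_dens (W c : E -> R) (k q del : R) : cp W -> 0 <= k -> 1 <= q ->
  0 <= del -> cp c -> (forall x, `|c x| `^ q <= dens x) ->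
  (forall x, `|W x| <= k * (pipe x * (K0 * `|c x| + del))) ->
  I (fun x => `|W x| `^ q) <=
    k `^ q * 2 `^ q * K0 `^ q * (2 / m) ^+ d.-1 * (I dens + S * (2 * d%:R / n%:R) + del `^ q).
Proof.
move=> cW k0 q1 d0 cc cA Wk; have q0 : 0 < q by exact: lt_le_trans q1.
have cP := sm_cp sm_pipe; have cD := sm_cp sm_dens.
set kq := k `^ q * 2 `^ q * K0 `^ q.
have kq0 : 0 <= kq by rewrite !mulr_ge0 ?powR_ge0.
apply: (@le_trans _ _ (kq * (I (fun x => dens x * pipe x) + del `^ q * I pipe))).
  rewrite -(cpIZ (del `^ q))// -cpID; [|exact: cpM|by apply: cpM => //; exact: cp_cst].
  have cDP : cp (fun x => dens x * pipe x + del `^ q * pipe x).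
    by apply: cpD; [exact: cpM|by apply: cpM => //; exact: cp_cst].
  rewrite -cpIZ//; apply: cp_le => [||x]; first exact: cp_powR.
    by apply: cpM => //; exact: cp_cst.
  apply: (le_trans (ler_powRl (ltW q0) (normr_ge0 _) (Wk x))).
  have c0 : 0 <= K0 * `|c x| by rewrite mulr_ge0// ltW.
  rewrite powRM ?mulr_ge0 ?addr_ge0// powRM ?addr_ge0// /kq -!mulrA ler_wpM2l ?powR_ge0//.
  rewrite -mulrDl (mulrC _ (pipe x)) (mulrCA (K0 `^ q)) (mulrCA (2 `^ q)).
  apply: ler_pM; rewrite ?powR_ge0//.
    by rewrite powR_le1// pipe_gt0; exact: pipe_le1.
  apply: (le_trans (powR_addr_le c0 d0 (ltW q0))); rewrite ler_wpM2l ?powR_ge0//.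
  rewrite powRM ?(ltW K00)// mulrDr lerD//; first by rewrite ler_wpM2l ?powR_ge0.
  by rewrite ler_peMl ?powR_ge0// -(powRr0 K0) ler_powR// ltW.
rewrite -mulrA ler_wpM2l// mulrDr lerD//; last first.
  by rewrite mulrC ler_wpM2r ?powR_ge0// torus_pipe_le.
apply: (le_trans (decorrelation (sm_Phi m i) (fun x => ltW (Phi_gt0 m i x)) n0 sm_dens (ltW S0) SA)).
rewrite ler_wpM2r ?torus_Phi_le// addr_ge0 ?mulr_ge0 ?invr_ge0 ?(ltW S0)//.
by apply: cpI_ge0 => x; exact: powR_ge0.
Qed.

(** Dividing by this mean makes the leading part of the product of the two increments average to
    F. *)
Let N0 := I (fun x => pd j0 (Phi m i) x ^+ 2).
Let N0_ge : m / 4 * (4 * m)^-1 ^+ d.-2 <= N0.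
Proof. exact: torus_pdPhi2_ge. Qed.
Let N00 : 0 < N0.
Proof. by apply: lt_le_trans N0_ge; rewrite mulr_gt0 ?divr_gt0// exprn_gt0// invr_gt0 mulr_gt0. Qed.

Let d2 : (1 < d)%N.
Proof.
have := ltn_ord i; have := ltn_ord j0; move: ij0; rewrite -val_eqE /=.
by move: (nat_of_ord i) (nat_of_ord j0) => a b; clear; lia.
Qed.

(** The integral of [pipe] is of order m^(-D), so m^(D/p) normalises the density profile in L^p.
    [sigma] is then forced by tau sigma = m^2 / N0 and turns out to be at most of order m^(D/r). *)
Let tau : R := locked (m `^ (D / p)).
Let sigma : R := locked (m ^+ 2 / N0 / tau).
Let tau0 : 0 < tau. Proof. rewrite /tau -lock; exact: powR_gt0. Qed.
Let sigma0 : 0 < sigma. Proof. rewrite /sigma -lock; by rewrite divr_gt0// divr_gt0// exprn_gt0. Qed.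

Let tausigma : tau * sigma = m ^+ 2 / N0.
Proof. by rewrite /sigma -lock mulrC divfK// gt_eqF. Qed.

Let tausigma_le : m ^+ 2 / N0 <= (4 * m) ^+ d.-1.
Proof.
have -> : d.-1 = d.-2.+1 by move: d2; case: (d) => [|[|]].
rewrite ler_pdivrMr// (exprS _ d.-2).
have e4 : 0 < (4 * m) ^+ d.-2 by rewrite exprn_gt0// mulr_gt0.
apply: (@le_trans _ _ (4 * m * (4 * m) ^+ d.-2 * (m / 4 * (4 * m)^-1 ^+ d.-2))).
  rewrite exprVn; move: ((4 * m) ^+ d.-2) e4 => y y0.
  by rewrite le_eqVlt; apply/orP; left; apply/eqP; field; rewrite gt_eqF.
by rewrite ler_wpM2l// mulr_ge0 ?(ltW e4)// mulr_ge0// ltW.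
Qed.

Let mD : m `^ D = m ^+ d.-1. Proof. by rewrite DE powR_mulrn// ltW. Qed.

Let tau_p : tau `^ p = m ^+ d.-1.
Proof. by rewrite /tau -lock -powRrM divfK ?gt_eqF. Qed.

Let Dpr : D = D / p + D / r. Proof. by rewrite -mulrDr pr mulr1. Qed.

Let sigma_le : sigma <= 4 ^+ d.-1 * m `^ (D / r).
Proof.
rewrite /sigma -lock ler_pdivrMr// -[leRHS]mulrA /tau -lock -powRD; last by rewrite (gt_eqF m0) implybT.
by rewrite [_ / r + _]addrC -Dpr mD -exprMn.
Qed.

Let sigma_r : sigma `^ r <= (4 ^+ d.-1) `^ r * m ^+ d.-1.
Proof.
apply: (le_trans (ler_powRl (ltW r0) (ltW sigma0) sigma_le)).
by rewrite powRM ?exprn_ge0 ?powR_ge0// -powRrM divfK ?gt_eqF// mD.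
Qed.

(** The prefactor compensates the cost n m of a derivative of [pipe]: the derivative along e_j0 has
    amplitude tau, and the potential itself is smaller by that factor. *)
Definition potZ (x : E) : R := tau / (n%:R * m) * (ampa x * pipe x).
Let potY (x : E) : R := sigma / (n%:R * m) * (ampb x * pipe x).
(** The rotated gradient of [potY] in the plane of e_i and e_j0: [true] is the component along e_i,
    [false] the one along e_j0. *)
Definition flow (b : bool) : E -> R := if b then pd j0 potY else (fun x => - pd i potY x).

Let s_ap : sm (fun x => ampa x * pipe x). Proof. by apply: smM; [exact: sm_ampa|exact: sm_pipe]. Qed.
Let s_bp : sm (fun x => ampb x * pipe x). Proof. by apply: smM; [exact: sm_ampb|exact: sm_pipe]. Qed.
Lemma sm_potZ : sm potZ. Proof. exact: smZ. Qed.
Let sm_potY : sm potY. Proof. exact: smZ. Qed.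
Lemma sm_flow b : sm (flow b).
Proof. by case: b; [exact: sm_pd|apply: smN; exact: sm_pd]. Qed.

Let nm0 : n%:R * m != 0. Proof. by rewrite mulf_neq0// gt_eqF. Qed.

Let thetaE x : pd j0 potZ x = tau * (ampa x * (ratn j0 x * pipe x / m) + pd j0 ampa x * pipe x / (n%:R * m)).
Proof.
rewrite pdZ// pdM; [|exact: sm_ampa|exact: sm_pipe].
rewrite pd_pipe; field; by rewrite !gt_eqF.
Qed.

Let flow1E x : flow true x = sigma * (ampb x * (ratn j0 x * pipe x / m) + pd j0 ampb x * pipe x / (n%:R * m)).
Proof.
rewrite /flow pdZ// pdM; [|exact: sm_ampb|exact: sm_pipe].
rewrite pd_pipe; field; by rewrite !gt_eqF.
Qed.

(** The profile does not vary along e_i, so only the amplitude is differentiated and this component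
    carries a factor 1 / (n m). *)
Let flow2E x : flow false x = - (sigma * (pd i ampb x * pipe x / (n%:R * m))).
Proof.
rewrite /flow pdZ// pdM; [|exact: sm_ampb|exact: sm_pipe].
rewrite pd_pipe /ratn /rat eqxx; field; by rewrite !gt_eqF.
Qed.

Hypothesis Sa : forall x, `|ampa x| <= S.
Hypothesis Sb : forall x, `|ampb x| <= S.
Hypothesis Sa1 : forall l x, `|pd l ampa x| <= S.
Hypothesis Sb1 : forall l x, `|pd l ampb x| <= S.
Hypothesis Sb2 : forall l j x, `|pd l (pd j ampb) x| <= S.
Hypothesis SF : forall l x, `|pd l F x| <= S.

(** Bounds the terms in which the derivative falls on an amplitude. *)
Let Sn := S / n%:R.
Let Sn0 : 0 <= Sn. Proof. by rewrite divr_ge0 ?ltW. Qed.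
Let SnS : Sn <= S. Proof. by rewrite ler_pdivrMr// ler_peMr// ltW. Qed.

Let main_le x : `|ratn j0 x * pipe x / m| <= K0 * pipe x.
Proof.
rewrite !normrM (ger0_norm (pipe_ge0 x)) [X in _ * X]ger0_norm ?invr_ge0 ?(ltW m0)//.
rewrite mulrAC ler_wpM2r// ler_pdivrMr//.
Qed.

Let corr_le (c : R) x : `|c| <= S -> `|c * pipe x / (n%:R * m)| <= Sn * pipe x.
Proof.
move=> cS; rewrite !normrM (ger0_norm (pipe_ge0 x)) [X in _ * X]ger0_norm ?invr_ge0 ?mulr_ge0 ?(ltW m0)//.
rewrite mulrAC ler_wpM2r// /Sn invfM mulrA.
rewrite ler_pdivrMr// -[leLHS]mulr1 ler_pM ?divr_ge0//.
by rewrite ler_wpM2r ?invr_ge0.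
Qed.

Let theta_le x : `|pd j0 potZ x| <= tau * (pipe x * (K0 * `|ampa x| + Sn)).
Proof.
rewrite thetaE normrM gtr0_norm// ler_wpM2l ?(ltW tau0)// (le_trans (ler_normD _ _))//.
rewrite mulrDr lerD//; last by rewrite [leRHS]mulrC corr_le.
by rewrite normrM [leRHS](_ : _ = `|ampa x| * (K0 * pipe x)); [rewrite ler_wpM2l|ring].
Qed.

Let flow_le b x : `|flow b x| <= sigma * (pipe x * (K0 * `|ampb x| + Sn)).
Proof.
case: b.
  rewrite flow1E normrM gtr0_norm// ler_wpM2l ?(ltW sigma0)// (le_trans (ler_normD _ _))//.
  rewrite mulrDr lerD//; last by rewrite [leRHS]mulrC corr_le.
  by rewrite normrM [leRHS](_ : _ = `|ampb x| * (K0 * pipe x)); [rewrite ler_wpM2l|ring].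
rewrite flow2E normrN normrM gtr0_norm// ler_wpM2l ?(ltW sigma0)// (le_trans (corr_le _ (Sb1 i x)))//.
by rewrite mulrC ler_wpM2l// lerDr mulr_ge0// ltW.
Qed.

Let theta_le' x : `|pd j0 potZ x| <= 2 * K0 * S * tau * pipe x.
Proof.
apply: (le_trans (theta_le x)).
rewrite [leRHS](_ : _ = tau * (pipe x * (2 * K0 * S))); last by ring.
rewrite ler_wpM2l ?(ltW tau0)// ler_wpM2l//.
have h : K0 * `|ampa x| <= K0 * S by rewrite ler_wpM2l// ltW.
have h' : Sn <= K0 * S by rewrite (le_trans SnS)// ler_peMl// ltW.
lra.
Qed.

Let flow_le' b x : `|flow b x| <= 2 * K0 * S * sigma * pipe x.
Proof.
apply: (le_trans (flow_le b x)).
rewrite [leRHS](_ : _ = sigma * (pipe x * (2 * K0 * S))); last by ring.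
rewrite ler_wpM2l ?(ltW sigma0)// ler_wpM2l//.
have h : K0 * `|ampb x| <= K0 * S by rewrite ler_wpM2l// ltW.
have h' : Sn <= K0 * S by rewrite (le_trans SnS)// ler_peMl// ltW.
lra.
Qed.

Let pd2_bp_le l j x : `|pd l (pd j (fun x => ampb x * pipe x)) x| <= 4 * S * n%:R ^+ 2 * K0 * m ^+ 2 * pipe x.
Proof.
have sa := sm_ampb; have sp := sm_pipe.
have -> : pd j (fun x => ampb x * pipe x) = (fun x => ampb x * pd j pipe x + pipe x * pd j ampb x).
  by apply/funext => y; rewrite pdM.
rewrite pdD; [|by apply: smM => //; exact: sm_pd..].
rewrite !pdM//; [|by exact: sm_pd..].
have nm1 : 1 <= n%:R * K0 * m by rewrite -[leLHS]mulr1 ler_pM// -[leLHS]mulr1 ler_pM.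
have nm2 : n%:R * K0 * m <= n%:R ^+ 2 * K0 * m ^+ 2.
  by rewrite !expr2; have : 1 <= n%:R * m by [rewrite -[leLHS]mulr1 ler_pM//]; nra.
have h1 : `|ampb x * pd l (pd j pipe) x| <= S * (n%:R ^+ 2 * K0 * m ^+ 2 * pipe x).
  by rewrite normrM ler_pM.
have h2 c l' : `|c| <= S -> `|pd l' pipe x * c| <= S * (n%:R ^+ 2 * K0 * m ^+ 2 * pipe x).
  by move=> cS; rewrite normrM mulrC ler_pM// (le_trans (pd_pipe_le l' x))// ler_wpM2r.
have h3 : `|pipe x * pd l (pd j ampb) x| <= S * (n%:R ^+ 2 * K0 * m ^+ 2 * pipe x).
  rewrite normrM mulrC ler_pM// ger0_norm// ler_peMl// (le_trans nm1 nm2)//.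
have h2a := h2 _ j (Sb1 l x); have h2b := h2 _ l (Sb1 j x).
rewrite (mulrC (pd j ampb x)).
rewrite (le_trans (ler_normD _ _))// (le_trans (lerD (ler_normD _ _) (ler_normD _ _)))//.
move: h1 h2a h2b h3; set X := S * _ => h1 h2a h2b h3.
have -> : 4 * S * n%:R ^+ 2 * K0 * m ^+ 2 * pipe x = X + X + (X + X) by rewrite /X; ring.
exact: lerD (lerD h1 h2a) (lerD h3 h2b).
Qed.

Let pd_flow_le b l x : `|pd l (flow b) x| <= 4 * S * n%:R * K0 * (m * sigma) * pipe x.
Proof.
have h j : `|pd l (pd j potY) x| <= 4 * S * n%:R * K0 * (m * sigma) * pipe x.
  have -> : pd j potY = (fun x => sigma / (n%:R * m) * pd j (fun x => ampb x * pipe x) x).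
    by apply/funext => y; rewrite pdZ.
  rewrite pdZ; last exact: sm_pd.
  have k0 : 0 <= sigma / (n%:R * m) by rewrite divr_ge0 ?mulr_ge0 ?(ltW sigma0) ?(ltW m0).
  rewrite normrM ger0_norm// (le_trans (ler_wpM2l k0 (pd2_bp_le l j x)))// le_eqVlt; apply/orP; left; apply/eqP.
  by field; rewrite !gt_eqF.
case: b => //=; rewrite pdN ?normrN//; exact: sm_pd.
Qed.

Let m2D : (2 / m) ^+ d.-1 = 2 ^+ d.-1 * m `^ (- D).
Proof. by rewrite exprMn powRN mD exprVn. Qed.

Let mpow (a b c : R) : a + b = c -> m `^ a * m `^ b = m `^ c.
Proof. by move=> <-; rewrite powRD// (gt_eqF m0) implybT. Qed.

(** Free of m, which is the last parameter to be chosen. *)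
Definition Cb := 4 * S * n%:R * K0 * 8 ^+ d.-1.
Let e48 : 4 ^+ d.-1 * 2 ^+ d.-1 = 8 ^+ d.-1 :> R.
Proof. by rewrite -exprMn -natrM. Qed.
Let e28 : 2 ^+ d.-1 <= 8 ^+ d.-1 :> R.
Proof. by rewrite lerXn2r ?nnegrE ?ler_nat. Qed.
Let Cb_ge (c : R) : 0 <= c -> c <= 8 ^+ d.-1 -> 2 * K0 * S * c <= Cb.
Proof.
move=> c0 c8; rewrite /Cb; apply: ler_pM => //; first by rewrite !mulr_ge0// ltW.
have : 2 * K0 * S <= 2 * K0 * S * n%:R by rewrite ler_peMr// !mulr_ge0// ltW.
have : 0 <= K0 * S * n%:R by rewrite !mulr_ge0// ltW.
lra.
Qed.
Lemma Cb_gt0 : 0 < Cb. Proof. by rewrite !mulr_gt0// exprn_gt0. Qed.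

Lemma potZ_L1 : I (fun x => `|potZ x|) <= Cb * m `^ (- 1 - D / r).
Proof.
have k0 : 0 <= 2 * K0 * S * tau / m by rewrite !mulr_ge0 ?invr_ge0// ltW.
have := @pipe_bound1 potZ _ (sm_cp sm_potZ) k0 _; move=> h.
apply: le_trans (h _) _ => [x|].
  have tnm : 0 <= tau / (n%:R * m) by rewrite divr_ge0 ?mulr_ge0 ?(ltW tau0) ?(ltW m0).
  rewrite /potZ normrM (ger0_norm tnm) (normrM (ampa x)) (ger0_norm (pipe_ge0 x)) mulrA ler_wpM2r//.
  rewrite invfM [leRHS](_ : _ = tau * m^-1 * (2 * K0 * S)); last by ring.
  rewrite [leLHS](_ : _ = tau * m^-1 * (`|ampa x| / n%:R)); last by ring.
  rewrite ler_wpM2l ?mulr_ge0 ?invr_ge0 ?(ltW m0) ?(ltW tau0)//.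
  apply: (@le_trans _ _ S); last by rewrite ler_peMl ?(ltW S0)// (le_trans K1)// ler_peMl ?(ltW K00)// ler1n.
  by rewrite ler_pdivrMr// (le_trans (Sa x))// ler_peMr// ltW.
have -> : 2 * K0 * S * tau / m * (2 / m) ^+ d.-1 = 2 * K0 * S * 2 ^+ d.-1 * m `^ (- 1 - D / r).
  have -> : m `^ (-1 - D / r) = tau * m^-1 * m `^ (- D).
    rewrite /tau -lock -[in RHS](powR_inv1 (ltW m0)) (@mpow _ _ (D / p - 1)) ?(@mpow _ _ (-1 - D / r))//.
    by rewrite {2}Dpr; ring.
  by rewrite m2D; ring.
by rewrite ler_wpM2r ?powR_ge0// Cb_ge// exprn_ge0.
Qed.

Lemma theta_L1 : I (fun x => `|pd j0 potZ x|) <= Cb * m `^ (- (D / r)).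
Proof.
have k0 : 0 <= 2 * K0 * S * tau by rewrite !mulr_ge0// ltW.
apply: (le_trans (pipe_bound1 (sm_cp (sm_pd j0 sm_potZ)) k0 theta_le')).
rewrite m2D [leLHS](_ : _ = 2 * K0 * S * 2 ^+ d.-1 * (tau * m `^ (- D))); last by ring.
rewrite {1}/tau -lock (@mpow _ _ (- (D / r))); last by rewrite {2}Dpr; ring.
by rewrite ler_wpM2r ?powR_ge0// Cb_ge// exprn_ge0.
Qed.

Lemma flow_L1 b : I (fun x => `|flow b x|) <= Cb * m `^ (- (D / p)).
Proof.
have k0 : 0 <= 2 * K0 * S * sigma by rewrite !mulr_ge0// ltW.
apply: (le_trans (pipe_bound1 (sm_cp (sm_flow b)) k0 (flow_le' b))).
have KS0 : 0 <= 2 * K0 * S by rewrite !mulr_ge0// ltW.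
apply: (@le_trans _ _ (2 * K0 * S * (4 ^+ d.-1 * m `^ (D / r)) * (2 / m) ^+ d.-1)).
  by apply: ler_wpM2r; [rewrite exprn_ge0// divr_ge0// ltW|rewrite ler_wpM2l].
rewrite m2D [leLHS](_ : _ = 2 * K0 * S * (4 ^+ d.-1 * 2 ^+ d.-1) * (m `^ (D / r) * m `^ (- D))); last by ring.
rewrite (@mpow _ _ (- (D / p))); last by rewrite {2}Dpr; ring.
by rewrite e48 ler_wpM2r ?powR_ge0// Cb_ge// exprn_ge0.
Qed.

(** The derivative costs m, [sigma] is at most of order m^(D/r), and the L^q norm of [pipe]
    contributes m^(-D/q). *)
Let Lq (W : E -> R) (q : R) : cp W -> 1 <= q ->
  (forall x, `|W x| <= 4 * S * n%:R * K0 * (m * sigma) * pipe x) ->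
  I (fun x => `|W x| `^ q) <= (Cb * m `^ (1 + D / r - D / q)) `^ q.
Proof.
move=> cW q1 Wk; have q0 : 0 < q by exact: lt_le_trans q1.
have k0 : 0 <= 4 * S * n%:R * K0 * (m * sigma) by rewrite !mulr_ge0// ltW.
apply: (le_trans (pipe_bound cW k0 q1 Wk)).
have -> : (2 / m) ^+ d.-1 = ((2 / m) ^+ d.-1) `^ q^-1 `^ q.
  by rewrite -powRrM mulVf ?gt_eqF// powRr1// exprn_ge0// divr_ge0// ltW.
rewrite -(powRM _ k0 (powR_ge0 _ _)); apply: ler_powRl; first exact: ltW.
  by apply: mulr_ge0 => //; exact: powR_ge0.
rewrite m2D powRM ?exprn_ge0 ?powR_ge0// -powRrM mulNr.
have h2 : (2 ^+ d.-1) `^ q^-1 <= 2 ^+ d.-1 :> R.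
  by apply: ler1_powR; [rewrite exprn_ege1//; lra|rewrite invf_le1].
apply: (@le_trans _ _ (4 * S * n%:R * K0 * (m * (4 ^+ d.-1 * m `^ (D / r))) * (2 ^+ d.-1 * m `^ (- (D / q))))).
  apply: ler_pM => //; first by rewrite mulr_ge0 ?powR_ge0.
    by rewrite ler_wpM2l ?mulr_ge0 ?(ltW S0) ?(ltW K00)// ler_wpM2l// ltW.
  by rewrite ler_wpM2r ?powR_ge0.
rewrite le_eqVlt; apply/orP; left; apply/eqP.
rewrite -(@mpow (1 + D / r) (- (D / q)) _ erefl) -(@mpow 1 (D / r) _ erefl) powRr1 ?(ltW m0)// /Cb -e48.
by ring.
Qed.

Lemma flow_Lq b (q : R) : 1 <= q ->
  I (fun x => `|flow b x| `^ q) <= (Cb * m `^ (1 + D / r - D / q)) `^ q.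
Proof.
move=> q1; apply: (Lq (sm_cp (sm_flow b)) q1) => x.
apply: (le_trans (flow_le' b x)); rewrite ler_wpM2r//.
have m1n : 1 <= m * n%:R by rewrite -[leLHS]mulr1 ler_pM.
have h : 0 <= K0 * S * sigma by rewrite !mulr_ge0// ltW.
have : K0 * S * sigma <= K0 * S * sigma * (m * n%:R) by rewrite ler_peMr.
nra.
Qed.

Lemma pd_flow_Lq b l (q : R) : 1 <= q ->
  I (fun x => `|pd l (flow b) x| `^ q) <= (Cb * m `^ (1 + D / r - D / q)) `^ q.
Proof.
by move=> q1; apply: (Lq (sm_cp (sm_pd l (sm_flow b))) q1) => x; exact: pd_flow_le.
Qed.

Let densS := I dens + S * (2 * d%:R / n%:R).
Let densS0 : 0 <= densS.
Proof.
rewrite addr_ge0 ?mulr_ge0 ?invr_ge0 ?(ltW S0)//.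
by apply: cpI_ge0 => x; exact: powR_ge0.
Qed.

Let mm : m ^+ d.-1 * (2 / m) ^+ d.-1 = 2 ^+ d.-1.
Proof. by rewrite -exprMn mulrCA mulfV ?mulr1// gt_eqF. Qed.

(** No power of m is left, because tau^p = m^(d-1) cancels the bound on the integral of [pipe]. *)
Lemma theta_Lp : I (fun x => `|pd j0 potZ x| `^ p) <=
  2 `^ p * K0 `^ p * 2 ^+ d.-1 * (densS + Sn `^ p).
Proof.
apply: (le_trans (pipe_bound_dens (sm_cp (sm_pd j0 sm_potZ)) (ltW tau0) (ltW p1) Sn0 (sm_cp sm_ampa) ampa_powR theta_le)).
rewrite -/densS tau_p -mm le_eqVlt; apply/orP; left; apply/eqP; ring.
Qed.

Lemma flow_Lr b : I (fun x => `|flow b x| `^ r) <=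
  (4 ^+ d.-1) `^ r * 2 `^ r * K0 `^ r * 2 ^+ d.-1 * (densS + Sn `^ r).
Proof.
have ar x : `|ampb x| `^ r <= dens x by rewrite ampb_powR.
apply: (le_trans (pipe_bound_dens (sm_cp (sm_flow b)) (ltW sigma0) (ltW r1) Sn0 (sm_cp sm_ampb) ar (flow_le b))).
rewrite -/densS; apply: ler_wpM2r; first by apply: addr_ge0 => //; exact: powR_ge0.
rewrite -mm [leRHS](_ : _ = (4 ^+ d.-1) `^ r * m ^+ d.-1 * (2 `^ r * K0 `^ r * (2 / m) ^+ d.-1)); last by ring.
rewrite [leLHS](_ : _ = sigma `^ r * (2 `^ r * K0 `^ r * (2 / m) ^+ d.-1)); last by ring.
by rewrite ler_wpM2r ?mulr_ge0 ?powR_ge0 ?exprn_ge0// ?divr_ge0 ?(ltW m0).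
Qed.

Lemma flow_div (psi : E -> R) : sm psi ->
  I (fun x => flow true x * pd i psi x + flow false x * pd j0 psi x) = 0.
Proof.
move=> sp; rewrite cpID; [|by apply: cpM; apply: sm_cp; [exact: sm_flow|exact: sm_pd]..].
rewrite /= [X in _ + X](_ : _ = - I (fun x => pd i potY x * pd j0 psi x)).
  have e : I (fun x => pd j0 potY x * pd i psi x) = I (fun x => pd i potY x * pd j0 psi x) :=
    torus_skew i j0 sm_potY sp.
  by rewrite e subrr.
rewrite -mulN1r -cpIZ; last by apply: cpM; apply: sm_cp; exact: sm_pd.
by apply: eq_Rintegral => x _; rewrite mulN1r mulNr.
Qed.

(** What remains of the e_i component once the leading term, where both derivatives hit the profile,
    is subtracted; every other term contains a derivative of an amplitude, hence 1 / n. *)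
Let r1f (x : E) := pd j0 potZ x * flow true x - F x * ((ratn j0 x * pipe x) ^+ 2 / N0).

Let r1f_le x : `|r1f x| <= (4 * m) ^+ d.-1 * (3 * K0 * S ^+ 2 / n%:R) * pipe x.
Proof.
rewrite /r1f thetaE flow1E -ampM.
set Q := ratn j0 x * pipe x; set u := pd j0 ampa x * pipe x / (n%:R * m); set v := pd j0 ampb x * pipe x / (n%:R * m).
have -> : tau * (ampa x * (Q / m) + u) * (sigma * (ampb x * (Q / m) + v)) - ampa x * ampb x * (Q ^+ 2 / N0) =
  (tau * sigma) * (ampa x * (Q / m) * v + ampb x * (Q / m) * u + u * v) + (tau * sigma - m ^+ 2 / N0) * (ampa x * ampb x * (Q / m) ^+ 2).
  by field; rewrite !gt_eqF.
rewrite tausigma subrr mul0r addr0 normrM ger0_norm; last by rewrite divr_ge0 ?exprn_ge0 ?ltW.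
rewrite -[leRHS]mulrA; apply: ler_pM => //; first by rewrite divr_ge0 ?exprn_ge0 ?ltW.
have hQ := main_le x; have hu : `|u| <= Sn * pipe x := corr_le _ (Sa1 j0 x).
have hv : `|v| <= Sn * pipe x := corr_le _ (Sb1 j0 x).
have P1 := pipe_le1 x; have P0 := pipe_ge0 x.
have PP : pipe x * pipe x <= pipe x by rewrite ler_piMr.
have KSn : 0 <= S * K0 * Sn by rewrite !mulr_ge0// ltW.
have main c w : `|c| <= S -> `|w| <= Sn * pipe x -> `|c * (Q / m) * w| <= S * K0 * Sn * pipe x.
  move=> hc hw; rewrite normrM (normrM c).
  apply: (@le_trans _ _ (S * (K0 * pipe x) * (Sn * pipe x))).
    by apply: ler_pM => //; exact: ler_pM.
  rewrite [leLHS](_ : _ = S * K0 * Sn * (pipe x * pipe x)); last by ring.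
  by rewrite ler_wpM2l.
have huv : `|u * v| <= S * K0 * Sn * pipe x.
  rewrite normrM (@le_trans _ _ ((Sn * pipe x) * (Sn * pipe x)))//; first by rewrite ler_pM.
  rewrite [leLHS](_ : _ = Sn * Sn * (pipe x * pipe x)); last by ring.
  apply: ler_pM => //; [exact: mulr_ge0|exact: mulr_ge0|].
  by apply: ler_wpM2r => //; rewrite (le_trans SnS)// ler_peMr// ltW.
have h1 := main _ _ (Sa x) hv; have h2 := main _ _ (Sb x) hu.
have -> : 3 * K0 * S ^+ 2 / n%:R * pipe x = 3 * (S * K0 * Sn * pipe x) by rewrite /Sn; ring.
rewrite (le_trans (ler_normD _ _))// (le_trans (lerD (ler_normD _ _) (lexx _)))//.
lra.
Qed.

Let r2f (x : E) := pd j0 potZ x * flow false x.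

Let r2f_le x : `|r2f x| <= (4 * m) ^+ d.-1 * (3 * K0 * S ^+ 2 / n%:R) * pipe x.
Proof.
rewrite /r2f flow2E mulrN normrN thetaE.
set Q := ratn j0 x * pipe x; set u := pd j0 ampa x * pipe x / (n%:R * m); set v := pd i ampb x * pipe x / (n%:R * m).
rewrite [X in `|X|](_ : _ = (tau * sigma) * (ampa x * (Q / m) * v + u * v)); last by ring.
rewrite tausigma normrM ger0_norm; last by rewrite divr_ge0 ?exprn_ge0 ?ltW.
rewrite -[leRHS]mulrA; apply: ler_pM => //; first by rewrite divr_ge0 ?exprn_ge0 ?ltW.
have hQ := main_le x; have hu : `|u| <= Sn * pipe x := corr_le _ (Sa1 j0 x).
have hv : `|v| <= Sn * pipe x := corr_le _ (Sb1 i x).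
have P1 := pipe_le1 x; have P0 := pipe_ge0 x.
have PP : pipe x * pipe x <= pipe x by rewrite ler_piMr.
have KSn : 0 <= S * K0 * Sn by rewrite !mulr_ge0// ltW.
have main c w : `|c| <= S -> `|w| <= Sn * pipe x -> `|c * (Q / m) * w| <= S * K0 * Sn * pipe x.
  move=> hc hw; rewrite normrM (normrM c).
  apply: (@le_trans _ _ (S * (K0 * pipe x) * (Sn * pipe x))).
    by apply: ler_pM => //; exact: ler_pM.
  rewrite [leLHS](_ : _ = S * K0 * Sn * (pipe x * pipe x)); last by ring.
  by rewrite ler_wpM2l.
have huv : `|u * v| <= S * K0 * Sn * pipe x.
  rewrite normrM (@le_trans _ _ ((Sn * pipe x) * (Sn * pipe x)))//; first by rewrite ler_pM.
  rewrite [leLHS](_ : _ = Sn * Sn * (pipe x * pipe x)); last by ring.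
  apply: ler_pM => //; [exact: mulr_ge0|exact: mulr_ge0|].
  by apply: ler_wpM2r => //; rewrite (le_trans SnS)// ler_peMr// ltW.
have h1 := main _ _ (Sa x) hv.
have h0 : 0 <= S * K0 * Sn * pipe x by rewrite mulr_ge0.
have -> : 3 * K0 * S ^+ 2 / n%:R * pipe x = 3 * (S * K0 * Sn * pipe x) by rewrite /Sn; ring.
rewrite (le_trans (ler_normD _ _))//.
lra.
Qed.

Let rf_L1 (W : E -> R) : cp W -> (forall x, `|W x| <= (4 * m) ^+ d.-1 * (3 * K0 * S ^+ 2 / n%:R) * pipe x) ->
  I (fun x => `|W x|) <= 8 ^+ d.-1 * (3 * K0 * S ^+ 2 / n%:R).
Proof.
move=> cW h.
have k0 : 0 <= (4 * m) ^+ d.-1 * (3 * K0 * S ^+ 2 / n%:R).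
  apply: mulr_ge0; first by rewrite exprn_ge0// mulr_ge0// ltW.
  by apply: divr_ge0 => //; apply: mulr_ge0; [rewrite mulr_ge0// ltW|rewrite exprn_ge0// ltW].
apply: (le_trans (pipe_bound1 cW k0 h)).
rewrite mulrAC -exprMn.
by have -> : 4 * m * (2 / m) = 8 by field; rewrite gt_eqF.
Qed.

(** The leading term is F f(n x) with f of mean 1, so it equals F plus F times the divergence of the
    oscillating fields [Psi], which are O(1/n) in L^1. The derivative on [Psi] must be moved away
    without differentiating psi twice. *)
Lemma building_block_error : exists V : 'I_d -> E -> R, [/\ forall j, sm (V j),
  forall j, I (fun x => `|V j x|) <= (8 ^+ d.-1 * (6 * K0 * S ^+ 2) + 2 * (d%:R + 1) * S) / n%:R &
  forall psi, sm psi ->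
    I (fun x => pd j0 potZ x * (flow true x * pd i psi x + flow false x * pd j0 psi x)) =
    I (fun x => F x * pd i psi x) + \sum_j I (fun x => V j x * pd j psi x)].
Proof.
pose f (x : E) := pd j0 (Phi m i) x * pd j0 (Phi m i) x / N0.
have sf : sm f.
  apply: smM; last exact: sm_cst.
  by apply: smM; apply: sm_pd; exact: sm_Phi.
have If : I f = 1.
  rewrite /f -(mulfV (lt0r_neq0 N00)) mulrC /N0 -cpIZ.
    by apply: eq_Rintegral => x _; rewrite expr2 mulrC.
  split; last by move=> x k; have [-> _] := sm_pd j0 (sm_Phi m i).
  by under eq_fun do rewrite expr2; apply: contM; apply: sm_cont; apply: sm_pd; exact: sm_Phi.
have f0 x : 0 <= f x by rewrite divr_ge0 ?(ltW N00)// -expr2 sqr_ge0.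
(* Independence of the coordinate i passes to [Psi]; it kills d_i [Psi] in [key]. *)
have fi : indep i f.
  move=> x s; rewrite /f pd_Phi /rat (negbTE ij0) indep_Phi.
  by rewrite !mxE /= (negbTE ij0) mulr0 addr0.
have [Psi [sP PE P1 Pi]] := oscillation sf f0 n0.
rewrite If in PE P1.
have fE x : f (n%:R *: x) = (ratn j0 x * pipe x) ^+ 2 / N0 by rewrite /f pd_Phi expr2.
have sr1 : sm r1f.
  apply: smB; first by apply: smM; [exact/sm_pd/sm_potZ|exact: sm_flow].
  apply: smM => //; have -> : (fun x => (ratn j0 x * pipe x) ^+ 2 / N0) = (fun x => f (n%:R *: x)).
    by apply/funext => x; rewrite fE.
  exact: sm_dilate.
have sr2 : sm r2f by apply: smM; [exact/sm_pd/sm_potZ|exact: sm_flow].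
pose U (x : E) := r1f x - \sum_l Psi l x * pd l F x.
have sPF l : sm (fun x => Psi l x * pd l F x) by apply: smM => //; exact: sm_pd.
have sU : sm U by apply: smB => //; exact: sm_sum.
(* The terms Psi_j d_i F point along every e_j, [U] collects the errors along e_i, [r2f] those along
   e_j0. *)
pose V j (x : E) := Psi j x * pd i F x + (j == i)%:R * U x + (j == j0)%:R * r2f x.
have sPi j : sm (fun x => Psi j x * pd i F x) by apply: smM => //; exact: sm_pd.
have sV j : sm (V j) by apply: smD; [apply: smD => //|]; exact: smZ.
have L1r1 := rf_L1 (sm_cp sr1) r1f_le; have L1r2 := rf_L1 (sm_cp sr2) r2f_le.
have L1P l j : I (fun x => `|Psi l x * pd j F x|) <= 2 * S / n%:R.
  rewrite (_ : (fun x => `|Psi l x * pd j F x|) = (fun x => `|pd j F x * Psi l x|)); last first.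
    by apply/funext => x; rewrite mulrC.
  apply: (le_trans (cp_le_bounded (sm_cp (sm_pd j sF)) (sm_cp (sP l)) (SF j))).
  rewrite mulrC mulrAC; apply: ler_wpM2r; first exact: ltW.
  by have := P1 l; rewrite mulr1.
exists V; split => // [j|psi sp].
  have cn (g : E -> R) : sm g -> cp (fun x => `|g x|) by move=> sg; exact/cp_norm/sm_cp.
  have cs : cp (fun x => \sum_l `|Psi l x * pd l F x|) by apply: cp_sum => l; exact: cn.
  apply: (@le_trans _ _ (I (fun x => (`|Psi j x * pd i F x| + (`|r1f x| + \sum_l `|Psi l x * pd l F x|)) + `|r2f x|))).
    apply: cp_le => [||x]; first exact: cn.
      by apply: cpD; [apply: cpD; [exact: cn|apply: cpD => //; exact: cn]|exact: cn].
    rewrite /V (le_trans (ler_normD _ _))// lerD//.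
      rewrite (le_trans (ler_normD _ _))// lerD//.
      rewrite normrM (@le_trans _ _ `|U x|)//.
        by rewrite ler_piMl// normr_nat lern1; case: eqP.
      by rewrite /U (le_trans (ler_normB _ _))// lerD// ler_norm_sum.
    by rewrite normrM ler_piMl// normr_nat lern1; case: eqP.
  rewrite cpID; [|by apply: cpD; [exact: cn|apply: cpD => //; exact: cn]|exact: cn].
  rewrite cpID; [|exact: cn|by apply: cpD => //; exact: cn].
  rewrite cpID; [|exact: cn|by []].
  rewrite cpI_sum; last by move=> l; exact: cn.
  have hs : \sum_l I (fun x => `|Psi l x * pd l F x|) <= d%:R * (2 * S / n%:R).
    rewrite mulr_natl -[X in _ *+ X](card_ord d) -sumr_const; apply: ler_sum => l _; exact: L1P.
  have h1 := L1P j i.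
  rewrite [leRHS](_ : _ = (2 * S / n%:R + (8 ^+ d.-1 * (3 * K0 * S ^+ 2 / n%:R) + d%:R * (2 * S / n%:R))) + 8 ^+ d.-1 * (3 * K0 * S ^+ 2 / n%:R)); last by ring.
  by rewrite !lerD.
have cpi l : cp (pd l psi) by exact/sm_cp/sm_pd.
have cc (g : E -> R) l : sm g -> cp (fun x => g x * pd l psi x) by move=> sg; apply: cpM => //; exact: sm_cp.
have sFP l : sm (fun x => F x * Psi l x) by exact: smM.
have sFPl l : sm (fun x => F x * pd l (Psi l) x) by apply: smM => //; exact: sm_pd.
have aux (a b c z : R) : z = a + b -> z = c -> a = c - b by move=> -> <-; rewrite addrK.
(* [torus_skew] exchanges the derivatives l and i between F Psi_l and psi, so that only first
   derivatives of psi occur. *)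
have key l : I (fun x => F x * pd l (Psi l) x * pd i psi x) =
    I (fun x => Psi l x * pd i F x * pd l psi x) - I (fun x => Psi l x * pd l F x * pd i psi x).
  have e1 : I (fun x => pd l (fun x => F x * Psi l x) x * pd i psi x) = I (fun x => Psi l x * pd i F x * pd l psi x).
    rewrite torus_skew//; apply: eq_Rintegral => x _; rewrite pdM// (Pi i fi) mulr0 add0r//.
  have cA := cc (fun x => F x * pd l (Psi l) x) i (sFPl l).
  have e2 : I (fun x => pd l (fun x => F x * Psi l x) x * pd i psi x) =
      I (fun x => F x * pd l (Psi l) x * pd i psi x) + I (fun x => Psi l x * pd l F x * pd i psi x).
    have cB := cc (fun x => Psi l x * pd l F x) i (sPF l).
    by rewrite -(cpID cA cB); apply: eq_Rintegral => x _; rewrite (pdM l x sF (sP l)) mulrDl.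
  exact: aux e2 e1.
have csum (f' : 'I_d -> E -> R) k : (forall l, sm (f' l)) -> I (fun x => (\sum_l f' l x) * pd k psi x) = \sum_l I (fun x => f' l x * pd k psi x).
  move=> sf'; rewrite -cpI_sum; last by move=> l; exact: cc.
  by apply: eq_Rintegral => x _; rewrite mulr_suml.
have lhs : I (fun x => pd j0 potZ x * (flow true x * pd i psi x + flow false x * pd j0 psi x)) =
  I (fun x => F x * pd i psi x) + \sum_l I (fun x => F x * pd l (Psi l) x * pd i psi x) +
  I (fun x => r1f x * pd i psi x) + I (fun x => r2f x * pd j0 psi x).
  have cS := cc (fun x => \sum_l F x * pd l (Psi l) x) i (sm_sum _ sFPl).
  have [c1 c3 c4] := And3 (cc F i sF) (cc r1f i sr1) (cc r2f j0 sr2).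
  rewrite -(csum (fun l x => F x * pd l (Psi l) x) i sFPl) -(cpID c1 cS) -(cpID (cpD c1 cS) c3) -(cpID (cpD (cpD c1 cS) c3) c4).
  apply: eq_Rintegral => x _; rewrite -mulr_sumr /r1f /r2f -fE PE.
  by move: (\sum_l _) (pd _ _ _) (pd _ _ _) (pd _ _ _) (flow _ _) (flow _ _) (F x) => *; ring.
have rhs j : I (fun x => V j x * pd j psi x) = I (fun x => Psi j x * pd i F x * pd j psi x) +
   (j == i)%:R * (I (fun x => r1f x * pd i psi x) - \sum_l I (fun x => Psi l x * pd l F x * pd i psi x)) +
   (j == j0)%:R * I (fun x => r2f x * pd j0 psi x).
  have -> : (j == i)%:R * (I (fun x => r1f x * pd i psi x) - \sum_l I (fun x => Psi l x * pd l F x * pd i psi x)) = I (fun x => (j == i)%:R * U x * pd j psi x).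
    have [->|_] := eqVneq j i; last first.
      by rewrite mul0r -[LHS](torus_cst d); apply: eq_Rintegral => x _; rewrite !mul0r.
    rewrite mul1r; symmetry; apply: (aux _ _ _ _ _ erefl).
    rewrite -(csum (fun l x => Psi l x * pd l F x) i sPF).
    have cU := cc (fun x => true%:R * U x) i (smZ _ sU).
    have cS := cc (fun x => \sum_l Psi l x * pd l F x) i (sm_sum _ sPF).
    rewrite -(cpID cU cS); apply: eq_Rintegral => x _.
    by rewrite /U mul1r -mulrDl subrK.
  have -> : (j == j0)%:R * I (fun x => r2f x * pd j0 psi x) = I (fun x => (j == j0)%:R * r2f x * pd j psi x).
    rewrite -cpIZ; last exact: cc.
    by apply: eq_Rintegral => x _; have [->|_] := eqVneq j j0; rewrite ?mul1r// !mul0r.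
  rewrite -!cpID; try by apply: cc => //; exact: smZ.
    by apply: eq_Rintegral => x _; rewrite -!mulrDl.
  by apply: cpD; apply: cc => //; exact: smZ.
have one k (c : R) : \sum_(j < d) (j == k)%:R * c = c.
  by rewrite (bigD1 k)//= eqxx mul1r big1 ?addr0// => j /negbTE ->; rewrite mul0r.
have sl := eq_bigr (op := +%R) (idx := 0 : R) _ (r := index_enum 'I_d) (P := xpredT) (fun l _ => key l).
have sr := eq_bigr (op := +%R) (idx := 0 : R) _ (r := index_enum 'I_d) (P := xpredT) (fun j _ => rhs j).
rewrite sumrB in sl; rewrite !big_split /= !one in sr.
have fin (L a s1 t1 t2 B C Sv : R) : L = a + s1 + t1 + t2 -> s1 = B - C ->
    Sv = B + (t1 - C) + t2 -> L = a + Sv by move=> -> -> ->; ring.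
exact: fin lhs sl sr.
Qed.

End building_block.


Section building_blocks.
Variables (R : realType) (d : nat) (p r : R).
Hypotheses (p1 : 1 < p) (r1 : 1 < r) (pr : p^-1 + r^-1 = 1).
Local Notation E := 'rV[R]_d.
Local Notation mu := (torus_measure R d).
Local Notation I f := (\int[mu]_x f x).
Local Notation D := (d.-1%:R : R).

Lemma sm_uniform_bound (F a b A : E -> R) : sm F -> sm a -> sm b -> sm A ->
  exists S : R, [/\ 1 <= S, forall l x, `|pd l A x| <= S, forall x, `|a x| <= S,
    forall x, `|b x| <= S &
    [/\ forall l x, `|pd l a x| <= S, forall l x, `|pd l b x| <= S,
        forall l j x, `|pd l (pd j b) x| <= S & forall l x, `|pd l F x| <= S]].
Proof.
move=> sF sa sb sA.
have [M1 M10 h1] := sm_pd_bounded sA; have [M2 M20 h2] := sm_bounded sa.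
have [M3 M30 h3] := sm_bounded sb; have [M4 M40 h4] := sm_pd_bounded sa.
have [M5 M50 h5] := sm_pd_bounded sb; have [M6 M60 h6] := sm_pd_bounded sF.
have /choice[g gP] : forall j, exists M, 0 < M /\ forall l x, `|pd l (pd j b) x| <= M.
  by move=> j; have [M M0 h] := sm_pd_bounded (sm_pd j sb); exists M.
have g0 : 0 <= \sum_j g j by apply: sumr_ge0 => j _; apply: ltW; case: (gP j).
have gl j : g j <= \sum_j g j.
  by rewrite (bigD1 j)//= lerDl sumr_ge0// => k _; apply: ltW; case: (gP k).
exists (1 + M1 + M2 + M3 + M4 + M5 + M6 + \sum_j g j); split=> [|l x|x|x|].
- lra.
- by have := h1 l x; lra.
- by have := h2 x; lra.
- by have := h3 x; lra.
- split=> [l x|l x|l j x|l x].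
  + by have := h4 l x; lra.
  + by have := h5 l x; lra.
  + by have [_ /(_ l x)] := gP j; have := gl j; lra.
  + by have := h6 l x; lra.
Qed.

(** The order of the quantifiers matters: [C] depends only on the exponents and the dimension, [C1]
    also on F and eps, and m stays free, to be linked with the concentration in time. *)
Lemma building_blocks : exists2 C : R, 0 < C &
  forall (F : E -> R) i j0 (eps : R), sm F -> j0 != i -> 0 < eps ->
  exists2 C1 : R, 0 < C1 & forall m, 8 <= m ->
  exists (Z : E -> R) (w : bool -> E -> R) (V : 'I_d -> E -> R),
  [/\ [/\ sm Z, forall b, sm (w b) & forall j, sm (V j)],
      I (fun x => `|pd j0 Z x| `^ p) <= C * (I (fun x => `|F x|) + eps) /\
      (forall b, I (fun x => `|w b x| `^ r) <= C * (I (fun x => `|F x|) + eps)),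
      [/\ I (fun x => `|Z x|) <= C1 * m `^ (-1 - D / r),
          I (fun x => `|pd j0 Z x|) <= C1 * m `^ (- (D / r)) &
          forall b, I (fun x => `|w b x|) <= C1 * m `^ (- (D / p))],
      [/\ forall b q, 1 <= q -> I (fun x => `|w b x| `^ q) <= (C1 * m `^ (1 + D / r - D / q)) `^ q,
          forall b l q, 1 <= q -> I (fun x => `|pd l (w b) x| `^ q) <= (C1 * m `^ (1 + D / r - D / q)) `^ q &
          forall j, I (fun x => `|V j x|) <= eps] &
      forall psi, sm psi ->
        I (fun x => pd j0 Z x * (w true x * pd i psi x + w false x * pd j0 psi x)) =
          I (fun x => F x * pd i psi x) + \sum_j I (fun x => V j x * pd j psi x) /\
        I (fun x => w true x * pd i psi x + w false x * pd j0 psi x) = 0].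
Proof.
pose K := pipe_cst R.
have K1 : 1 <= K by exact: pipe_cst_ge1.
pose Ca := 2 `^ p * K `^ p * 2 ^+ d.-1 : R.
pose Cw := (4 ^+ d.-1) `^ r * 2 `^ r * K `^ r * 2 ^+ d.-1 : R.
have pw (x y : R) : 0 < x -> 0 < x `^ y by exact: powR_gt0.
have K0 : 0 < K by lra.
have Ca0 : 0 < Ca by rewrite !mulr_gt0 ?pw// exprn_gt0.
have Cw0 : 0 < Cw by rewrite !mulr_gt0 ?pw ?exprn_gt0.
exists (Ca + Cw); first exact: addr_gt0.
move=> F i j0 eps sF ij0 e0.
pose eta := eps / 2; have eta0 : 0 < eta by rewrite divr_gt0.
have sd := sm_dens sF eta0; have sa := sm_ampa r sF eta0; have sb := sm_ampb r sF eta0.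
have [S [S1 SA Sa Sb [Sa1 Sb1 Sb2 SF]]] := sm_uniform_bound sF sa sb sd.
have S0 : 0 < S by lra.
pose B := 8 ^+ d.-1 * (6 * K * S ^+ 2) + 2 * (d%:R + 1) * S.
(* Chosen so that n >= A makes the decorrelation and amplitude errors together at most eps / 2, S /
   n at most 1 and the L^1 norms of V at most eps. *)
pose A := (2 * d%:R + 1) * S * 2 / eps + S + B / eps.
have B0 : 0 <= B.
  have h1 : 0 <= 8 ^+ d.-1 * (6 * K * S ^+ 2).
    by rewrite mulr_ge0 ?exprn_ge0// mulr_ge0 ?exprn_ge0 ?(ltW S0)// mulr_ge0// ltW.
  by rewrite addr_ge0// mulr_ge0 ?(ltW S0)// mulr_ge0// addr_ge0.
have A1 : 0 <= (2 * d%:R + 1) * S * 2 / eps.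
  by rewrite divr_ge0 ?(ltW e0)// mulr_ge0// mulr_ge0 ?(ltW S0)// addr_ge0// mulr_ge0.
have A2 : 0 <= B / eps by rewrite divr_ge0// ltW.
pose n := (Num.truncn A).+1.
have An : A <= n%:R by rewrite ltW// truncnS_gt.
have n0 : (0 < n)%N by [].
have nn : 0 < n%:R :> R by rewrite ltr0n.
have hA1 : ((2 * d%:R + 1) * S) / n%:R <= eps / 2.
  have : (2 * d%:R + 1) * S * 2 / eps <= n%:R by rewrite (le_trans _ An)// /A; lra.
  by rewrite ler_pdivrMr// ler_pdivrMr// => h; lra.
have hA2 : S / n%:R <= 1 by rewrite ler_pdivrMr// mul1r (le_trans _ An)// /A; lra.
have hA3 : B / n%:R <= eps.
  rewrite ler_pdivrMr// mulrC -ler_pdivrMr// (le_trans _ An)// /A; lra.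
exists (Cb d K S n); first exact: (@Cb_gt0 _ _ K _ _ erefl).
move=> m m8.
have [V [sV V1 VE]] := @building_block_error _ _ p _ _ d.-1%:R _ _ _ _ _ _ _ erefl ij0 sF eta0 m8 n0 S1 Sa Sb Sa1 Sb1 SF.
have Sn0 : 0 <= S / n%:R by rewrite divr_ge0 ?ltW.
have Sn (x : R) : 1 < x -> (S / n%:R) `^ x <= S / n%:R.
  by move=> x1; apply: powR_le1; [rewrite divr_gt0|exact: ltW].
have dE : I (dens F eta) <= I (fun x => `|F x|) + eps / 2.
  have cF := cp_norm (sm_cp sF).
  rewrite -[X in _ + X](torus_cst d) -(cpID cF (cp_cst d (eps / 2))).
  by apply: cp_le => [||x]; [exact: sm_cp|exact: cpD cF (cp_cst d _)|exact: dens_le].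
have dS (x : R) : 1 < x -> I (dens F eta) + S * (2 * d%:R / n%:R) + (S / n%:R) `^ x <= I (fun x => `|F x|) + eps.
  move=> x1; have := Sn x x1.
  have -> : S * (2 * d%:R / n%:R) = 2 * d%:R * S / n%:R by ring.
  have : 2 * d%:R * S / n%:R + S / n%:R <= eps / 2 by rewrite -mulrDl -[X in (_ + X) / _]mul1r -mulrDl.
  by lra.
have IF0 : 0 <= I (fun x => `|F x|) + eps by rewrite addr_ge0 ?(ltW e0)// cpI_ge0.
exists (potZ p r d.-1%:R i F eta m n), (flow p r d.-1%:R i j0 F eta m n), V; split.
- split => //; first exact: sm_potZ.
  by move=> b; exact: sm_flow.
- split => [|b].
    apply: (le_trans (theta_Lp i j0 erefl erefl p1 pr sF eta0 m8 n0 S1 SA Sa1)).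
    apply: ler_pM; [exact: ltW| | |exact: dS].
      by rewrite !addr_ge0 ?powR_ge0 ?cpI_ge0// ?mulr_ge0 ?invr_ge0 ?(ltW S0)// => x; exact: powR_ge0.
    by rewrite lerDl ltW.
  apply: (le_trans (flow_Lr erefl erefl r1 pr ij0 sF eta0 m8 n0 S1 SA Sb1 b)).
  apply: ler_pM; [exact: ltW| | |exact: dS].
    by rewrite !addr_ge0 ?powR_ge0 ?cpI_ge0// ?mulr_ge0 ?invr_ge0 ?(ltW S0)// => x; exact: powR_ge0.
  by rewrite lerDr ltW.
- split => [||b].
  + exact: (potZ_L1 i erefl erefl pr sF eta0 m8 n0 S1 Sa).
  + exact: (theta_L1 i j0 erefl erefl pr sF eta0 m8 n0 S1 Sa Sa1).
  + exact: (flow_L1 erefl erefl pr ij0 sF eta0 m8 n0 S1 Sb Sb1 b).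
- split => [b q q1|b l q q1|j].
  + exact: (flow_Lq erefl erefl pr ij0 sF eta0 m8 n0 S1 Sb Sb1 b q1).
  + exact: (pd_flow_Lq erefl erefl pr ij0 sF eta0 m8 n0 S1 Sb Sb1 Sb2 b l q1).
  + exact: le_trans (V1 j) hA3.
- move=> psi sp; split; first exact: VE.
  by apply: flow_div.
Qed.

End building_blocks.


(** * Building blocks in time *)

Section bump.
Variable R : realType.

(** A quadratic remainder treats the square of a positive part uniformly, also at 0. *)
Lemma is_derive_quad (f : R -> R) (x l C : R) : 0 <= C ->
  (forall h : R, `|f (x + h) - f x - l * h| <= C * h ^+ 2) -> is_derive x (1 : R) f l.
Proof.
move=> C0 H.
have cv : h^-1 *: ((f \o shift x) (h *: (1 : R)) - f x) @[h --> (0 : R)^'] --> l.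
  apply/cvgrPdist_le => /= e e0.
  have eC : 0 < e / (C + 1) by rewrite divr_gt0// ltr_wpDl.
  near=> h.
  have h0 : h != 0 by near: h; exact: nbhs_dnbhs_neq.
  have hb : `|h| <= e / (C + 1) by near: h; exact: dnbhs0_le.
  have -> : h *: (1 : R) = h by rewrite -[RHS]mulr1.
  have -> : l - h^-1 *: (f (h + x) - f x) = - (h^-1 * (f (x + h) - f x - l * h)).
    by rewrite /GRing.scale/= (addrC h x); field.
  rewrite normrN normrM normfV ler_pdivrMl ?normr_gt0// (le_trans (H h))//.
  rewrite -[h ^+ 2]ger0_norm ?sqr_ge0// normrX expr2 mulrCA ler_wpM2l//.
  rewrite ler_pdivlMr in hb; last by rewrite ltr_wpDl.
  have := normr_ge0 h; nra.
split; first by apply/cvg_ex; exists l.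
by apply: cvg_lim => //; exact: Rhausdorff.
Unshelve. all: by end_near. Qed.

(** Of class C^1 only, which is enough: in time no derivative beyond the first of the density
    profile is taken. *)
Definition bump (y : R) : R := Num.max 0 (y * (1 - y)) ^+ 2.
Definition dbump (y : R) : R := 2 * Num.max 0 (y * (1 - y)) * (1 - 2 * y).

Lemma is_derive_bump (y : R) : is_derive y (1 : R) bump (dbump y).
Proof.
have d1 (z : R) : is_derive z (1 : R) (fun z => Num.max 0 z ^+ 2) (2 * Num.max 0 z).
  apply: (@is_derive_quad _ _ _ 1) => // h; rewrite ler_norml.
  by case: (ltP 0 (z + h)) => h1; case: (ltP 0 z) => h2; apply/andP; split; nra.
have d2 : is_derive y (1 : R) (fun y : R => y * (1 - y)) (1 - 2 * y).
  have := is_deriveM (is_derive_id y (1 : R)) (is_deriveB (is_derive_cst (1 : R) y (1 : R)) (is_derive_id y (1 : R))).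
  by move=> h; apply: is_derive_eq h _; rewrite /GRing.scale/= !fctE /=; ring.
exact: (is_derive1_comp (f := fun z : R => Num.max 0 z ^+ 2) (g := fun y : R => y * (1 - y)) (d1 (y * (1 - y))) d2).
Qed.

Lemma continuous_dbump : continuous dbump.
Proof.
have cq : continuous (fun y : R => y * (1 - y)).
  by apply: contM => y; [exact: cvg_id|apply: cvgB; [exact: cvg_cst|exact: cvg_id]].
rewrite /dbump; apply: contM; last first.
  by move=> y; apply: cvgB; [exact: cvg_cst|exact: (@cont_mull R 2 y)].
apply: contM; first by move=> y; exact: cvg_cst.
move=> y; apply: (@continuous_max R R (fun=> 0) (fun y : R => y * (1 - y)) y); [exact: cvg_cst|exact: cq].
Qed.

Lemma continuous_bump : continuous bump.
Proof. exact: (cont_of_derive is_derive_bump). Qed.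

Definition supp01 (g : R -> R) := forall y, ~~ (0 < y < 1) -> g y = 0.

Let q_le0 (y : R) : ~~ (0 < y < 1) -> y * (1 - y) <= 0.
Proof. by rewrite negb_and -!leNgt => /orP[] h; nra. Qed.

Lemma supp01_bump : supp01 bump.
Proof. by move=> y /q_le0 h; rewrite /bump (max_idPl h) expr0n. Qed.

Lemma supp01_dbump : supp01 dbump.
Proof. by move=> y /q_le0 h; rewrite /dbump (max_idPl h) mulr0 mul0r. Qed.

Let q_le1 (y : R) : 0 <= Num.max 0 (y * (1 - y)) <= 1 / 4.
Proof.
have := sqr_ge0 (y - 1 / 2); rewrite expr2 => h.
by rewrite le_max lexx/= ge_max; apply/andP; split; lra.
Qed.

Lemma bump_ge0 y : 0 <= bump y. Proof. exact: sqr_ge0. Qed.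
Lemma bump_le1 y : bump y <= 1.
Proof. by have := q_le1 y; rewrite /bump; nra. Qed.

Lemma dbump_le1 y : `|dbump y| <= 1.
Proof.
have [h|/negP/negP/supp01_dbump ->] := boolP (0 < y < 1); last by rewrite normr0.
have := q_le1 y; rewrite /dbump ler_norml; move: (Num.max _ _) => q qq; move: h => /andP[y0 y1].
by apply/andP; split; nra.
Qed.

Definition bump2 : R := \int[tmf 1]_y (bump y ^+ 2).

Lemma bump2_gt0 : 0 < bump2.
Proof.
have cq : continuous (fun y : R => y * (1 - y)).
  by apply: contM => y; [exact: cvg_id|apply: cvgB; [exact: cvg_cst|exact: cvg_id]].
have dq (y : R) : is_derive y (1 : R) (fun y : R => y ^+ 2 / 2 - y ^+ 3 / 3) (y * (1 - y)).
  by apply: is_derive_eq; rewrite /GRing.scale/=; field.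
have qE := FTC_tmf ltr01 cq dq.
(* Tangent line of u^4 at u = 1/6, which is the mean of y (1 - y): the bound is Jensen's
   inequality. *)
apply: (@lt_le_trans _ _ (\int[tmf 1]_y (4 / 216 * (y * (1 - y)) - 3 / 1296))).
  rewrite tmfB//; [|by apply: contM => // y; exact: cvg_cst|by move=> y; exact: cvg_cst].
  by rewrite tmfZ// (tmf_cst ltr01) qE; lra.
apply: tmf_le => //.
- by move=> y; apply: cvgB; [apply: cvgM; [exact: cvg_cst|exact: cq]|exact: cvg_cst].
- by apply: (@cont_comp R R R bump (fun w : R => w ^+ 2)); [exact: continuous_bump|exact: exprn_continuous].
- move=> y /andP[y0 y1]; rewrite /bump.
  have q0 : 0 <= y * (1 - y) by nra.
  rewrite (max_idPr q0); move: (y * (1 - y)) q0 => u u0.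
  have := sqr_ge0 (u ^+ 2 - 1 / 36); have := sqr_ge0 (u - 1 / 6); rewrite !expr2; nra.
Qed.

Lemma derive_ge0_le (H g : R -> R) (a b : R) : (forall y : R, is_derive y (1 : R) H (g y)) ->
  a <= b -> (forall y, a < y < b -> 0 <= g y) -> H a <= H b.
Proof.
move=> dH; rewrite le_eqVlt => /predU1P[->//|ab] g0.
have cH := cont_of_derive dH.
have [y + E] := MVT ab (fun s _ => dH s) (continuous_subspaceT cH).
by rewrite in_itv/= => yab; rewrite -subr_ge0 E mulr_ge0 ?g0// subr_ge0 ltW.
Qed.

Lemma derive_eq0_eq (H g : R -> R) (a b : R) : (forall y : R, is_derive y (1 : R) H (g y)) ->
  a <= b -> (forall y, a < y < b -> g y = 0) -> H a = H b.
Proof.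
move=> dH ab g0; apply/eqP; rewrite eq_le (derive_ge0_le dH ab) => [/=|y /g0 ->//].
have dN (y : R) : is_derive y (1 : R) (fun y => - H y) (- g y) by exact: is_deriveN.
by rewrite -lerN2; apply: (derive_ge0_le dN ab) => y /g0 ->; rewrite oppr0.
Qed.

Lemma continuous_bump2 : continuous (fun y => bump y ^+ 2).
Proof.
apply: (@cont_comp R R R bump (fun w : R => w ^+ 2)); [exact: continuous_bump|exact: exprn_continuous].
Qed.

Lemma supp01_bump2 : supp01 (fun y => bump y ^+ 2).
Proof. by move=> y /supp01_bump ->; rewrite expr0n. Qed.

Let K : R -> R := sval (cid (primitive continuous_bump2)).
Let dK (y : R) : is_derive y (1 : R) K (bump y ^+ 2).
Proof. exact: (svalP (cid (primitive continuous_bump2))). Qed.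
Let K01 : K 1 - K 0 = bump2. Proof. by rewrite -(FTC_tmf ltr01 continuous_bump2 dK). Qed.

(** The share of the mass of [bump]^2 delivered up to y; it rises from 0 to 1 across the window. *)
Definition bump_step (y : R) := (K y - K 0) / bump2.

Lemma is_derive_bump_step (y : R) : is_derive y (1 : R) bump_step (bump y ^+ 2 / bump2).
Proof.
have := is_deriveZ (bump2^-1) (is_deriveB (dK y) (is_derive_cst (K 0) y (1 : R))).
move=> h; have := h; congr is_derive; last by rewrite /GRing.scale/= subr0 mulrC.
by apply/funext => u; rewrite /= /GRing.scale/= mulrC.
Qed.

Lemma bump_step_ge1 y : 1 <= y -> bump_step y = 1.
Proof.
move=> y1; rewrite /bump_step; have -> : K y = K 1.
  symmetry; apply: (derive_eq0_eq dK y1) => u /andP[u1 _].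
  by apply: supp01_bump2; rewrite negb_and -!leNgt (ltW u1) orbT.
by rewrite K01 mulfV// gt_eqF// bump2_gt0.
Qed.

Lemma bump_step_le0 y : y <= 0 -> bump_step y = 0.
Proof.
move=> y0; rewrite /bump_step; have -> : K y = K 0.
  apply: (derive_eq0_eq dK y0) => u /andP[_ u1].
  by apply: supp01_bump2; rewrite negb_and -!leNgt (ltW u1).
by rewrite subrr mul0r.
Qed.

Lemma bump_step01 y : 0 <= bump_step y <= 1.
Proof.
have [y0|y0] := leP y 0; first by rewrite bump_step_le0// lexx ler01.
have [y1|y1] := leP 1 y; first by rewrite bump_step_ge1// lexx ler01.
have h1 := derive_ge0_le dK (ltW y0) (fun u _ => sqr_ge0 (bump u)).
have h2 := derive_ge0_le dK (ltW y1) (fun u _ => sqr_ge0 (bump u)).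
rewrite /bump_step divr_ge0 ?subr_ge0 ?(ltW bump2_gt0)//=.
by rewrite ler_pdivrMr ?bump2_gt0// mul1r -K01 lerD2r.
Qed.

Lemma derive_affine (H : R -> R) (a l y z : R) : is_derive ((y - a) / l) (1 : R) H z ->
  is_derive y (1 : R) (fun y => H ((y - a) / l)) (z / l).
Proof.
move=> dH.
have d2 : is_derive y (1 : R) (fun y : R => (y - a) / l) (l^-1).
  have := is_deriveZ (l^-1) (is_deriveB (is_derive_id y (1 : R)) (is_derive_cst a y (1 : R))).
  move=> h; have := h; congr is_derive; last by rewrite /GRing.scale/= subr0 mulr1.
  by apply/funext => u; rewrite /= /GRing.scale/= mulrC.
exact: (is_derive1_comp (f := H) (g := fun y : R => (y - a) / l) dH d2).
Qed.

Lemma cont_affine (g : R -> R) (a l : R) : continuous g -> continuous (fun y : R => g ((y - a) / l)).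
Proof.
move=> cg; apply: (@cont_comp R R R (fun y : R => (y - a) / l) g) => // y.
by apply: cvgM; [apply: cvgB; [exact: cvg_id|exact: cvg_cst]|exact: cvg_cst].
Qed.

Lemma window_integral (T a l : R) (g : R -> R) : 0 < T -> 0 < l -> 0 <= a -> a + l <= T ->
  continuous g -> supp01 g -> \int[tmf T]_t g ((t - a) / l) = l * \int[tmf 1]_y g y.
Proof.
move=> T0 l0 a0 alT cg sg; have [H dH] := primitive cg.
have dHl (t : R) : is_derive t (1 : R) (fun t => l * H ((t - a) / l)) (g ((t - a) / l)).
  have := is_deriveZ l (derive_affine (dH ((t - a) / l))).
  by move=> h; apply: is_derive_eq h _; rewrite /GRing.scale/= mulrCA mulfV ?mulr1// gt_eqF.
rewrite (FTC_tmf T0 (cont_affine (a := a) (l := l) cg) dHl) (FTC_tmf ltr01 cg dH) mulrBr; congr (l * _ - l * _).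
- symmetry; apply: (derive_eq0_eq dH).
    by rewrite ler_pdivlMr// mul1r lerBrDl.
  by move=> y /andP[y1 _]; apply: sg; rewrite negb_and -!leNgt (ltW y1) orbT.
- apply: (derive_eq0_eq dH); first by rewrite ler_pdivrMr// mul0r sub0r oppr_le0.
  by move=> y /andP[_ y1]; apply: sg; rewrite negb_and -!leNgt (ltW y1).
Qed.

End bump.

(** * Combs of bumps: one window per cell of time *)

Section cells.
Variables (R : realType) (T : R) (nu : nat) (kap : R).
Hypotheses (T0 : 0 < T) (nu0 : (0 < nu)%N) (kap1 : 1 <= kap).
Let tau := T / nu%:R.
Let l := tau / kap.
Let nu0' : 0 < nu%:R :> R. Proof. by rewrite ltr0n. Qed.
Let tau0 : 0 < tau. Proof. by rewrite divr_gt0. Qed.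
Let kap0 : 0 < kap. Proof. exact: lt_le_trans kap1. Qed.
Let l0 : 0 < l. Proof. by rewrite divr_gt0. Qed.
Let lk : l * kap = tau. Proof. by rewrite divfK// gt_eqF. Qed.
Let l_tau : l <= tau. Proof. by rewrite ler_pdivrMr// ler_peMr// ltW. Qed.

(** Affine coordinate on the window of cell c, which starts with the cell and has 1 / kap of its
    length. *)
Definition win (c : nat) (t : R) := (t - c%:R * tau) / l.

Lemma win_ge1 c t : c.+1%:R * tau <= t -> 1 <= win c t.
Proof. by move=> h; rewrite ler_pdivlMr// mul1r lerBrDr (le_trans _ h)// -natr1 mulrDl mul1r addrC lerD2l. Qed.

Lemma win_le0 c t : t <= c%:R * tau -> win c t <= 0.
Proof. by move=> h; rewrite ler_pdivrMr// mul0r subr_le0. Qed.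

Lemma cell_inj (t : R) (c c' : 'I_nu) : c%:R * tau < t < c.+1%:R * tau ->
  c'%:R * tau < t < c'.+1%:R * tau -> c = c'.
Proof.
move=> /andP[h1 h2] /andP[h3 h4]; apply/val_inj/eqP; case: ltngtP => // lt.
- have : c.+1%:R * tau <= c'%:R * tau by rewrite ler_wpM2r ?(ltW tau0)// ler_nat.
  by lra.
- have : c'.+1%:R * tau <= c%:R * tau by rewrite ler_wpM2r ?(ltW tau0)// ler_nat.
  by lra.
Qed.

(** At most one cell is active at a time. Hence powers, absolute values and products pass inside the
    sums over cells. *)
Lemma cell_unique (t : R) (x : 'I_nu -> R) :
  (forall c : 'I_nu, ~~ (c%:R * tau < t < c.+1%:R * tau) -> x c = 0) ->
  (forall c, x c = 0) \/ exists c0, forall c, c != c0 -> x c = 0.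
Proof.
move=> hx; have [[c0 xc0]|h] := pselect (exists c, x c != 0); last first.
  by left => c; apply/eqP/negPn/negP => xc; apply: h; exists c.
right; exists c0 => c cc0; apply: (hx c); apply/negP => Pc.
have Pc0 : c0%:R * tau < t < c0.+1%:R * tau by apply: contraNT xc0 => /hx ->.
by rewrite (cell_inj Pc Pc0) eqxx in cc0.
Qed.

Lemma cell_sum (t : R) (x : 'I_nu -> R) (f : R -> R) : f 0 = 0 ->
  (forall c : 'I_nu, ~~ (c%:R * tau < t < c.+1%:R * tau) -> x c = 0) ->
  f (\sum_c x c) = \sum_c f (x c).
Proof.
move=> f0 /cell_unique[h|[c0 h]]; first by rewrite !big1// => c _; rewrite h.
by rewrite (bigD1 c0)//= [RHS](bigD1 c0)//= !big1 ?addr0// => c cc0; rewrite h.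
Qed.

Lemma win_supp (g : R -> R) (t : R) (c : nat) : supp01 g ->
  ~~ (c%:R * tau < t < c.+1%:R * tau) -> g (win c t) = 0.
Proof.
move=> sg; rewrite negb_and -!leNgt => /orP[h|h]; apply: sg; rewrite negb_and -!leNgt.
- by rewrite win_le0.
- by rewrite win_ge1// orbT.
Qed.

Definition comb (a : 'I_nu -> R) (g : R -> R) (t : R) := \sum_c a c * g (win c t).

Lemma comb_map (a : 'I_nu -> R) g (f : R -> R) t : supp01 g -> f 0 = 0 ->
  f (comb a g t) = \sum_c f (a c * g (win c t)).
Proof. by move=> sg f0; apply: (@cell_sum t (fun c => a c * g (win c t)) f f0) => c h; rewrite (win_supp sg h) mulr0. Qed.

Lemma combM (a b : 'I_nu -> R) g g' t : supp01 g -> supp01 g' ->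
  comb a g t * comb b g' t = comb (fun c => a c * b c) (fun y => g y * g' y) t.
Proof.
move=> sg sg'; rewrite /comb.
have h (c : 'I_nu) : ~~ (c%:R * tau < t < c.+1%:R * tau) -> a c * g (win c t) = 0.
  by move=> nP; rewrite (win_supp sg nP) mulr0.
have [z|[c0 z]] := cell_unique h.
  by rewrite [X in X * _]big1// mul0r big1// => c _; rewrite mulrACA z mul0r.
rewrite (bigD1 c0)//= [X in _ + X]big1 ?addr0 => [|c /z//].
rewrite [RHS](bigD1 c0)//= [X in _ + X]big1 ?addr0 => [|c /z z']; last by rewrite mulrACA z' mul0r.
have [P|nP] := boolP (c0%:R * tau < t < c0.+1%:R * tau); last by rewrite (win_supp sg nP) !(mulr0, mul0r).
have h' (c : 'I_nu) : c != c0 -> b c * g' (win c t) = 0.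
  move=> cc0; rewrite (win_supp sg') ?mulr0//; apply/negP => Pc.
  by rewrite (cell_inj Pc P) eqxx in cc0.
by rewrite (bigD1 c0)//= [X in _ + X]big1 ?addr0 => [|c /h'//]; rewrite mulrACA.
Qed.

Lemma cont_comb a g : continuous g -> continuous (comb a g).
Proof.
move=> cg; apply: (@cont_bigsum R R _ (index_enum 'I_nu) (fun c t => a c * g (win c t))) => c.
by apply: contM; [exact: cst_continuous|exact: cont_affine].
Qed.

Lemma int_comb a g : continuous g -> supp01 g ->
  \int[tmf T]_t comb a g t = l * (\sum_c a c) * \int[tmf 1]_y g y.
Proof.
move=> cg sg; rewrite /comb.
have ci c : continuous (fun t : R => a c * g (win c t)).
  by apply: contM; [exact: cst_continuous|exact: cont_affine].
transitivity (\sum_c \int[tmf T]_t (a c * g (win c t))).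
  elim: (index_enum _) => [|c s IH].
    by rewrite big_nil -[RHS](mul0r T) -(tmf_cst T0 0); apply: eq_Rintegral => t _; rewrite big_nil.
  rewrite big_cons -IH -tmfD//; first by apply: eq_Rintegral => t _; rewrite big_cons.
  exact: (@cont_bigsum R R _ s (fun c t => a c * g (win c t))).
rewrite -mulrA mulrCA mulr_suml; apply: eq_bigr => c _.
rewrite tmfZ; last exact: cont_affine.
rewrite /win window_integral//; first by rewrite mulr_ge0// ltW.
rewrite (@le_trans _ _ (c.+1%:R * tau))//.
  by rewrite -natr1 mulrDl mul1r lerD2l.
by rewrite /tau mulrA ler_pdivrMr// mulrC ler_wpM2l ?(ltW T0)// ler_nat.
Qed.

End cells.


Section time_block.
Variables (R : realType) (T s : R) (beta : R -> R) (zeta M kap : R) (nu : nat).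
Hypotheses (T0 : 0 < T) (s1 : 1 <= s) (cb : continuous beta) (zeta0 : 0 < zeta)
  (M1 : 1 <= M) (bM : forall t, 0 <= t <= T -> `|beta t| <= M) (nu0 : (0 < nu)%N)
  (kap1 : 1 <= kap).
Local Notation bump := (@bump R).
Local Notation dbump := (@dbump R).
Local Notation n2 := (bump2 R).
Let tau := T / nu%:R.
Let l := tau / kap.
Let s0 : 0 < s. Proof. exact: lt_le_trans s1. Qed.
Let nu0' : 0 < nu%:R :> R. Proof. by rewrite ltr0n. Qed.
Let tau0 : 0 < tau. Proof. by rewrite divr_gt0. Qed.
Let kap0 : 0 < kap. Proof. exact: lt_le_trans kap1. Qed.
Let l0 : 0 < l. Proof. by rewrite divr_gt0. Qed.
Let n20 : 0 < n2. Proof. exact: bump2_gt0. Qed.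
Let lnu : l * nu%:R = T / kap.
Proof. by rewrite /l /tau mulrAC divfK// gt_eqF. Qed.

Variables (P Q : R -> R).
Hypotheses (dP : forall t : R, is_derive t (1 : R) P (beta t))
  (dQ : forall t : R, is_derive t (1 : R) Q (`|beta t|)).

Definition cell_mass (c : nat) : R := P (c.+1%:R * tau) - P (c%:R * tau).
Local Notation m := cell_mass.
(** Over the window of cell c the product of the two profiles must integrate to - m c, hence ca cc =
    - m c / (l n2). The density |m c| / l is split with exponents 1/s and 1 - 1/s, which makes the
    bounds in L^s and in the conjugate space independent of kap; the sign goes to [tgam], and zeta
    shifts size from one factor to the other. *)
Let ca (c : 'I_nu) : R := - (zeta * Num.sg (m c) * (`|m c| / l) `^ s^-1).
Let cc (c : 'I_nu) : R := zeta^-1 / n2 * (`|m c| / l) `^ (1 - s^-1).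
Definition tgam : R -> R := comb T kap ca bump.
Definition tdgam : R -> R := comb T kap (fun c : 'I_nu => ca c / l) dbump.
Definition tchi : R -> R := comb T kap cc bump.

Let ml0 c : 0 <= `|m c| / l. Proof. by rewrite divr_ge0// ltW. Qed.
Let cb_bump : continuous bump. Proof. exact: continuous_bump. Qed.
Let cb_dbump : continuous dbump. Proof. exact: continuous_dbump. Qed.
Let s_bump : supp01 bump. Proof. exact: supp01_bump. Qed.
Let s_dbump : supp01 dbump. Proof. exact: supp01_dbump. Qed.

Lemma cont_tgam : continuous tgam. Proof. exact: cont_comb. Qed.
Lemma cont_tdgam : continuous tdgam. Proof. exact: cont_comb. Qed.
Lemma cont_tchi : continuous tchi. Proof. exact: cont_comb. Qed.

Lemma is_derive_sum1 (I : Type) (r : seq I) (f : I -> R -> R) (df : I -> R) (t : R) :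
  (forall c, is_derive t (1 : R) (f c) (df c)) ->
  is_derive t (1 : R) (fun t => \sum_(c <- r) f c t) (\sum_(c <- r) df c).
Proof.
move=> h; elim: r => [|c r IH].
  rewrite big_nil; have := is_derive_cst (0 : R) t (1 : R); congr is_derive.
  by apply/funext => u; rewrite big_nil.
rewrite big_cons; have := is_deriveD (h c) IH; congr is_derive.
by apply/funext => u; rewrite big_cons.
Qed.

Let is_derive_comb (a : 'I_nu -> R) (g dg : R -> R) (t : R) :
  (forall y : R, is_derive y (1 : R) g (dg y)) ->
  is_derive t (1 : R) (comb T kap a g) (comb T kap (fun c => a c / l) dg t).
Proof.
move=> h; apply: is_derive_sum1 => c.
have := is_deriveZ (a c) (derive_affine (h ((t - c%:R * tau) / l))).
by move=> hd; apply: (is_derive_eq hd); rewrite /GRing.scale/= /win -/tau -/l; ring.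
Qed.

Lemma is_derive_tgam t : is_derive t (1 : R) tgam (tdgam t).
Proof. by apply: is_derive_comb => y; exact: is_derive_bump. Qed.

Let caM c : ca c * cc c = - m c / l / n2.
Proof.
rewrite /ca /cc; have [->|m0] := eqVneq (m c) 0.
  by rewrite sgr0 mulr0 !mul0r oppr0 !mul0r.
have ml : `|m c| / l != 0 by rewrite mulf_neq0// ?normr_eq0// gt_eqF// invr_gt0.
have -> : - (zeta * Num.sg (m c) * (`|m c| / l) `^ s^-1) * (zeta^-1 / n2 * (`|m c| / l) `^ (1 - s^-1)) =
  - (Num.sg (m c) / n2 * ((`|m c| / l) `^ s^-1 * (`|m c| / l) `^ (1 - s^-1))).
  by field; rewrite !gt_eqF.
rewrite -powRD ?ml ?implybT// addrCA subrr addr0 powRr1// -mulrA.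
by rewrite [in RHS](numEsg (m c)); ring.
Qed.

Lemma tgam_tchi t : tgam t * tchi t = - comb T kap (fun c : 'I_nu => m c / l / n2) (fun y => bump y ^+ 2) t.
Proof.
rewrite /tgam /tchi combM// /comb -sumrN; apply: eq_bigr => c _.
by rewrite caM expr2 !mulNr.
Qed.

Let le_P a b : 0 <= a -> a <= b -> b <= T -> `|P b - P a| <= Q b - Q a.
Proof.
move=> a0 ab bT.
have h1 (t : R) : is_derive t (1 : R) (fun t => Q t - P t) (`|beta t| - beta t) by exact: is_deriveB.
have h2 (t : R) : is_derive t (1 : R) (fun t => Q t + P t) (`|beta t| + beta t) by exact: is_deriveD.
have p1 y : a < y < b -> 0 <= `|beta y| + beta y.
  by move=> _; have := ler_norm (- beta y); rewrite normrN; lra.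
have p2 y : a < y < b -> 0 <= `|beta y| - beta y.
  by move=> _; have := ler_norm (beta y); lra.
have := derive_ge0_le h1 ab p2; have := derive_ge0_le h2 ab p1.
by rewrite ler_norml => H1 H2; apply/andP; split; lra.
Qed.

Let le_QM a b : 0 <= a -> a <= b -> b <= T -> Q b - Q a <= M * (b - a).
Proof.
move=> a0 ab bT.
have h (t : R) : is_derive t (1 : R) (fun t => M * t - Q t) (M - `|beta t|).
  have := is_deriveB (is_deriveZ M (is_derive_id t (1 : R))) (dQ t).
  by move=> hd; apply: (is_derive_eq hd); rewrite /GRing.scale/= mulr1.
have := derive_ge0_le h ab => /(_ _)h'.
suff : M * a - Q a <= M * b - Q b by lra.
apply: h' => y /andP[y1 y2]; rewrite subr_ge0 bM//; apply/andP; split; lra.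
Qed.

Let ctau (c : nat) : (c <= nu)%N -> 0 <= c%:R * tau <= T.
Proof.
move=> cn; rewrite mulr_ge0 ?(ltW tau0)//= /tau mulrA ler_pdivrMr// mulrC.
by rewrite ler_wpM2l ?(ltW T0)// ler_nat.
Qed.

Let le_ctau c : c%:R * tau <= c.+1%:R * tau.
Proof. by rewrite ler_wpM2r ?(ltW tau0)// ler_nat. Qed.

Let m_le (c : 'I_nu) : `|m c| <= tau * M.
Proof.
have /andP[h1 _] := ctau (ltnW (ltn_ord c)); have /andP[_ h2] := ctau (ltn_ord c).
apply: (le_trans (le_P h1 (le_ctau c) h2)); apply: (le_trans (le_QM h1 (le_ctau c) h2)).
by rewrite -natr1; lra.
Qed.

Lemma nutau : nu%:R * tau = T. Proof. by rewrite mulrC divfK// gt_eqF. Qed.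

Let sum_m : \sum_(c < nu) `|m c| <= Q T - Q 0.
Proof.
apply: (@le_trans _ _ (\sum_(c < nu) (Q (c.+1%:R * tau) - Q (c%:R * tau)))).
  apply: ler_sum => c _.
  have /andP[h1 _] := ctau (ltnW (ltn_ord c)); have /andP[_ h2] := ctau (ltn_ord c).
  exact: le_P.
rewrite -(big_mkord xpredT (fun c => Q (c.+1%:R * tau) - Q (c%:R * tau))).
by rewrite (telescope_sumr (fun c => Q (c%:R * tau)))// nutau mul0r.
Qed.

Let betaL1 : \int[tmf T]_t `|beta t| = Q T - Q 0.
Proof. by apply: FTC_tmf => //; exact: cont_norm. Qed.

Let comb_abs (a : 'I_nu -> R) (g : R -> R) (r t : R) : supp01 g -> 0 < r ->
  `|comb T kap a g t| `^ r = comb T kap (fun c => `|a c| `^ r) (fun y => `|g y| `^ r) t.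
Proof.
move=> sg r0; rewrite (@comb_map _ _ _ kap T0 nu0 kap1 a g (fun x => `|x| `^ r) t sg); last first.
  by rewrite normr0 powR0// gt_eqF.
by apply: eq_bigr => c _; rewrite normrM powRM.
Qed.

Let supp_pow (g : R -> R) (r : R) : supp01 g -> 0 < r -> supp01 (fun y => `|g y| `^ r).
Proof. by move=> sg r0 y /sg ->; rewrite normr0 powR0// gt_eqF. Qed.

Lemma comb_Lr (a : 'I_nu -> R) (g : R -> R) (r : R) : continuous g -> supp01 g ->
  (forall y, `|g y| <= 1) -> 1 <= r ->
  \int[tmf T]_t `|comb T kap a g t| `^ r <= l * \sum_c `|a c| `^ r.
Proof.
move=> cg sg g1 r1; have r0 : 0 < r by exact: lt_le_trans r1.
have cgr := cont_powR_norm r0 cg.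
under eq_Rintegral do rewrite comb_abs//.
rewrite (int_comb T0 nu0 kap1)//; last exact: supp_pow.
rewrite -/tau -/l -[leRHS]mulr1; apply: ler_wpM2l.
  by rewrite mulr_ge0 ?(ltW l0)// sumr_ge0// => c _; exact: powR_ge0.
apply: (@le_trans _ _ (\int[tmf 1]_(y in setT) 1)); last by rewrite (tmf_cst ltr01) mulr1.
apply: tmf_le => // [|y _]; first exact: cst_continuous.
have := ler_powRl (ltW r0) (normr_ge0 (g y)) (g1 y).
by rewrite powR1.
Qed.

Let comb_sup (a : 'I_nu -> R) (g : R -> R) (X t : R) : supp01 g ->
  (forall y, `|g y| <= 1) -> 0 <= X -> (forall c, `|a c| <= X) -> `|comb T kap a g t| <= X.
Proof.
move=> sg g1 X0 aX.
have h (c : 'I_nu) : ~~ (c%:R * tau < t < c.+1%:R * tau) -> a c * g (win T nu kap c t) = 0.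
  by move=> nP; rewrite (win_supp T0 nu0 kap1 sg nP) mulr0.
have [z|[c0 z]] := cell_unique T0 nu0 h; first by rewrite /comb big1 ?normr0.
rewrite /comb (bigD1 c0)//= big1 ?addr0 => [|c /z//].
by rewrite normrM -[leRHS]mulr1 ler_pM.
Qed.

Let bump_abs y : `|bump y| <= 1.
Proof. by rewrite ger0_norm ?bump_ge0// bump_le1. Qed.

Let powM (x : R) : 0 <= x -> x <= 1 -> forall c, (`|m (c : 'I_nu)| / l) `^ x <= M * kap `^ x.
Proof.
move=> x0 x1 c.
have h : `|m c| / l <= M * kap.
  have lk : l * kap = tau by rewrite divfK// gt_eqF.
  by rewrite ler_pdivrMr// (le_trans (m_le c))// -[leRHS]mulrA (mulrC kap) lk mulrC.
apply: (le_trans (ler_powRl x0 (ml0 c) h)).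
rewrite powRM ?(ltW kap0) ?(le_trans _ M1)// ler_wpM2r ?powR_ge0//.
exact: ler1_powR.
Qed.

Let is1 : 0 <= s^-1 <= 1.
Proof. by rewrite invr_ge0 (ltW s0) invf_le1. Qed.

Let ca_le c : `|ca c| <= zeta * M * kap `^ s^-1.
Proof.
have /andP[h1 h2] := is1.
rewrite /ca normrN !normrM (gtr0_norm zeta0) (ger0_norm (powR_ge0 _ _)) -!mulrA.
rewrite ler_wpM2l ?(ltW zeta0)//; apply: (le_trans _ (powM h1 h2 c)).
by rewrite -[leRHS]mul1r ler_wpM2r ?powR_ge0// normr_sg lern1; case: (_ == _).
Qed.

Let cc_le c : `|cc c| <= zeta^-1 / n2 * M * kap `^ (1 - s^-1).
Proof.
have /andP[h1 h2] := is1.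
have k0 : 0 <= zeta^-1 / n2 by rewrite divr_ge0 ?invr_ge0 ?ltW.
rewrite /cc normrM (ger0_norm k0) (ger0_norm (powR_ge0 _ _)) -[leRHS]mulrA ler_wpM2l//.
by apply: powM; lra.
Qed.

Definition Ct : R := zeta * M * (1 + T + nu%:R) + zeta^-1 / n2 * M.
Let M0 : 0 < M. Proof. exact: lt_le_trans M1. Qed.
Let zM : 0 < zeta * M. Proof. exact: mulr_gt0. Qed.
Let izM : 0 < zeta^-1 / n2 * M. Proof. by rewrite mulr_gt0// divr_gt0// invr_gt0. Qed.
Lemma Ct_gt0 : 0 < Ct.
Proof. by rewrite addr_gt0// mulr_gt0// !addr_gt0. Qed.

Let Ct_ge1 x : 0 <= x -> x <= 1 + T + nu%:R -> zeta * M * x <= Ct.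
Proof. by move=> x0 x1; rewrite /Ct -[leLHS]addr0 lerD ?(ltW izM)// ler_wpM2l ?(ltW zM). Qed.
Let Ct_ge2 : zeta^-1 / n2 * M <= Ct.
Proof. by rewrite lerDr mulr_ge0 ?(ltW zM)// !addr_ge0// ltW. Qed.

Lemma tgam_sup t : `|tgam t| <= Ct * kap `^ s^-1.
Proof.
apply: (le_trans (comb_sup t s_bump bump_abs _ ca_le)).
  by rewrite mulr_ge0 ?powR_ge0 ?(ltW zM).
rewrite ler_wpM2r ?powR_ge0// -[leLHS]mulr1 Ct_ge1//; have := ltW nu0'; have := ltW T0; lra.
Qed.

Lemma tchi_sup t : `|tchi t| <= Ct * kap `^ (1 - s^-1).
Proof.
apply: (le_trans (comb_sup t s_bump bump_abs _ cc_le)).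
  by rewrite mulr_ge0 ?powR_ge0 ?(ltW izM).
by rewrite ler_wpM2r ?powR_ge0.
Qed.

Lemma tdgam_L1 : \int[tmf T]_t `|tdgam t| <= Ct * kap `^ s^-1.
Proof.
have := comb_Lr (fun c => ca c / l) cb_dbump s_dbump (@dbump_le1 R) (lexx 1).
under eq_Rintegral do rewrite powRr1//; move=> /le_trans; apply.
apply: (@le_trans _ _ (\sum_(c < nu) zeta * M * kap `^ s^-1)).
  rewrite mulr_sumr; apply: ler_sum => c _; rewrite powRr1// normrM normfV (gtr0_norm l0).
  by rewrite mulrCA mulfV ?gt_eqF// mulr1.
rewrite sumr_const card_ord -[_ *+ _]mulr_natr mulrAC ler_wpM2r ?powR_ge0// Ct_ge1//; have := ltW T0; lra.
Qed.

Lemma tgam_L1 : \int[tmf T]_t `|tgam t| <= Ct * kap `^ s^-1 / kap.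
Proof.
have := comb_Lr ca cb_bump s_bump bump_abs (lexx 1).
under eq_Rintegral do rewrite powRr1//; move=> /le_trans; apply.
apply: (@le_trans _ _ (l * \sum_(c < nu) zeta * M * kap `^ s^-1)).
  by rewrite ler_wpM2l ?(ltW l0)//; apply: ler_sum => c _; rewrite powRr1.
rewrite sumr_const card_ord -[_ *+ _]mulr_natl mulrA lnu.
rewrite [leLHS](_ : _ = zeta * M * T * (kap `^ s^-1 / kap)); last by ring.
rewrite -[leRHS]mulrA ler_wpM2r ?divr_ge0 ?powR_ge0 ?(ltW kap0)// Ct_ge1 ?(ltW T0)//.
by have := ltW nu0'; lra.
Qed.

Lemma tchi_Lr r : 1 <= r -> \int[tmf T]_t `|tchi t| `^ r <= (Ct * kap `^ (1 - s^-1)) `^ r * (T / kap).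
Proof.
move=> r1; have r0 : 0 <= r by exact: le_trans r1.
apply: (le_trans (comb_Lr cc cb_bump s_bump bump_abs r1)).
apply: (@le_trans _ _ (l * \sum_(c < nu) (Ct * kap `^ (1 - s^-1)) `^ r)).
  rewrite ler_wpM2l ?(ltW l0)//; apply: ler_sum => c _.
  apply: ler_powRl => //; apply: (le_trans (cc_le c)).
  by rewrite ler_wpM2r ?powR_ge0.
by rewrite sumr_const card_ord -[_ *+ _]mulr_natl mulrA lnu mulrC.
Qed.

(** Each window contributes at most l (|m c| / l) = |m c| times zeta^s, and these masses add up to
    at most the L^1 norm of beta. *)
Lemma tgam_Ls : \int[tmf T]_t `|tgam t| `^ s <= zeta `^ s * \int[tmf T]_t `|beta t|.
Proof.
apply: (le_trans (comb_Lr ca cb_bump s_bump bump_abs s1)).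
apply: (@le_trans _ _ (zeta `^ s * \sum_(c < nu) `|m c|)); last first.
  by rewrite ler_wpM2l ?powR_ge0// betaL1.
rewrite !mulr_sumr; apply: ler_sum => c _.
rewrite /ca normrN !normrM (gtr0_norm zeta0) (ger0_norm (powR_ge0 _ _)).
rewrite powRM ?mulr_ge0 ?powR_ge0 ?(ltW zeta0)// -powRrM mulVf ?gt_eqF// powRr1//.
rewrite mulrCA [l * _]mulrC divfK ?gt_eqF// ler_wpM2r// ler_powRl ?(ltW s0) ?mulr_ge0 ?(ltW zeta0)//.
by rewrite -[leRHS]mulr1 ler_wpM2l ?(ltW zeta0)// normr_sg lern1; case: (_ == _).
Qed.

Lemma tchi_Ls : s != 1 ->
  \int[tmf T]_t `|tchi t| `^ (s / (s - 1)) <= (n2^-1 / zeta) `^ (s / (s - 1)) * \int[tmf T]_t `|beta t|.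
Proof.
move=> sn1; have s11 : 0 < s - 1 by rewrite subr_gt0 lt_neqAle eq_sym sn1.
have r1 : 1 <= s / (s - 1) by rewrite ler_pdivlMr// mul1r gerBl.
apply: (le_trans (comb_Lr cc cb_bump s_bump bump_abs r1)).
apply: (@le_trans _ _ ((n2^-1 / zeta) `^ (s / (s - 1)) * \sum_(c < nu) `|m c|)); last first.
  by rewrite ler_wpM2l ?powR_ge0// betaL1.
have k0 : 0 <= zeta^-1 / n2 by rewrite divr_ge0 ?invr_ge0 ?ltW.
rewrite !mulr_sumr; apply: ler_sum => c _.
rewrite /cc normrM (ger0_norm k0) (ger0_norm (powR_ge0 _ _)) powRM ?powR_ge0// -powRrM.
have -> : (1 - s^-1) * (s / (s - 1)) = 1 by field; rewrite gt_eqF//= gt_eqF.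
by rewrite powRr1// mulrCA [l * _]mulrC divfK ?gt_eqF// [zeta^-1 / _]mulrC.
Qed.

Lemma tchi_L1sup t : s = 1 -> `|tchi t| <= n2^-1 / zeta.
Proof.
move=> sE; apply: (comb_sup t s_bump bump_abs).
  by rewrite divr_ge0 ?invr_ge0 ?ltW.
move=> c; rewrite /cc sE invr1 subrr powRr0 mulr1 ger0_norm; first by rewrite mulrC.
by rewrite divr_ge0 ?invr_ge0 ?ltW.
Qed.

Lemma tgamchi_L1 : \int[tmf T]_t `|tgam t * tchi t| <= \int[tmf T]_t `|beta t|.
Proof.
rewrite betaL1; apply: le_trans sum_m.
have sb2 : supp01 (fun y => bump y ^+ 2) by move=> y /s_bump ->; rewrite expr0n.
have cb2 : continuous (fun y => bump y ^+ 2).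
  by apply: (@cont_comp R R R bump (fun w : R => w ^+ 2)) => //; exact: exprn_continuous.
have E t : `|tgam t * tchi t| = comb T kap (fun c : 'I_nu => `|m c| / l / n2) (fun y => bump y ^+ 2) t.
  rewrite tgam_tchi normrN (@comb_map _ _ _ kap T0 nu0 kap1 _ _ (fun x => `|x|) t sb2 (normr0 _)).
  apply: eq_bigr => c _; rewrite normrM (ger0_norm (sqr_ge0 _)) !normrM !normfV.
  by rewrite (gtr0_norm l0) (gtr0_norm n20).
under eq_Rintegral do rewrite E.
rewrite (int_comb T0 nu0 kap1)// -/tau -/l -/n2 -!mulr_suml -mulrA divfK ?gt_eqF//.
by rewrite mulrC divfK// gt_eqF.
Qed.

Definition tsupp : set R := \big[setU/set0]_(c < nu) `[c%:R * tau, c%:R * tau + l]%classic.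

Lemma measurable_tsupp : measurable tsupp.
Proof. by apply: bigsetU_measurable => c _; exact: measurable_itv. Qed.

Lemma tsupp_le : (tmf T tsupp <= (T / kap)%:E)%E.
Proof.
apply: (@le_trans _ _ (lebesgue_measure tsupp)).
  rewrite /tmf /mrestr; apply: le_measure; rewrite ?inE.
  - by apply: measurableI; [exact: measurable_tsupp|exact: measurable_itv].
  - exact: measurable_tsupp.
  - by move=> t [].
apply: (@le_trans _ _ (\sum_(c < nu) lebesgue_measure (`[(c%:R * tau)%R, (c%:R * tau + l)%R]%classic : set R))%E).
  apply: (@content_subadditive _ _ _ lebesgue_measure tsupp (fun c => `[(c%:R * tau)%R, (c%:R * tau + l)%R]%classic) nu) => //.
  - exact: measurable_tsupp.
rewrite (eq_bigr (fun=> l%:E)) => [|c _].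
  by rewrite sumEFin lee_fin sumr_const card_ord -mulr_natr lnu.
by rewrite lebesgue_measure_itv/= lte_fin ltrDl l0 -EFinB addrAC subrr add0r.
Qed.

Lemma tsupp_out t : ~ tsupp t -> tgam t = 0 /\ tchi t = 0.
Proof.
move=> nt.
have h (c : 'I_nu) : bump (win T nu kap c t) = 0.
  apply: s_bump; apply/negP => /andP[w0 w1]; apply: nt.
  rewrite /tsupp -(bigcup_mkord nu (fun c : nat => `[c%:R * tau, c%:R * tau + l]%classic)).
  exists (c : nat) => //=; rewrite in_itv/=.
  move: w0 w1; rewrite /win -/tau -/l.
  by rewrite ltr_pdivlMr// mul0r ltr_pdivrMr// mul1r => h1 h2; apply/andP; split; lra.
by rewrite /tgam /tchi /comb !big1// => c _; rewrite h mulr0.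
Qed.

Let win0 (c : nat) : win T nu kap c 0 <= 0.
Proof. by apply: win_le0 => //; rewrite mulr_ge0// ltW. Qed.
Let winT (c : 'I_nu) : 1 <= win T nu kap c T.
Proof. by apply: win_ge1 => //; case/andP: (ctau (ltn_ord c)). Qed.

Lemma tgam0 : tgam 0 = 0.
Proof. by rewrite /tgam /comb big1// => c _; rewrite s_bump ?mulr0// ltNge win0. Qed.
Lemma tgamT : tgam T = 0.
Proof. by rewrite /tgam /comb big1// => c _; rewrite s_bump ?mulr0// negb_and -!leNgt winT orbT. Qed.

Local Notation step := (@bump_step R).
(* The primitive of beta + tgam * tchi vanishing at 0. *)
Definition tB (t : R) : R := P t - P 0 - comb T kap (fun c : 'I_nu => m c) step t.

Lemma is_derive_tB t : is_derive t (1 : R) tB (beta t + tgam t * tchi t).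
Proof.
have ds := @is_derive_bump_step R.
have := is_deriveB (is_deriveB (dP t) (is_derive_cst (P 0) t (1 : R))) (is_derive_comb (fun c : 'I_nu => m c) t ds).
move=> hd; apply: (is_derive_eq hd); rewrite subr0 tgam_tchi; congr (_ - _).
by rewrite /comb; apply: eq_bigr => c _; ring.
Qed.

Let telP (f : nat -> R) : \sum_(c < nu) (P (f c.+1) - P (f c)) = P (f nu) - P (f 0%N).
Proof.
rewrite -(big_mkord xpredT (fun c => P (f c.+1) - P (f c))).
by rewrite (telescope_sumr (fun c => P (f c))).
Qed.

Lemma tB0 : tB 0 = 0.
Proof. by rewrite /tB subrr sub0r /comb big1 ?oppr0// => c _; rewrite bump_step_le0 ?mulr0. Qed.

Lemma tBT : tB T = 0.
Proof.
rewrite /tB /comb (eq_bigr (fun c : 'I_nu => m c)) => [|c _]; last by rewrite bump_step_ge1 ?mulr1.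
by rewrite (telP (fun c => c%:R * tau)) nutau mul0r subrr.
Qed.

(** The comb delivers in each cell the mass of beta on that cell, so [tB] vanishes at the ends of
    the cells; inside a cell both contributions are at most M tau. *)
Lemma tB_le t : 0 <= t <= T -> `|tB t| <= 2 * M * tau.
Proof.
move=> /andP[t0 tT].
have X0 : 0 <= 2 * M * tau by rewrite mulr_ge0 ?(ltW tau0)// mulr_ge0// ltW.
(* Clipping the cell ends at t writes P t - P 0 as a sum over cells, matched term by term with the
   comb: only the cell that contains t survives. *)
pose q (c : nat) := Num.min t (c%:R * tau).
have E : tB t = \sum_(c < nu) (P (q c.+1) - P (q c) - m c * step (win T nu kap c t)).
  rewrite big_split/= sumrN telP /q nutau (min_idPl tT) mul0r (min_idPr t0).
  by [].
rewrite E.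
have z (c : 'I_nu) : ~~ (c%:R * tau < t < c.+1%:R * tau) -> P (q c.+1) - P (q c) - m c * step (win T nu kap c t) = 0.
  rewrite negb_and -!leNgt => /orP[h|h].
    rewrite bump_step_le0 ?win_le0// mulr0 subr0 /q (min_idPl h) (min_idPl _) ?subrr//.
    exact: le_trans (le_ctau c).
  rewrite bump_step_ge1 ?win_ge1// mulr1 /q (min_idPr h) (min_idPr _) ?subrr//.
  exact: le_trans (le_ctau c) h.
have [z'|[c0 z']] := cell_unique T0 nu0 z.
  by rewrite big1 ?normr0.
rewrite (bigD1 c0)//= big1 ?addr0 => [|c /z'//].
have [P0|/z ->] := boolP (c0%:R * tau < t < c0.+1%:R * tau); last first.
  by rewrite normr0.
have /andP[p1 p2] := P0.
have /andP[c1 _] := ctau (ltnW (ltn_ord c0)).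
rewrite /q (min_idPl (ltW p2)) (min_idPr (ltW p1)).
have h1 := le_trans (le_P c1 (ltW p1) tT) (le_QM c1 (ltW p1) tT).
have h2 : `|m c0 * step (win T nu kap c0 t)| <= tau * M.
  have /andP[st0 st1] := bump_step01 (win T nu kap c0 t).
  rewrite normrM (ger0_norm st0) -[leRHS]mulr1 ler_pM// m_le.
rewrite (le_trans (ler_normB _ _))//.
have : M * (t - c0%:R * tau) <= M * tau.
  by rewrite ler_wpM2l ?(ltW M0)//; move: p2; rewrite -natr1; lra.
lra.
Qed.

End time_block.

Lemma continuous_bounded (R : realType) (T : R) (f : R -> R) : 0 < T -> continuous f ->
  exists2 M : R, 1 <= M & forall t, 0 <= t <= T -> `|f t| <= M.
Proof.
move=> T0 cf.
have [t _ tM] := @EVT_max R (fun t => `|f t|) 0 T (ltW T0) (continuous_subspaceT (cont_norm cf)).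
exists (`|f t| + 1); first by rewrite lerDr.
by move=> u uT; rewrite (le_trans (tM u _)) ?in_itv//= lerDl.
Qed.

(** The number of cells is fixed through the bound on B by eps; kap stays free, and [C] does not
    depend on beta, zeta or eps. *)
Lemma time_blocks (R : realType) (T s : R) : 0 < T -> 1 <= s ->
  exists2 C : R, 0 < C & forall (beta : R -> R) (zeta eps : R),
  continuous beta -> 0 < zeta -> 0 < eps ->
  exists2 C1 : R, 0 < C1 & forall kap, 1 <= kap ->
  exists (g dg chi B : R -> R) (N : set R),
  [/\ [/\ continuous g, continuous dg, continuous chi,
         forall t : R, is_derive t (1 : R) g (dg t) &
         forall t : R, is_derive t (1 : R) B (beta t + g t * chi t)],
      [/\ g 0 = 0, g T = 0, B 0 = 0, B T = 0 & forall t, 0 <= t <= T -> `|B t| <= eps],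
      [/\ \int[tmf T]_t `|g t| `^ s <= zeta `^ s * \int[tmf T]_t `|beta t|,
          s = 1 -> forall t, `|chi t| <= C / zeta,
          s != 1 -> \int[tmf T]_t `|chi t| `^ (s / (s - 1)) <=
                    (C / zeta) `^ (s / (s - 1)) * \int[tmf T]_t `|beta t| &
          \int[tmf T]_t `|g t * chi t| <= \int[tmf T]_t `|beta t|],
      [/\ forall t, `|g t| <= C1 * kap `^ s^-1,
          forall t, `|chi t| <= C1 * kap `^ (1 - s^-1),
          \int[tmf T]_t `|dg t| <= C1 * kap `^ s^-1,
          \int[tmf T]_t `|g t| <= C1 * kap `^ s^-1 / kap &
          forall r, 1 <= r ->
            \int[tmf T]_t `|chi t| `^ r <= (C1 * kap `^ (1 - s^-1)) `^ r * (T / kap)] &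
      [/\ measurable N, (tmf T N <= (T / kap)%:E)%E &
          forall t, ~ N t -> g t = 0 /\ chi t = 0]].
Proof.
move=> T0 s1; exists (bump2 R)^-1; first by rewrite invr_gt0 bump2_gt0.
move=> beta zeta eps cb zeta0 eps0.
have [M M1 bM] := continuous_bounded T0 cb.
pose nu := (Num.truncn (2 * M * T / eps)).+1.
have nu0 : (0 < nu)%N by [].
have nuE : 2 * M * (T / nu%:R) <= eps.
  have : 2 * M * T / eps <= nu%:R by rewrite ltW// truncnS_gt.
  by rewrite ler_pdivrMr// => h; rewrite mulrA ler_pdivrMr ?ltr0n// [leRHS]mulrC.
exists (Ct T zeta M nu); first exact: (Ct_gt0 T0 zeta0 M1 nu0).
move=> kap kap1.
have [P dP] := primitive cb; have [Q dQ] := primitive (cont_norm cb).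
exists (tgam T s zeta kap nu P), (tdgam T s zeta kap nu P), (tchi T s zeta kap nu P),
  (tB T kap nu P), (tsupp T kap nu).
split.
- split.
  + exact: cont_tgam.
  + exact: cont_tdgam.
  + exact: cont_tchi.
  + exact: is_derive_tgam.
  + exact: is_derive_tB.
- split.
  + exact: tgam0.
  + exact: tgamT.
  + exact: tB0.
  + exact: tBT.
  + by move=> t tT; apply: le_trans nuE; apply: tB_le tT.
- split.
  + exact: tgam_Ls.
  + by move=> sE t; exact: tchi_L1sup.
  + by move=> sn; exact: tchi_Ls.
  + exact: tgamchi_L1.
- split.
  + exact: tgam_sup.
  + exact: tchi_sup.
  + exact: tdgam_L1.
  + exact: tgam_L1.
  + exact: tchi_Lr.
- split.
  + exact: measurable_tsupp.
  + exact: tsupp_le.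
  + exact: tsupp_out.
Qed.


(** * The convex integration step *)

Section perturbation.
Variables (R : realType) (T : R) (d : nat) (p q r s st g : R).
Local Notation E := 'rV[R]_d.
Local Notation mu := (torus_measure R d).
Local Notation I f := (\int[mu]_x f x).
Local Notation D := (d.-1%:R : R).
Hypotheses (T0 : 0 < T) (d2 : (1 < d)%N) (p1 : 1 < p) (q1 : 1 <= q) (r1 : 1 < r)
  (pr : p^-1 + r^-1 = 1) (s1 : 1 <= s) (st1 : 1 <= st)
  (g0 : 0 < g) (ge1 : g < 1 + D / r)
  (ge2 : g * s * (1 - s^-1 - st^-1) + (1 + D / r - D / q) < 0).

Lemma powR_small (h K e : R) : 0 < h -> 0 < e ->
  exists m0 : R, forall m, m0 <= m -> 1 <= m -> K * m `^ (- h) <= e.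
Proof.
move=> h0 e0; exists ((`|K| / e) `^ h^-1) => m mm m1.
have m0 : 0 < m by exact: lt_le_trans m1.
rewrite powRN ler_pdivrMr ?powR_gt0// (le_trans (ler_norm K))//.
have : ((`|K| / e) `^ h^-1) `^ h <= m `^ h.
  by apply: ler_powRl => //; [exact: ltW|exact: powR_ge0].
rewrite -powRrM mulVf ?gt_eqF// powRr1 ?divr_ge0 ?(ltW e0)//.
by rewrite ler_pdivrMr// mulrC.
Qed.

Lemma young (x y : R) : 0 <= x -> 0 <= y -> x * y <= x `^ p + y `^ r.
Proof.
move=> x0 y0; have p0 : 0 < p by exact: lt_trans p1. have r0 : 0 < r by exact: lt_trans r1.
have := conjugate_powR x0 y0 p0 r0 pr; move/le_trans; apply; apply: lerD.
- by rewrite ler_pdivrMr// ler_peMr ?powR_ge0// ltW.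
- by rewrite ler_pdivrMr// ler_peMr ?powR_ge0// ltW.
Qed.

Definition tsize (z : (R -> R) * (E -> R) * 'I_d) : R :=
  (\int[tmf T]_t `|z.1.1 t|) * I (fun x => `|z.1.2 x|).

Lemma powR_root (x y a : R) : 0 < a -> 0 <= y -> x <= y `^ a -> 0 <= x -> x `^ a^-1 <= y.
Proof.
move=> a0 y0 xy x0; apply: (@le_trans _ _ ((y `^ a) `^ a^-1)).
  by apply: ler_powRl => //; rewrite invr_ge0 ltW.
by rewrite -powRrM mulfV ?gt_eqF// powRr1.
Qed.

Lemma perturbation : exists2 C : R, 0 < C &
  forall (beta : R -> R) (F : E -> R) (i j0 : 'I_d) (a e : R),
  continuous beta -> sm F -> j0 != i -> 0 < a -> 0 < e ->
  exists (gam dgam chi B : R -> R) (N : set R) (Z : E -> R) (w : bool -> E -> R) (V : 'I_d -> E -> R),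
  let size := tsize (beta, F, i) in
  [/\ [/\ continuous gam, continuous dgam, continuous chi,
         forall t : R, is_derive t (1 : R) gam (dgam t) &
         forall t : R, is_derive t (1 : R) B (beta t + gam t * chi t)],
      [/\ sm Z, forall b, sm (w b), forall j, sm (V j) &
       forall psi, sm psi ->
        I (fun x => pd j0 Z x * (w true x * pd i psi x + w false x * pd j0 psi x)) =
          I (fun x => F x * pd i psi x) + \sum_j I (fun x => V j x * pd j psi x) /\
        I (fun x => w true x * pd i psi x + w false x * pd j0 psi x) = 0],
      [/\ [/\ gam 0 = 0, gam T = 0, B 0 = 0, B T = 0 & forall t, 0 <= t <= T -> `|B t| <= e],
          measurable N, (tmf T N <= e%:E)%E & forall t, ~ N t -> gam t = 0 /\ chi t = 0],
      [/\ (\int[tmf T]_t `|gam t| `^ s) `^ s^-1 * (I (fun x => `|pd j0 Z x| `^ p)) `^ p^-1 <= a,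
          forall b, s = 1 -> forall t, `|chi t| * (I (fun x => `|w b x| `^ r)) `^ r^-1 <= C * (size + e) / a,
          forall b, s != 1 -> (\int[tmf T]_t `|chi t| `^ (s / (s - 1))) `^ (1 - s^-1) *
             (I (fun x => `|w b x| `^ r)) `^ r^-1 <= C * (size + e) / a,
          forall b, (\int[tmf T]_t `|chi t| `^ st) `^ st^-1 * (I (fun x => `|w b x| `^ q)) `^ q^-1 <= e &
          forall b l, (\int[tmf T]_t `|chi t| `^ st) `^ st^-1 * (I (fun x => `|pd l (w b) x| `^ q)) `^ q^-1 <= e] &
      [/\ (\int[tmf T]_t `|dgam t|) * I (fun x => `|Z x|) <= e /\
             (forall t, `|gam t| * I (fun x => `|Z x|) <= e),
          forall b, (\int[tmf T]_t `|chi t|) * I (fun x => `|w b x|) <= e,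
          (\int[tmf T]_t `|gam t|) * I (fun x => `|pd j0 Z x|) <= e,
          forall j, (\int[tmf T]_t `|gam t * chi t|) * I (fun x => `|V j x|) <= e &
          forall b, (\int[tmf T]_t `|gam t * chi t|) * I (fun x => `|pd j0 Z x * w b x|) <= C * (size + e)]].
Proof.
have [T0' ge1' ge2'] := And3 T0 ge1 ge2.
have p0 : 0 < p by exact: lt_trans p1. have r0 : 0 < r by exact: lt_trans r1.
have s0 : 0 < s by exact: lt_le_trans s1. have st0 : 0 < st by exact: lt_le_trans st1.
have q0 : 0 < q by exact: lt_le_trans q1.
have D0 : 0 < D by rewrite ltr0n; case: (d) d2 => [|[]].
have [C2 C20 block] := @building_blocks R d p r p1 r1 pr.
have [Ct Ct0 tblock] := time_blocks T0 s1.
exists (C2 * Ct + 2 * C2); first by rewrite addr_gt0 ?mulr_gt0.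
set C := C2 * Ct + 2 * C2.
move=> beta F i j0 a e cb sF ij0 a0 e0.
set A := \int[tmf T]_t `|beta t|; set Bf := I (fun x => `|F x|).
have A0 : 0 <= A by apply: Rintegral_ge0.
have B0 : 0 <= Bf by exact: cpI_ge0.
(* Small enough for (A + del) (Bf + del) <= A Bf + e and A del <= e. *)
pose del := e / (A + Bf + 1 + e).
have den0 : 0 < A + Bf + 1 + e by lra.
have del0 : 0 < del by rewrite divr_gt0.
have delA : del * (A + Bf + 1) <= e.
  by rewrite /del mulrAC ler_pdivrMr// ler_wpM2l ?(ltW e0)//; lra.
have del1 : del <= 1 by rewrite /del ler_pdivrMr// mul1r; lra.
pose X := A + del; pose Y := Bf + del.
have AX : A <= X by rewrite lerDl ltW.
have T10 : 0 <= 1 + T by rewrite addr_ge0// ltW.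
have X0 : 0 < X by rewrite /X; lra.
have Y0 : 0 < Y by rewrite /Y; lra.
have XY : X * Y <= A * Bf + e by rewrite /X /Y; nra.
have AdelE : A * del <= e by nra.
have CY0 : 0 < C2 * Y by rewrite mulr_gt0.
(* Makes the norm of the density increment at most a. By 1/s + (1 - 1/s) = 1 and 1/p + 1/r = 1 the
   velocity increment then costs a constant times X Y / a. *)
pose zeta := a / (X `^ s^-1 * (C2 * Y) `^ p^-1).
have zd0 : 0 < X `^ s^-1 * (C2 * Y) `^ p^-1 by rewrite mulr_gt0 ?powR_gt0.
have zeta0 : 0 < zeta by rewrite divr_gt0.
have [C1s C1s0 {}block] := block F i j0 del sF ij0 del0.
have [C1t C1t0 {}tblock] := tblock beta zeta e cb zeta0 e0.
pose K := C1t * C1s * (1 + T) + T.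
have K0 : 0 < K by rewrite addr_gt0 ?mulr_gt0// addr_gt0.
(* The exponents of 1 / m in gam' Z, in the L^1 norms of w and of d_j0 Z, in the W^(1,q) norm and in
   the measure of the time support: all are positive, so one large m serves for every bound. *)
have h1 : 0 < 1 + D / r - g by lra.
have h3 : 0 < D / p by rewrite divr_gt0.
have h4 : 0 < D / r by rewrite divr_gt0.
have h5 : 0 < - (g * s * (1 - s^-1 - st^-1) + (1 + D / r - D / q)) by lra.
have h6 : 0 < g * s by rewrite mulr_gt0.
have [m1 m1P] := powR_small K h1 e0; have [m3 m3P] := powR_small K h3 e0.
have [m4 m4P] := powR_small K h4 e0; have [m5 m5P] := powR_small K h5 e0.
have [m6 m6P] := powR_small K h6 e0.
have [m [m8 ml1 ml3 ml4 [ml5 ml6]]] : exists m : R, [/\ 8 <= m, m1 <= m, m3 <= m, m4 <= m & m5 <= m /\ m6 <= m].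
  exists (Num.max 8 (Num.max m1 (Num.max m3 (Num.max m4 (Num.max m5 m6))))).
  by rewrite !le_max !lexx !orbT.
have m1' : 1 <= m by apply: le_trans m8; rewrite ler1n.
have mp : 0 < m by exact: lt_le_trans m1'.
have {}m1P := m1P m ml1 m1'; have {}m3P := m3P m ml3 m1'; have {}m4P := m4P m ml4 m1'.
have {}m5P := m5P m ml5 m1'; have {}m6P := m6P m ml6 m1'.
have [kap kapE] : exists kap : R, kap = m `^ (g * s) by exists (m `^ (g * s)).
have kap1 : 1 <= kap by rewrite kapE -(powRr0 m) ler_powR// ltW.
have kap0 : 0 < kap by exact: lt_le_trans kap1.
have kE x : kap `^ x = m `^ (g * s * x) by rewrite kapE -powRrM.
have ks : kap `^ s^-1 = m `^ g by rewrite kE -mulrA mulfV ?mulr1// gt_eqF.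
have [Z [w [V [[sZ sw sV] [La Lb] [L1Z L1th L1w] [Lq Lpq LV] Lid]]]] := block m m8.
have [gam [dgam [chi [B [N [[cg cdg cc dg dB] [g00 gT B00 BT Be] [gs c1 cs gcL] [gsup csup dg1 g1 cr] [mN tN oN]]]]]]] := tblock kap kap1.
have mpow (x y z : R) : x + y = z -> m `^ x * m `^ y = m `^ z.
  by move=> <-; rewrite powRD// (gt_eqF mp) implybT.
have IZ0 : 0 <= I (fun x => `|Z x|) by exact: cpI_ge0.
have Kts : C1t * C1s <= K.
  by rewrite /K mulrDr mulr1 -addrA lerDl addr_ge0 ?mulr_ge0 ?(ltW C1t0) ?(ltW C1s0) ?(ltW T0).
have KtsT : C1t * T * C1s <= K.
  by rewrite mulrAC /K mulrDr mulr1 -addrA addrCA lerDl addr_ge0 ?mulr_ge0 ?(ltW C1t0) ?(ltW C1s0) ?(ltW T0).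
have tZ x : 0 <= x -> x <= C1t * kap `^ s^-1 -> x * I (fun x => `|Z x|) <= e.
  move=> x0 xle; apply: le_trans m1P.
  apply: (@le_trans _ _ (C1t * m `^ g * (C1s * m `^ (-1 - D / r)))); first by rewrite -ks ler_pM.
  rewrite mulrACA (mpow _ _ (- (1 + D / r - g))); last by ring.
  by rewrite ler_wpM2r ?powR_ge0.
have TT : T `^ st^-1 <= 1 + T.
  have it : 0 <= st^-1 <= 1 by rewrite invr_ge0 (ltW st0) invf_le1.
  have [T1|/ltW T1] := leP 1 T.
    by apply: (@le_trans _ _ T); [apply: ler1_powR => //; case/andP: it|rewrite lerDr].
  apply: (@le_trans _ _ 1); last by rewrite lerDl ltW.
  have := ler_powRl (_ : 0 <= st^-1) (ltW T0) T1; rewrite powR1; apply.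
  by case/andP: it.
have key x : x `^ q^-1 <= C1s * m `^ (1 + D / r - D / q) ->
    (\int[tmf T]_t `|chi t| `^ st) `^ st^-1 * x `^ q^-1 <= e.
  move=> xq; apply: le_trans m5P.
  have Tk : 0 <= T / kap by rewrite divr_ge0 ?ltW.
  have Ck : 0 <= C1t * kap `^ (1 - s^-1) by rewrite mulr_ge0 ?powR_ge0 ?ltW.
  apply: (@le_trans _ _ (C1t * kap `^ (1 - s^-1) * (T / kap) `^ st^-1 * (C1s * m `^ (1 + D / r - D / q)))).
    apply: ler_pM; rewrite ?powR_ge0//.
    have -> : C1t * kap `^ (1 - s^-1) * (T / kap) `^ st^-1 = ((C1t * kap `^ (1 - s^-1)) `^ st * (T / kap)) `^ st^-1.
      by rewrite [RHS]powRM ?powR_ge0// -powRrM mulfV ?gt_eqF// powRr1.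
    apply: ler_powRl; [by rewrite invr_ge0 ltW|by apply: Rintegral_ge0 => t _; exact: powR_ge0|exact: cr].
  rewrite powRM ?invr_ge0 ?(ltW T0) ?(ltW kap0)//.
  have -> : (kap^-1) `^ st^-1 = kap `^ (- st^-1) by rewrite -[kap^-1]powR_inv1 ?(ltW kap0)// -powRrM mulN1r.
  have -> : C1t * kap `^ (1 - s^-1) * (T `^ st^-1 * kap `^ (- st^-1)) * (C1s * m `^ (1 + D / r - D / q)) =
     C1t * C1s * T `^ st^-1 * (kap `^ (1 - s^-1) * kap `^ (- st^-1) * m `^ (1 + D / r - D / q)) by ring.
  rewrite !kE (mpow _ _ _ erefl) (mpow _ _ (- - (g * s * (1 - s^-1 - st^-1) + (1 + D / r - D / q)))); last by ring.
  rewrite ler_wpM2r ?powR_ge0// /K (@le_trans _ _ (C1t * C1s * (1 + T)))//.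
    by rewrite ler_wpM2l// mulr_ge0 ?ltW.
  by rewrite lerDl ltW.
have roots (f : E -> R) : I (fun x => `|f x| `^ q) <= (C1s * m `^ (1 + D / r - D / q)) `^ q ->
    (I (fun x => `|f x| `^ q)) `^ q^-1 <= C1s * m `^ (1 + D / r - D / q).
  move=> h; apply: powR_root => //; first by rewrite mulr_ge0 ?powR_ge0 ?ltW.
  by apply: cpI_ge0 => x; exact: powR_ge0.
have kle1 x : x <= 1 -> kap `^ x / kap <= 1.
  by move=> x1; rewrite ler_pdivrMr// mul1r -[leRHS]powRr1 ?(ltW kap0)// ler_powR.
have is0 : 0 < s^-1 <= 1 by rewrite invr_gt0 s0 invf_le1.
exists gam, dgam, chi, B, N, Z, w, V; move=> size.
have sizeE : A * Bf = size by [].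
rewrite sizeE in XY.
split; [by []|by []| | |].
- split=> //; apply: (le_trans tN); rewrite lee_fin.
  apply: le_trans m6P; rewrite powRN -kapE ler_wpM2r ?invr_ge0 ?(ltW kap0)//.
  by rewrite /K lerDr !mulr_ge0 ?(ltW C1t0) ?(ltW C1s0).
- have wr b : (I (fun x => `|w b x| `^ r)) `^ r^-1 <= (C2 * Y) `^ r^-1.
    apply: ler_powRl; [by rewrite invr_ge0 ltW|by apply: cpI_ge0 => x; exact: powR_ge0|exact: Lb].
  have Cfin x b : 0 <= x -> x <= Ct / zeta * X `^ (1 - s^-1) -> x * (I (fun x => `|w b x| `^ r)) `^ r^-1 <= C * (size + e) / a.
    move=> x0 xle; apply: (@le_trans _ _ (Ct / zeta * X `^ (1 - s^-1) * (C2 * Y) `^ r^-1)).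
      by rewrite ler_pM ?powR_ge0.
    have -> : Ct / zeta * X `^ (1 - s^-1) * (C2 * Y) `^ r^-1 = Ct * C2 * (X * Y) / a.
      have e1 : X `^ s^-1 * X `^ (1 - s^-1) = X.
        rewrite -powRD; last by rewrite (gt_eqF X0) implybT.
        by rewrite addrCA subrr addr0 powRr1// ltW.
      have e2 : (C2 * Y) `^ p^-1 * (C2 * Y) `^ r^-1 = C2 * Y.
        rewrite -powRD; last by rewrite (gt_eqF CY0) implybT.
        by rewrite pr powRr1// ltW.
      rewrite /zeta invf_div.
      transitivity (Ct / a * (X `^ s^-1 * X `^ (1 - s^-1)) * ((C2 * Y) `^ p^-1 * (C2 * Y) `^ r^-1)); first by ring.
      by rewrite e1 e2; ring.
    rewrite ler_wpM2r ?invr_ge0 ?(ltW a0)//; apply: ler_pM => //.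
    + by rewrite mulr_ge0 ?ltW.
    + by rewrite mulr_ge0 ?ltW.
    + by rewrite /C mulrC lerDl mulr_ge0 ?ltW.
  split.
  + apply: (@le_trans _ _ (zeta * X `^ s^-1 * (C2 * Y) `^ p^-1)); last first.
      by rewrite /zeta -mulrA divfK// gt_eqF.
    apply: ler_pM; rewrite ?powR_ge0//.
      have -> : zeta * X `^ s^-1 = (zeta `^ s * X) `^ s^-1.
        by rewrite powRM ?powR_ge0 ?(ltW X0)// -powRrM mulfV ?gt_eqF// powRr1// ltW.
      apply: ler_powRl; [by rewrite invr_ge0 ltW|by apply: Rintegral_ge0 => t _; exact: powR_ge0|].
      by apply: (le_trans gs); rewrite ler_wpM2l ?powR_ge0.
    apply: ler_powRl; [by rewrite invr_ge0 ltW|by apply: cpI_ge0 => x; exact: powR_ge0|exact: La].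
  + move=> b sE t; apply: Cfin => //; apply: (le_trans (c1 sE t)).
    by rewrite sE invr1 subrr powRr0 mulr1.
  + move=> b sn; apply: Cfin; first exact: powR_ge0.
    have s11 : 0 < s - 1 by rewrite subr_gt0 lt_neqAle eq_sym sn.
    have sE : 1 - s^-1 = (s / (s - 1))^-1 by field; rewrite !gt_eqF.
    have s'0 : 0 < s / (s - 1) by rewrite divr_gt0.
    have cz : 0 <= Ct / zeta by rewrite divr_ge0 ?ltW.
    have -> : Ct / zeta * X `^ (1 - s^-1) = ((Ct / zeta) `^ (s / (s - 1)) * X) `^ (1 - s^-1).
      by rewrite powRM ?powR_ge0 ?(ltW X0)// sE -(powRrM (Ct / zeta)) mulfV ?gt_eqF// powRr1.
    apply: ler_powRl; [by rewrite sE invr_ge0 ltW|by apply: Rintegral_ge0 => t _; exact: powR_ge0|].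
    by apply: (le_trans (cs sn)); rewrite ler_wpM2l ?powR_ge0.
  + by move=> b; apply/key/roots/Lq.
  + by move=> b l; apply/key/roots/Lpq.
- split.
  + split; first by apply: tZ dg1; apply: Rintegral_ge0.
    by move=> t; exact: tZ.
  + move=> b; apply: le_trans m3P.
    have c1L : \int[tmf T]_t `|chi t| <= C1t * T.
      have := cr 1 (lexx 1); rewrite powRr1 ?mulr_ge0 ?powR_ge0 ?(ltW C1t0)//.
      under eq_Rintegral do rewrite powRr1//.
      move=> /le_trans; apply.
      rewrite [leLHS](_ : _ = C1t * T * (kap `^ (1 - s^-1) / kap)); last by ring.
      by rewrite -[leRHS]mulr1 ler_wpM2l ?mulr_ge0 ?(ltW C1t0) ?(ltW T0) ?kle1// gerBl; case/andP: is0 => /ltW.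
    apply: (@le_trans _ _ (C1t * T * (C1s * m `^ (- (D / p))))).
      by apply: ler_pM => //; [exact: Rintegral_ge0|exact: cpI_ge0].
    by rewrite mulrA ler_wpM2r ?powR_ge0.
  + apply: le_trans m4P.
    apply: (@le_trans _ _ (C1t * (C1s * m `^ (- (D / r))))).
      apply: ler_pM => //; [exact: Rintegral_ge0|exact: cpI_ge0|].
      apply: (le_trans g1); rewrite -mulrA -[leRHS]mulr1 ler_wpM2l ?(ltW C1t0)// kle1//.
      by case/andP: is0.
    by rewrite mulrA ler_wpM2r ?powR_ge0.
  + move=> j; apply: (@le_trans _ _ (A * del)); last exact: AdelE.
    by apply: ler_pM => //; [exact: Rintegral_ge0|exact: cpI_ge0].
  + move=> b.
    have cth : cp (pd j0 Z) by exact/sm_cp/sm_pd.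
    have cw : cp (w b) by exact/sm_cp.
    have cthp := cp_powR p0 cth; have cwr := cp_powR r0 cw.
    have thw : I (fun x => `|pd j0 Z x * w b x|) <= 2 * C2 * Y.
      apply: (@le_trans _ _ (I (fun x => `|pd j0 Z x| `^ p + `|w b x| `^ r))).
        apply: cp_le => [||x]; [exact/cp_norm/cpM|exact: cpD|by rewrite normrM; exact: young].
      rewrite cpID//; apply: (le_trans (lerD La (Lb b))).
      by rewrite -/Bf -/Y -mulr2n -mulrA mulr_natl.
    apply: (@le_trans _ _ (A * (2 * C2 * Y))).
      by apply: ler_pM => //; [exact: Rintegral_ge0|exact: cpI_ge0].
    apply: (@le_trans _ _ (2 * C2 * (X * Y))).
      by rewrite mulrCA ler_wpM2l ?mulr_ge0 ?(ltW C20)// ler_wpM2r ?(ltW Y0).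
    apply: ler_pM => //; [by rewrite mulr_ge0 ?ltW|by rewrite mulr_ge0 ?ltW|].
    by rewrite /C lerDr mulr_ge0 ?ltW.
Qed.

End perturbation.


Fixpoint every (A : Type) (P : A -> Prop) (s : seq A) : Prop :=
  if s is x :: s' then P x /\ every P s' else True.

Section every.
Variables (A A' : Type).
Implicit Types (P : A -> Prop) (s : seq A).

Lemma every_cat P s1 s2 : every P (s1 ++ s2) <-> every P s1 /\ every P s2.
Proof. by elim: s1 => [|x s1 IH] /=; [split=> [|[]//]|rewrite IH; tauto]. Qed.

Lemma every_map (f : A' -> A) P (s : seq A') : every P [seq f x | x <- s] <-> every (fun x => P (f x)) s.
Proof. by elim: s => [|x s IH] //=; rewrite IH. Qed.

Lemma every_nth P x0 s : every P s -> forall k, (k < size s)%N -> P (nth x0 s k).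
Proof. by elim: s => [|x s IH] //= [Px Ps] [|k] //=; rewrite ltnS; exact: IH. Qed.

Lemma everyW P (P' : A -> Prop) s : (forall x, P x -> P' x) -> every P s -> every P' s.
Proof. by move=> PP; elim: s => [|x s IH] //= [/PP ? /IH]. Qed.

Lemma every_all P s : (forall x, P x) -> every P s.
Proof. by move=> h; elim: s => [|x s IH] //=. Qed.

End every.

(** * The weak form of the relaxed equation *)

Section weak_identity.
Variables (R : realType) (T : R) (d : nat).
Hypothesis T0 : 0 < T.
Local Notation E := 'rV[R]_d.
Local Notation mu := (torus_measure R d).
Local Notation I f := (\int[mu]_x f x).

(* (al, f) encodes the function al(t) f(x), and ((al, f), i) the vector field al(t) f(x) e_i. *)
Definition scal := ((R -> R) * (E -> R))%type.
Definition vect := (scal * 'I_d)%type.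
Definition ok (z : scal) := continuous z.1 /\ sm z.2.
Definition tprod (z : scal) (v : vect) : vect :=
  ((fun t => z.1 t * v.1.1 t, fun x => z.2 x * v.1.2 x), v.2).

Lemma ok_tprod z v : ok z -> ok v.1 -> ok (tprod z v).1.
Proof. by move=> [c1 m1] [c2 m2]; split; [exact: contM|exact: smM]. Qed.

(* psi is a test function, seen as a curve of functions of x, and dpsi its time derivative. *)
Record test_curve (psi dpsi : R -> E -> R) : Prop := TestCurve {
  tc_sm : forall t, sm (psi t);
  tc_cp : forall t, cp (dpsi t);
  tc_end : forall x, psi T x = 0;
  tc_der : forall f, sm f -> forall t : R,
    is_derive t (1 : R) (fun t => I (fun x => f x * psi t x)) (I (fun x => f x * dpsi t x));
  tc_cont : forall f, sm f -> continuous (fun t : R => I (fun x => f x * dpsi t x));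
  tc_bound : exists2 M : R, 0 < M & forall t j x, 0 <= t <= T -> `|pd j (psi t) x| <= M }.

Section curve.
Variables (psi dpsi : R -> E -> R).
Hypothesis tc : test_curve psi dpsi.

(** [T1] is the contribution of a density tensor, paired with the time derivative of psi; [T2] is
    that of a vector tensor, paired with the gradient of psi. *)
Definition T1 (z : scal) : R := \int[tmf T]_t (z.1 t * I (fun x => z.2 x * dpsi t x)).
Definition T2 (v : vect) : R := \int[tmf T]_t (v.1.1 t * I (fun x => v.1.2 x * pd v.2 (psi t) x)).

Lemma tc_ibp f j t : sm f -> I (fun x => f x * pd j (psi t) x) = - I (fun x => pd j f x * psi t x).
Proof. by move=> sf; apply: torus_ibp => //; exact: (tc_sm tc). Qed.

Lemma tc_cont0 f : sm f -> continuous (fun t : R => I (fun x => f x * psi t x)).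
Proof. by move=> sf; apply: cont_of_derive => t; exact: (tc_der tc sf). Qed.

Lemma tc_cont2 f j : sm f -> continuous (fun t : R => I (fun x => f x * pd j (psi t) x)).
Proof.
move=> sf; under eq_fun do rewrite tc_ibp//.
move=> t; apply: cvgN; exact: (tc_cont0 (sm_pd j sf)).
Qed.

Lemma T2_cont v : ok v.1 -> continuous (fun t : R => v.1.1 t * I (fun x => v.1.2 x * pd v.2 (psi t) x)).
Proof. by move=> [cv sv]; apply: contM => //; exact: tc_cont2. Qed.

(** An increment g d_j W of the density is traded for the error g' W e_j: integrate by parts in x
    and in t. The boundary terms vanish because g 0 = 0 and psi vanishes at T. *)
Lemma T1_pd (g dg : R -> R) W j : sm W -> continuous dg -> g 0 = 0 ->
  (forall t : R, is_derive t (1 : R) g (dg t)) -> T1 (g, pd j W) = T2 ((dg, W), j).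
Proof.
move=> sW cdg g00 dgP; rewrite /T1 /T2 /=.
have cg := cont_of_derive dgP.
pose A (t : R) := I (fun x => pd j W x * psi t x).
have dA (t : R) : is_derive t (1 : R) A (I (fun x => pd j W x * dpsi t x)).
  exact: (tc_der tc (sm_pd j sW)).
have cdA := tc_cont tc (sm_pd j sW); have cA : continuous A := tc_cont0 (sm_pd j sW).
have dgA (t : R) : is_derive t (1 : R) (fun t => g t * A t) (g t * I (fun x => pd j W x * dpsi t x) + dg t * A t).
  have := is_deriveM (dgP t) (dA t); move=> h; apply: (is_derive_eq h).
  by rewrite /GRing.scale/= (mulrC (A t)).
have c1 : continuous (fun t : R => g t * I (fun x => pd j W x * dpsi t x)) by exact: contM.
have c2 : continuous (fun t : R => dg t * A t) by exact: contM.
have := FTC_tmf T0 (contD c1 c2) dgA.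
rewrite g00 mul0r subr0 (_ : A T = 0); last first.
  by rewrite /A -[RHS](torus_cst d); apply: eq_Rintegral => x _; rewrite (tc_end tc) mulr0.
rewrite mulr0 (tmfD T c1 c2) => /eqP; rewrite addr_eq0 => /eqP ->.
rewrite -mulN1r -tmfZ//; apply: eq_Rintegral => t _.
by rewrite tc_ibp// mulrN mulN1r.
Qed.

Lemma T2_le v : ok v.1 -> forall M, (forall t j x, 0 <= t <= T -> `|pd j (psi t) x| <= M) ->
  `|T2 v| <= M * tsize T v.
Proof.
move=> okv M hM; have [cv sv] := okv.
apply: (le_trans (tmf_norm T (T2_cont okv))).
have cF : cp v.1.2 by exact: sm_cp.
have cn := cont_norm cv.
apply: (@le_trans _ _ (\int[tmf T]_t (M * I (fun x => `|v.1.2 x|) * `|v.1.1 t|))); last first.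
  by rewrite tmfZ// /tsize -mulrA [X in M * X]mulrC.
apply: tmf_le => //.
- by apply: cont_norm; exact: T2_cont.
- by apply: contM => //; exact: cst_continuous.
move=> t tT; rewrite normrM mulrC ler_wpM2r//.
have cP : cp (pd v.2 (psi t)) by apply: sm_cp; apply: sm_pd; exact: (tc_sm tc).
apply: (le_trans (cp_abs (cpM cF cP))).
rewrite (_ : (fun x => `|v.1.2 x * pd v.2 (psi t) x|) = (fun x => `|pd v.2 (psi t) x * v.1.2 x|)); last first.
  by apply/funext => x; rewrite mulrC.
by apply: cp_le_bounded => // x; exact: hM.
Qed.

End curve.

(* The weak form of d_t rho + div (rho u) = div R with rho(0) = rho0, where rho, u and R are the sums of the lists. *)
Definition weak_id (rho0 : E -> R) (lr : seq scal) (lu lR : seq vect) : Prop :=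
  forall psi dpsi, test_curve psi dpsi ->
  \sum_(z <- lr) T1 dpsi z + \sum_(z <- lr) \sum_(v <- lu) T2 psi (tprod z v) +
    I (fun x => rho0 x * psi 0 x) = \sum_(v <- lR) T2 psi v.

Section step.
Variables (rho0 : E -> R) (lr : seq scal) (lu lR : seq vect) (beta : R -> R) (F : E -> R)
  (i j0 : 'I_d) (gam dgam chi B : R -> R) (Z : E -> R) (w : bool -> E -> R) (V : 'I_d -> E -> R).
Hypotheses (okr : every ok lr) (oku : every (fun v => ok v.1) lu)
  (cb : continuous beta) (sF : sm F) (cg : continuous gam) (cdg : continuous dgam)
  (cc : continuous chi) (sZ : sm Z) (sw : forall b, sm (w b)) (sV : forall j, sm (V j))
  (g00 : gam 0 = 0) (B0 : B 0 = 0)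
  (dgP : forall t : R, is_derive t (1 : R) gam (dgam t))
  (dBP : forall t : R, is_derive t (1 : R) B (beta t + gam t * chi t))
  (wid : forall psi, sm psi ->
        I (fun x => pd j0 Z x * (w true x * pd i psi x + w false x * pd j0 psi x)) =
          I (fun x => F x * pd i psi x) + \sum_j I (fun x => V j x * pd j psi x)).

Definition dir (b : bool) := if b then i else j0.
Definition new_theta : scal := (gam, pd j0 Z).
Definition new_corr : scal := (B, pd i (fun x => - F x)).
Definition new_flow (b : bool) : vect := ((chi, w b), dir b).
Definition next_r : seq scal := new_theta :: new_corr :: lr.
Definition next_u : seq vect := new_flow true :: new_flow false :: lu.
(** The product of the new density profile with the new flow is absent: together with the correction
    it cancels the removed term, up to the fields V. All products with older terms and all products
    with the correction are counted as errors. *)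
Definition next_R : seq vect :=
  lR ++ ((dgam, Z), j0) :: [seq ((fun t => gam t * chi t, V j), j) | j <- index_enum 'I_d] ++
  [seq tprod z (new_flow true) | z <- lr] ++ [seq tprod z (new_flow false) | z <- lr] ++
  [seq tprod new_theta v | v <- lu] ++ [seq tprod new_corr v | v <- next_u].

Lemma ok_theta : ok new_theta. Proof. by split => //; exact: sm_pd. Qed.
Lemma ok_flow b : ok (new_flow b).1.
Proof. by split; [exact: cc|exact: sw]. Qed.

(** Bookkeeping only: [t1] and [t2] are arbitrary, and [a1] stands for the contribution of gam chi
    F, which cancels between the correction and the new product. *)
Lemma step_sum (t1 : scal -> R) (t2 : vect -> R) (c a1 : R) :
  t1 new_theta = t2 ((dgam, Z), j0) -> t1 new_corr = - t2 ((beta, F), i) - a1 ->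
  t2 (tprod new_theta (new_flow true)) + t2 (tprod new_theta (new_flow false)) =
    a1 + \sum_(j <- index_enum 'I_d) t2 ((fun t => gam t * chi t, V j), j) ->
  \sum_(z <- lr) t1 z + \sum_(z <- lr) \sum_(v <- lu) t2 (tprod z v) + c =
    \sum_(v <- ((beta, F), i) :: lR) t2 v ->
  \sum_(z <- next_r) t1 z + \sum_(z <- next_r) \sum_(v <- next_u) t2 (tprod z v) + c =
    \sum_(v <- next_R) t2 v.
Proof.
move=> E1 E2 E3; rewrite /next_r /next_u /next_R big_cons => W.
rewrite big_cat/= !big_cons !big_cat/= !big_map !big_cons !big_map E1 E2.
have -> : \sum_(z <- lr) \sum_(v <- [:: new_flow true, new_flow false & lu]) t2 (tprod z v) =
   \sum_(z <- lr) t2 (tprod z (new_flow true)) + \sum_(z <- lr) t2 (tprod z (new_flow false)) +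
   \sum_(z <- lr) \sum_(v <- lu) t2 (tprod z v).
  by rewrite -!big_split/=; apply: eq_bigr => z _; rewrite !big_cons addrA.
have comb (x1 x2 x3 x4 x5 x6 x7 x8 x9 y1 y2 y3 y4 y5 y6 : R) :
  x1 + x2 = a1 + x3 -> x4 + x5 + c = x6 + x7 ->
  x8 + (- x6 - a1 + x4) + ((x1 + (x2 + y1)) + ((y2 + (y3 + y4)) + (y5 + y6 + x5))) + c =
  x7 + (x8 + (x3 + (y5 + (y6 + (y1 + (y2 + (y3 + y4))))))) by lra.
exact: comb E3 W.
Qed.


Lemma weak_id_step : weak_id rho0 lr lu (((beta, F), i) :: lR) -> weak_id rho0 next_r next_u next_R.
Proof.
move=> W psi dpsi tc; have {W} := W psi dpsi tc.
have cgc : continuous (fun t : R => gam t * chi t) by exact: contM.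
have cbg : continuous (fun t : R => beta t + gam t * chi t) by exact: contD.
have E1 : T1 dpsi new_theta = T2 psi ((dgam, Z), j0) by exact: (T1_pd tc).
have E2 : T1 dpsi new_corr = - T2 psi ((beta, F), i) - T2 psi ((fun t => gam t * chi t, F), i).
  rewrite /new_corr (T1_pd tc i (smN sF) cbg B0 dBP) /T2 /=.
  have ok1 := T2_cont tc (v := ((beta, F), i)) (conj cb sF).
  have ok2 := T2_cont tc (v := ((fun t => gam t * chi t, F), i)) (conj cgc sF).
  rewrite -opprD -(tmfD T ok1 ok2)/= -mulN1r -tmfZ; last by apply: contD.
  apply: eq_Rintegral => t _; rewrite -mulrDl mulN1r -mulrN; congr (_ * _).
  rewrite -mulN1r -cpIZ; last by apply: cpM; apply: sm_cp => //; apply: sm_pd; exact: (tc_sm tc).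
  by apply: eq_Rintegral => x _; rewrite mulN1r mulNr.
have E3 : T2 psi (tprod new_theta (new_flow true)) + T2 psi (tprod new_theta (new_flow false)) =
    T2 psi ((fun t => gam t * chi t, F), i) + \sum_(j <- index_enum 'I_d) T2 psi ((fun t => gam t * chi t, V j), j).
  have okt b : ok (tprod new_theta (new_flow b)).1 by apply: ok_tprod; [exact: ok_theta|exact: ok_flow].
  have okF := T2_cont tc (v := ((fun t => gam t * chi t, F), i)) (conj cgc sF).
  have okV j := T2_cont tc (v := ((fun t => gam t * chi t, V j), j)) (conj cgc (sV j)).
  rewrite /T2 -(tmfD T (T2_cont tc (okt true)) (T2_cont tc (okt false)))/=.
  have -> : \sum_(j <- index_enum 'I_d) \int[tmf T]_t (gam t * chi t * I (fun x => V j x * pd j (psi t) x)) =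
      \int[tmf T]_t \sum_(j <- index_enum 'I_d) (gam t * chi t * I (fun x => V j x * pd j (psi t) x)).
    elim: (index_enum _) => [|j s IH].
      by rewrite big_nil -[LHS](mul0r T) -(tmf_cst T0 0); apply: eq_Rintegral => t _; rewrite big_nil.
    rewrite big_cons IH -(tmfD T (okV j)); last exact: cont_bigsum.
    by apply: eq_Rintegral => t _; rewrite big_cons.
  rewrite -(tmfD T okF); last exact: cont_bigsum.
  apply: eq_Rintegral => t _ /=; rewrite -mulr_sumr -!mulrDr; congr (_ * _).
  have smp := tc_sm tc t; rewrite -(wid smp).
  have cpw b : cp (fun x => pd j0 Z x * w b x * pd (dir b) (psi t) x).
    by apply: cpM; [apply: cpM; apply: sm_cp => //; exact: sm_pd|apply: sm_cp; exact: sm_pd].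
  rewrite -(cpID (cpw true) (cpw false)); apply: eq_Rintegral => x _.
  by rewrite /= mulrDr !mulrA.
exact: step_sum E1 E2 E3.
Qed.

End step.

End weak_identity.


Section convex_integration_step.
Variables (R : realType) (T : R) (d : nat) (p q r s st g : R).
Local Notation E := 'rV[R]_d.
Local Notation mu := (torus_measure R d).
Local Notation I f := (\int[mu]_x f x).
Local Notation D := (d.-1%:R : R).
Hypotheses (T0 : 0 < T) (d2 : (1 < d)%N) (p1 : 1 < p) (q1 : 1 <= q) (r1 : 1 < r)
  (pr : p^-1 + r^-1 = 1) (s1 : 1 <= s) (st1 : 1 <= st)
  (g0 : 0 < g) (ge1 : g < 1 + D / r)
  (ge2 : g * s * (1 - s^-1 - st^-1) + (1 + D / r - D / q) < 0).
Local Notation scal := (scal R d).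
Local Notation vect := (vect R d).
Local Notation tsize := (@tsize R T d).

Lemma tsize_ge0 v : 0 <= tsize v.
Proof. by rewrite mulr_ge0//; [apply: Rintegral_ge0|exact: cpI_ge0]. Qed.

Lemma tsize_tprod (z : scal) (v : vect) (A B : R) : ok z -> ok v.1 ->
  (forall t, 0 <= t <= T -> `|z.1 t| <= A) -> (forall x, `|z.2 x| <= B) ->
  tsize (tprod z v) <= A * B * tsize v.
Proof.
move=> [cz sz] [cv sv] zA zB.
have A0 : 0 <= A by apply: le_trans (zA 0 _); rewrite ?lexx ?(ltW T0).
have B0 : 0 <= B by exact: le_trans (zB 0).
rewrite /tsize mulrACA; apply: ler_pM.
- exact: Rintegral_ge0.
- exact: cpI_ge0.
- rewrite -tmfZ; last exact: cont_norm.
  apply: tmf_le => // [||t tT].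
  + by apply: cont_norm; exact: contM.
  + by apply: contM; [exact: cst_continuous|exact: cont_norm].
  + by rewrite normrM ler_wpM2r// zA.
- by apply: cp_le_bounded => //; exact: sm_cp.
Qed.

(** Lets [tsize_tprod] put the sup bound on either factor of a product. *)
Lemma tsize_tprodC (z : scal) (v : vect) : tsize (tprod z v) = tsize (tprod v.1 (z, v.2)).
Proof.
rewrite /tsize /=; congr (_ * _); apply: eq_Rintegral => x _; by rewrite mulrC.
Qed.

Definition bounded_by (L : R) (z : scal) :=
  (forall t, 0 <= t <= T -> `|z.1 t| <= L) /\ forall x, `|z.2 x| <= L.

Lemma ok_bounded z : ok z -> exists2 L : R, 1 <= L & bounded_by L z.
Proof.
move=> [cz sz]; have [M M1 zM] := continuous_bounded T0 cz; have [K K0 zK] := sm_bounded sz.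
exists (M + K); first by rewrite (le_trans M1)// lerDl ltW.
split => [t /zM h|x]; first by rewrite (le_trans h)// lerDl ltW.
by rewrite (le_trans (zK x))// lerDr (le_trans _ M1).
Qed.

Lemma bounded_byW L L' z : L <= L' -> bounded_by L z -> bounded_by L' z.
Proof. by move=> LL [h1 h2]; split => [t /h1|x]; [|have := h2 x] => h; exact: le_trans LL. Qed.

Lemma every_bounded (ss : seq scal) : every (@ok R d) ss -> exists2 L : R, 1 <= L & every (bounded_by L) ss.
Proof.
elim: ss => [_|z ss IH] /=; first by exists 1.
move=> [/ok_bounded[L L1 zL] /IH[L' L1' sL']]; exists (Num.max L L').
  by rewrite le_max L1.
split; first by apply: bounded_byW zL; rewrite le_max lexx.
by apply: everyW sL' => z'; apply: bounded_byW; rewrite le_max lexx orbT.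
Qed.

Lemma tsize_bounded L v : ok v.1 -> bounded_by L v.1 -> 0 <= L -> tsize v <= T * L ^+ 2.
Proof.
move=> [cv sv] [vL1 vL2] L0; rewrite expr2 mulrA; apply: ler_pM.
- exact: Rintegral_ge0.
- exact: cpI_ge0.
- rewrite mulrC -(tmf_cst T0); apply: tmf_le => //; [exact: cont_norm|exact: cst_continuous].
- rewrite -[leRHS](torus_cst d); apply: cp_le => //; [exact/cp_norm/sm_cp|exact: cp_cst].
Qed.

Lemma every_sum (A : Type) (ss : seq A) (P : A -> Prop) (f : A -> R) (X : R) :
  (forall z, P z -> f z <= X) -> every P ss -> \sum_(z <- ss) f z <= (size ss)%:R * X.
Proof.
move=> fX; elim: ss => [_|z ss IH [Pz /IH h]] /=; first by rewrite big_nil mul0r.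
by rewrite big_cons -natr1 mulrDl mul1r addrC lerD// fX.
Qed.

Lemma every_and (A : Type) (P P' : A -> Prop) (ss : seq A) : every P ss -> every P' ss -> every (fun z => P z /\ P' z) ss.
Proof. by elim: ss => [|z ss IH] //= [? /IH h] [? /h]. Qed.

(* The density increment is gam theta + B h, the velocity increment the sum over b of chi w_b e_(dir b). *)
Record stp := Stp { s_gam : R -> R; s_theta : E -> R; s_B : R -> R; s_h : E -> R;
  s_chi : R -> R; s_w : bool -> E -> R; s_dir : bool -> 'I_d; s_N : set R; s_err : seq vect }.

Definition s_rho1 x : scal := (s_gam x, s_theta x).
Definition s_rho2 x : scal := (s_B x, s_h x).
Definition s_u x b : vect := ((s_chi x, s_w x b), s_dir x b).

(** [gs_size] gives the number of new errors before e is chosen, which the scheduling of the queue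
    needs; [gs_weak] controls the new density profile at every time through its potential; [gs_prod]
    makes the limit of the flux possible. *)
Record good_step (C a e : R) (lr : seq scal) (lu : seq vect) (v0 : vect) (x : stp) : Prop := GoodStep {
  gs_ok1 : ok (s_rho1 x); gs_ok2 : ok (s_rho2 x); gs_oku : forall b, ok (s_u x b).1;
  gs_okerr : every (fun v => ok v.1) (s_err x);
  gs_gam0 : s_gam x 0 = 0; gs_gamT : s_gam x T = 0; gs_B0 : s_B x 0 = 0; gs_BT : s_B x T = 0;
  gs_supp : measurable (s_N x); gs_suppe : (tmf T (s_N x) <= e%:E)%E;
  gs_out : forall t, ~ s_N x t -> s_gam x t = 0 /\ s_chi x t = 0;
  gs_theta : (\int[tmf T]_t `|s_gam x t| `^ s) `^ s^-1 * (I (fun y => `|s_theta x y| `^ p)) `^ p^-1 <= a;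
  gs_L1 : (\int[tmf T]_t `|s_gam x t|) * I (fun y => `|s_theta x y|) <= e;
  gs_corr : forall t y, 0 <= t <= T -> `|s_B x t * s_h x y| <= e;
  gs_flow1 : forall b, s = 1 -> forall t, `|s_chi x t| * (I (fun y => `|s_w x b y| `^ r)) `^ r^-1 <= C * (tsize v0 + e) / a;
  gs_flow2 : forall b, s != 1 -> (\int[tmf T]_t `|s_chi x t| `^ (s / (s - 1))) `^ (1 - s^-1) *
             (I (fun y => `|s_w x b y| `^ r)) `^ r^-1 <= C * (tsize v0 + e) / a;
  gs_flowq : forall b, (\int[tmf T]_t `|s_chi x t| `^ st) `^ st^-1 * (I (fun y => `|s_w x b y| `^ q)) `^ q^-1 <= e;
  gs_pdflowq : forall b l, (\int[tmf T]_t `|s_chi x t| `^ st) `^ st^-1 * (I (fun y => `|pd l (s_w x b) y| `^ q)) `^ q^-1 <= e;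
  gs_weak : forall psi M, sm psi -> (forall j y, `|pd j psi y| <= M) ->
    forall t, `|s_gam x t * I (fun y => s_theta x y * psi y)| <= e * M;
  gs_div : forall psi, sm psi -> I (fun y => s_w x true y * pd (s_dir x true) psi y + s_w x false y * pd (s_dir x false) psi y) = 0;
  gs_size : size (s_err x) = (3 + d + 2 * size lr + 2 * size lu)%N;
  gs_err : every (fun v => tsize v <= e) (s_err x);
  gs_prod : \sum_(z <- lr) \sum_b tsize (tprod z (s_u x b)) +
            \sum_(v <- lu) (tsize (tprod (s_rho1 x) v) + tsize (tprod (s_rho2 x) v)) +
            \sum_b (tsize (tprod (s_rho1 x) (s_u x b)) + tsize (tprod (s_rho2 x) (s_u x b))) <= C * (tsize v0 + e) }.

Lemma exists_neq (i : 'I_d) : exists j : 'I_d, j != i.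
Proof.
have d0 : (0 < d)%N by exact: ltn_trans d2.
have [i0|i0] := eqVneq (i : nat) 0%N; [exists (Ordinal d2)|exists (Ordinal d0)].
  by rewrite -val_eqE /= i0.
by rewrite -val_eqE /= eq_sym.
Qed.

Lemma convex_step : exists2 C : R, 0 < C &
  forall rho0 (lr : seq scal) (lu lR : seq vect) (v0 : vect) (a e : R),
  every (@ok R d) lr -> every (fun v => ok v.1) lu -> ok v0.1 -> 0 < a -> 0 < e ->
  weak_id T rho0 lr lu (v0 :: lR) ->
  exists x, good_step C a e lr lu v0 x /\
    weak_id T rho0 (s_rho1 x :: s_rho2 x :: lr) (s_u x true :: s_u x false :: lu) (lR ++ s_err x).
Proof.
have [C C0 pert] := perturbation T0 d2 p1 q1 r1 pr s1 st1 g0 ge1 ge2.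
exists (2 * C + 1); first by rewrite addr_gt0// mulr_gt0.
have CC : C <= 2 * C + 1 by lra.
have two (x y c : R) : x <= c -> y <= c -> x + y <= 2 * c by lra.
have four (x y z u c c' : R) : x <= c -> y <= c -> z <= c' -> u <= c' -> x + z + (y + u) <= 2 * c + 2 * c' by lra.
have fin (x1 x2 c z e1 y : R) : 0 <= z -> 0 <= e1 -> y * (2 * (x1 + x2) + 2) <= e1 ->
    x1 * (2 * y) + x2 * (2 * y) + (2 * (c * (z + e1)) + 2 * y) <= (2 * c + 1) * (z + e1).
  by move=> z0 e10 h; lra.
move=> rho0 lr lu lR [[beta F] i] a e okr oku [/= cb sF] a0 e0 W.
have [j0 ij0] := exists_neq i.
have sh : sm (pd i (fun x => - F x)) by apply: sm_pd; exact: smN.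
have [Lh Lh0 hL] := sm_bounded sh.
have [Lr Lr1 rL] := every_bounded okr.
have oku' : every (@ok R d) [seq v.1 | v <- lu] by rewrite every_map.
have [Lu Lu1 uL] := every_bounded oku'.
pose L := Lh + Lr + Lu.
have L1 : 1 <= L by rewrite /L; lra.
have hL' x : `|pd i (fun x => - F x) x| <= L by rewrite (le_trans (hL x))// /L; lra.
have {}rL : every (bounded_by L) lr by apply: everyW rL => z; apply: bounded_byW; rewrite /L; lra.
have {}uL : every (fun v => bounded_by L v.1) lu.
  by move: uL; rewrite every_map; apply: everyW => z; apply: bounded_byW; rewrite /L; lra.
pose n : R := (size lr + size lu)%:R.
have n0 : 0 <= n by [].
(* Old terms are bounded by L. All products except that of the new pair are at most Q e', there are
   at most 2 n + 2 of them, and e' below is so small that their sum is at most e. *)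
pose Q := (1 + T) * L ^+ 3.
have T00 : 0 < T := T0.
have L0 : 0 < L by lra.
have L2 : L <= L ^+ 2 by rewrite expr2 ler_peMl// ltW.
have L3 : L ^+ 2 <= L ^+ 3 by rewrite (exprS _ 2) ler_peMl// exprn_ge0// ltW.
have QL3 : L ^+ 3 <= Q by rewrite /Q ler_peMl ?exprn_ge0 ?(ltW L0)// lerDl ltW.
have QT : T * L ^+ 3 <= Q by rewrite /Q ler_wpM2r ?exprn_ge0 ?(ltW L0)// lerDr.
have QL2 : L ^+ 2 <= Q by exact: le_trans L3 QL3.
have QL : L <= Q by exact: le_trans L2 QL2.
have Q1 : 1 <= Q by exact: le_trans L1 QL.
have Q0 : 0 < Q by exact: lt_le_trans Q1.
pose K := Q * (2 * n + 2) + 1.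
have K1 : 1 <= K by rewrite lerDr mulr_ge0 ?(ltW Q0)// addr_ge0// mulr_ge0.
have Ke0 : 0 < K + e by rewrite addr_gt0// (lt_le_trans _ K1).
pose e' := e / (K + e).
have e'0 : 0 < e' by rewrite divr_gt0.
have e'1 : e' <= 1 by rewrite ler_pdivrMr// mul1r lerDr (le_trans _ K1).
have Qe : (Q * (2 * n + 2)) * e' <= e.
  by rewrite /e' mulrA ler_pdivrMr// mulrC ler_wpM2l ?(ltW e0)// /K -addrA lerDl addr_ge0// ltW.
have Qe1 : Q * e' <= e.
  apply: le_trans Qe; rewrite ler_wpM2r ?(ltW e'0)// ler_peMr ?(ltW Q0)//; lra.
have e'e : e' <= e by apply: le_trans Qe1; rewrite ler_peMl// ltW.
have [gam [dgam [chi [B [N [Z [w [V]]]]]]]] := pert beta F i j0 a e' cb sF ij0 a0 e'0.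
rewrite -/tsize; move=> [[cg cdg cc dg dB] [sZ sw sV wid] [[g00 gT B00 BT Be] mN tN oN]
  [Lth Lf1 Lf2 Lfq Lpfq] [[dgZ gZ] cw gth gV gthw]].
set sz := tsize (beta, F, i) in Lf1 Lf2 gthw *.
have sz0 : 0 <= sz by exact: tsize_ge0.
pose h := pd i (fun x => - F x); pose dr b := if b then i else j0.
pose flow b : vect := ((chi, w b), dr b).
pose th : scal := (gam, pd j0 Z); pose co : scal := (B, h).
have okth : ok th by split => //; exact: sm_pd.
have okco : ok co by split => //; exact: (cont_of_derive dB).
have okf b : ok (flow b).1 by split => //; exact: sw.
have cLe (x : R) : x <= sz + e' -> x <= sz + e by move=> /le_trans; apply; rewrite lerD2l.
have b1 b z : ok z /\ bounded_by L z -> tsize (tprod z (flow b)) <= Q * e'.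
  move=> [okz [zL1 zL2]]; apply: (le_trans (tsize_tprod okz (okf b) zL1 zL2)).
  rewrite -expr2; apply: ler_pM => //; [by rewrite exprn_ge0// ltW|exact: tsize_ge0|exact: cw].
have b2 v : ok v.1 /\ bounded_by L v.1 -> tsize (tprod th v) <= Q * e'.
  move=> [okz [zL1 zL2]]; rewrite tsize_tprodC; apply: (le_trans (tsize_tprod okz (okth : ok (th, v.2).1) zL1 zL2)).
  rewrite -expr2; apply: ler_pM => //; [by rewrite exprn_ge0// ltW|exact: tsize_ge0].
have b3 v : ok v.1 /\ bounded_by L v.1 -> tsize (tprod co v) <= Q * e'.
  move=> [okz zL]; apply: (le_trans (tsize_tprod okco okz Be hL')).
  rewrite -mulrA mulrC; apply: ler_pM => //; [by rewrite mulr_ge0 ?tsize_ge0// ltW|exact: ltW|].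
  apply: le_trans QT; rewrite [leRHS](_ : _ = L * (T * L ^+ 2)); last by ring.
  rewrite ler_wpM2l ?(ltW L0)//.
  by apply: tsize_bounded => //; exact: ltW.
have b4 b : tsize (tprod co (flow b)) <= Q * e'.
  apply: (le_trans (tsize_tprod okco (okf b) Be hL')).
  rewrite mulrAC mulrC; apply: ler_pM => //; [exact: ltW|by rewrite mulr_ge0 ?tsize_ge0// ltW|].
  rewrite mulrC -[leRHS]mul1r; apply: ler_pM => //; [exact: tsize_ge0|exact: ltW|].
  by apply: le_trans e'1; exact: cw.
have b5 b : tsize (tprod th (flow b)) <= C * (sz + e) by apply: (le_trans (gthw b)); rewrite ler_wpM2l ?(ltW C0)// cLe.
have okrL := every_and okr rL; have okuL := every_and oku uL.
have [er erE] : exists er, er = ((dgam, Z), j0) :: [seq ((fun t => gam t * chi t, V j), j) | j <- index_enum 'I_d] ++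
  [seq tprod z (flow true) | z <- lr] ++ [seq tprod z (flow false) | z <- lr] ++
  [seq tprod th v | v <- lu] ++ [seq tprod co v | v <- [:: flow true, flow false & lu]] by eexists.
exists (Stp gam (pd j0 Z) B h chi w dr N er).
have cgc : continuous (fun t : R => gam t * chi t) by exact: contM.
split; last first.
  have := weak_id_step T0 cb sF cg cdg cc sZ sw sV g00 B00 dg dB (fun psi sp => (wid psi sp).1) W.
  by rewrite /next_R -/th -/co -!/(flow _) erE.
have epos (x : R) : x <= e' -> x <= e by move=> /le_trans; apply.
split; simpl.
- exact: okth.
- exact: okco.
- exact: okf.
- rewrite erE /= !every_cat !every_map; split; first by split.
  split; first by apply: every_all => j; split; [exact: cgc|exact: sV].
  split; first by apply: everyW okr => z okz; apply: ok_tprod => //; exact: okf.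
  split; first by apply: everyW okr => z okz; apply: ok_tprod => //; exact: okf.
  split; first by apply: everyW oku => v okv; apply: ok_tprod.
  split; first exact: (ok_tprod okco (okf true)).
  split; first exact: (ok_tprod okco (okf false)).
  by rewrite every_map; apply: everyW oku => v okv; apply: ok_tprod.
- exact: g00.
- exact: gT.
- exact: B00.
- exact: BT.
- exact: mN.
- by apply: (le_trans tN); rewrite lee_fin.
- exact: oN.
- exact: Lth.
- exact: epos.
- move=> t y tT; rewrite normrM; apply: le_trans Qe1; rewrite mulrC; apply: ler_pM => //; last exact: Be.
  exact: le_trans (hL' y) QL.
- move=> b sE t; apply: (le_trans (Lf1 b sE t)); rewrite ler_wpM2r ?invr_ge0 ?(ltW a0)//.
  by apply: ler_pM => //; [exact: ltW|by rewrite addr_ge0// ltW|exact: cLe].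
- move=> b sE; apply: (le_trans (Lf2 b sE)); rewrite ler_wpM2r ?invr_ge0 ?(ltW a0)//.
  by apply: ler_pM => //; [exact: ltW|by rewrite addr_ge0// ltW|exact: cLe].
- by move=> b; exact/epos/Lfq.
- by move=> b l; exact/epos/Lpfq.
- move=> psi M sp Mp t; have M0 : 0 <= M by exact: le_trans (Mp i 0).
  have -> : I (fun y => pd j0 Z y * psi y) = - I (fun y => Z y * pd j0 psi y).
    by rewrite torus_ibp// opprK.
  rewrite normrM normrN; have cZ := sm_cp sZ; have cP := sm_cp (sm_pd j0 sp).
  have h1 : `|I (fun y => Z y * pd j0 psi y)| <= I (fun y => `|Z y|) * M.
    apply: (le_trans (cp_abs (cpM cZ cP))).
    rewrite (_ : (fun y => `|Z y * pd j0 psi y|) = (fun y => `|pd j0 psi y * Z y|)); last first.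
      by apply/funext => y; rewrite mulrC.
    by rewrite mulrC; apply: cp_le_bounded.
  apply: (@le_trans _ _ (`|gam t| * (I (fun y => `|Z y|) * M))); first by rewrite ler_wpM2l.
  by rewrite mulrA ler_wpM2r//; exact/epos/gZ.
- by move=> psi sp; exact: (wid psi sp).2.
- have sI : size (index_enum 'I_d) = d by rewrite [index_enum _]unlock -enumT size_enum_ord.
  rewrite erE /= !size_cat/= !size_map sI; move: (size lr) (size lu) => x y; clear; lia.
- rewrite erE /= !every_cat !every_map; split; first exact/epos.
  split; first by apply: every_all => j; exact/epos/gV.
  split; first by apply: everyW okrL => z /(b1 true) hz; exact: le_trans hz Qe1.
  split; first by apply: everyW okrL => z /(b1 false) hz; exact: le_trans hz Qe1.
  split; first by apply: everyW okuL => v /b2 hz; exact: le_trans hz Qe1.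
  split; first exact: le_trans (b4 true) Qe1.
  split; first exact: le_trans (b4 false) Qe1.
  by rewrite every_map; apply: everyW okuL => v /b3 hz; exact: le_trans hz Qe1.
- have S1 : \sum_(z <- lr) \sum_b tsize (tprod z (flow b)) <= (size lr)%:R * (2 * (Q * e')).
    apply: every_sum okrL => z hz; rewrite big_bool/=; exact: two (b1 true z hz) (b1 false z hz).
  have S2 : \sum_(v <- lu) (tsize (tprod th v) + tsize (tprod co v)) <= (size lu)%:R * (2 * (Q * e')).
    apply: every_sum okuL => z hz; exact: two (b2 z hz) (b3 z hz).
  have S3 : \sum_b (tsize (tprod th (flow b)) + tsize (tprod co (flow b))) <= 2 * (C * (sz + e)) + 2 * (Q * e').
    rewrite big_bool/=; exact: four (b5 true) (b5 false) (b4 true) (b4 false).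
  have nE : n = (size lr)%:R + (size lu)%:R by rewrite /n natrD.
  apply: (le_trans (lerD (lerD S1 S2) S3)).
  apply: fin sz0 (ltW e0) _; apply: le_trans Qe.
  by rewrite nE le_eqVlt mulrAC eqxx.
Qed.

End convex_integration_step.


(** * Test functions on space-time as curves of periodic functions *)

Section slices.
Variables (R : realType) (d : nat).
Local Notation E := 'rV[R]_d.
Local Notation e := (@basis_vec R d).
Local Notation mu := (torus_measure R d).
Local Notation I f := (\int[mu]_x f x).
Implicit Types (phi : R * E -> R).

Lemma slice_space phi t j x : derivable phi (t, x) (0, e j) ->
  is_derive x (e j) (fun x => phi (t, x)) ('D_(0, e j) phi (t, x)).
Proof.
move=> dphi.
have E1 : (fun h : R => h^-1 *: (((fun x => phi (t, x)) \o shift x) (h *: e j) - phi (t, x))) =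
          (fun h : R => h^-1 *: ((phi \o shift (t, x)) (h *: (0, e j)) - phi (t, x))).
  by apply/funext => h /=; congr (_ *: (phi _ - _)); congr (_, _); rewrite /= scaler0 add0r.
by split; [move: dphi|]; rewrite /derivable /derive E1.
Qed.

Lemma slice_time phi t x : derivable phi (t, x) (1, 0) ->
  is_derive t (1 : R) (fun t => phi (t, x)) ('D_(1, 0) phi (t, x)).
Proof.
move=> dphi.
have E1 : (fun h : R => h^-1 *: (((fun t => phi (t, x)) \o shift t) (h *: (1 : R)) - phi (t, x))) =
          (fun h : R => h^-1 *: ((phi \o shift (t, x)) (h *: (1, 0)) - phi (t, x))).
  by apply/funext => h /=; congr (_ *: (phi _ - _)); congr (_, _); rewrite /= scaler0 add0r.
by split; [move: dphi|]; rewrite /derivable /derive E1.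
Qed.

Definition zper phi := forall t, Zperiodic (fun x => phi (t, x)).

Lemma zper_derive phi v : zper phi -> zper ('D_v phi).
Proof.
move=> pphi t x k; rewrite /derive.
have -> : (fun h : R => h^-1 *: ((phi \o shift (t, x + map_mx intr k)) (h *: v) - phi (t, x + map_mx intr k))) =
         (fun h : R => h^-1 *: ((phi \o shift (t, x)) (h *: v) - phi (t, x))).
  apply/funext => h /=; rewrite pphi; congr (_ *: (_ - _)).
  have -> : h *: v + (t, x + map_mx intr k) = (h *: v.1 + t, (h *: v.2 + x) + map_mx intr k).
    by rewrite -addrA.
  by rewrite pphi.
by [].
Qed.

Lemma smooth_iter phi vs : smooth phi -> smooth (iter_derive phi vs).
Proof.
move=> sphi ws; have -> : iter_derive (iter_derive phi vs) ws = iter_derive phi (ws ++ vs).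
  by elim: ws => [|w ws IH] //=; rewrite IH.
exact: sphi.
Qed.

Lemma pd_slice phi t j : smooth phi -> pd j (fun x => phi (t, x)) = (fun x => 'D_(0, e j) phi (t, x)).
Proof.
move=> sphi; apply/funext => x; apply: pd_val; apply: slice_space.
by have [_] := sphi [::]; apply.
Qed.

Lemma sm_slice phi t : smooth phi -> zper phi -> sm (fun x => phi (t, x)).
Proof.
move=> sphi pphi; split => [|n]; first exact: pphi.
elim: n phi sphi {pphi} => [|n IH] phi sphi.
  by split => //; apply: continuous_pairl; have [] := sphi [::].
have dphi x j : derivable phi x (0, e j) by have [_] := sphi [::]; apply.
apply: (@Cn_build _ _ _ _ (fun j x => 'D_(0, e j) phi (t, x))).
- by apply: continuous_pairl; have [] := sphi [::].
- by move=> j x; exact: slice_space.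
- by move=> j; apply: (IH ('D_(0, e j) phi)); exact: (smooth_iter [:: (0, e j)] sphi).
Qed.

Lemma bounded_slab phi (a b : R) : continuous phi -> zper phi ->
  exists2 M : R, 0 < M & forall t x, a <= t <= b -> `|phi (t, x)| <= M.
Proof.
move=> cphi pphi.
have cs : continuous (fun z : R * E => phi (z.1 + a, z.2)).
  have -> : (fun z : R * E => phi (z.1 + a, z.2)) = (fun z => phi (z + (a, 0))).
    by apply/funext => -[z1 z2] /=; congr (phi (_, _)); rewrite /= addr0.
  exact: (@cont_comp _ _ R (fun z : R * E => z + (a, 0)) phi (@cont_addr R (R * E)%type (a, 0)) cphi).
have [M M0 h] := @periodic_bounded_pair R d (b - a) _ cs (fun t => pphi (t + a)).
exists M => // t x /andP[ta tb]; have := h (t - a) x; rewrite /= subrK; apply.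
by rewrite subr_ge0 ta lerB.
Qed.

Lemma is_derive_slice_integral phi f (t : R) : smooth phi -> zper phi -> sm f ->
  is_derive t (1 : R) (fun t => I (fun x => f x * phi (t, x))) (I (fun x => f x * 'D_(1, 0) phi (t, x))).
Proof.
move=> sphi pphi sf.
pose dphi := 'D_(1, 0) phi.
have sdphi : smooth dphi by exact: (smooth_iter [:: (1, 0)] sphi).
have pdphi : zper dphi by exact: zper_derive.
have [M M0 hM] := bounded_slab (t - 1) (t + 1) (sdphi [::]).1 pdphi.
have [L L0 fL] := sm_bounded sf.
pose F (h : R) x := f x * phi (h, x).
have dF (h : R) x : is_derive h (1 : R) (F ^~ x) (f x * dphi (h, x)).
  have dd : derivable phi (h, x) (1, 0) by have [_] := sphi [::]; apply.
  have := is_deriveZ (f x) (slice_time dd).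
  by congr is_derive.
have cF h : cp (F h) by apply: cpM; [exact: sm_cp|apply: sm_cp; exact: sm_slice].
have Hint h : `](t - 1 : R), (t + 1)[%classic h -> mu.-integrable setT (EFin \o F h).
  by move=> _; exact: cp_integrable.
have It : (`](t - 1 : R), (t + 1)[%classic : set R) t by rewrite /= in_itv/=; apply/andP; split; lra.
have Hder h x : `](t - 1 : R), (t + 1)[%classic h -> setT x -> derivable (F ^~ x) h 1.
  by move=> _ _; exact: ex_derive.
have iG : mu.-integrable setT (EFin \o (fun _ : E => L * M)) by apply: cp_integrable; exact: cp_cst.
have Hub (h : R) x : `](t - 1 : R), (t + 1)[%classic h -> setT x -> `|partial1of2 F h x| <= L * M.
  rewrite /= in_itv/= => /andP[h1 h2] _; rewrite partial1of2E derive_val normrM ler_pM//.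
  by apply: hM; rewrite !ltW.
have ML0 (x : E) : 0 <= L * M by rewrite mulr_ge0 ?ltW.
have D0 := @derivable_under_integral _ _ _ mu F setT measurableT t (t - 1) (t + 1) It Hint Hder _ ML0 iG Hub.
have D1 := @differentiation_under_integral _ _ _ mu F setT measurableT t (t - 1) (t + 1) It Hint Hder _ ML0 iG Hub.
split; first exact: D0.
rewrite -derive1E D1; apply: eq_Rintegral => x _.
by rewrite partial1of2E derive_val.
Qed.

Lemma test_curve_of (T : R) phi : test_function T phi ->
  test_curve T (fun t x => phi (t, x)) (fun t x => 'D_(1, 0) phi (t, x)).
Proof.
move=> [sphi pphi [T1 T1T phi0]].
have sd v : smooth ('D_v phi) by exact: (smooth_iter [:: v] sphi).
split.
- by move=> t; exact: sm_slice.
- move=> t; apply: sm_cp; apply: (@sm_slice ('D_(1, 0) phi)); [exact: sd|exact: zper_derive].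
- by move=> x; apply: phi0; exact: ltW.
- by move=> f sf t; exact: is_derive_slice_integral.
- move=> f sf; exact: (cont_of_derive (fun t => is_derive_slice_integral t (sd (1, 0)) (zper_derive (1, 0) pphi) sf)).
- have /choice[M MP] : forall j : 'I_d, exists M, 0 < M /\ forall t x, 0 <= t <= T -> `|'D_(0, e j) phi (t, x)| <= M.
    move=> j; have [M M0 h] := bounded_slab 0 T (sd (0, e j) [::]).1 (zper_derive (0, e j) pphi).
    by exists M.
  have M0 : 0 <= \sum_j M j by apply: sumr_ge0 => j _; apply: ltW; case: (MP j).
  exists (1 + \sum_j M j); first by rewrite ltr_wpDr.
  move=> t j x tT; rewrite pd_slice//; have [M0j /(_ t x tT) h] := MP j.
  apply: (le_trans h); rewrite (bigD1 j)//=.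
  have : 0 <= \sum_(k | k != j) M k by apply: sumr_ge0 => k _; apply: ltW; case: (MP k).
  by lra.
Qed.

End slices.


(** * The iteration *)

Section base.
Variables (R : realType) (T : R) (d : nat) (rhot : R * 'rV[R]_d -> R).
Local Notation E := 'rV[R]_d.
Local Notation mu := (torus_measure R d).
Local Notation I f := (\int[mu]_x f x).
Hypotheses (T0 : 0 < T) (d0 : (0 < d)%N) (srho : smooth_time_periodic T rhot)
  (mean : forall t, t \in `[0, T] -> I (fun x => rhot (t, x)) = I (fun x => rhot (0, x))).

(** The scheme needs finite sums of tensors, so rhot is interpolated in time between snapshots. The
    difference of consecutive snapshots has mean 0 because the mean of rhot is constant, hence is a
    divergence, and the time derivative of the interpolant is the initial error. *)
Lemma base_approximation (delta : R) : 0 < delta ->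
  exists (lr : seq (scal R d)) (lR : seq (vect R d)),
  [/\ every (@ok R d) lr, every (fun v => ok v.1) lR /\ (0 < size lR)%N,
      weak_id T (fun x => rhot (0, x)) lr [::] lR,
      forall (t : R) x, 0 <= t <= T -> `|\sum_(z <- lr) z.1 t * z.2 x - rhot (t, x)| <= delta &
      forall x, \sum_(z <- lr) z.1 0 * z.2 x = rhot (0, x) /\
                \sum_(z <- lr) z.1 T * z.2 x = rhot (T, x)].
Proof.
move=> dl0; have [sr perT pr] := srho.
have smr t : sm (fun x => rhot (t, x)) by exact: sm_slice.
have sdr : smooth ('D_(1, 0) rhot) by exact: (smooth_iter [:: (1, 0)] sr).
have [M0 M00 hM0] := bounded_slab 0 T (sdr [::]).1 (zper_derive (1, 0) pr).
pose M := M0 + 1; have M1 : 1 <= M by rewrite lerDr ltW.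
have hM t x : 0 <= t <= T -> `|'D_(1, 0) rhot (t, x)| <= M.
  by move=> tT; rewrite (le_trans (hM0 t x tT))// lerDl.
pose nu := (Num.truncn (2 * M * T / delta)).+1.
have nu0 : (0 < nu)%N by [].
have nuE : 2 * M * (T / nu%:R) <= delta.
  have : 2 * M * T / delta <= nu%:R by rewrite ltW// truncnS_gt.
  by rewrite ler_pdivrMr// => h; rewrite mulrA ler_pdivrMr ?ltr0n// [leRHS]mulrC.
pose rr (c : nat) (x : E) := rhot (c%:R * (T / nu%:R), x).
have srr c : sm (rr c) by exact: smr.
have mrr (c : nat) : (c <= nu)%N -> I (rr c) = I (fun x => rhot (0, x)).
  move=> cn; apply: mean; rewrite in_itv/= mulr_ge0 ?divr_ge0 ?(ltW T0)//=.
  by rewrite mulrA ler_pdivrMr ?ltr0n// mulrC ler_wpM2l ?(ltW T0)// ler_nat.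
pose df (c : nat) (x : E) := rr c.+1 x - rr c x.
have sdf c : sm (df c) by exact: smB.
have /choice[J JP] : forall c : 'I_nu, exists J : 'I_d -> E -> R,
    (forall j, sm (J j)) /\ forall x, df c x = \sum_j pd j (J j) x.
  move=> c; have [|J [sJ JE _ _]] := antidivergence (sdf c).
    by rewrite /df torusB// !mrr ?subrr// ltnW.
  by exists J.
(* With kap = 1 the windows fill the cells, and the step functions interpolate between consecutive
   snapshots. *)
pose sc (c : nat) (t : R) := bump_step (win T nu 1 c t).
pose dsc (c : nat) (t : R) := bump (win T nu 1 c t) ^+ 2 / bump2 R / (T / nu%:R / 1).
have dscP c (t : R) : is_derive t (1 : R) (sc c) (dsc c t).
  exact: (derive_affine (is_derive_bump_step ((t - c%:R * (T / nu%:R)) / (T / nu%:R / 1)))).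
have cdsc c : continuous (dsc c).
  apply: contM; last exact: cst_continuous.
  apply: contM; last exact: cst_continuous.
  exact: (cont_affine (a := c%:R * (T / nu%:R)) (l := T / nu%:R / 1) (@continuous_bump2 R)).
have csc c : continuous (sc c) by exact: (cont_of_derive (dscP c)).
have sc0 c : sc c 0 = 0.
  by rewrite /sc bump_step_le0// win_le0// mulr_ge0// divr_ge0// ltW.
pose lr : seq (scal R d) := ((fun=> 1), rr 0%N) :: [seq (sc c, df c) | c : 'I_nu <- index_enum 'I_nu].
pose lR : seq (vect R d) := [seq ((dsc c, J c j), j) | c : 'I_nu <- index_enum 'I_nu, j : 'I_d <- index_enum 'I_d].
have sumE t x : \sum_(z <- lr) z.1 t * z.2 x = rr 0%N x + \sum_(c < nu) sc c t * df c x.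
  by rewrite /lr big_cons big_map mul1r.
have rr0 x : rr 0%N x = rhot (0, x) by rewrite /rr mul0r.
(* For fixed x the interpolation error is the function [tB] with primitive t -> rhot (t, x), so its
   smallness and its vanishing at T are already known. *)
have tBE t x : rhot (t, x) - (rr 0%N x + \sum_(c < nu) sc c t * df c x) =
    tB T 1 nu (fun t => rhot (t, x)) t.
  rewrite /tB /comb rr0 opprD addrA; congr (_ - _).
  by apply: eq_bigr => c _; rewrite mulrC.
have dP x (t : R) : is_derive t (1 : R) (fun t => rhot (t, x)) ('D_(1, 0) rhot (t, x)).
  by apply: slice_time; have [_] := sr [::]; apply.
have cb x : continuous (fun t : R => 'D_(1, 0) rhot (t, x)).
  by apply: (@continuous_pairr _ _ ('D_(1, 0) rhot)); have [] := sdr [::].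
exists lr, lR; split.
- split; first by split; [exact: cst_continuous|exact: srr].
  by rewrite every_map; apply: every_all => c; split; [exact: csc|exact: sdf].
- split.
    have H (s1 : seq 'I_nu) (s2 : seq 'I_d) : every (fun v : vect R d => ok v.1) [seq ((dsc c, J c j), j) | c : 'I_nu <- s1, j : 'I_d <- s2].
      elim: s1 => [|c s1 IH] //=; rewrite every_cat; split => //.
      rewrite every_map; apply: every_all => j; split; [exact: cdsc|exact: (JP c).1].
    exact: H.
  have sI n : size (index_enum 'I_n) = n by rewrite [index_enum _]unlock -enumT size_enum_ord.
  by rewrite size_allpairs !sI muln_gt0 nu0.
- move=> psi dpsi tc.
  rewrite [X in _ + X + _]big1 ?addr0 => [|z _]; last by rewrite big_nil.
  rewrite big_cons big_map.
  have -> : T1 T dpsi ((fun=> 1), rr 0%N) = - I (fun x => rhot (0, x) * psi 0 x).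
    have sr0 : sm (fun x => rhot (0, x)) by exact: smr.
    have := FTC_tmf T0 (tc_cont tc sr0) (tc_der tc sr0).
    rewrite (_ : I (fun x => rhot (0, x) * psi T x) = 0) ?sub0r; last first.
      by rewrite -[RHS](torus_cst d); apply: eq_Rintegral => x _; rewrite (tc_end tc) mulr0.
    move=> <-; apply: eq_Rintegral => t _; rewrite mul1r /=.
    by apply: eq_Rintegral => x _; rewrite rr0.
  rewrite addrAC addNr add0r /lR big_allpairs_dep.
  apply: eq_bigr => c _; have [sJ JE] := JP c.
  transitivity (\sum_(j <- index_enum 'I_d) T1 T dpsi (sc c, pd j (J c j))); last first.
    apply: eq_bigr => j _; exact: (T1_pd T0 tc j (sJ j) (cdsc c) (sc0 c) (dscP c)).
  have ct j : continuous (fun t : R => sc c t * I (fun x => pd j (J c j) x * dpsi t x)).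
    by apply: contM; [exact: csc|apply: (tc_cont tc); exact: sm_pd].
  have cpj t j : cp (fun x => pd j (J c j) x * dpsi t x).
    by apply: cpM; [exact/sm_cp/sm_pd|exact: (tc_cp tc)].
  rewrite /T1 /=.
  transitivity (\int[tmf T]_t \sum_(j <- index_enum 'I_d) (sc c t * I (fun x => pd j (J c j) x * dpsi t x))).
    apply: eq_Rintegral => t _; rewrite -mulr_sumr -cpI_sum//; congr (_ * _).
    by apply: eq_Rintegral => x _; rewrite JE mulr_suml.
  elim: (index_enum _) => [|j s IH].
    by rewrite big_nil -[RHS](mul0r T) -(tmf_cst T0 0); apply: eq_Rintegral => t _; rewrite big_nil.
  rewrite big_cons -IH -(tmfD T (ct j)); last exact: cont_bigsum.
  by apply: eq_Rintegral => t _; rewrite big_cons.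
- move=> t x tT; rewrite sumE distrC tBE; apply: le_trans nuE.
  have [Q dQ] := primitive (cont_norm (cb x)).
  exact: (tB_le T0 M1 (fun t tT => hM t x tT) nu0 (lexx 1) (dP x) dQ tT).
- move=> x; rewrite !sumE; split.
    by rewrite big1 ?addr0// => c _; rewrite sc0 mul0r.
  apply/eqP; rewrite eq_sym -subr_eq0 tBE; apply/eqP.
  exact: (tBT T0 nu0 (lexx 1)).
Qed.

End base.


Section iteration.
Variables (R : realType) (T : R) (d : nat) (p q r s st C : R).
Local Notation E := 'rV[R]_d.
Local Notation scal := (scal R d).
Local Notation vect := (vect R d).
Local Notation stp := (stp R d).
Local Notation tsize := (@tsize R T d).
Local Notation good_step := (@good_step R T d p q r s st C).
Hypothesis step : forall (rho0 : E -> R) (lr : seq scal) (lu lR : seq vect) (v0 : vect) (a e : R),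
  every (@ok R d) lr -> every (fun v => ok v.1) lu -> ok v0.1 -> 0 < a -> 0 < e ->
  weak_id T rho0 lr lu (v0 :: lR) ->
  exists x, good_step a e lr lu v0 x /\
    weak_id T rho0 (s_rho1 x :: s_rho2 x :: lr) (s_u x true :: s_u x false :: lu) (lR ++ s_err x).
Variables (a eps : nat -> R).
Hypotheses (a0 : forall n, 0 < a n) (eps0 : forall n, 0 < eps n) (epsS : forall n, 2 * eps n.+1 <= eps n).

(* Step n removes the error v n, the head of lR n. *)
Record scheme (rho0 : E -> R) (lr : nat -> seq scal) (lu lR : nat -> seq vect)
    (v : nat -> vect) (e : nat -> R) (X : nat -> stp) : Prop := Scheme {
  sc_lu0 : lu 0%N = [::];
  sc_lr : forall n, lr n.+1 = s_rho1 (X n) :: s_rho2 (X n) :: lr n;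
  sc_lu : forall n, lu n.+1 = s_u (X n) true :: s_u (X n) false :: lu n;
  sc_okr : forall n, every (@ok R d) (lr n);
  sc_oku : forall n, every (fun v => ok v.1) (lu n);
  sc_okR : forall n, every (fun v => ok v.1) (lR n);
  sc_weak : forall n, weak_id T rho0 (lr n) (lu n) (lR n);
  sc_e : forall n, 0 < e n <= eps n;
  sc_good : forall n, good_step (a n) (e n) (lr n) (lu n) (v n) (X n);
  sc_size : exists N, forall n, (N <= n)%N ->
    tsize (v n) <= eps n /\ \sum_(w <- lR n) tsize w <= 2 * eps n }.

Lemma eps_le m n : (m <= n)%N -> eps n <= eps m.
Proof.
elim: n => [|n IH]; first by rewrite leqn0 => /eqP ->.
rewrite leq_eqVlt => /predU1P[->//|/IH]; apply: le_trans.
by apply: le_trans (epsS n); rewrite mulr_natl mulr2n lerDl ltW.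
Qed.

Lemma eps_sum m n : \sum_(k < m) eps (n + k)%N <= 2 * eps n.
Proof.
(* The induction needs the stronger bound that also counts the tail 2 eps (n + m). *)
suff : \sum_(k < m) eps (n + k)%N + 2 * eps (n + m)%N <= 2 * eps n.
  by apply: le_trans; rewrite lerDl mulr_ge0// ltW.
elim: m => [|m IH]; first by rewrite big_ord0 add0r addn0.
rewrite big_ord_recr /= addnS; apply: le_trans IH; rewrite -addrA lerD2l.
by have := epsS (n + m)%N; lra.
Qed.

(* The error at position j at step n is removed at step n + j: new errors are made smaller than eps at that time. *)
Lemma iterate rho0 lr0 lR0 : every (@ok R d) lr0 -> every (fun v => ok v.1) lR0 -> (0 < size lR0)%N ->
  weak_id T rho0 lr0 [::] lR0 ->
  exists lr lu lR v e X, lr 0%N = lr0 /\ scheme rho0 lr lu lR v e X.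
Proof.
move=> okr okR sR W; pose N := size lR0.
have [v0 _] : exists v0 : vect, True by case: (lR0) sR => [//|v l] _; exists v.
(* The first N errors, those of the start, carry no bound; they are the positions with n + j < N. *)
pose inv (n : nat) (z : seq scal * seq vect * seq vect) : Prop :=
  [/\ every (@ok R d) z.1.1, every (fun v => ok v.1) z.1.2, every (fun v => ok v.1) z.2 &
    weak_id T rho0 z.1.1 z.1.2 z.2] /\
  [/\ (0 < size z.2)%N, (N <= n + size z.2)%N &
    forall j, (j < size z.2)%N -> (N <= n + j)%N -> tsize (nth v0 z.2 j) <= eps (n + j)].
pose next (z : seq scal * seq vect * seq vect) (x : stp) :=
  (s_rho1 x :: s_rho2 x :: z.1.1, s_u x true :: s_u x false :: z.1.2, behead z.2 ++ s_err x).
have ex (nz : nat * (seq scal * seq vect * seq vect)) : exists xe : stp * R, inv nz.1 nz.2 ->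
    [/\ 0 < xe.2 <= eps nz.1,
        good_step (a nz.1) xe.2 nz.2.1.1 nz.2.1.2 (head v0 nz.2.2) xe.1 &
        inv nz.1.+1 (next nz.2 xe.1)].
  case: nz => n [[lr lu] lR] /=.
  (* Beyond the step at which the last of the new errors will be removed: the present step, the
     length of the queue and the number of new errors known from [gs_size]. *)
  pose m := (n.+1 + size lR + (3 + d + 2 * size lr + 2 * size lu))%N; pose e := eps m.
  have nm : (n.+1 <= m)%N by rewrite /m -addnA leq_addr.
  have [h|h] := pselect (inv n (lr, lu, lR)); last first.
    (* Default value for states that violate the invariant. *)
    have x : stp by exact: (Stp (fun=> 0) (fun=> 0) (fun=> 0) (fun=> 0) (fun=> 0) (fun=> fun=> 0) (fun=> v0.2) set0 [::]).
    by exists (x, 0).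
  have [[/= Hr Hu HR HW] [/= s0 sN sj]] := h.
  case: lR HR HW s0 sN sj @m nm @e {h} => [//|w lR] [Hw HR] HW _ sN sj m nm e.
  have [x [gx Wx]] := step Hr Hu Hw (a0 n) (eps0 m) HW.
  exists (x, e) => _ /=; split; [by rewrite eps0 eps_le// ltnW|exact: gx|].
  split => /=.
    split.
    - by split; [exact: (gs_ok1 gx)|split; [exact: (gs_ok2 gx)|]].
    - by split; [exact: (gs_oku gx)|split; [exact: (gs_oku gx)|]].
    - by apply/every_cat; split => //; exact: (gs_okerr gx).
    - exact: Wx.
  have sE := gs_size gx; split.
  - by rewrite size_cat sE addnC.
  - by rewrite size_cat sE; move: sN => /=; lia.
  - move=> j; rewrite size_cat sE nth_cat => jlt Nj.
    have [jR|jR] := ltnP j (size lR).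
      by have := sj j.+1; rewrite ltnS addSnnS /=; apply => //; rewrite -addSnnS.
    apply: (@le_trans _ _ e); last by apply: eps_le; rewrite /m /=; lia.
    by apply: (every_nth v0 (gs_err gx)); rewrite sE; lia.
have /choice[F FP] := ex.
pose zs := fix zs n := if n is n'.+1 then next (zs n') (F (n', zs n')).1 else (lr0, [::], lR0).
have izs n : inv n (zs n).
  elim: n => [|n IH]; last by have [] := FP (n, zs n) IH.
  by split; split => //= j jlt; rewrite add0n /N leqNgt jlt.
exists (fun n => (zs n).1.1), (fun n => (zs n).1.2), (fun n => (zs n).2),
  (fun n => head v0 (zs n).2), (fun n => (F (n, zs n)).2), (fun n => (F (n, zs n)).1).
split => //; split => //.
- by move=> n; have [[]] := izs n.
- by move=> n; have [[]] := izs n.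
- by move=> n; have [[]] := izs n.
- by move=> n; have [[]] := izs n.
- by move=> n; have [] := FP (n, zs n) (izs n).
- by move=> n; have [] := FP (n, zs n) (izs n).
- exists N => n Nn; have [_ [s0 _ sj]] := izs n; split.
    by rewrite -nth0 -[n in eps n]addn0; apply: sj => //; rewrite addn0.
  apply: le_trans (eps_sum (size (zs n).2) n).
  rewrite (big_nth v0) big_mkord; apply: ler_sum => k _; apply: sj => //.
  by rewrite (leq_trans Nn)// leq_addr.
Qed.

End iteration.


(** * Passage to the limit *)

Section integral_norms.
Context {dd : measure_display} {X : measurableType dd} {R : realType}.
Variable m : {measure set X -> \bar R}.

(** No measurability is assumed: the integral of a nonnegative function is a supremum over the
    simple functions below it. The slice norms of the limits can then be estimated as they are. *)
Lemma le_integral_ge0 (f g : X -> \bar R) : (forall x, 0 <= f x)%E -> (forall x, f x <= g x)%E ->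
  (\int[m]_x f x <= \int[m]_x g x)%E.
Proof.
move=> f0 fg; rewrite !ge0_integralTE//; last by move=> x; exact: le_trans (fg x).
apply: le_ereal_sup => _ [h hf <-]; exists h => // x; exact: le_trans (fg x).
Qed.

Lemma le_Lnorm (r : R) (f g : X -> \bar R) : 0 < r -> (forall x, `|f x| <= `|g x|)%E ->
  (Lnorm m r%:E f <= Lnorm m r%:E g)%E.
Proof.
move=> r0 fg; rewrite unlock /Lnorm; apply: gt0_ler_poweR.
- by rewrite invr_ge0 ltW.
- by rewrite in_itv/= leey andbT integral_ge0// => x _; exact: poweR_ge0.
- by rewrite in_itv/= leey andbT integral_ge0// => x _; exact: poweR_ge0.
apply: le_integral_ge0 => x; first exact: poweR_ge0.
by apply: gt0_ler_poweR; rewrite ?(ltW r0)// in_itv/= leey andbT abse_ge0.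
Qed.

Lemma sum_half (n : nat) : \sum_(k < n) (2^-1 : R) ^+ k.+1 = 1 - 2^-1 ^+ n.
Proof.
elim: n => [|n IH]; first by rewrite big_ord0 expr0 subrr.
by rewrite big_ord_recr /= IH exprS; lra.
Qed.

Lemma nneseries_le (u : nat -> \bar R) (K : \bar R) : (forall n, 0 <= u n)%E ->
  (forall n, \sum_(k < n) u k <= K)%E -> (\sum_(0 <= k <oo) u k <= K)%E.
Proof.
move=> u0 uK; apply: lime_le; first by apply: is_cvg_nneseries => n _ _.
by apply: nearW => n; rewrite big_mkord; exact: uK.
Qed.

(** The weights 2^-(k+1) have sum at most 1, so the sum of the y k is at most the largest 2^(k+1) y
    k, which is bounded by the root of the right-hand side. *)
Lemma sum_pow_le (s : R) (y : nat -> R) (n : nat) : 1 <= s -> (forall k, 0 <= y k) ->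
  (\sum_(k < n) y k) `^ s <= \sum_(k < n) (2 ^+ k.+1 * y k) `^ s.
Proof.
move=> s1 y0.
have s0 : s != 0 by rewrite gt_eqF// (lt_le_trans ltr01).
pose z k := 2 ^+ k.+1 * y k.
have z0 k : 0 <= z k by rewrite mulr_ge0// exprn_ge0.
pose S := \sum_(k < n) z k `^ s.
have S0 : 0 <= S by apply: sumr_ge0 => k _; exact: powR_ge0.
have zS (k : 'I_n) : z k <= S `^ s^-1.
  rewrite -[leLHS]powRr1// -(mulfV s0) powRrM; apply: ler_powRl.
  - by rewrite invr_ge0 (le_trans ler01).
  - exact: powR_ge0.
  - by rewrite /S (bigD1 k)//= lerDl; apply: sumr_ge0 => j _; exact: powR_ge0.
suff h : \sum_(k < n) y k <= S `^ s^-1.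
  apply: le_trans (ler_powRl _ _ h) _.
  - exact: le_trans s1.
  - by apply: sumr_ge0 => k _; exact: y0.
  - by rewrite -powRrM mulVf// powRr1.
apply: (@le_trans _ _ (\sum_(k < n) 2^-1 ^+ k.+1 * S `^ s^-1)).
  apply: ler_sum => k _; rewrite -[leLHS](mulKf (expf_neq0 k.+1 (_ : 2 != 0)))//.
  by rewrite -exprVn; apply: ler_wpM2l; [rewrite exprn_ge0// invr_ge0|exact: zS].
rewrite -mulr_suml sum_half ler_piMl ?powR_ge0// gerBl exprn_ge0//.
Qed.

End integral_norms.

Section torus_norms.
Variables (R : realType) (d : nat).
Local Notation E := 'rV[R]_d.
Local Notation mu := (torus_measure R d).
Local Notation I f := (\int[mu]_x f x).

Definition torus_norm (r : R) (f : E -> R) := (I (fun x => `|f x| `^ r)) `^ r^-1.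

Variable r : R.
Hypothesis r1 : 1 <= r.

Let r0 : 0 < r. Proof. exact: lt_le_trans r1. Qed.

Lemma Lnorm_torus f : cp f -> Lnorm mu r%:E (EFin \o f) = (torus_norm r f)%:E.
Proof.
move=> cf; rewrite unlock /Lnorm /torus_norm -poweR_EFin; congr (_ `^ _)%E.
rewrite /Rintegral fineK; last first.
  by apply: integrable_fin_num => //; apply: (cp_integrable (cp_powR r0 cf)).
by apply: eq_integral => x _; rewrite -poweR_EFin.
Qed.

Lemma torus_norm_ge0 f : 0 <= torus_norm r f.
Proof. exact: powR_ge0. Qed.

Lemma torus_norm_abs f : torus_norm r (fun x => `|f x|) = torus_norm r f.
Proof. by rewrite /torus_norm; under eq_Rintegral do rewrite normr_id. Qed.

Lemma torus_normZ c f : cp f -> torus_norm r (fun x => c * f x) = `|c| * torus_norm r f.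
Proof.
move=> cf; rewrite /torus_norm -[X in X * _]powRr1// -(@mulfV _ r) ?gt_eqF// powRrM -powRM//; last by apply: cpI_ge0 => x; exact: powR_ge0.
rewrite -cpIZ; last exact: cp_powR.
by congr (_ `^ _); apply: eq_Rintegral => x _; rewrite normrM powRM.
Qed.

Lemma torus_normD f g : cp f -> cp g -> torus_norm r (fun x => f x + g x) <= torus_norm r f + torus_norm r g.
Proof.
move=> cf cg; have mcp (h : E -> R) : cp h -> measurable_fun setT h by move=> [ch ph]; exact: measurable_periodic.
have := minkowski_EFin mu (mcp _ cf) (mcp _ cg) r1.
by rewrite !Lnorm_torus//; exact: cpD.
Qed.

Lemma torus_norm_sum J (l : seq J) (f : J -> E -> R) : (forall j, cp (f j)) ->
  torus_norm r (fun x => \sum_(j <- l) f j x) <= \sum_(j <- l) torus_norm r (f j).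
Proof.
move=> cf; elim: l => [|j l IH].
  rewrite big_nil /torus_norm [X in X `^ _](_ : _ = 0) ?powR0 ?invr_eq0 ?gt_eqF//.
  rewrite -[RHS](torus_cst d); apply: eq_Rintegral => x _.
  by rewrite big_nil normr0 powR0// gt_eqF.
rewrite big_cons; apply: le_trans (_ : _ <= torus_norm r (f j) + torus_norm r (fun x => \sum_(j <- l) f j x)) _.
  rewrite (_ : (fun x => \sum_(j0 <- (j :: l)) f j0 x) = fun x => f j x + \sum_(j <- l) f j x); last first.
    by apply/funext => x; rewrite big_cons.
  by apply: torus_normD => //; exact: cp_sum.
by rewrite lerD2l.
Qed.

Lemma torus_norm_cst c : torus_norm r (fun=> c) = `|c|.
Proof. by rewrite /torus_norm torus_cst -powRrM mulfV ?gt_eqF// powRr1. Qed.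

Lemma Lnorm_le_sum J (l : seq J) (c : J -> R) (f : J -> E -> R) (F : E -> R) : (forall j, cp (f j)) ->
  (forall x, `|F x| <= \sum_(j <- l) `|c j| * `|f j x|) ->
  (Lnorm mu r%:E (EFin \o F) <= (\sum_(j <- l) `|c j| * torus_norm r (f j))%:E)%E.
Proof.
move=> cf FJ; pose g x := \sum_(j <- l) `|c j| * `|f j x|.
have cg j : cp (fun x => `|c j| * `|f j x|) by apply: cpM; [exact: cp_cst|exact: cp_norm].
apply: (@le_trans _ _ (Lnorm mu r%:E (EFin \o g))).
  by apply: le_Lnorm => // x /=; rewrite lee_fin (le_trans (FJ x))// ler_norm.
rewrite Lnorm_torus; last exact: cp_sum.
rewrite lee_fin; apply: (le_trans (torus_norm_sum l cg)); apply: ler_sum => j _.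
by rewrite torus_normZ ?normr_id ?torus_norm_abs//; exact: cp_norm.
Qed.

End torus_norms.

Section time_norms.
Variables (R : realType) (T : R) (G : set R).
Hypotheses (T0 : 0 < T) (mG : measurable (G : set (measurableTypeR R))) (G0 : tmf T (~` G) = 0%E).

Lemma time_sup_le (f : R -> \bar R) (K : R) : (0 <= K)%R -> (forall t, 0 <= f t)%E ->
  (forall t, G t -> f t <= K%:E)%E -> (Lnorm (tmf T) +oo%E f <= K%:E)%E.
Proof.
move=> K0 f0 fK; rewrite unlock /Lnorm; case: ifPn => [_|_]; last by rewrite lee_fin.
apply/ess_supP; exists (~` G); split => //; first exact: measurableC.
by move=> t /= h Gt; apply: h; rewrite gee0_abs//; exact: fK.
Qed.

(** At each t in G the dominating sum is finite but its length depends on t, so f is compared with a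
    series. [sum_pow_le] loses 2^(k+1), and the factor 4^-(k+1) in the hypothesis leaves a geometric
    series of sum at most 1. *)
Lemma time_norm_le (s K : R) (al : nat -> R -> R) (x : nat -> R) (f : R -> \bar R) : 1 <= s ->
  0 <= K -> (forall k, continuous (al k)) -> (forall k, 0 <= x k) -> (forall t, 0 <= f t)%E ->
  (forall k, (\int[tmf T]_t `|al k t| `^ s) `^ s^-1 * x k <= K * 4^-1 ^+ k.+1) ->
  (forall t, G t -> exists n, f t <= (\sum_(k < n) `|al k t| * x k)%:E)%E ->
  (Lnorm (tmf T) s%:E f <= K%:E)%E.
Proof.
move=> s1 K0 cal x0 f0 alK fle.
have s0 : 0 < s by exact: lt_le_trans s1.
pose y k (t : R) := (2 ^+ k.+1 * (`|al k t| * x k)) `^ s.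
have y0 k t : 0 <= y k t by exact: powR_ge0.
have cal' k : continuous (fun t => `|al k t| `^ s) by exact: cont_powR_norm.
have yE k t : y k t = (2 ^+ k.+1 * x k) `^ s * `|al k t| `^ s.
  by rewrite -powRM ?mulr_ge0 ?exprn_ge0// /y -mulrA (mulrC (x k)).
have cy k : continuous (y k).
  rewrite (_ : y k = fun t => (2 ^+ k.+1 * x k) `^ s * `|al k t| `^ s); last exact/funext.
  by apply: contM; [exact: cst_continuous|exact: cal'].
have mc (h : R -> R) : continuous h -> measurable_fun [set: measurableTypeR R] (EFin \o h).
  by move=> ch; apply/measurable_EFinP; exact: continuous_measurable_fun.
pose g t := (\sum_(0 <= k <oo) (y k t)%:E)%E.
have g0 t : (0 <= g t)%E by apply: nneseries_ge0 => k _ _; rewrite lee_fin.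
have mg : measurable_fun [set: measurableTypeR R] g.
  by apply: ge0_emeasurable_sum => // [k t _ _|k _]; [rewrite lee_fin|exact: mc].
(* Infinite off G, so that the domination holds at every t; its integral vanishes since G has full
   measure. *)
pose h (t : R) : \bar R := (+oo * (\1_(~` G) t)%:E)%E.
have mI : measurable_fun [set: measurableTypeR R] (fun t => (\1_(~` G) t : R)%:E).
  by apply/measurable_EFinP; apply: measurable_indic; exact: measurableC.
have i0 (t : R) : (0 <= (\1_(~` G) t : R)%:E)%E by rewrite lee_fin indicE.
have h0 t : (0 <= h t)%E by rewrite mule_ge0.
have mh : measurable_fun [set: measurableTypeR R] h by exact: measurable_funeM.
suff : (\int[tmf T]_t (`|f t| `^ s)%E <= (K `^ s)%:E)%E.
  move=> le; rewrite unlock /Lnorm.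
  have -> : K%:E = ((K `^ s)%:E `^ s^-1)%E by rewrite poweR_EFin -powRrM mulfV ?gt_eqF// powRr1.
  apply: gt0_ler_poweR => //; first by rewrite invr_ge0 ltW.
  - by rewrite in_itv/= leey andbT integral_ge0// => t _; exact: poweR_ge0.
  - by rewrite in_itv/= leey andbT lee_fin powR_ge0.
apply: (@le_trans _ _ (\int[tmf T]_t (g t + h t))%E).
  apply: le_integral_ge0 => t; first exact: poweR_ge0.
  have [Gt|Gt] := pselect (G t); last first.
    rewrite /h indicE mem_set//= mule1 addey ?leey//.
    by apply/eqP => e; have := g0 t; rewrite e.
  have [n fn] := fle t Gt; rewrite gee0_abs//; apply: (@le_trans _ _ (g t)); last by rewrite leeDl.
  apply: (@le_trans _ _ ((\sum_(k < n) y k t)%:E)).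
    apply: le_trans (_ : _ <= ((\sum_(k < n) `|al k t| * x k)%:E `^ s)%E)%E _.
      apply: gt0_ler_poweR => //; first exact: ltW.
      - by rewrite in_itv/= leey andbT.
      - by rewrite in_itv/= leey andbT (le_trans (f0 t)).
    rewrite poweR_EFin lee_fin; apply: (sum_pow_le (y := fun k => `|al k t| * x k)) => // k.
    exact: mulr_ge0.
  rewrite /g -sumEFin -(big_mkord xpredT (fun k => (y k t)%:E)).
  by apply: nneseries_lim_ge => k _ _; rewrite lee_fin.
rewrite ge0_integralD//.
have -> : (\int[tmf T]_t h t = 0)%E.
  rewrite /h ge0_integralZl//.
  rewrite integral_indic ?setIT//; last exact: measurableC.
  by rewrite [X in (_ * X)%E]G0 mule0.
rewrite adde0 integral_nneseries//; [|by move=> k; exact: mc|by move=> k t _; rewrite lee_fin].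
apply: nneseries_le => [k|n]; first by apply: integral_ge0 => t _; rewrite lee_fin.
have int k : (\int[tmf T]_t (y k t)%:E <= (K `^ s * 2^-1 ^+ k.+1)%:E)%E.
  have iy : (tmf T).-integrable setT (EFin \o y k) by exact: integrable_tmf_cont.
  rewrite -[leLHS]fineK; last exact: integrable_fin_num.
  rewrite lee_fin -/(Rintegral (tmf T) setT (y k)).
  have -> : \int[tmf T]_t y k t = (2 ^+ k.+1 * x k) `^ s * \int[tmf T]_t `|al k t| `^ s.
    by rewrite -tmfZ//; apply: eq_Rintegral => t _; rewrite yE.
  set J := \int[tmf T]_t _ in alK *.
  have J0 : 0 <= J by apply: Rintegral_ge0 => t _; exact: powR_ge0.
  have -> : J = (J `^ s^-1) `^ s by rewrite -powRrM mulVf ?gt_eqF// powRr1.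
  rewrite -powRM ?powR_ge0 ?mulr_ge0 ?exprn_ge0//.
  apply: (@le_trans _ _ ((K * 2^-1 ^+ k.+1) `^ s)).
    apply: ler_powRl; first exact: ltW.
      by rewrite mulr_ge0 ?powR_ge0// mulr_ge0// exprn_ge0.
    rewrite mulrAC -mulrA.
    have -> : K * 2^-1 ^+ k.+1 = 2 ^+ k.+1 * (K * 4^-1 ^+ k.+1).
      rewrite mulrCA -exprMn; congr (_ * _ ^+ _); lra.
    by apply: ler_wpM2l; [exact: exprn_ge0|exact: alK].
  have p0 : 0 < (2^-1 : R) ^+ k.+1 by rewrite exprn_gt0.
  rewrite powRM ?(ltW p0)//; apply: ler_wpM2l; first exact: powR_ge0.
  by apply: powR_le1 => //; rewrite p0 exprn_ile1// ?invf_le1 ?ler1n// invr_ge0.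
apply: (@le_trans _ _ (\sum_(k < n) (K `^ s * 2^-1 ^+ k.+1)%:E)%E); first exact: lee_sum.
rewrite sumEFin lee_fin -mulr_sumr sum_half ler_piMr ?powR_ge0// gerBl exprn_ge0//.
Qed.

End time_norms.


Lemma continuous_uniform_limit (R : realType) (X : topologicalType) (f : nat -> X -> R) (g : X -> R) (c : nat -> R) :
  (forall n, continuous (f n)) -> c @ \oo --> (0 : R) -> (forall n x, `|g x - f n x| <= c n) ->
  continuous g.
Proof.
move=> cf c0 gf x; apply/cvgrPdist_lt => e e0.
have e3 : 0 < e / 3 by rewrite divr_gt0.
have [n _ cn] := (cvgrPdist_lt _ _).1 c0 _ e3.
have cn3 : c n < e / 3 by have := cn n (leqnn n); rewrite /= sub0r normrN => /(le_lt_trans (ler_norm _)).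
near=> y.
have fy : `|f n x - f n y| < e / 3 by near: y; exact: ((cvgrPdist_lt _ _).1 (cf n x) _ e3).
have -> : g x - g y = (g x - f n x) + (f n x - f n y) + (f n y - g y) by lra.
have g1 := gf n x; have g2 := gf n y; rewrite distrC in g2.
have := ler_normD (g x - f n x + (f n x - f n y)) (f n y - g y).
have := ler_normD (g x - f n x) (f n x - f n y); lra.
Unshelve. all: by end_near.
Qed.

Section geometric_sequences.
Variables (R : realType) (eps : nat -> R).
Hypotheses (eps0 : forall n, 0 < eps n) (epsS : forall n, 2 * eps n.+1 <= eps n).

Lemma eps_cvg0 : eps @ \oo --> (0 : R).
Proof.
have le n : eps n <= geometric (eps 0%N) (2^-1 : R) n.
  elim: n => [|n IH]; first by rewrite /= expr0 mulr1.
  have := epsS n; move: IH; rewrite /= exprS; lra.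
apply: (@squeeze_cvgr _ _ _ _ (fun=> 0) (geometric (eps 0%N) (2^-1 : R))).
- by apply: nearW => n; rewrite le ltW//=.
- exact: cvg_cst.
- by apply: cvg_geometric; rewrite ger0_norm ?invr_ge0// invf_lt1// ltr1n.
Qed.

Lemma cvg_eps c : (fun n => c * eps n) @ \oo --> (0 : R).
Proof. by rewrite -(mulr0 c); apply: cvgMr; exact: eps_cvg0. Qed.

(** As eps at least halves, x n + 2 c eps n decreases and x n - 2 c eps n increases from m on:
    nested intervals shrink to the limit and give the rate at once. *)
Lemma geometric_cvg (x : nat -> R) (c : R) (m : nat) : 0 <= c ->
  (forall n, (m <= n)%N -> `|x n.+1 - x n| <= c * eps n) ->
  exists2 l : R, x @ \oo --> l & forall n, (m <= n)%N -> `|l - x n| <= 2 * c * eps n.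
Proof.
move=> c0 xS.
pose y n := x (n + m)%N + 2 * c * eps (n + m)%N.
pose z n := x (n + m)%N - 2 * c * eps (n + m)%N.
have st (n : nat) : y n.+1 <= y n /\ z n <= z n.+1.
  have := xS (n + m)%N (leq_addl _ _); have := epsS (n + m)%N.
  rewrite /y /z addSn ler_norml => /(ler_wpM2l c0) h /andP[h1 h2]; split; lra.
have yd : {homo y : n k / (n <= k)%N >-> k <= n}.
  by apply: homo_leq => [//|a b d ab bd|n]; [exact: le_trans bd ab|exact: (st n).1].
have zd : {homo z : n k / (n <= k)%N >-> n <= k}.
  by apply: homo_leq => [//|a b d ab bd|n]; [exact: le_trans ab bd|exact: (st n).2].
have zy n : z n <= y n.
  have : 0 <= c * eps (n + m)%N by rewrite mulr_ge0// ltW.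
  by rewrite /z /y; lra.
have yb : has_lbound (range y).
  by exists (z 0%N) => _ [n _ <-]; apply: le_trans (zd _ _ (leq0n n)) (zy n).
have cy := nonincreasing_is_cvgn yd yb; set l := limn y in cy.
have xl : x @ \oo --> l.
  rewrite -(cvg_shiftn m).
  have -> : [sequence x (n + m)%N]_n = fun n => y n - 2 * c * eps (n + m)%N.
    by apply/funext => n; rewrite /y /=; lra.
  rewrite -[l]subr0; apply: cvgB; first exact: cy.
  by have := cvg_eps (2 * c); rewrite -(cvg_shiftn m).
exists l => // n mn.
have ly k : l <= y k by exact: nonincreasing_cvgn_ge.
have lz k : z k <= l.
  apply: limr_ge => //; exists k => // j /= kj; exact: le_trans (zd _ _ kj) (zy j).
have := ly (n - m)%N; have := lz (n - m)%N; rewrite /y /z subnK// => h1 h2.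
by rewrite ler_norml; apply/andP; split; lra.
Qed.

End geometric_sequences.

Section integral_limit.
Context {dd : measure_display} {X : measurableType dd} {R : realType}.
Variable m : {measure set X -> \bar R}.

(** Dominated convergence, with |H 0| plus the sum of all J k as the dominating function. *)
Lemma integral_limit (H J : nat -> X -> R) (F : X -> R) (G : set X) (K : R) :
  measurable G -> m (~` G) = 0%E ->
  (forall n, m.-integrable setT (EFin \o H n)) -> (forall n, m.-integrable setT (EFin \o J n)) ->
  measurable_fun setT F -> (forall n z, 0 <= J n z) ->
  (forall n z, G z -> `|H n.+1 z - H n z| <= J n z) ->
  (forall z, G z -> H ^~ z @ \oo --> F z) ->
  (forall n, \sum_(k < n) \int[m]_z J k z <= K) ->
  m.-integrable setT (EFin \o F) /\ (fun n => \int[m]_z H n z) @ \oo --> \int[m]_z F z.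
Proof.
move=> mG G0 iH iJ mF J0 HJ HF JK.
pose S z := (\sum_(0 <= k <oo) (J k z)%:E)%E.
pose g z := (`|H 0%N z|%:E + S z)%E.
have mJ k : measurable_fun setT (EFin \o J k) by exact: (measurable_int m).
have mS : measurable_fun setT S.
  by apply: ge0_emeasurable_sum => [k z _ _|k _]; [rewrite lee_fin|exact: mJ].
have S0 z : (0 <= S z)%E by apply: nneseries_ge0 => k _ _; rewrite lee_fin.
have mH0 : measurable_fun setT (fun z => `|H 0%N z|%:E).
  by apply/measurable_EFinP; apply: measurableT_comp => //; apply/measurable_EFinP; exact: (measurable_int m).
have g0 z : (0 <= g z)%E by rewrite adde_ge0.
have iS : (\int[m]_z S z <= K%:E)%E.
  rewrite integral_nneseries//; last by move=> n x _; rewrite lee_fin.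
  apply: nneseries_le => [n|n]; first by apply: integral_ge0 => x _; rewrite lee_fin.
  apply: le_trans (_ : _ <= (\sum_(k < n) \int[m]_z J k z)%:E)%E _; last by rewrite lee_fin.
  rewrite -sumEFin; apply: lee_sum => k _; rewrite /Rintegral fineK//; apply: integrable_fin_num => //; exact: iJ.
have ig : m.-integrable setT g.
  apply/integrableP; split; first exact: emeasurable_funD.
  under eq_integral do rewrite gee0_abs//.
  rewrite ge0_integralD//; apply: lte_add_pinfty.
    by have /integrableP[_] := iH 0%N.
  by apply: le_lt_trans iS _; rewrite ltry.
have Hg n z : G z -> (`|(H n z)%:E| <= g z)%E.
  move=> Gz; have hn : `|H n z| <= `|H 0%N z| + \sum_(k < n) J k z.
    elim: n => [|n IH]; first by rewrite big_ord0 addr0.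
    rewrite big_ord_recr /= addrA -[H n.+1 z](subrK (H n z)) addrC.
    by apply: le_trans (ler_normD _ _) _; rewrite lerD// HJ.
  apply: (@le_trans _ _ ((`|H 0%N z| + \sum_(k < n) J k z)%:E)); first by rewrite abse_EFin lee_fin.
  rewrite EFinD leeD2l// -sumEFin -(big_mkord xpredT (fun k => (J k z)%:E)).
  by apply: nneseries_lim_ge => k _ _; rewrite lee_fin.
have [|||//||] := @dominated_convergence _ _ _ m setT measurableT (fun n => EFin \o H n) (EFin \o F) g.
- by move=> n; exact: (measurable_int m).
- exact/measurable_EFinP.
- exists (~` G); split => //; first exact: measurableC.
  move=> z /= h Gz; apply: h => _; apply: cvg_EFin; first exact: nearW.
  exact: HF.
- exists (~` G); split => //; first exact: measurableC.
  by move=> z /= h Gz; apply: h => n _; exact: Hg.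
- move=> iF _ cF; split => //.
  apply: (@fine_cvg _ _ _ _ (fun n => \int[m]_z (EFin \o H n) z)%E).
  rewrite /Rintegral fineK//; exact: integrable_fin_num.
Qed.

End integral_limit.

(** * Good times, and limits on them *)

Section good_times.
Variables (R : realType) (T : R) (N : nat -> set R) (eps : nat -> R).
Hypotheses (eps0 : forall n, 0 < eps n) (epsS : forall n, 2 * eps n.+1 <= eps n)
  (mN : forall n, measurable (N n : set (measurableTypeR R)))
  (Ne : forall n, (tmf T (N n) <= (eps n)%:E)%E).

(** Times that lie in finitely many of the sets N n: from some step on, only the uniformly small
    correction acts there. *)
Definition good_times : set R := `[0, T] `&` ~` lim_sup_set N.

Lemma measurable_good_times : measurable (good_times : set (measurableTypeR R)).
Proof.
apply: measurableI => //; apply: measurableC.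
by apply: bigcapT_measurable => n; exact: bigcup_measurable.
Qed.

Lemma good_times_full : tmf T (~` good_times) = 0%E.
Proof.
apply/eqP; rewrite eq_le measure_ge0 andbT setCI setCK.
have mL : measurable (lim_sup_set N : set (measurableTypeR R)).
  by apply: bigcapT_measurable => n; exact: bigcup_measurable.
apply: (@le_trans _ _ (tmf T (~` `[0%R, T]) + tmf T (lim_sup_set N))%E).
  by apply: measureU2 => //; exact: measurableC.
rewrite tmf_out add0e (_ : tmf T (lim_sup_set N) = 0%E)//.
apply: (@lim_sup_set_cvg0 _ _ _ (tmf T)) => //.
apply: (@le_lt_trans _ _ (2 * eps 0%N)%:E); last exact: ltry.
apply: nneseries_le => // n.
apply: (@le_trans _ _ (\sum_(k < n) (eps k)%:E)%E); first by apply: lee_sum => k _; exact: Ne.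
by rewrite sumEFin lee_fin; have := eps_sum eps0 epsS n 0; under eq_bigr do rewrite add0n.
Qed.

Lemma good_timesP t : good_times t -> 0 <= t <= T /\ exists m, forall n, (m <= n)%N -> ~ N n t.
Proof.
move=> [/= ]; rewrite in_itv /= => tT h; split => //.
apply: contrapT => /forallNP h'; apply: h => m _ /=.
have /existsNP[n /not_implyP[mn /contrapT Nn]] := h' m.
by exists n.
Qed.

End good_times.


Lemma cont_every (R : realType) (X : topologicalType) (A : Type) (l : seq A) (F : A -> X -> R) :
  every (fun w => continuous (F w)) l -> continuous (fun z => \sum_(w <- l) F w z).
Proof.
elim: l => [_|w l IH [cw /IH h]] /=.
  by rewrite (_ : (fun z => _) = fun=> 0); [exact: cst_continuous|apply/funext => z; rewrite big_nil].
rewrite (_ : (fun z => _) = fun z => F w z + \sum_(w <- l) F w z); first exact: contD.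
by apply/funext => z; rewrite big_cons.
Qed.

Lemma periodic_every (R : realType) d (A : Type) (l : seq A) (F : A -> 'rV[R]_d -> R) :
  every (fun w => Zperiodic (F w)) l -> Zperiodic (fun z => \sum_(w <- l) F w z).
Proof.
elim: l => [_|w l IH [cw /IH h]] x k /=; first by rewrite !big_nil.
by rewrite !big_cons cw h.
Qed.

Lemma cont_tensor (R : realType) d (a : R -> R) (f : 'rV[R]_d -> R) : continuous a -> continuous f ->
  continuous (fun z : R * 'rV[R]_d => a z.1 * f z.2).
Proof.
move=> ca cf; apply: contM => z.
- by apply: continuous_comp; [exact: cvg_fst|exact: ca].
- by apply: continuous_comp; [exact: cvg_snd|exact: cf].
Qed.

Section limits_on_good_times.
Variables (R : realType) (d : nat) (G : set R).
Local Notation E := 'rV[R]_d.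
Hypothesis mG : measurable (G : set (measurableTypeR R)).

(** The value 0 outside the good times makes the limit measurable, and periodic in x at every
    time. *)
Definition lim_on (f : nat -> R * E -> R) (z : R * E) : R :=
  if z.1 \in G then limn (f ^~ z) else 0.

Lemma lim_on_cvg f z l : G z.1 -> f ^~ z @ \oo --> l -> lim_on f z = l.
Proof. by move=> Gz fl; rewrite /lim_on mem_set//; exact/cvg_lim. Qed.

Lemma lim_on_eq f z l m : G z.1 -> (forall n, (m <= n)%N -> f n z = l) -> lim_on f z = l.
Proof.
move=> Gz fl; apply: lim_on_cvg => //; apply: cvg_near_cst.
by exists m => // n /=; exact: fl.
Qed.

Lemma measurable_lim_on f : (forall n, continuous (f n)) -> (forall z, G z.1 -> cvgn (f ^~ z)) ->
  measurable_fun [set: measurableTypeR R * E] (lim_on f).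
Proof.
move=> cf fl.
apply: (@measurable_fun_cvg _ _ _ _ (fun n (z : measurableTypeR R * E) => \1_G z.1 * f n z)).
- move=> n; apply: measurable_funM; last exact: measurable_continuous_pair.
  by apply: (measurableT_comp (f := \1_G : measurableTypeR R -> R)) => //; exact: measurable_indic.
- move=> z _; rewrite /lim_on indicE; case: ifPn => [|_].
    move=> /set_mem /fl h; under eq_fun do rewrite mul1r; exact: h.
  by under eq_fun do rewrite mul0r; exact: cvg_cst.
Qed.

Lemma periodic_lim_on f t : (forall n, Zperiodic (fun x => f n (t, x))) -> Zperiodic (fun x => lim_on f (t, x)).
Proof.
move=> pf x k; rewrite /lim_on /=; congr (if _ then _ else _); congr (limn _).
by apply/funext => n; exact: pf.
Qed.

End limits_on_good_times.

Section limit.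
Variables (R : realType) (T : R) (d : nat) (p q s st C : R) (r : R).
Local Notation E := 'rV[R]_d.
Local Notation mu := (torus_measure R d).
Local Notation I f := (\int[mu]_x f x).
Variables (a eps : nat -> R) (rho0 : E -> R) (lr : nat -> seq (scal R d)) (lu lR : nat -> seq (vect R d))
  (v : nat -> vect R d) (e : nat -> R) (Xs : nat -> stp R d).
Hypotheses (eps0 : forall n, 0 < eps n) (epsS : forall n, 2 * eps n.+1 <= eps n).
Hypothesis sch : scheme T p q r s st C a eps rho0 lr lu lR v e Xs.

Definition density n (z : R * E) : R := \sum_(w <- lr n) w.1 z.1 * w.2 z.2.

(** [D] is the identity for the velocity and [pd l] for its gradient; each estimate is proved once
    for both. *)
Definition velocity (D : (E -> R) -> E -> R) (i : 'I_d) n (z : R * E) : R :=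
  \sum_(w <- lu n) (w.2 == i)%:R * (w.1.1 z.1 * D w.1.2 z.2).

Let G := good_times T (fun n => s_N (Xs n)).

Lemma e_le n : e n <= eps n. Proof. by have /andP[] := sc_e sch n. Qed.
Lemma measurable_G : measurable (G : set (measurableTypeR R)).
Proof. by apply: measurable_good_times => n; exact: (gs_supp (sc_good sch n)). Qed.

Lemma G_full : tmf T (~` G) = 0%E.
Proof.
apply: (good_times_full eps0 epsS) => n; first exact: (gs_supp (sc_good sch n)).
by apply: le_trans (gs_suppe (sc_good sch n)) _; rewrite lee_fin e_le.
Qed.

Lemma G_itv t : G t -> 0 <= t <= T.
Proof. by move=> /good_timesP[]. Qed.

Lemma G_still t : G t -> exists m, forall n, (m <= n)%N -> s_gam (Xs n) t = 0 /\ s_chi (Xs n) t = 0.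
Proof.
move=> /good_timesP[_ [m hm]]; exists m => n mn; apply: (gs_out (sc_good sch n)); exact: hm.
Qed.

Lemma densityS n z : density n.+1 z =
  s_gam (Xs n) z.1 * s_theta (Xs n) z.2 + s_B (Xs n) z.1 * s_h (Xs n) z.2 + density n z.
Proof. by rewrite /density (sc_lr sch) !big_cons /= addrA. Qed.

Lemma velocityS D i n z : velocity D i n.+1 z =
  s_chi (Xs n) z.1 * (\sum_b (s_dir (Xs n) b == i)%:R * D (s_w (Xs n) b) z.2) + velocity D i n z.
Proof.
rewrite /velocity (sc_lu sch) !big_cons /= addrA; congr (_ + _).
by rewrite big_bool mulrDr; congr (_ + _); rewrite mulrCA.
Qed.

Lemma density_cont n : continuous (density n).
Proof.
apply: cont_every; apply: everyW (sc_okr sch n) => w [cw sw].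
by apply: cont_tensor => //; exact: sm_cont.
Qed.

Lemma density_per n t : Zperiodic (fun x => density n (t, x)).
Proof.
apply: periodic_every; apply: everyW (sc_okr sch n) => w [cw [pw _]] x k /=.
by rewrite pw.
Qed.

Lemma density_cp n t : cp (fun x => density n (t, x)).
Proof. by split; [apply: continuous_pairl; exact: density_cont|exact: density_per]. Qed.

Lemma density_close n t x : 0 <= t <= T -> s_gam (Xs n) t = 0 ->
  `|density n.+1 (t, x) - density n (t, x)| <= 1 * eps n.
Proof.
move=> tT g0; rewrite densityS /= g0 mul0r add0r addrK mul1r.
exact: le_trans (gs_corr (sc_good sch n) x tT) (e_le n).
Qed.

Definition lim_density : R * E -> R := lim_on G density.

Lemma lim_densityP t : G t -> exists m, forall x,
  density ^~ (t, x) @ \oo --> lim_density (t, x) /\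
  forall n, (m <= n)%N -> `|lim_density (t, x) - density n (t, x)| <= 2 * eps n.
Proof.
move=> Gt; have [m hm] := G_still Gt; exists m => x.
have [|l xl lb] := geometric_cvg eps0 epsS (x := density ^~ (t, x)) (m := m) ler01.
  by move=> n mn; apply: density_close; [exact: G_itv|exact: (hm n mn).1].
rewrite /lim_density (lim_on_cvg (l := l))//; split => // n /lb.
by rewrite mulr1.
Qed.

Lemma lim_density_cp t : G t -> cp (fun x => lim_density (t, x)).
Proof.
move=> Gt; split; last by apply: periodic_lim_on => n; exact: density_per.
have [m hm] := lim_densityP Gt.
apply: (@continuous_uniform_limit _ _ (fun n x => density (n + m) (t, x)) _ (fun n => 2 * eps (n + m)%N)).
- by move=> n; exact: (density_cp (n + m) t).1.
- by have := cvg_eps eps0 epsS 2; rewrite -(cvg_shiftn m).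
- by move=> n x; apply: (hm x).2; exact: leq_addl.
Qed.

Lemma measurable_lim_density : measurable_fun [set: measurableTypeR R * E] lim_density.
Proof.
apply: measurable_lim_on; [exact: measurable_G|exact: density_cont|].
move=> [t x] /= Gt; have [m hm] := lim_densityP Gt.
by apply/cvg_ex; exists (lim_density (t, x)); exact: (hm x).1.
Qed.

(** The corrections B h are uniformly small in [0, T], so their whole contribution is absorbed in 2
    eps 0 and only the profiles gam theta need an L^p bound. *)
Lemma lim_density_le t : G t -> exists m, forall x,
  `|lim_density (t, x) - density 0 (t, x)| <=
    2 * eps 0%N + \sum_(k < m) `|s_gam (Xs k) t| * `|s_theta (Xs k) x|.
Proof.
move=> Gt; have [m hm] := lim_densityP Gt; exists m => x.
have h n : `|density n (t, x) - density 0 (t, x)| + 2 * eps n <=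
    2 * eps 0%N + \sum_(k < n) `|s_gam (Xs k) t| * `|s_theta (Xs k) x|.
  elim: n => [|n IH]; first by rewrite subrr normr0 add0r big_ord0 addr0.
  rewrite big_ord_recr densityS /=.
  have := le_trans (gs_corr (sc_good sch n) x (G_itv Gt)) (e_le n).
  have := epsS n; rewrite -normrM; move: IH.
  set A := s_gam _ _ * _; set B := s_B _ _ * _; set c := \sum_(k < n) _.
  rewrite -(addrA (A + B)).
  have := ler_normD (A + B) (density n (t, x) - density 0 (t, x)).
  have := ler_normD A B; lra.
have := (hm x).2 m (leqnn m); have := h m.
have := ler_normD (lim_density (t, x) - density m (t, x)) (density m (t, x) - density 0 (t, x)).
by rewrite addrA subrK; lra.
Qed.

Section velocity.
Variable D : (E -> R) -> E -> R.
Hypothesis smD : forall f, sm f -> sm (D f).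
Variable i : 'I_d.

Definition flow_field k (x : E) : R := \sum_b (s_dir (Xs k) b == i)%:R * D (s_w (Xs k) b) x.

Lemma flow_cp k : cp (flow_field k).
Proof.
apply: cp_sum => b; apply: cpM; first exact: cp_cst.
by apply: sm_cp; apply: smD; have [] := gs_oku (sc_good sch k) b.
Qed.

Lemma velocity_cont n : continuous (velocity D i n).
Proof.
apply: cont_every; apply: everyW (sc_oku sch n) => w [cw sw].
apply: contM; first exact: cst_continuous.
by apply: cont_tensor => //; apply: sm_cont; exact: smD.
Qed.

Lemma velocity_per n t : Zperiodic (fun x => velocity D i n (t, x)).
Proof.
apply: periodic_every; apply: everyW (sc_oku sch n) => w [cw /smD[pw _]] x k /=.
by rewrite pw.
Qed.

Definition lim_velocity : R * E -> R := lim_on G (velocity D i).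

Lemma lim_velocityE t m : G t -> (forall n, (m <= n)%N -> s_chi (Xs n) t = 0) ->
  forall n x, (m <= n)%N -> lim_velocity (t, x) = velocity D i n (t, x).
Proof.
move=> Gt hm n x mn.
apply: (lim_on_eq (m := n)) => // k; elim: k => [|k IH]; first by rewrite leqn0 => /eqP ->.
rewrite leq_eqVlt => /predU1P[<-//|]; rewrite ltnS => nk.
by rewrite velocityS /= (hm k (leq_trans mn nk)) mul0r add0r IH.
Qed.

Lemma measurable_lim_velocity : measurable_fun [set: measurableTypeR R * E] lim_velocity.
Proof.
apply: measurable_lim_on; [exact: measurable_G|exact: velocity_cont|].
move=> [t x] /= Gt; have [m hm] := G_still Gt.
apply/cvg_ex; exists (lim_velocity (t, x)); apply: cvg_near_cst.
by exists m => // n /= mn; rewrite (@lim_velocityE t m Gt _ n)// => k /hm[].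
Qed.

Lemma lim_velocity_le t m : G t -> (forall n, (m <= n)%N -> s_chi (Xs n) t = 0) ->
  forall x, `|lim_velocity (t, x)| <= \sum_(k < m) `|s_chi (Xs k) t| * `|flow_field k x|.
Proof.
move=> Gt hm x; rewrite (lim_velocityE Gt hm x (leqnn m)).
elim: (m) => [|n IH]; first by rewrite /velocity (sc_lu0 sch) big_nil normr0 big_ord0.
rewrite big_ord_recr /= velocityS addrC; apply: le_trans (ler_normD _ _) _.
by rewrite lerD// normrM.
Qed.

End velocity.

End limit.


(** The finitely many indices before N are absorbed in the constant. The errors of the start are not
    small, so the costs of their removal are controlled only in this way. *)
Lemma exists_weight_bound (R : realType) (y w : nat -> R) (N : nat) (K : R) : (forall k, 0 < w k) -> 0 <= K ->
  (forall k, (N <= k)%N -> y k <= K * w k) -> exists2 K' : R, 0 <= K' & forall k, y k <= K' * w k.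
Proof.
move=> w0 K0 yK; exists (K + \sum_(j < N) `|y j| / w j).
  by rewrite addr_ge0// sumr_ge0// => j _; rewrite divr_ge0// ltW.
move=> k; have [kN|Nk] := ltnP k N.
  rewrite (bigD1 (Ordinal kN))//= mulrDl mulrDl mulfVK ?gt_eqF//.
  have : 0 <= K * w k by rewrite mulr_ge0// ltW.
  have : 0 <= (\sum_(i < N | i != Ordinal kN) `|y i| / w i) * w k.
    by rewrite mulr_ge0 ?(ltW (w0 k))// sumr_ge0// => j _; rewrite divr_ge0// ltW.
  have := ler_norm (y k); lra.
rewrite mulrDl; apply: le_trans (yK k Nk) _; rewrite lerDl mulr_ge0 ?(ltW (w0 k))//.
by rewrite sumr_ge0// => j _; rewrite divr_ge0// ltW.
Qed.

(** * Norms of the limit *)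

Section limit_norms.
Variables (R : realType) (T : R) (d : nat) (p q r s st C : R).
Local Notation E := 'rV[R]_d.
Local Notation mu := (torus_measure R d).
Local Notation I f := (\int[mu]_x f x).
Variables (a eps : nat -> R) (rho0 : E -> R) (lr : nat -> seq (scal R d)) (lu lR : nat -> seq (vect R d))
  (v : nat -> vect R d) (e : nat -> R) (Xs : nat -> stp R d).
Hypotheses (T0 : 0 < T) (eps0 : forall n, 0 < eps n) (epsS : forall n, 2 * eps n.+1 <= eps n).
Hypothesis sch : scheme T p q r s st C a eps rho0 lr lu lR v e Xs.
Local Notation G := (good_times T (fun n => s_N (Xs n))).
Local Notation rho := (lim_density T lr Xs).
Local Notation vel := (lim_velocity T lu Xs).
Hypotheses (p1 : 1 <= p) (q1 : 1 <= q) (r1 : 1 <= r) (s1 : 1 <= s) (st1 : 1 <= st).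

Let mG : measurable (G : set (measurableTypeR R)). Proof. exact: (measurable_G sch). Qed.
Let G0 : tmf T (~` G) = 0%E. Proof. exact: (G_full eps0 epsS sch). Qed.

(** Serves twice: with c a bound of the initial density it shows that rho has finite norm, with c
    the error of the initial approximation it gives the estimate by eps. *)
Lemma density_norm (K c : R) (F : R * E -> R) : 0 <= c -> 0 <= K ->
  (forall k, a k <= K * 4^-1 ^+ k.+2) -> (c + 2 * eps 0%N) * T `^ s^-1 <= K / 4 ->
  (forall t x, G t -> `|F (t, x)| <= c + `|rho (t, x) - density lr 0 (t, x)|) ->
  (LL_norm T s%:E p%:E F <= K%:E)%E.
Proof.
move=> c0 K0 aK cK FG.
pose c1 := c + 2 * eps 0%N; have c10 : 0 <= c1 by rewrite addr_ge0// mulr_ge0// ltW.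
(* Index 0 carries the constant part, so the profile of step k has index k + 1 and the hypothesis on
   [a] the exponent k + 2. *)
pose al k (t : R) := if k is k'.+1 then s_gam (Xs k') t else 1.
pose f k (x : E) := if k is k'.+1 then s_theta (Xs k') x else c1.
have cf k : cp (f k).
  case: k => [|k] /=; first exact: cp_cst.
  by apply: sm_cp; have [] := gs_ok1 (sc_good sch k).
apply: (@time_norm_le R T G mG G0 s K al (fun k => torus_norm p (f k))) => //.
- by case=> [|k]; [exact: cst_continuous|have [] := gs_ok1 (sc_good sch k)].
- by move=> k; exact: torus_norm_ge0.
- by move=> t; exact: Lnorm_ge0.
- case=> [|k] /=; last exact: le_trans (gs_theta (sc_good sch k)) (aK k).
  rewrite torus_norm_cst// ger0_norm// expr1 mulrC.
  by under eq_Rintegral do rewrite powR1; rewrite tmf_cst// mul1r ger0_norm// mulrC.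
- move=> t Gt; have [m hm] := lim_density_le eps0 epsS sch Gt; exists m.+1.
  apply: (Lnorm_le_sum p1 (l := index_enum 'I_m.+1) (c := fun j => al j t) (f := fun j => f j)) => // x.
  rewrite big_ord_recl /= normr1 mul1r (ger0_norm c10); apply: le_trans (FG t x Gt) _.
  by rewrite /c1 -addrA lerD2l; exact: hm.
Qed.

Section velocity.
Variables (D : (E -> R) -> E -> R) (i : 'I_d) (rr : R).
Hypotheses (smD : forall f, sm f -> sm (D f)) (rr1 : 1 <= rr).

Lemma velocity_Lnorm t m : G t -> (forall n, (m <= n)%N -> s_chi (Xs n) t = 0) ->
  (Lnorm mu rr%:E (fun x => (vel D i (t, x))%:E) <=
   (\sum_(k < m) `|s_chi (Xs k) t| * torus_norm rr (flow_field Xs D i k))%:E)%E.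
Proof.
move=> Gt hm.
apply: (Lnorm_le_sum rr1 (l := index_enum 'I_m) (c := fun j => s_chi (Xs j) t) (f := fun j => flow_field Xs D i j)).
- by move=> j; exact: (flow_cp sch).
- exact: (lim_velocity_le sch D i Gt hm).
Qed.

Lemma flow_norm k : torus_norm rr (flow_field Xs D i k) <= \sum_b torus_norm rr (D (s_w (Xs k) b)).
Proof.
have cw b : cp (D (s_w (Xs k) b)) by apply/sm_cp/smD; have [] := gs_oku (sc_good sch k) b.
have cb b : cp (fun x => (s_dir (Xs k) b == i)%:R * D (s_w (Xs k) b) x) by apply: cpM; [exact: cp_cst|].
apply: le_trans (torus_norm_sum rr1 (index_enum bool) cb) _; apply: ler_sum => b _.
rewrite torus_normZ//; case: eqP => _; rewrite ?normr1 ?mul1r// normr0 mul0r.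
exact: torus_norm_ge0.
Qed.

Lemma velocity_norm (sg K : R) : 1 <= sg -> 0 <= K ->
  (forall k, (\int[tmf T]_t `|s_chi (Xs k) t| `^ sg) `^ sg^-1 * torus_norm rr (flow_field Xs D i k) <= K * 4^-1 ^+ k.+1) ->
  (LL_norm T sg%:E rr%:E (vel D i) <= K%:E)%E.
Proof.
move=> sg1 K0 hK.
apply: (@time_norm_le R T G mG G0 sg K (fun k => s_chi (Xs k)) (fun k => torus_norm rr (flow_field Xs D i k))) => //.
- by move=> k; have [] := gs_oku (sc_good sch k) true.
- by move=> k; exact: torus_norm_ge0.
- by move=> t; exact: Lnorm_ge0.
- move=> t Gt; have [m hm] := G_still sch Gt; exists m.
  by apply: velocity_Lnorm => // n /hm[].
Qed.

Lemma velocity_norm_sup (K : R) : 0 <= K ->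
  (forall k t, `|s_chi (Xs k) t| * torus_norm rr (flow_field Xs D i k) <= K * 2^-1 ^+ k.+1) ->
  (LL_norm T +oo%E rr%:E (vel D i) <= K%:E)%E.
Proof.
move=> K0 hK; apply: (@time_sup_le R T G mG G0) => // [t|t Gt]; first exact: Lnorm_ge0.
have [m hm] := G_still sch Gt.
apply: le_trans (velocity_Lnorm Gt (m := m) _) _; first by move=> n /hm[].
rewrite lee_fin; apply: (@le_trans _ _ (\sum_(k < m) K * 2^-1 ^+ k.+1)); first by apply: ler_sum => k _.
by rewrite -mulr_sumr sum_half ler_piMr// gerBl exprn_ge0// invr_ge0.
Qed.

End velocity.

Lemma velocity_W1 i (K : R) : 0 <= K ->
  (forall k, (\int[tmf T]_t `|s_chi (Xs k) t| `^ st) `^ st^-1 *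
     (torus_norm q (flow_field Xs id i k) + \sum_l torus_norm q (flow_field Xs (pd l) i k)) <= K * 4^-1 ^+ k.+1) ->
  (Lnorm (time_measure T) st%:E (fun t => W1_norm q%:E (fun x => vel id i (t, x))
     (fun l x => vel (pd l) i (t, x))) <= K%:E)%E.
Proof.
move=> K0 hK.
have tn0 f : 0 <= torus_norm q f by exact: torus_norm_ge0.
apply: (@time_norm_le R T G mG G0 st K (fun k => s_chi (Xs k))
  (fun k => torus_norm q (flow_field Xs id i k) + \sum_l torus_norm q (flow_field Xs (pd l) i k))) => //.
- by move=> k; have [] := gs_oku (sc_good sch k) true.
- by move=> k; rewrite addr_ge0// sumr_ge0.
- move=> t; rewrite adde_ge0 ?Lnorm_ge0// sume_ge0// => l _; exact: Lnorm_ge0.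
- move=> t Gt; have [m hm] := G_still sch Gt; exists m.
  have hm' n : (m <= n)%N -> s_chi (Xs n) t = 0 by move=> /hm[].
  rewrite (_ : \sum_(k < m) _ = \sum_(k < m) `|s_chi (Xs k) t| * torus_norm q (flow_field Xs id i k) +
      \sum_l \sum_(k < m) `|s_chi (Xs k) t| * torus_norm q (flow_field Xs (pd l) i k)).
    rewrite EFinD; apply: leeD; first exact: (velocity_Lnorm (D := id) i (fun f sf => sf) q1 Gt hm').
    by rewrite -sumEFin; apply: lee_sum => l _; exact: (velocity_Lnorm (D := pd l) i (fun f sf => sm_pd l sf) q1 Gt hm').
  rewrite exchange_big -big_split; apply: eq_bigr => k _ /=.
  by rewrite mulrDr mulr_sumr.
Qed.

End limit_norms.


(** * Continuity in time of the limit density *)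

Section limit_distribution.
Variables (R : realType) (T : R) (d : nat) (p q r s st C : R).
Local Notation E := 'rV[R]_d.
Local Notation mu := (torus_measure R d).
Local Notation I f := (\int[mu]_x f x).
Variables (a eps : nat -> R) (rho0 : E -> R) (lr : nat -> seq (scal R d)) (lu lR : nat -> seq (vect R d))
  (v : nat -> vect R d) (e : nat -> R) (Xs : nat -> stp R d).
Hypotheses (T0 : 0 < T) (eps0 : forall n, 0 < eps n) (epsS : forall n, 2 * eps n.+1 <= eps n).
Hypothesis sch : scheme T p q r s st C a eps rho0 lr lu lR v e Xs.
Local Notation G := (good_times T (fun n => s_N (Xs n))).
Local Notation rho := (lim_density T lr Xs).

Definition pairing (n : nat) (t : R) (phi : E -> R) : R := I (fun x => density lr n (t, x) * phi x).

Definition lim_pairing (t : R) (phi : E -> R) : R := limn (fun n => pairing n t phi).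

Lemma pairing_cp n t phi : sm phi -> cp (fun x => density lr n (t, x) * phi x).
Proof. by move=> sp; apply: cpM; [exact: (density_cp sch)|exact: sm_cp]. Qed.

Lemma pairingS n t phi : sm phi -> pairing n.+1 t phi =
  s_gam (Xs n) t * I (fun x => s_theta (Xs n) x * phi x) +
  I (fun x => s_B (Xs n) t * s_h (Xs n) x * phi x) + pairing n t phi.
Proof.
move=> sp; have [[_ st1] [_ st2]] := (gs_ok1 (sc_good sch n), gs_ok2 (sc_good sch n)).
have c1 : cp (fun x => s_theta (Xs n) x * phi x) by apply: cpM; exact: sm_cp.
have c2 : cp (fun x => s_B (Xs n) t * s_h (Xs n) x * phi x).
  by apply: cpM; [apply: cpM; [exact: cp_cst|exact: sm_cp]|exact: sm_cp].
rewrite -(cpIZ _ c1) -cpID//; last by apply: cpM => //; exact: cp_cst.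
rewrite -cpID; last 2 first.
- by apply: cpD => //; apply: cpM => //; exact: cp_cst.
- exact: pairing_cp.
by apply: eq_Rintegral => x _; rewrite (densityS sch) /= !mulrDl mulrA.
Qed.

(** Valid at every time, also where the profile gam is large: the density profile is a derivative
    and is integrated by parts against phi, whence M1; the correction is uniformly small, whence
    M0. *)
Lemma pairing_close n t phi M0 M1 : sm phi -> 0 <= M1 -> (forall x, `|phi x| <= M0) -> (forall j x, `|pd j phi x| <= M1) ->
  0 <= t <= T -> `|pairing n.+1 t phi - pairing n t phi| <= (M0 + M1) * eps n.
Proof.
move=> sp M10 h0 h1 tT; rewrite pairingS// addrK.
have M00 : 0 <= M0 by exact: le_trans (h0 0).
have ee := e_le sch n.
have b1 := gs_weak (sc_good sch n) sp h1 t.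
have b2 : `|I (fun x => s_B (Xs n) t * s_h (Xs n) x * phi x)| <= eps n * M0.
  have [_ st2] := gs_ok2 (sc_good sch n).
  have cc : cp (fun x => s_B (Xs n) t * s_h (Xs n) x) by apply: cpM; [exact: cp_cst|exact: sm_cp].
  apply: le_trans (cp_abs (cpM cc (sm_cp sp))) _.
  apply: le_trans (cp_le_bounded cc (sm_cp sp) (fun x => le_trans (gs_corr (sc_good sch n) x tT) ee)) _.
  apply: ler_wpM2l; first exact: ltW.
  rewrite -[leRHS](torus_cst d); apply: cp_le => //; [exact/cp_norm/sm_cp|exact: cp_cst].
apply: le_trans (ler_normD _ _) _; rewrite mulrDl addrC; apply: lerD.
  by rewrite mulrC.
apply: (le_trans b1); rewrite mulrC; exact: ler_wpM2l.
Qed.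

Lemma lim_pairingP t phi M0 M1 : sm phi -> 0 <= M1 -> (forall x, `|phi x| <= M0) ->
  (forall j x, `|pd j phi x| <= M1) -> 0 <= t <= T ->
  (fun n => pairing n t phi) @ \oo --> lim_pairing t phi /\
  forall n, `|lim_pairing t phi - pairing n t phi| <= 2 * (M0 + M1) * eps n.
Proof.
move=> sp M10 h0 h1 tT.
have M00 : 0 <= M0 by exact: le_trans (h0 0).
have [|n _|l cl lb] := geometric_cvg eps0 epsS (x := fun n => pairing n t phi) (c := M0 + M1) (m := 0%N).
- exact: addr_ge0.
- exact: pairing_close.
- rewrite /lim_pairing (cvg_lim _ cl)//; split => // n; exact: lb.
Qed.

Lemma sm_bounds (phi : E -> R) : sm phi -> exists M0 M1 : R, [/\ 0 <= M1, forall x, `|phi x| <= M0 & forall j x, `|pd j phi x| <= M1].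
Proof.
move=> sp; have [M0 _ h0] := sm_bounded sp; have [M1 M10 h1] := sm_pd_bounded sp.
by exists M0, M1; split => //; exact: ltW.
Qed.

Lemma lim_pairing_cvg t phi : sm phi -> 0 <= t <= T -> (fun n => pairing n t phi) @ \oo --> lim_pairing t phi.
Proof. by move=> sp tT; have [M0 [M1 [M10 h0 h1]]] := sm_bounds sp; have [] := lim_pairingP sp M10 h0 h1 tT. Qed.

(** For t = 0 and t = T, where every increment vanishes, so that the end values of the initial
    approximation persist in the limit. *)
Lemma lim_pairing_still t phi : sm phi ->
  (forall n, s_gam (Xs n) t = 0 /\ s_B (Xs n) t = 0) ->
  lim_pairing t phi = I (fun x => density lr 0 (t, x) * phi x).
Proof.
move=> sp h; apply/cvg_lim => //; apply: cvg_near_cst; exists 0%N => // n _ /=.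
elim: n => [|n <-] //; rewrite pairingS// (h n).1 (h n).2 mul0r add0r.
rewrite -[RHS]add0r; congr (_ + _); rewrite -[RHS](torus_cst d).
by apply: eq_Rintegral => x _; rewrite !mul0r.
Qed.

Lemma lim_pairing_dist t : 0 <= t <= T -> distribution_torus (lim_pairing t).
Proof.
move=> tT; split.
  move=> b phi psi /smooth_torus_sm sp /smooth_torus_sm sq.
  have spq : sm (fun x => b * phi x + psi x) by apply: smD => //; apply: smM => //; exact: sm_cst.
  apply/cvg_lim => //.
  have -> : (fun n => pairing n t (fun x => b * phi x + psi x)) =
            (fun n => b * pairing n t phi + pairing n t psi).
    apply/funext => n; rewrite /pairing -cpIZ -?cpID; try exact: pairing_cp.
      by apply: eq_Rintegral => x _; rewrite mulrDr mulrCA.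
    by apply: cpM; [exact: cp_cst|exact: pairing_cp].
  by apply: cvgD; [apply: cvgMr|]; exact: lim_pairing_cvg.
have [L [L0 hL]] : exists L : R, 0 <= L /\ forall x, `|density lr 0 (t, x)| <= L.
  have [L L0 hL] := periodic_bounded (density_cp sch 0 t).1 (density_cp sch 0 t).2.
  by exists L; split => //; exact: le_trans (hL 0).
(* The order is 1, and 4 eps 0 comes from 2 (M0 + M1) eps 0 with M0 = M1 = M. *)
exists 1%N, (L + 4 * eps 0%N) => phi M /smooth_torus_sm sp hM.
have h0 x : `|phi x| <= M by exact: (hM [::]).
have h1 j x : `|pd j phi x| <= M by exact: (hM [:: j]).
have M0 : 0 <= M by exact: le_trans (h0 0).
have [_ /(_ 0%N) h] := lim_pairingP sp M0 h0 h1 tT.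
have h2 : `|pairing 0 t phi| <= L * M.
  apply: le_trans (cp_abs (pairing_cp 0 t sp)) _.
  apply: le_trans (cp_le_bounded (density_cp sch 0 t) (sm_cp sp) hL) _.
  apply: ler_wpM2l => //; rewrite -[leRHS](torus_cst d); apply: cp_le => //; [exact/cp_norm/sm_cp|exact: cp_cst].
have := ler_normD (lim_pairing t phi - pairing 0 t phi) (pairing 0 t phi).
rewrite subrK; move: h h2; lra.
Qed.

Lemma pairing_cont n phi : sm phi -> continuous (fun t : R => pairing n t phi).
Proof.
move=> sp.
have -> : (fun t : R => pairing n t phi) = fun t => \sum_(w <- lr n) w.1 t * I (fun x => w.2 x * phi x).
  apply/funext => t; rewrite /pairing /density; have := sc_okr sch n.
  elim: (lr n) => [_|w l IH [[cw sw] /[dup] ol /IH h]].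
    rewrite big_nil -[RHS](torus_cst d); apply: eq_Rintegral => x _; by rewrite big_nil mul0r.
  rewrite big_cons -h.
  have c1 : cp (fun x => w.2 x * phi x) by apply: cpM; exact: sm_cp.
  have c2 : cp (fun x => (\sum_(w <- l) w.1 t * w.2 x) * phi x).
    apply: cpM; last exact: sm_cp.
    split; first by apply: cont_every; apply: everyW ol => z [cz sz]; apply: contM; [exact: cst_continuous|exact: sm_cont].
    by apply: periodic_every; apply: everyW ol => z [cz [pz _]] x k /=; rewrite pz.
  rewrite -(cpIZ _ c1) -cpID//; last by apply: cpM => //; exact: cp_cst.
  by apply: eq_Rintegral => x _; rewrite big_cons /= mulrDl mulrA.
apply: cont_every; apply: everyW (sc_okr sch n) => w [cw _].
by apply: contM => //; exact: cst_continuous.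
Qed.

Lemma lim_pairing_cont phi : sm phi -> {within `[0, T], continuous (lim_pairing ^~ phi)}.
Proof.
move=> sp; have [M0 [M1 [M10 h0 h1]]] := sm_bounds sp.
(* the projection of the line onto [0, T] *)
pose cl (t : R) : R := (`|t| + -1 * `|t - T| + T) / 2.
have ccl : continuous cl.
  apply: contM; last exact: cst_continuous.
  apply: contD; last exact: cst_continuous.
  apply: contD; first by apply: cont_norm => z; exact: cvg_id.
  apply: contM; first exact: cst_continuous.
  by apply: cont_norm; exact: cont_addrR.
have clT t : 0 <= cl t <= T.
  have two : 0 < (2 : R) by [].
  rewrite /cl mulN1r divr_ge0//=; last by have := ler_normB t T; rewrite (ger0_norm (ltW T0)); lra.
  rewrite ler_pdivrMr//; have := ler_normD (t - T) T; rewrite subrK (ger0_norm (ltW T0)); lra.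
have clE t : t \in `[0, T]%classic -> lim_pairing (cl t) phi = lim_pairing t phi.
  rewrite inE /= in_itv /= => /andP[t0 tT].
  suff -> : cl t = t by [].
  rewrite /cl mulN1r ger0_norm// distrC ger0_norm ?subr_ge0//; lra.
apply: subspace_eq_continuous clE _; apply: continuous_subspaceT.
apply: (@continuous_uniform_limit _ _ (fun n t => pairing n (cl t) phi) _ (fun n => 2 * (M0 + M1) * eps n)).
- by move=> n; exact: (cont_comp ccl (pairing_cont (n := n) sp)).
- exact: cvg_eps.
- by move=> n t; apply: (lim_pairingP sp M10 h0 h1 (clT t)).2.
Qed.

(** At a good time the densities converge uniformly in x, so the limit of the pairings is the
    pairing with the limit. *)
Lemma lim_pairing_good t phi : G t -> sm phi -> lim_pairing t phi = I (fun x => rho (t, x) * phi x).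
Proof.
move=> Gt sp; have cr := lim_density_cp eps0 epsS sch Gt.
have [M0 [_ [_ h0 _]]] := sm_bounds sp.
have M00 : 0 <= M0 by exact: le_trans (h0 0).
have [m hm] := lim_densityP eps0 epsS sch Gt.
apply/cvg_lim => //.
have c0 := cvg_eps eps0 epsS (2 * M0).
apply/cvgrPdist_le => x x0.
have [N _ hN] := (cvgrPdist_le _ _).1 c0 _ x0.
exists (maxn N m) => // n /=; rewrite geq_max => /andP[Nn mn].
have := hN n Nn; rewrite /= sub0r normrN; apply: le_trans.
apply: le_trans (ler_norm _).
have cn := density_cp sch n t.
have cd : cp (fun x => rho (t, x) - density lr n (t, x)).
  rewrite (_ : (fun x => _) = fun x => rho (t, x) + -1 * density lr n (t, x)).
    by apply: cpD => //; apply: cpM => //; exact: cp_cst.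
  by apply/funext => y; rewrite mulN1r.
have -> : I (fun x => rho (t, x) * phi x) - pairing n t phi = I (fun x => (rho (t, x) - density lr n (t, x)) * phi x).
  apply/eqP; rewrite subr_eq; apply/eqP; rewrite -cpID; last 2 first.
  - by apply: cpM => //; exact: sm_cp.
  - exact: pairing_cp.
  by apply: eq_Rintegral => y _; rewrite -mulrDl subrK.
apply: le_trans (cp_abs (cpM cd (sm_cp sp))) _.
apply: le_trans (cp_le_bounded cd (sm_cp sp) (fun x => (hm x).2 n mn)) _.
rewrite [leRHS]mulrAC; apply: ler_wpM2l; first by rewrite mulr_ge0// ltW.
rewrite -[leRHS](torus_cst d); apply: cp_le => //; [exact/cp_norm/sm_cp|exact: cp_cst].
Qed.

Lemma distributional_limit : distributional_representative T rho lim_pairing.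
Proof.
split.
- by move=> t; rewrite in_itv; exact: lim_pairing_dist.
- by move=> phi /smooth_torus_sm; exact: lim_pairing_cont.
- exists (~` G); split.
  + by apply: measurableC; exact: (measurable_G sch).
  + exact: (G_full eps0 epsS sch).
  + move=> t /= h Gt; apply: h; split; first by apply: cp_integrable; exact: (lim_density_cp eps0 epsS sch Gt).
    by move=> phi /smooth_torus_sm; exact: lim_pairing_good.
Qed.

End limit_distribution.


Section spacetime_periodic.
Variables (R : realType) (T : R) (d : nat).
Hypothesis T0 : 0 < T.
Local Notation E := 'rV[R]_d.
Local Notation mu := (torus_measure R d).
Local Notation I f := (\int[mu]_x f x).
Local Notation st := (tmf T \x torus_measure R d)%E.

Definition sp (f : R * E -> R) := continuous f /\ forall t, Zperiodic (fun x => f (t, x)).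

Lemma spM f g : sp f -> sp g -> sp (fun z => f z * g z).
Proof. by move=> [cf pf] [cg pg]; split; [exact: contM|move=> t x k; rewrite pf pg]. Qed.

Lemma spD f g : sp f -> sp g -> sp (fun z => f z + g z).
Proof. by move=> [cf pf] [cg pg]; split; [exact: contD|move=> t x k; rewrite pf pg]. Qed.

Lemma sp_cst c : sp (fun=> c).
Proof. by split => //; exact: cst_continuous. Qed.

Lemma sp_norm f : sp f -> sp (fun z => `|f z|).
Proof. by move=> [cf pf]; split; [exact: cont_norm|move=> t x k; rewrite pf]. Qed.

Lemma sp_sum A (l : seq A) (F : A -> R * E -> R) : every (fun w => sp (F w)) l -> sp (fun z => \sum_(w <- l) F w z).
Proof.
move=> h; split; first by apply: cont_every; apply: everyW h => w [].
by move=> t; apply: (periodic_every (F := fun w x => F w (t, x))); apply: everyW h => w [_]; apply.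
Qed.

Lemma sp_tensor (z : scal R d) : ok z -> sp (fun y => z.1 y.1 * z.2 y.2).
Proof. by move=> [cz [pz sz]]; split; [apply: cont_tensor => //; exact: sm_cont|move=> t x k /=; rewrite pz]. Qed.

Lemma sp_integrable f : sp f -> st.-integrable setT (EFin \o f).
Proof. by move=> [cf pf]; exact: integrable_spacetime. Qed.

Lemma spI f : sp f -> \int[st]_z f z = \int[tmf T]_t I (fun x => f (t, x)).
Proof. by move=> [cf pf]; exact: (spacetime12 T cf pf). Qed.

Lemma spI_D f g : sp f -> sp g -> \int[st]_z (f z + g z) = \int[st]_z f z + \int[st]_z g z.
Proof. by move=> sf sg; rewrite RintegralD//; exact: sp_integrable. Qed.

Lemma spI_Z c f : sp f -> \int[st]_z (c * f z) = c * \int[st]_z f z.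
Proof. by move=> sf; rewrite RintegralZl//; exact: sp_integrable. Qed.

Lemma spI_cst (c : R) : \int[st]_z (c : R) = c * T.
Proof.
rewrite (spI (sp_cst c)) -(tmf_cst T0); apply: eq_Rintegral => t _; exact: torus_cst.
Qed.

Lemma spI_sum A (l : seq A) (F : A -> R * E -> R) : every (fun w => sp (F w)) l ->
  \int[st]_z (\sum_(w <- l) F w z) = \sum_(w <- l) \int[st]_z F w z.
Proof.
elim: l => [_|w l IH [sw sl]].
  by rewrite big_nil -[RHS](mul0r T) -spI_cst; apply: eq_Rintegral => z _; rewrite big_nil.
rewrite big_cons -(IH sl) -spI_D//; last exact: sp_sum.
by apply: eq_Rintegral => z _; rewrite big_cons.
Qed.

Lemma spI_tensor (z : scal R d) : ok z ->
  \int[st]_y `|z.1 y.1 * z.2 y.2| = (\int[tmf T]_t `|z.1 t|) * I (fun x => `|z.2 x|).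
Proof.
move=> okz; rewrite (spI (sp_norm (sp_tensor okz))) mulrC; have [cz sz] := okz.
rewrite -tmfZ//; last exact: cont_norm.
apply: eq_Rintegral => t _ /=; rewrite mulrC -cpIZ; last exact/cp_norm/sm_cp.
by apply: eq_Rintegral => x _; rewrite normrM.
Qed.

Lemma spI_curve (z : scal R d) (psi : R * E -> R) : ok z -> sp psi ->
  \int[st]_y (z.1 y.1 * z.2 y.2 * psi y) = \int[tmf T]_t (z.1 t * I (fun x => z.2 x * psi (t, x))).
Proof.
move=> okz spsi; rewrite (spI (spM (sp_tensor okz) spsi)); have [cz sz] := okz.
apply: eq_Rintegral => t _ /=; rewrite -cpIZ.
  by apply: eq_Rintegral => x _; rewrite mulrA.
apply: cpM; first exact: sm_cp.
by split; [apply: continuous_pairl; exact: spsi.1|exact: spsi.2].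
Qed.

Lemma good_times_spacetime (G : set R) : measurable (G : set (measurableTypeR R)) -> tmf T (~` G) = 0%E ->
  measurable [set z : measurableTypeR R * E | G z.1] /\ st (~` [set z : measurableTypeR R * E | G z.1]) = 0%E.
Proof.
move=> mG G0.
have mD : measurable [set z : measurableTypeR R * E | G z.1].
  by rewrite -[X in measurable X]setTI; exact: (measurable_fst measurableT _ mG).
split => //.
have -> : ~` [set z : measurableTypeR R * E | G z.1] = (~` G) `*` setT by apply/seteqP; split => z //= [].
rewrite product_measure1E//; last exact: measurableC.
by rewrite [X in (X * _)%E](_ : _ = 0%E) ?mul0e.
Qed.

End spacetime_periodic.

(** * The transport equation in the limit *)

Section limit_transport.
Variables (R : realType) (T : R) (d : nat) (p q r s st C : R).
Local Notation E := 'rV[R]_d.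
Local Notation mu := (torus_measure R d).
Local Notation I f := (\int[mu]_x f x).
Variables (a eps : nat -> R) (rho0 : E -> R) (lr : nat -> seq (scal R d)) (lu lR : nat -> seq (vect R d))
  (v : nat -> vect R d) (e : nat -> R) (Xs : nat -> stp R d).
Hypotheses (T0 : 0 < T) (C0 : 0 <= C) (eps0 : forall n, 0 < eps n) (epsS : forall n, 2 * eps n.+1 <= eps n).
Hypothesis sch : scheme T p q r s st C a eps rho0 lr lu lR v e Xs.
Local Notation G := (good_times T (fun n => s_N (Xs n))).
Local Notation rho := (lim_density T lr Xs).
Local Notation vel := (lim_velocity T lu Xs).

Lemma velocity_sm (D : (E -> R) -> E -> R) i n t : (forall f, sm f -> sm (D f)) ->
  sm (fun x => velocity lu D i n (t, x)).
Proof.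
move=> sD; rewrite /velocity; have := sc_oku sch n.
elim: (lu n) => [_|w l IH [[cw sw] /IH h]].
  by rewrite (_ : (fun x => _) = fun=> 0); [exact: sm_cst|apply/funext => x; rewrite big_nil].
rewrite (_ : (fun x => _) = fun x => (w.2 == i)%:R * (w.1.1 t * D w.1.2 x) +
    \sum_(w <- l) (w.2 == i)%:R * (w.1.1 t * D w.1.2 x)); last by apply/funext => x; rewrite big_cons.
apply: smD => //; apply: smM; first exact: sm_cst.
by apply: smM; [exact: sm_cst|exact: sD].
Qed.

Lemma pd_velocity l i n t : pd l (fun x => velocity lu id i n (t, x)) = (fun x => velocity lu (pd l) i n (t, x)).
Proof.
rewrite /velocity; have := sc_oku sch n.
have sm0 (L : seq (vect R d)) : every (fun v => ok v.1) L ->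
    sm (fun x => \sum_(w <- L) (w.2 == i)%:R * (w.1.1 t * id w.1.2 x)).
  elim: L => [_|w L IH [[cw sw] /IH h]].
    by rewrite (_ : (fun x => _) = fun=> 0); [exact: sm_cst|apply/funext => x; rewrite big_nil].
  rewrite (_ : (fun x => _) = fun x => (w.2 == i)%:R * (w.1.1 t * id w.1.2 x) +
    \sum_(w <- L) (w.2 == i)%:R * (w.1.1 t * id w.1.2 x)); last by apply/funext => x; rewrite big_cons.
  apply: smD => //; apply: smM; first exact: sm_cst.
  by apply: smM; [exact: sm_cst|].
elim: (lu n) => [_|w L IH [[cw sw] okL]]; apply/funext => x.
  rewrite big_nil (_ : (fun x => _) = fun=> 0) ?pd_cst//.
  by apply/funext => y; rewrite big_nil.
rewrite big_cons -(congr1 (fun f => f x) (IH okL)).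
rewrite (_ : (fun x => _) = fun x => ((w.2 == i)%:R * w.1.1 t) * w.1.2 x +
    \sum_(w <- L) (w.2 == i)%:R * (w.1.1 t * id w.1.2 x)); last by apply/funext => y; rewrite big_cons mulrA.
rewrite (pdD l x) ?pdZ ?mulrA//; last exact: sm0.
by apply: smM => //; exact: sm_cst.
Qed.

Lemma weak_gradient t i l : G t -> weak_partial l (fun x => vel id i (t, x)) (fun x => vel (pd l) i (t, x)).
Proof.
move=> Gt; have [m hm] := G_still sch Gt.
have hm' n : (m <= n)%N -> s_chi (Xs n) t = 0 by move=> /hm[].
have E1 : (fun x => vel id i (t, x)) = (fun x => velocity lu id i m (t, x)).
  by apply/funext => x; exact: (lim_velocityE sch id i Gt hm' x (leqnn m)).
have E2 : (fun x => vel (pd l) i (t, x)) = (fun x => velocity lu (pd l) i m (t, x)).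
  by apply/funext => x; exact: (lim_velocityE sch (pd l) i Gt hm' x (leqnn m)).
rewrite E1 E2.
have s1 : sm (fun x => velocity lu id i m (t, x)) by exact: velocity_sm.
split.
- exact/cp_integrable/sm_cp.
- by apply/cp_integrable/sm_cp; apply: velocity_sm => f; exact: sm_pd.
- move=> phi /smooth_torus_sm sphi; have := torus_ibp l s1 sphi.
  by rewrite pd_velocity.
Qed.

Lemma velocity_dot n z (g : 'I_d -> R) : \sum_i velocity lu id i n z * g i =
  \sum_(w <- lu n) w.1.1 z.1 * w.1.2 z.2 * g w.2.
Proof.
rewrite /velocity; under eq_bigr do rewrite mulr_suml.
rewrite exchange_big; apply: eq_bigr => w _; rewrite (bigD1 w.2)//= eqxx mul1r.
rewrite big1 ?addr0// => i iw; rewrite eq_sym (negbTE iw) !mul0r //.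
Qed.

Lemma velocity_div n t phi : sm phi -> I (fun x => \sum_i velocity lu id i n (t, x) * pd i phi x) = 0.
Proof.
move=> sphi; elim: n => [|n IH].
  rewrite -[RHS](torus_cst d); apply: eq_Rintegral => x _; rewrite velocity_dot (sc_lu0 sch).
  by rewrite big_nil.
have sw b := gs_oku (sc_good sch n) b.
have c1 : cp (fun x => s_w (Xs n) true x * pd (s_dir (Xs n) true) phi x + s_w (Xs n) false x * pd (s_dir (Xs n) false) phi x).
  by apply: cpD; apply: cpM; try (by apply: sm_cp; have [] := sw true); try (by apply: sm_cp; have [] := sw false); apply: sm_cp; exact: sm_pd.
have c2 : cp (fun x => \sum_i velocity lu id i n (t, x) * pd i phi x).
  by apply: cp_sum => i; apply: cpM; [apply: sm_cp; exact: velocity_sm|apply: sm_cp; exact: sm_pd].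
transitivity (I (fun x => s_chi (Xs n) t * (s_w (Xs n) true x * pd (s_dir (Xs n) true) phi x +
    s_w (Xs n) false x * pd (s_dir (Xs n) false) phi x) + \sum_i velocity lu id i n (t, x) * pd i phi x)).
  apply: eq_Rintegral => x _; rewrite !velocity_dot (sc_lu sch) !big_cons /= !addrA; congr (_ + _).
  by rewrite mulrDr !mulrA.
rewrite cpID//; last by apply: cpM => //; exact: cp_cst.
by rewrite IH addr0 cpIZ// (gs_div (sc_good sch n) sphi) mulr0.
Qed.

Lemma limit_div_free t : G t -> div_free (fun x => \row_i vel id i (t, x)).
Proof.
move=> Gt; have [m hm] := G_still sch Gt.
have hm' n : (m <= n)%N -> s_chi (Xs n) t = 0 by move=> /hm[].
have E1 i x : (\row_i vel id i (t, x)) 0 i = velocity lu id i m (t, x).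
  by rewrite mxE; exact: (lim_velocityE sch id i Gt hm' x (leqnn m)).
split.
- move=> i; under eq_fun do rewrite E1.
  by apply: (@cp_integrable _ _ (fun x => velocity lu id i m (t, x))); apply: sm_cp; exact: velocity_sm.
- move=> phi /smooth_torus_sm sphi; rewrite -[RHS](velocity_div m t sphi).
  by apply: eq_Rintegral => x _; apply: eq_bigr => i _; rewrite E1.
Qed.

(** The tensors by which the product of density and velocity grows at step n, kept in one list for
    the identities and the estimates. *)
Definition new_products n : seq (vect R d) :=
  [seq tprod z (s_u (Xs n) b) | z <- lr n, b <- index_enum bool] ++
  [seq tprod (s_rho1 (Xs n)) w | w <- lu n] ++ [seq tprod (s_rho2 (Xs n)) w | w <- lu n] ++
  [seq tprod (s_rho1 (Xs n)) (s_u (Xs n) b) | b <- index_enum bool] ++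
  [seq tprod (s_rho2 (Xs n)) (s_u (Xs n) b) | b <- index_enum bool].

Lemma new_products_sum n (F : vect R d -> R) : \sum_(w <- new_products n) F w =
  \sum_(z <- lr n) \sum_b F (tprod z (s_u (Xs n) b)) +
  \sum_(w <- lu n) (F (tprod (s_rho1 (Xs n)) w) + F (tprod (s_rho2 (Xs n)) w)) +
  \sum_b (F (tprod (s_rho1 (Xs n)) (s_u (Xs n) b)) + F (tprod (s_rho2 (Xs n)) (s_u (Xs n) b))).
Proof. by rewrite !big_cat /= big_allpairs_dep !big_map !big_split /= !addrA. Qed.

Lemma ok_new_products n : every (fun w => ok w.1) (new_products n).
Proof.
have okb b := gs_oku (sc_good sch n) b; have ok1 := gs_ok1 (sc_good sch n); have ok2 := gs_ok2 (sc_good sch n).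
have okr := sc_okr sch n; have oku := sc_oku sch n.
have H z (l : seq (vect R d)) : ok z -> every (fun w => ok w.1) l -> every (fun w => ok w.1) [seq tprod z w | w <- l].
  by move=> okz; rewrite every_map; apply: everyW => w; exact: ok_tprod.
have Hb z (l : seq bool) : ok z -> every (fun w => ok w.1) [seq tprod z (s_u (Xs n) b) | b <- l].
  by move=> okz; rewrite every_map; apply: every_all => b; exact: ok_tprod.
rewrite !every_cat; split; last by split; [exact: H|split; [exact: H|split; exact: Hb]].
by elim: (lr n) okr => [|z l IH] //= [okz /IH okl]; rewrite every_cat; split; [exact: Hb|].
Qed.

Lemma new_products_size n : \sum_(w <- new_products n) tsize T w <= C * (tsize T (v n) + e n).
Proof. by rewrite new_products_sum; exact: (gs_prod (sc_good sch n)). Qed.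

Section test_function.
Variable phi : R * E -> R.
Hypothesis tphi : test_function T phi.
Local Notation st' := (tmf T \x torus_measure R d)%E.
Local Notation dt := ('D_(1, 0) phi).
Local Notation dx i := ('D_(0, basis_vec R i) phi).

Let sphi : smooth phi. Proof. by case: tphi. Qed.
Let pphi t : Zperiodic (fun x => phi (t, x)). Proof. by case: tphi => _ h _; exact: h. Qed.
Let sD w : sp ('D_w phi).
Proof.
split; first by have [] := smooth_iter [:: w] sphi [::].
by move=> t; exact: (zper_derive w pphi).
Qed.

Definition flux n (z : R * E) : R :=
  density lr n z * (dt z + \sum_i velocity lu id i n z * dx i z).

Lemma fluxE n z : flux n z = \sum_(w <- lr n) (w.1 z.1 * w.2 z.2 * dt z) +
  \sum_(w <- lr n) \sum_(x <- lu n) ((tprod w x).1.1 z.1 * (tprod w x).1.2 z.2 * dx x.2 z).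
Proof.
rewrite /flux velocity_dot mulrDr /density !mulr_suml; congr (_ + _).
by apply: eq_bigr => w _; rewrite mulr_sumr; apply: eq_bigr => x _ /=; rewrite mulrA mulrACA.
Qed.

Lemma flux_sp n : sp (flux n).
Proof.
apply: spM; first by split; [exact: (density_cont sch)|move=> t; exact: (density_per sch)].
apply: spD; first exact: sD.
apply: sp_sum; apply: every_all => i; apply: spM; last exact: sD.
by split; [exact: (velocity_cont sch)|move=> t; exact: (velocity_per sch)].
Qed.

Lemma T2_spacetime w : ok w.1 ->
  \int[st']_z (w.1.1 z.1 * w.1.2 z.2 * dx w.2 z) = T2 T (fun t x => phi (t, x)) w.
Proof.
move=> okw; rewrite (spI_curve T okw (sD (0, basis_vec R w.2))) /T2.
apply: eq_Rintegral => t _.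
have -> // : pd w.2 (fun x => phi (t, x)) = (fun x => dx w.2 (t, x)).
exact: pd_slice.
Qed.

Lemma flux_integral n : \int[st']_z flux n z =
  \sum_(w <- lR n) T2 T (fun t x => phi (t, x)) w - I (fun x => rho0 x * phi (0, x)).
Proof.
have tc := test_curve_of tphi.
have := sc_weak sch n tc => h; apply/eqP; rewrite eq_sym subr_eq -h; apply/eqP; congr (_ + _).
have okr := sc_okr sch n; have oku := sc_oku sch n.
transitivity (\int[st']_z (\sum_(w <- lr n) (w.1 z.1 * w.2 z.2 * dt z) +
  \sum_(w <- lr n) \sum_(x <- lu n) ((tprod w x).1.1 z.1 * (tprod w x).1.2 z.2 * dx x.2 z))); last first.
  by apply: eq_Rintegral => z _; rewrite fluxE.
have s1 : every (fun w => sp (fun z => w.1 z.1 * w.2 z.2 * dt z)) (lr n).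
  by apply: everyW okr => w okw; apply: spM; [exact: sp_tensor|exact: sD].
have s2 w : ok w -> every (fun x : vect R d => sp (fun z => (tprod w x).1.1 z.1 * (tprod w x).1.2 z.2 * dx x.2 z)) (lu n).
  by move=> okw; apply: everyW oku => x okx; apply: spM; [apply: sp_tensor; exact: ok_tprod|exact: sD].
have s3 : every (fun w => sp (fun z => \sum_(x <- lu n) ((tprod w x).1.1 z.1 * (tprod w x).1.2 z.2 * dx x.2 z))) (lr n).
  by apply: everyW okr => w okw; apply: sp_sum; exact: s2.
rewrite spI_D; [|exact: sp_sum|exact: sp_sum]; rewrite spI_sum// spI_sum//; congr (_ + _).
  elim: (lr n) okr => [|w l IH]; first by rewrite !big_nil.
  by move=> [okw /IH h']; rewrite !big_cons h' spI_curve//; exact: sD.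
elim: (lr n) okr => [|w l IH]; first by rewrite !big_nil.
move=> [okw /IH h']; rewrite !big_cons h'; congr (_ + _).
rewrite (spI_sum T0 (s2 _ okw)).
elim: (lu n) oku => [|x l' IH']; first by rewrite !big_nil.
move=> [okx /IH' h'']; rewrite !big_cons h''; congr (_ + _).
by rewrite -(T2_spacetime (ok_tprod okw okx)).
Qed.

Lemma flux_step n z : flux n.+1 z - flux n z =
  (s_gam (Xs n) z.1 * s_theta (Xs n) z.2 + s_B (Xs n) z.1 * s_h (Xs n) z.2) * dt z +
  \sum_(w <- new_products n) (w.1.1 z.1 * w.1.2 z.2 * dx w.2 z).
Proof.
rewrite new_products_sum /flux !velocity_dot (sc_lu sch) !big_cons (densityS sch) /=.
set A := density lr n z; set U := \sum_(w <- lu n) _.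
set r1 := s_gam _ _ * _; set r2 := s_B _ _ * _.
set u1 := s_chi _ _ * s_w _ true _ * _; set u2 := s_chi _ _ * s_w _ false _ * _.
have -> : \sum_(w <- lr n) \sum_b
    ((tprod w (s_u (Xs n) b)).1.1 z.1 * (tprod w (s_u (Xs n) b)).1.2 z.2 * dx (tprod w (s_u (Xs n) b)).2 z) =
    A * (u1 + u2).
  rewrite /A /density mulr_suml; apply: eq_bigr => w _; rewrite big_bool /= mulrDr /u1 /u2.
  by congr (_ + _); rewrite !mulrA; congr (_ * _); rewrite -!mulrA; congr (_ * _); rewrite mulrCA.
have -> : \sum_(w <- lu n) ((tprod (s_rho1 (Xs n)) w).1.1 z.1 * (tprod (s_rho1 (Xs n)) w).1.2 z.2 * dx (tprod (s_rho1 (Xs n)) w).2 z +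
    (tprod (s_rho2 (Xs n)) w).1.1 z.1 * (tprod (s_rho2 (Xs n)) w).1.2 z.2 * dx (tprod (s_rho2 (Xs n)) w).2 z) = (r1 + r2) * U.
  rewrite /U mulr_sumr; apply: eq_bigr => w _ /=; rewrite mulrDl /r1 /r2.
  by congr (_ + _); rewrite !mulrA; congr (_ * _); rewrite -!mulrA; congr (_ * _); rewrite mulrCA.
rewrite big_bool /=.
have aux (gm B ch th h w1 w2 g1 g2 x y D : R) :
    (gm * th + B * h + x) * (D + (ch * w1 * g1 + (ch * w2 * g2 + y))) - x * (D + y) =
    (gm * th + B * h) * D + (x * (ch * w1 * g1 + ch * w2 * g2) + (gm * th + B * h) * y +
    (gm * ch * (th * w1) * g1 + B * ch * (h * w1) * g1 + (gm * ch * (th * w2) * g2 + B * ch * (h * w2) * g2))) by ring.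
exact: aux.
Qed.

Definition flux_bound (M0 M1 : R) n (z : R * E) : R :=
  M0 * (`|s_gam (Xs n) z.1 * s_theta (Xs n) z.2| + eps n) +
  M1 * \sum_(w <- new_products n) `|w.1.1 z.1 * w.1.2 z.2|.

Let sp_products n : every (fun w : vect R d => sp (fun z => `|w.1.1 z.1 * w.1.2 z.2|)) (new_products n).
Proof. by apply: everyW (ok_new_products n) => w okw; exact/sp_norm/sp_tensor. Qed.

Let sp_theta n : sp (fun z => `|s_gam (Xs n) z.1 * s_theta (Xs n) z.2| + eps n).
Proof.
apply: spD; last exact: sp_cst.
exact: (sp_norm (sp_tensor (gs_ok1 (sc_good sch n)))).
Qed.

Lemma flux_bound_sp M0 M1 n : sp (flux_bound M0 M1 n).
Proof. by apply: spD; apply: spM; [exact: sp_cst|exact: sp_theta|exact: sp_cst|exact: sp_sum]. Qed.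

Lemma flux_close M0 M1 n z : 0 <= z.1 <= T -> 0 <= M0 -> (forall z, 0 <= z.1 <= T -> `|dt z| <= M0) ->
  (forall i z, 0 <= z.1 <= T -> `|dx i z| <= M1) ->
  `|flux n.+1 z - flux n z| <= flux_bound M0 M1 n z.
Proof.
move=> zT M00 h0 h1; rewrite flux_step; apply: le_trans (ler_normD _ _) _; apply: lerD.
  rewrite normrM mulrC; apply: ler_pM => //; first exact: h0.
  apply: le_trans (ler_normD _ _) _; rewrite lerD2l.
  exact: le_trans (gs_corr (sc_good sch n) z.2 zT) (e_le sch n).
apply: le_trans (ler_norm_sum _ _ _) _; rewrite mulr_sumr; apply: ler_sum => w _.
by rewrite normrM mulrC; apply: ler_wpM2r => //; exact: h1.
Qed.

Lemma flux_bound_ge0 M0 M1 n z : 0 <= M0 -> 0 <= M1 -> 0 <= flux_bound M0 M1 n z.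
Proof.
move=> M00 M10; apply: addr_ge0; apply: mulr_ge0 => //; first by rewrite addr_ge0// ltW.
exact: sumr_ge0.
Qed.

(** The new products have total size C (tsize (v n) + e n), the price of removing the error v n,
    which is at most eps n once the errors of the start are used up. *)
Lemma flux_bound_integral M0 M1 n : 0 <= M0 -> 0 <= M1 ->
  \int[st']_z flux_bound M0 M1 n z <= (M0 * (1 + T) + M1 * C) * eps n + M1 * C * tsize T (v n).
Proof.
move=> M00 M10; rewrite /flux_bound spI_D; last 2 first.
- by apply: spM; [exact: sp_cst|exact: sp_theta].
- by apply: spM; [exact: sp_cst|exact: sp_sum].
rewrite spI_Z; last exact: sp_theta.
rewrite spI_Z; last exact: sp_sum.
rewrite spI_D; [|exact: (sp_norm (sp_tensor (gs_ok1 (sc_good sch n))))|exact: sp_cst].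
rewrite (spI_cst d T0) (spI_sum T0 (sp_products n)).
rewrite (spI_tensor T (gs_ok1 (sc_good sch n))).
have -> : \sum_(w <- new_products n) \int[st']_z `|w.1.1 z.1 * w.1.2 z.2| = \sum_(w <- new_products n) tsize T w.
  elim: (new_products n) (ok_new_products n) => [|w l IH]; first by rewrite !big_nil.
  by move=> [okw /IH h]; rewrite !big_cons h (spI_tensor T okw).
have h1 := gs_L1 (sc_good sch n); have h2 := new_products_size n; have h3 := e_le sch n.
have {}h1 := ler_wpM2l M00 (le_trans h1 h3).
have {}h2 := ler_wpM2l M10 h2; have {}h3 := ler_wpM2l (mulr_ge0 M10 C0) h3.
have aux (m0 m1 c tt x y z w u : R) : m0 * x <= m0 * u -> m1 * y <= m1 * (c * (z + w)) -> m1 * c * w <= m1 * c * u ->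
    m0 * (x + u * tt) + m1 * y <= (m0 * (1 + tt) + m1 * c) * u + m1 * c * z by lra.
exact: aux h1 h2 h3.
Qed.

(** The product of density and velocity passes to the limit by summing the L^1 norms of its
    increments rather than by Hoelder, which also yields the integrability of the limit. The
    right-hand side converges because the remaining error tends to 0 in L^1. *)
Lemma limit_transport : let F z := rho z * (dt z + \sum_(i < d) (\row_i vel id i z) 0 i * dx i z) in
  st'.-integrable setT (EFin \o F) /\ \int[st']_z F z = - I (fun x => rho0 x * phi (0, x)).
Proof.
move=> F.
have [M0 M00 h0'] := bounded_slab 0 T (sD (1, 0)).1 (sD (1, 0)).2.
have /choice[Mi MiP] : forall i : 'I_d, exists M, 0 < M /\ forall (t : R) x, 0 <= t <= T -> `|dx i (t, x)| <= M.
  by move=> i; have [M M1 h] := bounded_slab 0 T (sD (0, basis_vec R i)).1 (sD (0, basis_vec R i)).2; exists M.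
pose M1 := \sum_i Mi i.
have Mi0 i : 0 <= Mi i by rewrite ltW//; case: (MiP i).
have M10 : 0 <= M1 by exact: sumr_ge0.
have h0 z : 0 <= z.1 <= T -> `|dt z| <= M0 by case: z => t x /= /h0'.
have h1 i z : 0 <= z.1 <= T -> `|dx i z| <= M1.
  case: z => t x /= tT; apply: le_trans ((MiP i).2 t x tT) _.
  by rewrite /M1 (bigD1 i)//= lerDl sumr_ge0.
have [N hN] := sc_size sch.
pose y n := \int[st']_z flux_bound M0 M1 n z.
pose K0 := M0 * (1 + T) + M1 * C + M1 * C.
have K00 : 0 <= K0 by rewrite /K0 !addr_ge0// ?mulr_ge0// ?addr_ge0// ltW.
have [|K K1 yK] := exists_weight_bound (y := y) (N := N) eps0 K00.
  move=> n Nn; apply: le_trans (flux_bound_integral n (ltW M00) M10) _.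
  rewrite /K0 [leRHS]mulrDl lerD2l; apply: ler_wpM2l; first exact: mulr_ge0.
  by case: (hN n Nn).
have [mG sG] := good_times_spacetime d (measurable_G sch) (G_full eps0 epsS sch).
(* At a good time the velocity is eventually constant in n, so only the density factor has to
   converge. *)
have Flim z : G z.1 -> (fun n => flux n z) @ \oo --> F z.
  case: z => t x /= Gt; have [m hm] := G_still sch Gt.
  have hm' n : (m <= n)%N -> s_chi (Xs n) t = 0 by move=> /hm[].
  have [k hk] := lim_densityP eps0 epsS sch Gt.
  pose c := dt (t, x) + \sum_(i < d) (\row_i vel id i (t, x)) 0 i * dx i (t, x).
  have cl : (fun n => density lr n (t, x) * c) @ \oo --> F (t, x) by apply: cvgMl; exact: (hk x).1.
  apply: cvg_trans cl; apply: near_eq_cvg; exists m => // n /= mn.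
  rewrite /flux /c; congr (_ * (_ + _)); apply: eq_bigr => i _; rewrite mxE.
  by rewrite (lim_velocityE sch id i Gt hm' x mn).
have mdx w : measurable_fun [set: measurableTypeR R * E] ('D_w phi) by apply: measurable_continuous_pair; exact: (sD w).1.
have mF : measurable_fun [set: measurableTypeR R * E] F.
  apply: measurable_funM; first exact: (measurable_lim_density eps0 epsS sch).
  apply: measurable_funD; first exact: mdx.
  apply: measurable_sum => i; apply: measurable_funM; last exact: mdx.
  under eq_fun do rewrite mxE.
  by apply: (measurable_lim_velocity sch).
have yS n : \sum_(k < n) y k <= K * (2 * eps 0%N).
  apply: (@le_trans _ _ (K * \sum_(k < n) eps k)).
    by rewrite mulr_sumr; apply: ler_sum => k _; exact: yK.
  by apply: ler_wpM2l => //; have := eps_sum eps0 epsS n 0; under eq_bigr do rewrite add0n.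
have [iF cF] := integral_limit mG sG (fun n => sp_integrable T (flux_sp n))
  (fun n => sp_integrable T (flux_bound_sp M0 M1 n)) mF (fun n z => flux_bound_ge0 n z (ltW M00) M10)
  (fun n z Gz => flux_close n (G_itv Gz) (ltW M00) h0 h1) Flim yS.
split => //; apply: cvg_unique cF _ => //.
have tc := test_curve_of tphi; have [M2 M20 h2] := tc_bound tc.
apply/cvgrPdist_le => x x0.
have c0 := cvg_eps eps0 epsS (M2 * 2).
have [N' _ hN'] := (cvgrPdist_le _ _).1 c0 _ x0.
exists (maxn N N') => // n /=; rewrite geq_max => /andP[Nn Nn'].
rewrite flux_integral opprB [X in `|X|](_ : _ = - \sum_(w <- lR n) T2 T (fun t x => phi (t, x)) w); last by ring.
rewrite normrN; have := hN' n Nn'; rewrite /= sub0r normrN => /(le_trans (ler_norm _)); apply: le_trans.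
apply: (@le_trans _ _ (M2 * \sum_(w <- lR n) tsize T w)); last first.
  by rewrite -mulrA; apply: ler_wpM2l; [exact: ltW|case: (hN n Nn)].
elim: (lR n) (sc_okR sch n) => [|w l IH]; first by rewrite !big_nil normr0 mulr0.
move=> [okw /IH h]; rewrite !big_cons mulrDr; apply: le_trans (ler_normD _ _) _; apply: lerD => //.
exact: (T2_le tc okw h2).
Qed.

End test_function.



End limit_transport.


(** * Choice of the exponents and conclusion *)

Lemma hoelder_conjugate_fin (R : realType) (p : R) : 1 < p -> hoelder_conjugate p%:E = (p / (p - 1))%:E.
Proof.
move=> p1; have p0 : p != 0 by rewrite gt_eqF// (lt_trans ltr01).
have p10 : p - 1 != 0 by rewrite subr_eq0 gt_eqF.
apply/esym/hoelder_conjugateP; [exact: ltNyr|by rewrite eqe|].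
rewrite !inver (negbTE p0) mulf_eq0 invr_eq0 (negbTE p0) (negbTE p10) /= -EFinD; congr EFin.
by rewrite invf_div -[X in X + _]mul1r -mulrDl addrC subrK mulfV.
Qed.

(* With x = D / p' and b = beta the hypotheses say x - D / q < b and s - 1 - s / st <= - theta, while
   8 b < x, so that (1 + b) / theta < 1 + x. *)
Lemma concentration_exponent (R : realType) (p q s st D : R) :
  let b := ((p - 1) * D) / (4 * p * (p + 1)) in
  1 < p -> 1 <= q -> 1 <= s -> 1 <= st -> 0 < D ->
  1 / p + 1 / q > 1 - (p - 1) / (4 * (p + 1) * p) ->
  st <= s / (s - 1 + (1 + 2 * b) / (1 + 4 * b)) ->
  exists g : R, [/\ 0 < g, g < 1 + D / (p / (p - 1)) &
    g * s * (1 - s^-1 - st^-1) + (1 + D / (p / (p - 1)) - D / q) < 0].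
Proof.
move=> b p1 q1 s1 st1 D0 pq hst.
have p0 : 0 < p by exact: lt_trans p1.
have p10 : 0 < p - 1 by rewrite subr_gt0.
have pp0 : 0 < p + 1 by rewrite addr_gt0.
have q0 : 0 < q by exact: lt_le_trans q1.
have s0 : 0 < s by exact: lt_le_trans s1.
have st0 : 0 < st by exact: lt_le_trans st1.
set x := D / (p / (p - 1)).
have xE : x = D * (p - 1) / p by rewrite /x invf_div mulrA.
have x0 : 0 < x by rewrite xE divr_gt0// mulr_gt0.
have b0 : 0 < b by rewrite /b divr_gt0// ?mulr_gt0.
have bE : b * (4 * (p + 1)) = x by rewrite xE /b; field; rewrite !gt_eqF.
have bx : 8 * b < x.
  rewrite -bE mulrC ltr_pM2l//; lra.
have xq : x - D / q < b.
  have -> : b = D * ((p - 1) / (4 * (p + 1) * p)) by rewrite /b; field; rewrite !gt_eqF.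
  have -> : x = D * (1 - 1 / p) by rewrite xE; field; rewrite gt_eqF.
  rewrite -mulrBr ltr_pM2l// -div1r; lra.
pose th := (1 + 2 * b) / (1 + 4 * b).
have b4 : 0 < 1 + 4 * b by rewrite addr_gt0// mulr_gt0.
have th0 : 0 < th by rewrite divr_gt0// addr_gt0// mulr_gt0.
pose e2 := 1 + x - D / q.
have e2x : e2 / th < 1 + x.
  rewrite ltr_pdivrMr// /th mulrA ltr_pdivlMr//.
  have h1 : e2 * (1 + 4 * b) < (1 + b) * (1 + 4 * b) by rewrite ltr_pM2r// /e2; lra.
  apply: (lt_trans h1); have : 0 < b * b by exact: mulr_gt0.
  have : 8 * b * (1 + 2 * b) < x * (1 + 2 * b) by rewrite ltr_pM2r// addr_gt0// mulr_gt0.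
  lra.
have sst : s * (1 - s^-1 - st^-1) <= - th.
  have d0 : 0 < s - 1 + th by rewrite ltr_wpDl// subr_ge0.
  have : s - 1 + th <= s / st by rewrite ler_pdivlMr// mulrC -ler_pdivlMr.
  by rewrite !mulrBr mulr1 mulfV ?gt_eqF//; lra.
(* The maximum with 0 keeps g positive when e2 <= 0. *)
pose k := Num.max 0 (e2 / th).
have k0 : 0 <= k by rewrite le_max lexx.
have ke : e2 / th <= k by rewrite le_max lexx orbT.
have kx : k < 1 + x by rewrite gt_max e2x addr_gt0.
exists ((k + (1 + x)) / 2); set g := _ / 2.
have gk : k < g by rewrite /g; lra.
have g0 : 0 < g by exact: le_lt_trans gk.
split => //; first by rewrite /g; lra.
rewrite -/e2 -mulrA; have := ler_wpM2l (ltW g0) sst.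
have : e2 < g * th by rewrite -ltr_pdivrMr//; exact: le_lt_trans gk.
by rewrite mulrN; lra.
Qed.

Theorem theorem1p3 (R : realType) (T : R) (d : nat) (p q s st : R) :
  let p' := hoelder_conjugate p%:E in
  let s' := hoelder_conjugate s%:E in
  let beta := ((p - 1) * (d%:R - 1)) / (4 * p * (p + 1)) in
  0 < T -> (3 <= d)%N ->
  1 <= p -> 1 <= q -> 1 <= s -> 1 <= st ->
  1 < p ->
  1 / p + 1 / q > 1 - (p - 1) / (4 * (p + 1) * p) ->
  st <= s / (fine (s%:E / s')%E + (1 + 2 * beta) / (1 + 4 * beta)) ->
  forall (eps : R) (rhot : R * 'rV[R]_d -> R),
  0 < eps ->
  smooth_time_periodic T rhot ->
  (forall t, t \in `[0, T] ->
     \int[torus_measure R d]_x rhot (t, x) =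
     \int[torus_measure R d]_x rhot (0, x)) ->
  exists (u : R * 'rV[R]_d -> 'rV[R]_d) (rho : R * 'rV[R]_d -> R),
  [/\ (* u and rho are defined on the torus, u is divergence-free *)
      [/\ forall t, Zperiodic (fun x => u (t, x)),
          forall t, Zperiodic (fun x => rho (t, x)) &
          {ae time_measure T, forall t, div_free (fun x => u (t, x))}],
      (* (i) *)
      [/\ forall i, in_LW T st%:E q%:E (fun z => u z 0 i),
          forall i, in_LL T s' p' (fun z => u z 0 i) &
          in_LL T s%:E p%:E rho],
      (* (ii) *)
      exists S : R -> ('rV[R]_d -> R) -> R,
        distributional_representative T rho S /\
        forall phi, smooth_torus phi ->
          S 0 phi = \int[torus_measure R d]_x (rhot (0, x) * phi x) /\
          S T phi = \int[torus_measure R d]_x (rhot (T, x) * phi x),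
      (* (iii) *)
      weak_solution T rho u (fun x => rhot (0, x)) &
      (* (iv) *)
      (LL_norm T s%:E p%:E (fun z => rho z - rhot z)%R <= eps%:E)%E].

Proof.
move=> p' s' beta T0 d3 _ q1 s1 st1 p1 pq hst eps rhot eps0 srho mean.
have d1 : (1 < d)%N by exact: leq_trans d3.
have d0 : (0 < d)%N by exact: leq_trans d3.
pose D : R := d.-1%:R.
have DE : d%:R - 1 = D by rewrite /D -subn1 natrB.
have D0 : 0 < D by rewrite ltr0n -subn1 subn_gt0.
have fE : fine (s%:E / s')%E = s - 1.
  by rewrite /s' hoelder_div_conjugate//; [exact: ltNyr|rewrite eqe gt_eqF// (lt_le_trans ltr01)].
pose r := p / (p - 1).
have p0 : 0 < p by exact: lt_trans p1.
have p10 : 0 < p - 1 by rewrite subr_gt0.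
have r1 : 1 < r by rewrite /r ltr_pdivlMr// mul1r; lra.
have pr : p^-1 + r^-1 = 1.
  by rewrite /r invf_div -[X in X + _]mul1r -mulrDl addrC subrK mulfV// gt_eqF.
have p'E : p' = r%:E by exact: hoelder_conjugate_fin.
rewrite fE /beta DE in hst.
have [g [g0 ge1 ge2]] := concentration_exponent p1 q1 s1 st1 D0 pq hst.
have [C C0 step] := convex_step T0 d1 p1 q1 r1 pr s1 st1 g0 ge1 ge2.
have s0 : 0 < s by exact: lt_le_trans s1.
have Ts0 : 0 <= T `^ s^-1 by exact: powR_ge0.
(* The factor 16 (1 + T^(1/s)) gives 3 kap T^(1/s) <= eps / 4, where 3 kap is the error kap of the
   initial approximation plus 2 kap for all the corrections. *)
pose kap := eps / (16 * (1 + T `^ s^-1)).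
have kap0 : 0 < kap by rewrite divr_gt0// mulr_gt0// ltr_wpDr.
have kapE : 3 * kap * T `^ s^-1 <= eps / 4.
  have eE : eps = 16 * (1 + T `^ s^-1) * kap by rewrite /kap mulrC divfK// gt_eqF// mulr_gt0// ltr_wpDr.
  rewrite eE; have := mulr_ge0 (ltW kap0) Ts0; lra.
(* Errors decay like 16^-n and density increments like 4^-n, so that the velocity costs, of order ep
   n / a n, still decay like 4^-n. The exponent n + 2 of [a] fits [density_norm]. *)
pose ep (n : nat) : R := kap * 16^-1 ^+ n.
pose a (n : nat) : R := eps * 4^-1 ^+ n.+2.
have ep0 n : 0 < ep n by rewrite mulr_gt0// exprn_gt0.
have epS n : 2 * ep n.+1 <= ep n by have := ep0 n; rewrite /ep exprS mulrCA; lra.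
have a0 n : 0 < a n by rewrite mulr_gt0// exprn_gt0.
have ep00 : ep 0%N = kap by rewrite /ep expr0 mulr1.
have [lr0 [lR0 [okr [okR sR] W approx ends]]] := base_approximation T0 d0 srho mean kap0.
have [lr [lu [lR [v [e [Xs [lrE sch]]]]]]] := iterate step a0 ep0 epS okr okR sR W.
pose rho := lim_density T lr Xs.
pose vel D i := lim_velocity T lu Xs D i.
pose u (z : R * 'rV[R]_d) : 'rV[R]_d := \row_i vel id i z.
pose G := good_times T (fun n => s_N (Xs n)).
have mG : measurable (G : set (measurableTypeR R)) by exact: (measurable_G sch).
have G0 : tmf T (~` G) = 0%E by exact: (G_full ep0 epS sch).
have aeG (P : R -> Prop) : (forall t, G t -> P t) -> {ae time_measure T, forall t, P t}.
  move=> GP; exists (~` G); split; [exact: measurableC|exact: G0|].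
  by move=> t /= h Gt; apply: h; exact: GP.
have GT t : G t -> 0 <= t <= T by exact: G_itv.
have dens0 t x : density lr 0 (t, x) = \sum_(z <- lr0) z.1 t * z.2 x by rewrite /density lrE.
have ue i : (fun z => u z 0 i) = vel id i by apply/funext => z; rewrite mxE.
have w4 (k : nat) : 0 < (4^-1 : R) ^+ k.+1 by rewrite exprn_gt0.
have p16 (k : nat) : (16^-1 : R) ^+ k <= 4^-1 ^+ k * 4^-1 ^+ k.
  by rewrite -exprMn -invfM; have -> : (4 * 4 : R) = 16 by ring.
have p41 (k : nat) : (4^-1 : R) ^+ k <= 1 by rewrite exprn_ile1// ?invr_ge0// invf_le1// ler1n.
have p40 (k : nat) : 0 <= (4^-1 : R) ^+ k by rewrite exprn_ge0// invr_ge0.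
exists u, rho; split.
- split.
  + move=> t x k; apply/rowP => i; rewrite !mxE.
    by apply: periodic_lim_on => n; apply: (velocity_per sch) => f.
  + by move=> t; apply: periodic_lim_on => n; exact: (density_per sch).
  + by apply: aeG => t Gt; exact: (limit_div_free sch).
- split.
  + move=> i; rewrite ue; split; first by apply: (measurable_lim_velocity sch) => f.
    exists (fun l => vel (pd l) i); split.
    * by move=> l; apply: (measurable_lim_velocity sch) => f; exact: sm_pd.
    * by apply: aeG => t Gt l; exact: (weak_gradient sch).
    * pose A k := (\int[tmf T]_t `|s_chi (Xs k) t| `^ st) `^ st^-1.
      pose y k := A k * (torus_norm q (flow_field Xs id i k) + \sum_l torus_norm q (flow_field Xs (pd l) i k)).
      have A0 k : 0 <= A k by exact: powR_ge0.
      (* Two components of the flow for the field itself, and two for each of its d partial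
         derivatives. *)
      have yE k : y k <= (2 + d%:R * 2) * e k.
        have fl (L : ('rV[R]_d -> R) -> 'rV[R]_d -> R) : (forall f, sm f -> sm (L f)) ->
            (forall b, A k * torus_norm q (L (s_w (Xs k) b)) <= e k) -> A k * torus_norm q (flow_field Xs L i k) <= 2 * e k.
          move=> sD h; apply: le_trans (ler_wpM2l (A0 k) (flow_norm sch i sD q1 k)) _.
          by rewrite big_bool mulrDr mulr_natl mulr2n lerD// h.
        rewrite /y mulrDr mulrDl; apply: lerD.
          by apply: fl => [//|b]; exact: (gs_flowq (sc_good sch k)).
        rewrite mulr_sumr; apply: (@le_trans _ _ (\sum_(l < d) 2 * e k)).
          by apply: ler_sum => l _; apply: fl => [f|b]; [exact: sm_pd|exact: (gs_pdflowq (sc_good sch k))].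
        by rewrite sumr_const card_ord -[leLHS]mulr_natl mulrA.
      have d00 : 0 <= 2 + d%:R * 2 :> R by rewrite addr_ge0// mulr_ge0.
      pose K := (2 + d%:R * 2) * (kap * 4).
      have K0 : 0 <= K by rewrite mulr_ge0// mulr_ge0// ltW.
      have hK k : y k <= K * 4^-1 ^+ k.+1.
        apply: (le_trans (yE k)); rewrite -mulrA; apply: ler_wpM2l => //.
        apply: (le_trans (e_le sch k)); rewrite /ep exprS -mulrA; apply: ler_wpM2l; first exact: ltW.
        rewrite mulrA divff// mul1r; apply: (le_trans (p16 k)).
        by rewrite ler_piMr.
      apply: le_lt_trans (velocity_W1 ep0 epS sch q1 st1 (i := i) K0 _) (ltry K).
      exact: hK.
  + move=> i; rewrite ue p'E; split; first by apply: (measurable_lim_velocity sch) => f.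
    have [N hN] := sc_size sch.
    pose y k := 2 * (C * (tsize T (v k) + e k) / a k).
    (* 256 = 4 * 16 * 4: two factors 2, the 16 of [a k], and the passage from 4^-k to 4^-(k+1). *)
    have yK k : (N <= k)%N -> y k <= (256 * C * kap / eps) * 4^-1 ^+ k.+1.
      move=> /hN[h _]; have h2 := e_le sch k; set z : R := 4^-1 ^+ k.
      have z0 : 0 < z by rewrite exprn_gt0.
      have epE : ep k <= kap * (z * z) by rewrite /ep; apply: ler_wpM2l; [exact: ltW|exact: p16].
      have aE : a k = eps * (z / 16) by rewrite /a !exprS -/z; congr (_ * _); field.
      have -> : (256 * C * kap / eps) * 4^-1 ^+ k.+1 = 2 * (C * (2 * (kap * (z * z))) / a k).
        by rewrite exprS -/z aE; field; rewrite !gt_eqF.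
      rewrite /y ler_pM2l// ler_pM2r ?invr_gt0// ler_pM2l//; lra.
    have [|K K0 hK] := exists_weight_bound w4 _ yK.
      apply: divr_ge0 (ltW eps0); apply: mulr_ge0 (ltW kap0); exact: mulr_ge0 (ler0n R 256) (ltW C0).
    have r1' := ltW r1.
    have fl (x : R) k : 0 <= x -> (forall b, x * torus_norm r (s_w (Xs k) b) <= C * (tsize T (v k) + e k) / a k) ->
        x * torus_norm r (flow_field Xs id i k) <= K * 4^-1 ^+ k.+1.
      move=> x0 h; apply: le_trans (hK k); apply: le_trans (ler_wpM2l x0 (flow_norm sch (D := id) i (fun f sf => sf) r1' k)) _.
      by rewrite big_bool mulrDr /y mulr_natl mulr2n lerD// h.
    (* For s = 1 the conjugate exponent is infinite and the bound on chi is pointwise in time. *)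
    have [s1E|s1E] := eqVneq s 1.
      have -> : s' = +oo%E by rewrite /s' s1E hoelder_conjugate1.
      apply: le_lt_trans (velocity_norm_sup ep0 epS sch (D := id) (i := i) (fun f sf => sf) r1' K0 _) (ltry K) => k t.
      apply: (@le_trans _ _ (K * 4^-1 ^+ k.+1)).
        by apply: fl => // b; exact: (gs_flow1 (sc_good sch k)).
      by apply: ler_wpM2l => //; apply: lerXn2r; rewrite ?nnegrE ?invr_ge0//; lra.
    have s1' : 1 < s by rewrite lt_neqAle eq_sym s1E.
    have s10 : 0 < s - 1 by rewrite subr_gt0.
    have -> : s' = (s / (s - 1))%:E by exact: hoelder_conjugate_fin.
    have sgE : (s / (s - 1))^-1 = 1 - s^-1 by field; rewrite !gt_eqF.
    have sg1 : 1 <= s / (s - 1) by rewrite ler_pdivlMr// mul1r; lra.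
    apply: le_lt_trans (velocity_norm ep0 epS sch (D := id) (i := i) (fun f sf => sf) r1' sg1 K0 _) (ltry K) => k.
    rewrite sgE; apply: fl => [|b]; first exact: powR_ge0.
    exact: (gs_flow2 (sc_good sch k)).
  + split; first exact: (measurable_lim_density ep0 epS sch).
    have [L L0 hL] := periodic_bounded_pair T (density_cont sch (n := 0)) (density_per sch 0).
    (* The first summand covers the sequence [a], the second makes K / 4 large enough for the
       constant part in [density_norm]. *)
    pose K := eps + 4 * ((L + 2 * ep 0%N) * T `^ s^-1).
    have X0 : 0 <= 4 * ((L + 2 * ep 0%N) * T `^ s^-1).
      apply: mulr_ge0 => //; apply: mulr_ge0 Ts0; apply: addr_ge0 (ltW L0) _.
      exact: mulr_ge0 (ler0n R 2) (ltW (ep0 0%N)).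
    have K0 : 0 <= K by rewrite addr_ge0// ltW.
    apply: le_lt_trans (density_norm T0 ep0 epS sch (ltW p1) s1 (c := L) (K := K) _ K0 _ _ _) (ltry K).
    * exact: ltW.
    * by move=> k; apply: ler_wpM2r => //; rewrite /K lerDl.
    * by rewrite /K; move: X0; set X := (L + _) * _ => X0; move: eps0; lra.
    * move=> t x Gt; have := ler_normD (rho (t, x) - density lr 0 (t, x)) (density lr 0 (t, x)).
      rewrite subrK => /le_trans; apply; rewrite addrC lerD2r; apply: hL; exact: GT.
- exists (lim_pairing lr); split; first exact: (distributional_limit T0 ep0 epS sch).
  move=> phi /smooth_torus_sm sphi; split.
  + rewrite (lim_pairing_still sch) => // [|n].
      by apply: eq_Rintegral => x _; rewrite dens0 (ends x).1.
    by split; [exact: (gs_gam0 (sc_good sch n))|exact: (gs_B0 (sc_good sch n))].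
  + rewrite (lim_pairing_still sch) => // [|n].
      by apply: eq_Rintegral => x _; rewrite dens0 (ends x).2.
    by split; [exact: (gs_gamT (sc_good sch n))|exact: (gs_BT (sc_good sch n))].
- by move=> phi tphi; exact: (limit_transport T0 (ltW C0) ep0 epS sch tphi).
- apply: (density_norm T0 ep0 epS sch (ltW p1) s1 (c := kap) (K := eps)) => //.
  + exact: ltW.
  + exact: ltW.
  + by rewrite ep00; apply: le_trans kapE; have -> : kap + 2 * kap = 3 * kap by ring.
  + move=> t x Gt; have -> : rho (t, x) - rhot (t, x) = (density lr 0 (t, x) - rhot (t, x)) + (rho (t, x) - density lr 0 (t, x)) by ring.
    by apply: le_trans (ler_normD _ _) _; rewrite lerD2r dens0; apply: approx; exact: GT.
Qed.
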